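(* Let $q$ be a prime power and let $\mathcal{C}_0$ be the plane subspace code (of size $q^8+q^5-q$) described in the context. By an extension of $\mathcal{C}_0$ we mean a plane subspace code containing $\mathcal{C}_0$, and a maximal extension is one of maximum possible size. (i) For $q=2$, maximal extensions $\overline{\mathcal{C}_0}$ of $\mathcal{C}_0$ have size $329$. There exist $26\,496$ different isomorphism types of such maximal extensions, all with trivial automorphism group. Both possible spectra of $\overline{\mathcal{C}_0}$ with respect to $S$, namely $(\alpha_0,\alpha_1,\alpha_2,\alpha_3)=(136,164,29,0)$ and $(136,165,28,0)$, occur, with $10\,368$ and $16\,128$ isomorphism types, respectively. (ii) For $q=3$ there exists an extension $\overline{\mathcal{C}_0}$ of $\mathcal{C}_0$ of size $6977$. (iii) For general $q$ there exists an extension $\overline{\mathcal{C}_0}$ of $\mathcal{C}_0$ of size $q^8+q^5+q^4+q^2-q$, which contains the $q^2+1$ planes $\{(\lambda\epsilon,y):\lambda\in\mathbb{F}_q,\ y\in r\mathbb{F}_{q^2}\}$, $r\in\mathbb{F}_{q^4}^\times$, where $\epsilon\in\mathbb{F}_{q^4}^\times$ satisfies $\epsilon^{q-1}=-1$.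
   Context: $\mathbb{F}_{q^4}$ is viewed as a $4$-dimensional $\mathbb{F}_q$-space; $\mathbb{F}_{q^2}\subset\mathbb{F}_{q^4}$ is the subfield. Let $W=\{x\in\mathbb{F}_{q^4}:x+x^q+x^{q^2}+x^{q^3}=0\}$, $V=W\times\mathbb{F}_{q^4}$ ($7$-dimensional over $\mathbb{F}_q$), $S=\{0\}\times\mathbb{F}_{q^4}$. Points, lines, planes of $V$ (or of $\mathbb{F}_{q^4}$) are $\mathbb{F}_q$-subspaces of dimension $1,2,3$; a point $\mathbb{F}_qx$ of $\mathbb{F}_{q^4}$ is identified with the coset $x\mathbb{F}_q^\times$. A plane subspace code is a set of planes of $V$ pairwise meeting in dimension at most $1$. Its spectrum with respect to $S$ is $(\alpha_0,\dots,\alpha_3)$ with $\alpha_i$ the number of members $E$ with $\dim(E\cap S)=i$. Isomorphism and automorphisms refer to the natural action of $\mathrm{GL}(V)$ on sets of planes. Notation: for $f\colon W\to\mathbb{F}_{q^4}$ $\mathbb{F}_q$-linear, $\Gamma_f=\{(x,f(x)):x\in W\}$; $\mathcal{G}=\{x\mapsto a_0x+a_1x^q: a_0,a_1\in\mathbb{F}_{q^4}\}$; $\mathcal{L}_0=\{\Gamma_f: f\in\mathcal{G}\}\setminus\{\Gamma_f: f(x)=r(ux^q-u^qx),\ r\in\mathbb{F}_{q^4}^\times,\ u\in\mathbb{F}_{q^4}\setminus W\}$. Put $\delta(x,y)=xy^q-x^qy$. For a $2$-dimensional $\mathbb{F}_q$-subspace $Z\subseteq W$ and $\mathbb{F}_q$-linear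 $g\colon Z\to\mathbb{F}_{q^4}$ put $N(Z,g)=\{(x,g(x)+\nu):x\in Z,\nu\in\mathbb{F}_q\}$. For a plane $E\neq W$ of $\mathbb{F}_{q^4}$, let $Z=E\cap W=\langle a,b\rangle$, choose $e\in E\setminus Z$, define $g_E(x)=\delta(e,x)/\delta(a,b)$ for $x\in Z$, and let $\mathcal{N}(E)=\{N(Z,\kappa g_E):\kappa\in\mathbb{F}_q^\times\}$ (independent of the choices of $a,b,e$). Then $\mathcal{C}_0=\mathcal{L}_0\cup\{\{(x,ry):(x,y)\in N\}: r\in\mathbb{F}_{q^4}^\times,\ N\in\mathcal{N}(E),\ E\text{ a plane of }\mathbb{F}_{q^4},\ E\neq W,\ E\neq u^{q+1}W\text{ for all }u\in\mathbb{F}_{q^4}^\times\}$. *)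

(* Defs.v *)
From HB Require Import structures.
From mathcomp Require Import all_boot all_order all_algebra all_field finmap.
From mathcomp Require Import boolp classical_sets cardinality.

Set Implicit Arguments.
Unset Strict Implicit.
Unset Printing Implicit Defensive.

Import GRing.Theory.

Local Open Scope classical_set_scope.
Local Open Scope card_scope.

Section PlaneCodes.
Variables (K : fieldType) (V : vectType K).

Definition code := {fset {vspace V}}.

Definition plane_code (C : code) : Prop :=
  (forall E, E \in C -> \dim E = 3) /\
  (forall E E', E \in C -> E' \in C -> E != E' -> (\dim (E :&: E') <= 1)%N).

Definition extension (C0 : set {vspace V}) (C : code) : Prop :=
  plane_code C /\ C0 `<=` [set` C].

(* Maximality refers to the cardinality, not to inclusion. *)
Definition maximal_extension (C0 : set {vspace V}) (C : code) : Prop :=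
  extension C0 C /\ forall C', extension C0 C' -> (#|` C' | <= #|` C |)%N.

Definition alpha (S : {vspace V}) (C : code) (i : nat) : nat :=
  #|` [fset E in C | \dim (E :&: S) == i]%fset |.

Definition spectrum (S : {vspace V}) (C : code) : seq nat :=
  [:: alpha S C 0; alpha S C 1; alpha S C 2; alpha S C 3].

Definition GL : set 'End(V) := [set g | lker g == 0%VS].

Definition code_image (g : 'End(V)) (C : code) : code :=
  [fset (g @: E)%VS | E in C]%fset.

Definition trivial_aut (C : code) : Prop :=
  forall g, GL g -> code_image g C = C -> g = \1%VF.

(* An isomorphism type is a GL(V)-orbit; the orbit of C is taken in the set   *)
(* of all codes, so the types represented in a family P of codes are the      *)
(* elements of iso_type @` P even if P is not GL(V)-invariant.                *)
Definition iso_type (C : code) : set code := [set code_image g C | g in GL].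

Definition iso_types (P : set code) : set (set code) := iso_type @` P.

End PlaneCodes.

Local Open Scope ring_scope.

Section Construction.
Variables (F : finFieldType) (L : fieldExtType F).

Let q := #|F|.

Definition tr4 (x : L) : L := x + x ^+ q + x ^+ (q ^ 2) + x ^+ (q ^ 3).

Fact expq_is_linear n : linear (fun x : L => x ^+ (q ^ n)).
Proof.
have qn_gt0 : (0 < q ^ n)%N by rewrite expn_gt0 (ltnW (finNzRing_gt1 F)).
have expB x y : (x - y) ^+ (q ^ n) = x ^+ (q ^ n) - y ^+ (q ^ n) :> L.
  have [p p_pr pF] := finPcharP F; rewrite /q (card_pprimeChar pF) -expnM.
  elim: (_ * n)%N => // k IHk; rewrite expnSr !exprM {}IHk.
  by rewrite -(pchar_lalg L) in pF; rewrite -(pFrobenius_autE pF) rmorphB.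
have expZ (a : F) (x : L) : (a *: x) ^+ (q ^ n) = a *: x ^+ (q ^ n).
  rewrite exprZn; congr (_ *: _); elim: {+}n => [|k IHk]; first exact: expr1.
  by rewrite expnSr exprM IHk expf_card.
move=> a x y; rewrite -[y in LHS]opprK expB expZ -[- y]sub0r expB.
by rewrite expr0n eqn0Ngt qn_gt0 sub0r opprK.
Qed.

Fact tr4_is_linear : linear tr4.
Proof.
have l1 := expq_is_linear 1; rewrite expn1 in l1.
move=> a x y; rewrite /tr4 (l1 a x y) (expq_is_linear 2 a x y).
rewrite (expq_is_linear 3 a x y) 3!scalerDr.
by rewrite (addrACA (a *: x)) (addrACA (a *: x + _)) (addrACA (a *: x + _ + _)).
Qed.

HB.instance Definition _ := GRing.isLinear.Build F L L *:%R tr4 tr4_is_linear.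

Definition W : {vspace L} := lker (linfun tr4).

Lemma mem_W x : (x \in W) = (tr4 x == 0).
Proof. by rewrite memv_ker lfunE. Qed.

(* V = W x F_{q^4}: the first component of v : V has type subvs_of W and is   *)
(* viewed in L through vsval.                                                 *)
Definition V : Type := (subvs_of W * L)%type.

Definition SV : {vspace V} := lker (linfun (fst : V -> subvs_of W)).

Lemma mem_SV v : (v \in SV) = (v.1 == 0).
Proof. by rewrite memv_ker lfunE. Qed.

Definition graph (f : subvs_of W -> L) : set V := [set v | v.2 = f v.1].

Definition calG : set (subvs_of W -> L) :=
  [set f | exists a0 a1 : L,
     forall x, f x = a0 * vsval x + a1 * vsval x ^+ q].

Definition removed : set (subvs_of W -> L) :=
  [set f | exists r u : L, [/\ r != 0, u \notin W &
     forall x, f x = r * (u * vsval x ^+ q - u ^+ q * vsval x)]].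

Definition graphs (A : set (subvs_of W -> L)) : set {vspace V} :=
  [set U : {vspace V} | exists2 f, A f & [set` U] = graph f].

Definition calL0 : set {vspace V} := graphs calG `\` graphs removed.

Definition delta (x y : L) : L := x * y ^+ q - x ^+ q * y.

(* Only the values of g on Z matter. *)
Definition planeN (Z : {vspace L}) (g : L -> L) : set V :=
  [set v | vsval v.1 \in Z /\ exists nu : F, v.2 = g (vsval v.1) + nu%:A].

Definition calN (E : {vspace L}) : set (set V) :=
  [set N | exists (a b e : L) (kappa : F),
     [/\ (E :&: W = <<[:: a; b]>>)%VS, e \in E, e \notin (E :&: W)%VS,
         kappa != 0 &
         N = planeN (E :&: W) (fun x => kappa *: (delta e x / delta a b))]].

Definition rscale (r : L) (N : set V) : set V := [set (v.1, r * v.2) | v in N].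

Definition admissible (E : {vspace L}) : Prop :=
  [/\ \dim E = 3%N, E != W &
      forall u : L, u != 0 -> E != (<[u ^+ q.+1]> * W)%VS].

Definition calC0 : set {vspace V} :=
  calL0 `|` [set U : {vspace V} | exists (r : L) (E : {vspace L}) (N : set V),
               [/\ r != 0, admissible E, calN E N & [set` U] = rscale r N]].

(* The subfield of order q^2, as a subset of L. *)
Definition Fq2 : set L := [set z | z ^+ (q ^ 2) = z].

Definition eps_planes (eps : L) : set {vspace V} :=
  [set U : {vspace V} | exists2 r : L, r != 0 &
     [set` U] = [set v | (exists lambda : F, vsval v.1 = lambda *: eps) /\
                         (exists2 z, Fq2 z & v.2 = r * z)]].

End Construction.

Arguments SV {F} L.
Arguments calC0 {F} L.

(* Main.v *)
(* Put sigma(x) = x^q and chi(t) = t^((q^2 + 1)(q - 1)). A plane E <> W of F_{q^4} is t W for some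
   t, and t W is inadmissible iff chi(t) = 1. If two planes r N(Z, g), r' N(Z', g') over distinct E,
   E' meet in a line, then this line contains the common point of both with S, and a point over some
   x in Z and Z'; the resulting equality of values delta(v, x) / delta(b, x) forces E and E' to be
   inadmissible. So C0 is a plane code, and it stays one when the planes r N(E_r), r <> 0, are added
   for an inadmissible E_r depending only on the point F r.

   Part (iii): take the same E_r for all r, and add the planes <eps> x r F_{q^2}.
   Part (ii): take E_r depending on r^8 only and add 96 planes <x> x <r1, r2>, invariant under
   F_9^*; this is checked by computation in F_81 = F_3[b], b^4 = b^2 + 1.

   Part (i): by computation in F_16 = F_2[alpha], alpha^4 = alpha + 1, exactly 170 planes meet all
   members of C0 in at most a point: 5 + 45 + 45 planes meeting S in a line, 15 planes of S, and 60
   planes meeting S in a point. Each set of 45 is indexed by Z/15 and three colours, where equal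
   colours conflict at certain distances, so that an extension is a pair of partial colourings of
   Z/15 and a choice of at most one of four planes over every point of S. A colouring leaves at least
   three elements uncoloured, which bounds an extension by 286 + 43 planes, and there are 60 * 26496
   solutions attaining the bound. Let g map a maximal extension to another. The points (1, y) are
   those which the members of a maximal extension join to all other points; so g preserves them, S,
   the set L0 of the members disjoint from S, and W x 0, which is recovered from L0 in the same way.
   Then g is one of the 60 maps (x, y) -> (phi x, r phi y), phi a power of the Frobenius map. These
   act freely on the solutions, so the isomorphism types are orbits of length 60. *)

Require Import Defs.
From HB Require Import structures.
From mathcomp Require Import all_boot all_order all_algebra all_field finmap.
From mathcomp Require Import boolp classical_sets functions cardinality.
From mathcomp Require Import ring zify.
From Stdlib Require NArith.

Set Implicit Arguments.
Unset Strict Implicit.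
Unset Printing Implicit Defensive.

Import GRing.Theory.

Local Open Scope ring_scope.

(** * Linear algebra and the Frobenius map *)

(** What makes two planes over the same x collide is hidden in the ratio delta v x / delta x b.
    After division by x it is, up to sign, the ratio of D(v/x) and D(b/x), where D y = y^q - y has
    kernel F and values of trace 0. A common ratio r for (b, v) and (b', v') puts B = D(b/x), B' =
    D(b'/x), r B and r B' into the kernel of the trace, and this forces delta B B' / (D r)^(q^2) to
    be negated by the Frobenius map. The Moore determinant of a basis of E gives the t in E = t W,
    and for x, b, v it differs from that of the basis x, b, b' of W by factors on which chi is
    trivial. In part (i) the solutions, about 1.6 million, are never listed: only the colourings
    with three or four gaps are, and the choices over the points of S are counted by a product.
    Canonical forms are avoided too, since every isomorphism between maximal extensions is among 60
    explicit maps. Of these, the ones with an even power of the Frobenius map preserve each set of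
    45 planes; an odd one is handled by its square, which is never the identity. *)

Section LinearAlgebra.
Variables (K : fieldType) (U : vectType K).
Implicit Types (A B : {vspace U}) (u v w : U).

Lemma span2P u v w :
  reflect (exists c d : K, w = c *: u + d *: v) (w \in <<[:: u; v]>>%VS).
Proof.
rewrite span_cons span_seq1; apply: (iffP memv_addP).
  by move=> [_ /vlineP[c ->] [_ /vlineP[d ->] ->]]; exists c, d.
by move=> [c [d ->]]; exists (c *: u); [|exists (d *: v)];
   rewrite ?memvZ ?memv_line.
Qed.

Lemma span3P u1 u2 u3 w :
  reflect (exists c d e : K, w = c *: u1 + d *: u2 + e *: u3)
          (w \in <<[:: u1; u2; u3]>>%VS).
Proof.
rewrite span_cons; apply: (iffP memv_addP).
  move=> [_ /vlineP[c ->] [_ /span2P[d [e ->]] ->]]; exists c, d, e.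
  by rewrite addrA.
move=> [c [d [e ->]]]; exists (c *: u1); first by rewrite memvZ ?memv_line.
by exists (d *: u2 + e *: u3); [apply/span2P; exists d, e | rewrite addrA].
Qed.

Definition indep2 u v := forall c d : K, c *: u + d *: v = 0 -> c = 0 /\ d = 0.
Definition indep3 u v w := forall c d e : K,
  c *: u + d *: v + e *: w = 0 -> [/\ c = 0, d = 0 & e = 0].

Lemma dim_span2 u v : indep2 u v -> \dim <<[:: u; v]>> = 2%N.
Proof.
move=> uv; suff: free [:: u; v] by move/eqP.
apply/(@freeP _ _ 2 [tuple u; v]) => k; rewrite !big_ord_recl big_ord0 addr0 => /uv[k0 k1] i.
case: i => [[|[|//]] ?].
  by rewrite -[RHS]k0; congr k; apply: val_inj.
by rewrite -[RHS]k1; congr k; apply: val_inj.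
Qed.

Lemma dim_span3 u v w : indep3 u v w -> \dim <<[:: u; v; w]>> = 3%N.
Proof.
move=> uv; suff: free [:: u; v; w] by move/eqP.
apply/(@freeP _ _ 3 [tuple u; v; w]) => k.
rewrite !big_ord_recl big_ord0 addr0 addrA => /uv[k0 k1 k2] i.
case: i => [[|[|[|//]]] ?].
- by rewrite -[RHS]k0; congr k; apply: val_inj.
- by rewrite -[RHS]k1; congr k; apply: val_inj.
- by rewrite -[RHS]k2; congr k; apply: val_inj.
Qed.

Lemma indep2P u v : u != 0 -> v \notin <[u]>%VS -> indep2 u v.
Proof.
move=> u0 vu c d /eqP; have [->|d0] := eqVneq d 0.
  by rewrite scale0r addr0 scaler_eq0 (negPf u0) orbF => /eqP ->.
rewrite addrC addr_eq0 => /eqP dv; case/negP: vu.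
by rewrite -[v](scalerK d0) dv memvZ // memvN memvZ // memv_line.
Qed.

Lemma dim_gt1P A : (1 < \dim A)%N -> exists u v, [/\ u \in A, v \in A & indep2 u v].
Proof.
move=> A1; have A0: A != 0%VS by rewrite -dimv_eq0 -lt0n ltnW.
have: ~~ (A <= <[vpick A]>)%VS.
  by apply: contraL A1 => /dimvS; rewrite dim_vline vpick0 A0 -leqNgt.
case/subvPn => w wA wn; exists (vpick A), w; split => //; first exact: memv_pick.
by apply: indep2P => //; rewrite vpick0.
Qed.

Lemma dim_ge2 A u v : u \in A -> v \in A -> indep2 u v -> (1 < \dim A)%N.
Proof.
move=> uA vA uv; apply: (@leq_trans (\dim <<[:: u; v]>>)).
  by rewrite dim_span2.
apply: dimvS; apply/span_subvP => x.
by rewrite !inE => /orP[] /eqP->.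
Qed.

Lemma plane_eq A B : \dim A = 3%N -> \dim B = 3%N -> (A <= B)%VS -> A = B.
Proof. by move=> A3 B3 AB; apply/eqP; rewrite eqEdim AB A3 B3. Qed.

End LinearAlgebra.

(** * The Frobenius map, the alternating form [delta] and the trace *)

Section Frobenius.
Variables (F : finFieldType) (L : fieldExtType F).
Local Notation q := #|F|.

Definition sg (x : L) : L := x ^+ q.

Fact sg_is_linear : linear sg.
Proof. by have := @expq_is_linear F L 1; rewrite expn1. Qed.
HB.instance Definition _ := GRing.isLinear.Build F L L *:%R sg sg_is_linear.

Fact sg_is_mult : monoid_morphism sg.
Proof. by split=> [|x y]; rewrite /sg ?exprMn ?expr1n. Qed.
HB.instance Definition _ := GRing.isMonoidMorphism.Build L L sg sg_is_mult.

Lemma q_gt1 : (1 < q)%N. Proof. exact: finNzRing_gt1. Qed.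

Lemma sg_scalar (c : F) : sg c%:A = c%:A.
Proof. by rewrite linearZ /= rmorph1. Qed.

Lemma sg_fix (x : L) : sg x = x -> exists c : F, x = c%:A.
Proof.
move=> sx; have: x \in 1%VS by rewrite Fermat's_little_theorem dimv1 expn1 -/(sg x) sx.
by move=> /vlineP[c ->]; exists c.
Qed.

Lemma sgXn n (x : L) : iter n sg x = x ^+ (q ^ n).
Proof. by elim: n => [|n IHn]; rewrite ?expr1 //= IHn /sg -exprM expnSr. Qed.

Lemma deltaE (x y : L) : delta x y = x * sg y - sg x * y. Proof. by []. Qed.

Lemma sg_eq0 (x : L) : (sg x == 0) = (x == 0).
Proof. by rewrite fmorph_eq0. Qed.

Lemma sg0 : sg 0 = 0. Proof. exact: rmorph0. Qed.
Lemma sgD (x y : L) : sg (x + y) = sg x + sg y. Proof. exact: rmorphD. Qed.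
Lemma sgN (x : L) : sg (- x) = - sg x. Proof. exact: rmorphN. Qed.
Lemma sgB (x y : L) : sg (x - y) = sg x - sg y. Proof. exact: rmorphB. Qed.
Lemma sgM (x y : L) : sg (x * y) = sg x * sg y. Proof. exact: rmorphM. Qed.
Lemma sgV (x : L) : sg x^-1 = (sg x)^-1. Proof. exact: fmorphV. Qed.
Lemma sgZ c (x : L) : sg (c *: x) = c *: sg x. Proof. exact: linearZ. Qed.

Lemma deltaDl (x y z : L) : delta (x + y) z = delta x z + delta y z.
Proof. by rewrite !deltaE rmorphD; ring. Qed.
Lemma deltaDr (x y z : L) : delta z (x + y) = delta z x + delta z y.
Proof. by rewrite !deltaE rmorphD; ring. Qed.
Lemma deltaZl c (x y : L) : delta (c *: x) y = c *: delta x y.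
Proof. by rewrite !deltaE linearZ /= -!scalerAl scalerBr. Qed.
Lemma deltaZr c (x y : L) : delta x (c *: y) = c *: delta x y.
Proof. by rewrite !deltaE linearZ /= -!scalerAr scalerBr. Qed.
Lemma deltaC (x y : L) : delta x y = - delta y x.
Proof. by rewrite !deltaE; ring. Qed.
Lemma deltaxx (x : L) : delta x x = 0.
Proof. by rewrite deltaE mulrC subrr. Qed.

Lemma delta_eq0 (a b : L) : a != 0 -> delta a b = 0 -> exists c : F, b = c *: a.
Proof.
move=> a0 /eqP; rewrite deltaE subr_eq0 => /eqP ab.
have [|c bc] := @sg_fix (b / a).
  rewrite fmorph_div; apply: (@mulfI _ (a * sg a)); first by rewrite mulf_neq0 ?sg_eq0.
  by rewrite mulrACA divff ?sg_eq0 // mulr1 ab; field.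
by exists c; rewrite -[b](divfK a0) bc -scalerAl mul1r.
Qed.

Lemma delta_neq0 (a b : L) : delta a b != 0 -> indep2 a b.
Proof.
move=> ab c d cd; have: delta (c *: a + d *: b) b = 0.
  by rewrite cd !deltaE rmorph0 !mul0r subrr.
rewrite deltaDl !deltaZl deltaxx scaler0 addr0 => /eqP.
rewrite scaler_eq0 (negPf ab) orbF => /eqP c0; split=> //.
have: delta a (c *: a + d *: b) = 0.
  by rewrite cd !deltaE rmorph0 !mulr0 subrr.
rewrite deltaDr !deltaZr deltaxx scaler0 add0r => /eqP.
by rewrite scaler_eq0 (negPf ab) orbF => /eqP.
Qed.

Lemma indep_delta (a b : L) : indep2 a b -> delta a b != 0.
Proof.
move=> ab; apply/eqP => d0; have [a0|a0] := eqVneq a 0.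
  by have [] := ab 1 0; rewrite ?a0 ?scaler0 ?scale0r ?addr0 // => /eqP; rewrite oner_eq0.
have [c bc] := delta_eq0 a0 d0.
have [] := ab c (-1); first by rewrite bc scaleN1r subrr.
by move=> _ /eqP; rewrite oppr_eq0 oner_eq0.
Qed.

(** Cramer's rule with determinant [delta x y]. A nonzero map a0 x + a1 x^q thus vanishes on at most
    a point, so distinct graphs meet in at most a point. *)
Lemma coef2_eq0 (a0 a1 x y : L) : delta x y != 0 ->
  a0 * x + a1 * sg x = 0 -> a0 * y + a1 * sg y = 0 -> a0 = 0 /\ a1 = 0.
Proof.
rewrite deltaE => d0 ex ey; split; apply: (mulIf d0); rewrite mul0r.
  have -> : a0 * (x * sg y - sg x * y) = (a0 * x + a1 * sg x) * sg y - (a0 * y + a1 * sg y) * sg x by ring.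
  by rewrite ex ey !mul0r subrr.
have -> : a1 * (x * sg y - sg x * y) = - ((a0 * x + a1 * sg x) * y) + (a0 * y + a1 * sg y) * x by ring.
by rewrite ex ey !mul0r oppr0 addr0.
Qed.

(** The Moore determinant of x, y, z, whose rows are the conjugates under the powers 1, q, q^2,
    expanded along the first row. *)
Definition moore3 (x y z : L) : L :=
  x * delta (sg y) (sg z) - y * delta (sg x) (sg z) + z * delta (sg x) (sg y).

Hypothesis hL : \dim {:L} = 4%N.

Lemma sg4 (x : L) : sg (sg (sg (sg x))) = x.
Proof.
have := memvf x; rewrite (Fermat's_little_theorem {:L}%AS) hL => /eqP.
by rewrite -(sgXn 4).
Qed.

Lemma tr4E (x : L) : tr4 x = x + sg x + sg (sg x) + sg (sg (sg x)).
Proof. by rewrite /tr4 -(sgXn 2) -(sgXn 3) -/(sg x). Qed.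

Lemma sg_tr4 (x : L) : sg (tr4 x) = tr4 x.
Proof. by rewrite tr4E !rmorphD /= sg4; ring. Qed.

Lemma tr4_scalar (x : L) : exists c : F, tr4 x = c%:A.
Proof. exact/sg_fix/sg_tr4. Qed.

Lemma tr4Z (c : F) (x : L) : tr4 (c *: x) = c *: tr4 x.
Proof. by rewrite linearZ. Qed.

Lemma card_L : #|finvect_type L| = (q ^ 4)%N.
Proof.
have e := @card_vspace F (finvect_type L) _ (fullv : {vspace finvect_type L}).
transitivity #|(fullv : {vspace finvect_type L})|.
  by apply: eq_card => x; rewrite memvf.
by rewrite e; congr (_ ^ _)%N; exact: hL.
Qed.

(** The polynomial has degree q^3, so the q^4 elements cannot all be roots. The case e = 1 gives an
    element of nonzero trace; for e = -1 the nonzero value itself is negated by the Frobenius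
    map. *)
Lemma alt_tr_neq0 (e : L) : e != 0 ->
  exists x : L, x + e * sg x + sg (sg x) + e * sg (sg (sg x)) != 0.
Proof.
move=> e0; apply: contrapT => /forallNP h.
pose p : {poly L} := 'X + e *: 'X^q + 'X^(q ^ 2) + e *: 'X^(q ^ 3).
have q3 : (q ^ 2 < q ^ 3)%N by rewrite ltn_exp2l ?q_gt1.
have q2 : (q < q ^ 2)%N by rewrite -{1}[q]expn1 ltn_exp2l ?q_gt1.
have q1 := q_gt1.
have sp : size p = (q ^ 3).+1.
  rewrite /p addrC size_polyDl size_scale // size_polyXn //.
  apply: (leq_ltn_trans (size_polyD _ _)); rewrite gtn_max size_polyXn !ltnS q3 andbT.
  apply: (leq_trans (size_polyD _ _)); rewrite geq_max size_scale // size_polyXn size_polyX.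
  by rewrite (ltn_trans q2 q3) (ltn_trans q1 (ltn_trans q2 q3)).
have p0 : p != 0 by rewrite -size_poly_eq0 sp.
have := @max_poly_roots _ p (enum (finvect_type L) : seq L) p0.
rewrite sp ltnS => H.
have : (size (enum (finvect_type L)) <= q ^ 3)%N.
  apply: H; last exact: (enum_uniq (finvect_type L)).
  apply/allP => x _; rewrite rootE !hornerE -(sgXn 2) -(sgXn 3) -/(sg x).
  by apply/eqP; have /negP := h x; rewrite negbK => /eqP.
by rewrite -cardE card_L leqNgt ltn_exp2l ?q_gt1.
Qed.

Lemma tr4_neq0 : exists x : L, tr4 x != 0.
Proof.
by have [x] := alt_tr_neq0 (oner_neq0 L); rewrite !mul1r -tr4E => h; exists x.
Qed.

Lemma exists_eps : exists2 k : L, k != 0 & sg k = - k.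
Proof.
have [|x x0] := @alt_tr_neq0 (-1); first by rewrite oppr_eq0 oner_eq0.
by eexists; [exact: x0 | rewrite !(sgD, sgM, sgN) rmorph1 sg4; ring].
Qed.

Lemma tr4_img : limg (linfun (@tr4 F L)) = 1%VS.
Proof.
have [x x0] := tr4_neq0.
apply/eqP; rewrite eq_sym eqEdim; apply/andP; split.
  rewrite -memvE; have [c ec] := tr4_scalar x.
  have c0 : c != 0 by apply: contraNneq x0 => c0; rewrite ec c0 scale0r.
  rewrite -(scalerK c0 1) -ec memvZ //.
  have -> : tr4 x = linfun (@tr4 F L) x by rewrite lfunE.
  exact: memv_img (memvf x).
apply: dimvS; apply/subvP => _ /memv_imgP[y _ ->]; rewrite lfunE /=.
by have [c ->] := tr4_scalar y; rewrite memvZ // memv_line.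
Qed.

Lemma dim_W : \dim (W L) = 3%N.
Proof.
have := limg_ker_dim (linfun (@tr4 F L)) fullv; rewrite capfv tr4_img dimv1 hL -/(W L).
by rewrite addn1 => -[].
Qed.

End Frobenius.

(** * Graphs and the planes r N(Z, g) as subspaces of V *)

Section Planes.
Variables (F : finFieldType) (L : fieldExtType F).
Local Notation q := #|F|.
Hypothesis hL : \dim {:L} = 4%N.
Local Notation W := (W L).
Local Notation V := (V L).

(** The first argument is projected to W, which makes [mk] linear without side conditions; it is the
    pair (x, y) only for x in W. *)
Definition mk (x y : L) : V := (vsproj W x, y).

Lemma mkK (w : V) : mk (vsval w.1) w.2 = w.
Proof. by case: w => x y; rewrite /mk vsvalK. Qed.

Lemma mk1 x y : x \in W -> vsval (mk x y).1 = x.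
Proof. exact: vsprojK. Qed.

Lemma mkD x y x' y' : mk x y + mk x' y' = mk (x + x') (y + y').
Proof. by rewrite /mk linearD. Qed.

Lemma mkZ c x y : c *: mk x y = mk (c *: x) (c *: y).
Proof. by rewrite /mk linearZ. Qed.

Lemma mk00 : mk 0 0 = 0.
Proof. by rewrite /mk linear0. Qed.

Lemma mk_inj x y x' y' : x \in W -> x' \in W -> mk x y = mk x' y' -> x = x' /\ y = y'.
Proof.
by move=> xW x'W [e ->]; split=> //; rewrite -(vsprojK xW) e vsprojK.
Qed.

Lemma mk_eq0 x y : x \in W -> mk x y = 0 -> x = 0 /\ y = 0.
Proof. by move=> xW; rewrite -mk00; apply: mk_inj => //; apply: mem0v. Qed.

Lemma W_basis : exists w0 w1 w2, [/\ w0 \in W, w1 \in W, w2 \in W & indep3 w0 w1 w2].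
Proof.
have [w0 [w1 [w0W w1W ind]]] : exists u v, [/\ u \in W, v \in W & indep2 u v].
  by apply: dim_gt1P; rewrite dim_W.
have : ~~ (W <= <<[:: w0; w1]>>)%VS.
  by apply/negP => /dimvS; rewrite dim_W // dim_span2.
case/subvPn => w2 w2W w2n; exists w0, w1, w2; split=> // c d e /eqP.
have [->|e0] := eqVneq e 0.
  by rewrite scale0r addr0 => /eqP/ind[-> ->].
rewrite addrC addr_eq0 => /eqP h; case/negP: w2n.
by rewrite -[w2](scalerK e0) h memvZ // memvN; apply/span2P; exists c, d.
Qed.

Lemma W_span w0 w1 w2 : w0 \in W -> w1 \in W -> w2 \in W -> indep3 w0 w1 w2 ->
  W = <<[:: w0; w1; w2]>>%VS.
Proof.
move=> h0 h1 h2 ind; apply/esym/plane_eq; rewrite ?dim_span3 ?dim_W //.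
by apply/span_subvP => x; rewrite !inE => /or3P[] /eqP->.
Qed.

Definition PGfun (a0 a1 : L) (w : V) : L := w.2 - (a0 * vsval w.1 + a1 * sg (vsval w.1)).

Fact PGfun_is_linear a0 a1 : linear (PGfun a0 a1).
Proof.
move=> c w w'; rewrite /PGfun /= !linearP /= !mulrDr -!scalerAr scalerBr scalerDr.
by ring.
Qed.
HB.instance Definition _ a0 a1 :=
  GRing.isLinear.Build F V L *:%R (PGfun a0 a1) (PGfun_is_linear a0 a1).

Definition PG a0 a1 : {vspace V} := lker (linfun (PGfun a0 a1)).

Lemma mem_PG a0 a1 w :
  (w \in PG a0 a1) = (w.2 == a0 * vsval w.1 + a1 * sg (vsval w.1)).
Proof. by rewrite memv_ker lfunE /= /PGfun subr_eq0. Qed.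

Lemma mk_PG a0 a1 x y : x \in W -> (mk x y \in PG a0 a1) = (y == a0 * x + a1 * sg x).
Proof. by move=> xW; rewrite mem_PG /= vsprojK. Qed.

Lemma PG_graph a0 a1 f : (forall x, f x = a0 * vsval x + a1 * vsval x ^+ q) ->
  [set` PG a0 a1]%classic = graph f.
Proof.
move=> fE; apply/seteqP; split=> w; rewrite /graph /= mem_PG fE -/(sg _).
  by move/eqP.
by move->.
Qed.

Lemma set_vspace_inj (U U' : {vspace V}) : [set` U]%classic = [set` U']%classic -> U = U'.
Proof.
move=> e; apply/vspaceP => v; apply/idP/idP => vU.
  by have: [set` U']%classic v by rewrite -e.
by have: [set` U]%classic v by rewrite e.
Qed.

Definition pg_basis (a0 a1 x : L) := mk x (a0 * x + a1 * sg x).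

Lemma PG_span a0 a1 w0 w1 w2 : w0 \in W -> w1 \in W -> w2 \in W -> indep3 w0 w1 w2 ->
  PG a0 a1 = <<[:: pg_basis a0 a1 w0; pg_basis a0 a1 w1; pg_basis a0 a1 w2]>>%VS.
Proof.
move=> h0 h1 h2 ind; apply/eqP; rewrite eqEsubv; apply/andP; split; last first.
  by apply/span_subvP => x; rewrite !inE => /or3P[] /eqP->; rewrite mk_PG.
apply/subvP => w; rewrite mem_PG => /eqP e.
have /span3P[c [d [g eg]]] : vsval w.1 \in <<[:: w0; w1; w2]>>%VS.
  by rewrite -(W_span h0 h1 h2 ind) subvsP.
apply/span3P; exists c, d, g; rewrite -[w]mkK e eg /pg_basis !mkZ !mkD.
by congr mk; rewrite !sgD !sgZ !mulrDr -!scalerAr !scalerDr; ring.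
Qed.

Lemma dim_PG a0 a1 : \dim (PG a0 a1) = 3%N.
Proof.
have [w0 [w1 [w2 [h0 h1 h2 ind]]]] := W_basis.
rewrite (PG_span _ _ h0 h1 h2 ind) dim_span3 // => c d e.
rewrite /pg_basis !mkZ !mkD => /mk_eq0[]; last by move=> /ind.
by rewrite !memvD ?memvZ.
Qed.

Lemma PG_S a0 a1 : (PG a0 a1 :&: SV L)%VS = 0%VS.
Proof.
apply/eqP; rewrite -subv0; apply/subvP => w; rewrite memv_cap mem_PG mem_SV memv0.
case/andP => /eqP e /eqP w1; rewrite -[w]mkK e w1 /=.
by rewrite sg0 !mulr0 addr0 mk00.
Qed.

Lemma PG_inter a0 a1 b0 b1 : (1 < \dim (PG a0 a1 :&: PG b0 b1))%N -> a0 = b0 /\ a1 = b1.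
Proof.
case/dim_gt1P => u [v []]; rewrite !memv_cap !mem_PG.
move=> /andP[/eqP ua /eqP ub] /andP[/eqP va /eqP vb] ind.
have ind1 : indep2 (vsval u.1) (vsval v.1).
  move=> c d cd; apply: ind; rewrite -[u]mkK -[v]mkK ua va !mkZ !mkD cd.
  rewrite -[RHS]mk00; congr mk; rewrite !scalerDr !scalerAr -!linearZ /=.
  have -> : a0 * (c *: vsval u.1) + a1 * sg (c *: vsval u.1) + (a0 * (d *: vsval v.1) + a1 * sg (d *: vsval v.1)) =
    a0 * (c *: vsval u.1 + d *: vsval v.1) + a1 * sg (c *: vsval u.1 + d *: vsval v.1).
    by rewrite rmorphD /=; ring.
  by rewrite cd sg0 !mulr0 addr0.
have [||] := @coef2_eq0 _ _ (a0 - b0) (a1 - b1) _ _ (indep_delta ind1).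
- by apply/eqP; rewrite !mulrBl addrACA -opprD -ua -ub subrr.
- by apply/eqP; rewrite !mulrBl addrACA -opprD -va -vb subrr.
by move=> /eqP; rewrite subr_eq0 => /eqP-> /eqP; rewrite subr_eq0 => /eqP->.
Qed.

(* the planes r N(Z, g), Z = <a, b>, with g(x) = delta v x / delta a b *)
Definition npl_basis (r a b v x : L) := mk x (r * (delta v x / delta a b)).
Definition Npl (r a b v : L) : {vspace V} :=
  <<[:: npl_basis r a b v a; npl_basis r a b v b; mk 0 r]>>%VS.

(** Here E = <a, b, v> and Z = <a, b>. The factor kappa of N(Z, kappa g_E) is absorbed into v. *)
Definition ndata (a b v : L) := [/\ a \in W, b \in W, delta a b != 0 & v \notin W].

Lemma npl_arg (r x y t : L) (c d n : F) :
  r * ((c *: x + d *: y) / t + n%:A) = c *: (r * (x / t)) + d *: (r * (y / t)) + n *: r.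
Proof.
by rewrite mulrDr mulrDl mulrDr -!scalerAl -!scalerAr mulr1.
Qed.

Lemma mem_Npl r a b v w : ndata a b v ->
  reflect (vsval w.1 \in <<[:: a; b]>>%VS /\
           exists n : F, w.2 = r * (delta v (vsval w.1) / delta a b + n%:A))
          (w \in Npl r a b v).
Proof.
move=> [aW bW ab vW]; apply: (iffP (span3P _ _ _ _)) => [[c [d [n ->]]]|].
  have cdW : c *: a + d *: b \in W by rewrite memvD ?memvZ.
  rewrite /npl_basis !mkZ !mkD scaler0 addr0 mk1 //; split.
    by apply/span2P; exists c, d.
  by exists n; rewrite /= deltaDr !deltaZr; exact/esym/npl_arg.
move=> [/span2P[c [d e1]] [n e2]]; exists c, d, n.
rewrite -[w]mkK e2 e1 /npl_basis !mkZ !mkD scaler0 addr0; congr mk.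
by rewrite deltaDr !deltaZr; exact: npl_arg.
Qed.

Lemma dim_Npl r a b v : r != 0 -> ndata a b v -> \dim (Npl r a b v) = 3%N.
Proof.
move=> r0 [aW bW ab vW]; rewrite dim_span3 // => c d n.
rewrite /npl_basis !mkZ !mkD scaler0 addr0 => /mk_eq0[].
  by rewrite memvD ?memvZ.
move=> /(delta_neq0 ab)[-> ->]; rewrite !scale0r !add0r => /eqP.
by rewrite scaler_eq0 (negPf r0) orbF => /eqP.
Qed.

End Planes.

Local Opaque delta.

(** * The planes r N(Z, g) and their intersections *)

Section Npl.
Variables (F : finFieldType) (L : fieldExtType F).
Hypothesis hL : \dim {:L} = 4%N.
Local Notation W := (W L).
Local Notation V := (V L).

Lemma divZr (c : F) (x y : L) : x / (c *: y) = c^-1 *: (x / y).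
Proof.
have [->|c0] := eqVneq c 0; first by rewrite !(invr0, scale0r) mulr0.
have [->|y0] := eqVneq y 0; first by rewrite scaler0 !(invr0, mulr0) scaler0.
by rewrite invrZ ?unitfE // -scalerAr.
Qed.

Lemma divZ (c : F) (x y : L) : c != 0 -> c *: x / (c *: y) = x / y.
Proof. by move=> c0; rewrite divZr -scalerAl scalerA mulVf // scale1r. Qed.

Lemma ndata_neq0 (a b v : L) : ndata a b v -> delta a b != 0.
Proof. by case. Qed.

Lemma mk_Npl r (a b v x y : L) : ndata a b v -> x \in W ->
  x \in <<[:: a; b]>>%VS -> (exists n : F, y = r * (delta v x / delta a b + n%:A)) ->
  mk x y \in Npl r a b v.
Proof. by move=> nd xW xab yE; apply/mem_Npl => //; rewrite mk1. Qed.

Lemma ndata_W (a b v x : L) : ndata a b v -> x \in <<[:: a; b]>>%VS -> x \in W.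
Proof. by case=> aW bW _ _ /span2P[c [d ->]]; rewrite memvD ?memvZ. Qed.

Lemma Npl_eqI r r' (a b v a' b' v' : L) : r != 0 -> r' != 0 ->
  ndata a b v -> ndata a' b' v' -> a \in <<[:: a'; b']>>%VS -> b \in <<[:: a'; b']>>%VS ->
  (exists c : F, r = c *: r') ->
  (forall x, x \in [:: a; b] -> exists n : F,
     r * (delta v x / delta a b) = r' * (delta v' x / delta a' b' + n%:A)) ->
  Npl r a b v = Npl r' a' b' v'.
Proof.
move=> r0 r0' nd nd' ha hb [c rc] h; apply: plane_eq; rewrite ?dim_Npl //.
have [aW bW _ _] := nd.
apply/span_subvP => w; rewrite !inE => /or3P[] /eqP->.
- by apply: mk_Npl => //; apply: h; rewrite !inE eqxx.
- by apply: mk_Npl => //; apply: h; rewrite !inE eqxx orbT.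
apply: mk_Npl; rewrite ?mem0v //; exists c.
by rewrite deltaE sg0 !mulr0 subrr mul0r add0r -scalerAr mulr1.
Qed.

Lemma delta_comb (a b : L) (c d e f : F) :
  delta (c *: a + d *: b) (e *: a + f *: b) = (c * f - d * e) *: delta a b.
Proof.
rewrite deltaDl !deltaDr !deltaZl !deltaZr !deltaxx !scaler0 add0r addr0 !scalerA.
by rewrite (deltaC b a) scalerN -scalerBl.
Qed.

Lemma delta_shift_l (a b v : L) (c d : F) : delta a b != 0 ->
  delta (v + (c *: a + d *: b)) a / delta a b = delta v a / delta a b - d%:A.
Proof.
move=> ab; have := delta_comb a b c d 1 0; rewrite scale1r scale0r addr0 => e.
by rewrite deltaDl e (mulrDl (delta v a)) mulr0 mulr1 sub0r -scalerAl divff // scaleNr.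
Qed.

Lemma delta_shift_r (a b v : L) (c d : F) : delta a b != 0 ->
  delta (v + (c *: a + d *: b)) b / delta a b = delta v b / delta a b + c%:A.
Proof.
move=> ab; have := delta_comb a b c d 0 1; rewrite scale1r scale0r add0r => e.
by rewrite deltaDl e (mulrDl (delta v b)) mulr0 mulr1 subr0 -scalerAl divff.
Qed.

(** The first of three changes of the data (r, a, b, v) that keep the plane: a scalar passes from r
    to v. *)
Lemma Npl_scale r (a b v : L) (c : F) : r != 0 -> c != 0 -> ndata a b v ->
  ndata a b (c *: v) /\ Npl (c *: r) a b v = Npl r a b (c *: v).
Proof.
move=> r0 c0 nd; have [aW bW ab vW] := nd.
have nd' : ndata a b (c *: v).
  by split=> //; apply: contra vW => h; rewrite -[v](scalerK c0) memvZ.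
split=> //; apply: Npl_eqI => //.
- by rewrite scaler_eq0 negb_or c0.
- by rewrite memv_span // !inE eqxx.
- by rewrite memv_span // !inE eqxx orbT.
- by exists c.
move=> x _; exists 0; rewrite scale0r addr0 deltaZl.
by rewrite -!scalerAl -scalerAr.
Qed.

(** For z in Z the function delta z x / delta a b takes values in F on Z, so it is absorbed by the
    summand nu. *)
Lemma Npl_shift r (a b v : L) (c d : F) : r != 0 -> ndata a b v ->
  let v' := v + (c *: a + d *: b) in ndata a b v' /\ Npl r a b v = Npl r a b v'.
Proof.
move=> r0 nd v'; have [aW bW ab vW] := nd.
have nd' : ndata a b v'.
  split=> //; apply: contra vW => h.
  by rewrite -[v](addrK (c *: a + d *: b)) memvB // memvD ?memvZ.
split=> //; apply: Npl_eqI => //.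
- by rewrite memv_span // !inE eqxx.
- by rewrite memv_span // !inE eqxx orbT.
- by exists 1; rewrite scale1r.
move=> x; rewrite /v' !inE => /orP[] /eqP->.
  by exists d; rewrite delta_shift_l // subrK.
by exists (- c); rewrite delta_shift_r // scaleNr addrK.
Qed.

(** A change of basis of Z multiplies [delta a b] by its determinant c, which c v compensates. *)
Lemma Npl_rebase r (a b v a' b' : L) : r != 0 -> ndata a b v ->
  a' \in <<[:: a; b]>>%VS -> b' \in <<[:: a; b]>>%VS -> delta a' b' != 0 ->
  exists c : F, [/\ c != 0, delta a' b' = c *: delta a b,
    <<[:: a'; b']>>%VS = <<[:: a; b]>>%VS, ndata a' b' (c *: v) &
    Npl r a b v = Npl r a' b' (c *: v)].
Proof.
move=> r0 nd ha hb ab'; have [aW bW ab vW] := nd.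
have [c1 [d1 ea]] := span2P _ _ _ ha; have [c2 [d2 eb]] := span2P _ _ _ hb.
have e : delta a' b' = (c1 * d2 - d1 * c2) *: delta a b by rewrite ea eb delta_comb.
have c0 : c1 * d2 - d1 * c2 != 0.
  by apply: contraNneq ab' => c0; rewrite e c0 scale0r.
have sp : <<[:: a'; b']>>%VS = <<[:: a; b]>>%VS.
  apply/eqP; rewrite eqEdim !dim_span2 //; [|exact: delta_neq0..].
  by rewrite andbT; apply/span_subvP => x; rewrite !inE => /orP[] /eqP->.
have nd' : ndata a' b' ((c1 * d2 - d1 * c2) *: v).
  split=> //; try exact: ndata_W nd _.
  by apply: contra vW => h; rewrite -[v](scalerK c0) memvZ.
exists (c1 * d2 - d1 * c2); split=> //; apply: Npl_eqI => //.
- by rewrite sp memv_span // !inE eqxx.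
- by rewrite sp memv_span // !inE eqxx orbT.
- by exists 1; rewrite scale1r.
move=> x _; exists 0; rewrite scale0r addr0 e deltaZl.
by rewrite divZ.
Qed.

Lemma span3_ch (a b v a' b' : L) (c d e : F) : c != 0 ->
  <<[:: a'; b']>>%VS = <<[:: a; b]>>%VS ->
  <<[:: a'; b'; (c *: v + (d *: a' + e *: b'))%R]>>%VS = <<[:: a; b; v]>>%VS.
Proof.
move=> c0 sp.
have cons3 (x y z : L) : <<[:: x; y; z]>>%VS = (<<[:: x; y]>> + <[z]>)%VS.
  by rewrite -[[:: x; y; z]]/([:: x; y] ++ [:: z]) span_cat span_seq1.
rewrite !cons3 -sp; apply/eqP; rewrite eqEsubv; apply/andP; split.
  rewrite subv_add addvSl -memvE memvD //.
    by rewrite (subvP (addvSr _ _)) // memvZ // memv_line.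
  by rewrite (subvP (addvSl _ _)) //; apply/span2P; exists d, e.
rewrite subv_add addvSl -memvE.
set z := c *: v + _.
have -> : v = c^-1 *: (z - (d *: a' + e *: b')) by rewrite /z addrK scalerK.
rewrite memvZ // memvB //.
  by rewrite (subvP (addvSr _ _)) // memv_line.
by rewrite (subvP (addvSl _ _)) //; apply/span2P; exists d, e.
Qed.

(** Two points over independent elements of Z can be taken as the basis of Z, and a shift of v then
    makes nu = 0 at both of them. *)
Lemma Npl_line r (a b v : L) w1 w2 : r != 0 -> ndata a b v ->
  w1 \in Npl r a b v -> w2 \in Npl r a b v ->
  indep2 (vsval w1.1) (vsval w2.1) ->
  exists u, [/\ ndata (vsval w1.1) (vsval w2.1) u,
    Npl r a b v = Npl r (vsval w1.1) (vsval w2.1) u,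
    w1.2 = r * (delta u (vsval w1.1) / delta (vsval w1.1) (vsval w2.1)) &
    w2.2 = r * (delta u (vsval w2.1) / delta (vsval w1.1) (vsval w2.1))].
Proof.
move=> r0 nd h1 h2 /indep_delta ind.
have [a1 _] := mem_Npl r w1 nd h1; have [b1 _] := mem_Npl r w2 nd h2.
have [c [c0 ce sp nd' eN]] := Npl_rebase r0 nd a1 b1 ind.
move: h1 h2; rewrite eN => /(mem_Npl r w1 nd')[_ [n1 e1]] /(mem_Npl r w2 nd')[_ [n2 e2]].
set x1 := vsval w1.1 in ind nd' e1 e2 eN *; set x2 := vsval w2.1 in ind nd' e1 e2 eN *.
have [nd2 eN2] := Npl_shift n2 (- n1) r0 nd'.
exists (c *: v + (n2 *: x1 + (- n1) *: x2)); split=> //.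
  by rewrite e1 delta_shift_l // scaleNr opprK.
by rewrite e2 delta_shift_r.
Qed.

Lemma Npl_point r (a b v : L) w : r != 0 -> ndata a b v -> w \in Npl r a b v ->
  vsval w.1 != 0 ->
  exists b1 v1, [/\ ndata (vsval w.1) b1 v1,
    <<[:: vsval w.1; b1]>>%VS = <<[:: a; b]>>%VS,
    <<[:: vsval w.1; b1; v1]>>%VS = <<[:: a; b; v]>>%VS,
    Npl r a b v = Npl r (vsval w.1) b1 v1 &
    w.2 = r * (delta v1 (vsval w.1) / delta (vsval w.1) b1)].
Proof.
move=> r0 nd h x0; have [xab _] := mem_Npl r w nd h.
set x := vsval w.1 in x0 xab *.
have [b1 b1ab xb1] : exists2 b1, b1 \in <<[:: a; b]>>%VS & delta x b1 != 0.
  have : ~~ (<<[:: a; b]>> <= <[x]>)%VS.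
    apply/negP => /dimvS; rewrite dim_span2; last exact/delta_neq0/ndata_neq0/nd.
    by rewrite dim_vline x0.
  case/subvPn => b1 b1ab b1x; exists b1 => //.
  exact/indep_delta/indep2P.
have [c [c0 ce sp nd' eN]] := Npl_rebase r0 nd xab b1ab xb1.
move: h; rewrite eN => /(mem_Npl r w nd')[_ [n e]].
have [nd2 eN2] := Npl_shift 0 (- n) r0 nd'.
exists b1, (c *: v + (0 *: x + (- n) *: b1)); split=> //.
  exact: span3_ch.
by rewrite e delta_shift_l // scaleNr opprK.
Qed.

(** The reason for the removal of graphs. A graph meets S trivially, so the common line projects
    onto Z; there the map of the graph agrees with r (u x^q - u^q x) / delta x1 x2, and two
    independent arguments determine both coefficients. *)
Lemma PG_N a0 a1 r (a b v : L) : r != 0 -> ndata a b v ->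
  (1 < \dim (PG a0 a1 :&: Npl r a b v))%N ->
  exists r' u, [/\ r' != 0, u \notin W, a0 = - (r' * sg u) & a1 = r' * u].
Proof.
move=> r0 nd /dim_gt1P[w1 [w2 []]]; rewrite !memv_cap !mem_PG.
move=> /andP[/eqP e1 h1] /andP[/eqP e2 h2] ind.
have ind1 : indep2 (vsval w1.1) (vsval w2.1).
  move=> c d cd; apply: ind; rewrite -[w1]mkK -[w2]mkK e1 e2 !mkZ !mkD cd.
  rewrite -[RHS]mk00; congr mk; rewrite !scalerDr !scalerAr -!sgZ.
  rewrite addrACA -!mulrDr -sgD cd sg0; by rewrite !mulr0 addr0.
have [u [nd' _ e1' e2']] := Npl_line r0 nd h1 h2 ind1.
have [_ _ d0 uW] := nd'.
set x1 := vsval w1.1 in d0 e1 e2 e1' e2' *; set x2 := vsval w2.1 in d0 e1 e2 e1' e2' *.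
exists (r / delta x1 x2), u.
have [||] := @coef2_eq0 _ _ (a0 + (r / delta x1 x2) * sg u) (a1 - (r / delta x1 x2) * u) _ _ d0.
- have -> : (a0 + r / delta x1 x2 * sg u) * x1 + (a1 - r / delta x1 x2 * u) * sg x1 =
   (a0 * x1 + a1 * sg x1) - r * (delta u x1 / delta x1 x2).
    by rewrite [delta u x1]deltaE; move: (delta x1 x2)^-1 => t; ring.
  by rewrite -e1 -e1' subrr.
- have -> : (a0 + r / delta x1 x2 * sg u) * x2 + (a1 - r / delta x1 x2 * u) * sg x2 =
   (a0 * x2 + a1 * sg x2) - r * (delta u x2 / delta x1 x2).
    by rewrite [delta u x2]deltaE; move: (delta x1 x2)^-1 => t; ring.
  by rewrite -e2 -e2' subrr.
move=> /eqP; rewrite addr_eq0 => /eqP h /eqP; rewrite subr_eq0 => /eqP h'; split=> //.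
by rewrite mulf_neq0 ?invr_eq0.
Qed.

Lemma mk0_1 (y : L) : (mk 0 y : V).1 = 0.
Proof. by rewrite /mk linear0. Qed.

Lemma Npl_vert r (a b v : L) w : ndata a b v -> w \in Npl r a b v -> w.1 = 0 ->
  exists n : F, w = n *: mk 0 r.
Proof.
move=> nd /(mem_Npl r w nd)[_ [n]] e w1; exists n.
rewrite -[w]mkK e w1 linear0 deltaE sg0 !mulr0 subrr mul0r add0r mkZ scaler0.
by rewrite -scalerAr mulr1.
Qed.

(** Either the projection of U to Z has rank 2, or its kernel is the point of S on the plane and
    some other point of U lies off S. *)
Lemma sub_Npl r (a b v : L) (U : {vspace V}) : ndata a b v -> (U <= Npl r a b v)%VS ->
  (1 < \dim U)%N ->
  (exists w1 w2, [/\ w1 \in U, w2 \in U & indep2 (vsval w1.1) (vsval w2.1)]) \/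
  (mk 0 r \in U /\ exists2 t, t \in U & vsval t.1 != 0).
Proof.
move=> nd /subvP sU /dim_gt1P[w1 [w2 [h1 h2 ind]]].
have [ind1|nind] := pselect (indep2 (vsval w1.1) (vsval w2.1)).
  by left; exists w1, w2.
right; have [s [sU1 s0 s1]] : exists s, [/\ s \in U, s != 0 & s.1 = 0].
  have [c [d [cd n0]]] : exists c d : F, c *: vsval w1.1 + d *: vsval w2.1 = 0 /\ ~ (c = 0 /\ d = 0).
    apply: contrapT => h; apply: nind => c d cd; apply: contrapT => h'.
    by apply: h; exists c, d.
  exists (c *: w1 + d *: w2); split; rewrite ?memvD ?memvZ //.
    by apply/eqP => /ind.
  apply: val_inj; change (vsval (c *: w1.1 + d *: w2.1) = 0).
  by rewrite linearD !linearZ /= cd.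
split.
  have [n sE] := Npl_vert nd (sU _ sU1) s1.
  have n0 : n != 0 by apply: contraNneq s0 => n0; rewrite sE n0 scale0r.
  by rewrite -[mk 0 r](scalerK n0) -sE memvZ.
apply: contrapT => h.
have hz w : w \in U -> w.1 = 0.
  move=> wU; apply: contrapT => w0; apply: h; exists w => //.
  by apply: contra_notN w0 => /eqP w0; apply: val_inj; exact: w0.
have [m1 E1] := Npl_vert nd (sU _ h1) (hz _ h1).
have [m2 E2] := Npl_vert nd (sU _ h2) (hz _ h2).
have [|] := ind m2 (- m1).
  by rewrite E1 E2 !scalerA mulNr scaleNr mulrC subrr.
move=> m20 m10; have [] := ind 1 1; last by move/eqP; rewrite oner_eq0.
have m1z : m1 = 0 by apply/eqP; rewrite -oppr_eq0; apply/eqP.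
by rewrite E1 E2 m20 m1z !scale0r scaler0 addr0.
Qed.

(** If the common line misses S, then r u = r' u' and r u^q = r' u'^q after normalisation; so u / u'
    is fixed by the Frobenius map and the planes coincide. Otherwise the points on S agree, and both
    planes are normalised at a second common point, which lies over x. *)
Lemma Npl_inter r r' (a b v a' b' v' : L) : r != 0 -> r' != 0 ->
  ndata a b v -> ndata a' b' v' ->
  (1 < \dim (Npl r a b v :&: Npl r' a' b' v'))%N ->
  Npl r a b v = Npl r' a' b' v' \/
  (exists2 c : F, c != 0 & r' = c *: r) /\
  exists x b1 v1 b1' v1', [/\ ndata x b1 v1, ndata x b1' v1', indep3 x b1 b1',
    delta v1 x / delta x b1 = delta v1' x / delta x b1' &
    [/\ <<[:: x; b1]>>%VS = <<[:: a; b]>>%VS, <<[:: x; b1; v1]>>%VS = <<[:: a; b; v]>>%VS,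
     <<[:: x; b1']>>%VS = <<[:: a'; b']>>%VS &
     <<[:: x; b1'; v1']>>%VS = <<[:: a'; b'; v']>>%VS]].
Proof.
move=> r0 r0' nd nd' dI.
have [[w1 [w2 []]]|[]] := sub_Npl nd (capvSl _ _) dI.
  rewrite !memv_cap => /andP[h1 h1'] /andP[h2 h2'] ind1.
  left; have [u [ndu -> e1 e2]] := Npl_line r0 nd h1 h2 ind1.
  have [u' [ndu' -> e1' e2']] := Npl_line r0' nd' h1' h2' ind1.
  have [xW yW d0 uW] := ndu; have [_ _ _ uW'] := ndu'.
  set x1 := vsval w1.1 in ndu ndu' d0 e1 e2 e1' e2' *; set x2 := vsval w2.1 in ndu ndu' d0 e1 e2 e1' e2' *.
  have hx x : r * (delta u x / delta x1 x2) = r' * (delta u' x / delta x1 x2) ->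
     (- (r * sg u - r' * sg u')) * x + (r * u - r' * u') * sg x = 0.
    rewrite !mulrA => /(mulIf (invr_neq0 d0)); rewrite !deltaE => /eqP; rewrite -subr_eq0.
    by move=> /eqP <-; ring.
  have [||] := @coef2_eq0 _ _ (- (r * sg u - r' * sg u')) (r * u - r' * u') _ _ d0.
  - by apply: hx; rewrite -e1 e1'.
  - by apply: hx; rewrite -e2 e2'.
  move=> /eqP; rewrite oppr_eq0 subr_eq0 => /eqP su /eqP; rewrite subr_eq0 => /eqP eu.
  have u'0 : u' != 0 by apply: contraNneq uW' => ->; rewrite mem0v.
  have [c ec] : exists c : F, u / u' = c%:A.
    apply: sg_fix; rewrite sgM sgV; apply: (@mulfI _ r) => //.
    by rewrite !mulrA su eu -!mulrA !divff // sg_eq0.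
  have uE : u = c *: u' by rewrite -[u](divfK u'0) ec -scalerAl mul1r.
  have u0 : u != 0 by apply: contraNneq uW => ->; rewrite mem0v.
  have c0 : c != 0 by apply: contraNneq u0 => c0; rewrite uE c0 scale0r.
  have rE : r' = c *: r.
    by apply: (mulIf u'0); rewrite -eu uE -scalerAl scalerAr.
  by rewrite rE uE; have [_ ->] := Npl_scale r0 c0 ndu'.
rewrite memv_cap => /andP[_ hr] [t]; have [n rn] := Npl_vert nd' hr (mk0_1 r).
rewrite memv_cap => /andP[tN tN'] t0.
have rr1 : r = n *: r' by move: rn; rewrite mkZ => /mk_inj[]; rewrite ?scaler0 ?mem0v.
have n0 : n != 0 by apply: contraNneq r0 => n0; rewrite rr1 n0 scale0r.
have rr : r' = n^-1 *: r by rewrite rr1 scalerK.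
set k := n^-1 in rr; have k0 : k != 0 by rewrite invr_eq0.
have [b1 [v1 [nd1 sp1 sp3 eN eT]]] := Npl_point r0 nd tN t0.
have [b2 [v2 [nd2 sp1' sp3' eN' eT']]] := Npl_point r0' nd' tN' t0.
set x := vsval t.1 in t0 nd1 sp1 sp3 eN eT nd2 sp1' sp3' eN' eT' *.
have [nd2k eNk] := Npl_scale r0 k0 nd2.
rewrite -rr in eNk.
have ee : delta v1 x / delta x b1 = delta (k *: v2) x / delta x b2.
  apply: (@mulfI _ r) => //; rewrite -eT eT' rr deltaZl.
  by rewrite -!scalerAl -scalerAr.
have [xW b1W d1 v1W] := nd1; have [_ b2W d2 v2W] := nd2.
(* Different spaces Z give the collision. If they are equal, the two vectors v, suitably scaled,
   differ by a multiple of x, and the planes coincide. *)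
have [b2in|b2n] := boolP (b2 \in <<[:: x; b1]>>%VS); last first.
  right; split; first by exists k.
  exists x, b1, v1, b2, (k *: v2); split=> //.
    move=> c d e /eqP; have [->|e0] := eqVneq e 0.
      by rewrite scale0r addr0 => /eqP /(delta_neq0 d1)[-> ->].
    rewrite addrC addr_eq0 => /eqP h; case/negP: b2n.
    by rewrite -[b2](scalerK e0) h memvZ // memvN; apply/span2P; exists c, d.
  split=> //; rewrite -sp3'; have := @span3_ch x b2 v2 x b2 k 0 0 k0 erefl.
  by rewrite !scale0r !addr0.
left; rewrite eN eN' eNk.
have xin : x \in <<[:: x; b1]>>%VS by rewrite memv_span // !inE eqxx.
have [c [c0 ce sp nd3 eN3]] := Npl_rebase r0 nd1 xin b2in d2.
rewrite eN3.
have /eqP : delta (k *: v2 - c *: v1) x = 0.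
  apply: (mulIf (invr_neq0 d2)); rewrite mul0r deltaDl (mulrDl (delta (k *: v2) x)) -ee -scaleNr deltaZl -scalerAl.
  by rewrite ce divZr scalerA mulNr divff // scaleN1r subrr.
rewrite deltaC oppr_eq0 => /eqP /(delta_eq0 t0)[m em].
have [_ ->] := Npl_shift m 0 r0 nd3.
by rewrite scale0r addr0 -em addrC subrK.
Qed.

Lemma delta_same (a b w : L) : delta a b != 0 -> delta w a = 0 -> delta w b = 0 -> w = 0.
Proof.
move=> ab wa wb; have [//|w0] := eqVneq w 0.
have [c ec] := delta_eq0 w0 wa; have [d ed] := delta_eq0 w0 wb.
by case/eqP: ab; rewrite ec ed deltaZl deltaZr deltaxx !scaler0.
Qed.

(** The converse of [Npl_scale] and [Npl_shift]: with a and b kept, no other change of r and v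
    preserves the plane. *)
Lemma Npl_same r r' (a b v v' : L) : r != 0 -> ndata a b v -> ndata a b v' ->
  Npl r a b v = Npl r' a b v' ->
  exists c d e : F, [/\ c != 0, r = c *: r' & v' = c *: v + (d *: a + e *: b)].
Proof.
move=> r0 nd nd' eN; have [aW bW ab _] := nd.
have [n rn] : exists n : F, mk 0 r = n *: mk 0 r'.
  apply: (Npl_vert nd' _ (mk0_1 r)).
  by rewrite -eN memv_span // !inE eqxx !orbT.
have rr : r = n *: r' by move: rn; rewrite mkZ => /mk_inj[]; rewrite ?scaler0 ?mem0v.
have n0 : n != 0 by apply: contraNneq r0 => n0; rewrite rr n0 scale0r.
have r'0 : r' != 0 by apply: contraNneq r0 => r'0; rewrite rr r'0 scaler0.
have key x : x \in [:: a; b] -> exists m : F, delta (v' - n *: v) x = m *: delta a b.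
  move=> xab; have xW : x \in W by move: xab; rewrite !inE => /orP[] /eqP->.
  have : npl_basis r a b v x \in Npl r' a b v'.
    by rewrite -eN memv_span //; move: xab; rewrite !inE => /orP[] /eqP->; rewrite eqxx ?orbT.
  case/(mem_Npl r' _ nd') => _ [m]; rewrite mk1 //= rr -scalerAl scalerAr => /(mulfI r'0) e.
  exists (- m); rewrite -scaleN1r deltaDl !deltaZl scaleN1r.
  apply: (mulIf (invr_neq0 ab)); rewrite mulrBl -!scalerAl divff // e.
  by rewrite scaleNr opprD addNKr.
have [m1 e1] := key a (mem_head _ _).
have [m2 e2] : exists m : F, delta (v' - n *: v) b = m *: delta a b.
  by apply: key; rewrite !inE eqxx orbT.
(* An element of Z is known from its [delta] with a and b: for m2 a - m1 b these are m1 and m2 times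
   [delta a b]. *)
exists n, m2, (- m1); split=> //; apply/eqP; rewrite -subr_eq0 opprD addrA; apply/eqP.
have := delta_comb a b m2 (- m1) 1 0; rewrite scale1r scale0r addr0 mulr0 mulr1 sub0r opprK => f1.
have := delta_comb a b m2 (- m1) 0 1; rewrite scale1r scale0r add0r mulr0 mulr1 subr0 => f2.
by apply: (delta_same ab); rewrite deltaDl -[- (_ + _)]scaleN1r deltaZl scaleN1r ?e1 ?e2 ?f1 ?f2 subrr.
Qed.

End Npl.

(** * The character chi, Moore determinants and the collision of two planes *)

Section Collision.
Variables (F : finFieldType) (L : fieldExtType F).
Local Notation q := #|F|.
Hypothesis hL : \dim {:L} = 4%N.
Local Notation W := (W L).
Local Notation D x := (sg x - x).

Lemma prim_rootL : exists g : L, (q ^ 4).-1.-primitive_root g.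
Proof.
have q4 : (0 < (q ^ 4).-1)%N.
  have : (q ^ 0 < q ^ 4)%N by rewrite ltn_exp2l ?q_gt1.
  by rewrite expn0; case: (q ^ 4)%N => [|[]].
pose rs : seq (finvect_type L) := enum (predC1 0).
have srs : size rs = (q ^ 4).-1 by rewrite -cardE cardC1 card_L.
have /hasP[g _ hg] : has (q ^ 4).-1.-primitive_root rs; last by exists g.
apply: cyclic.has_prim_root; rewrite ?srs ?enum_uniq //.
apply/allP => x; rewrite mem_enum inE => x0.
have := sg4 hL x; rewrite -[sg _]/(iter 4 (@sg F L) x) sgXn => e.
rewrite unity_rootE; apply/eqP/(mulfI x0).
by rewrite -exprS prednK ?mulr1 // expn_gt0 (ltnW (q_gt1 F)).
Qed.

Lemma expL (x : L) : x != 0 -> x ^+ (q ^ 4).-1 = 1.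
Proof.
move=> x0; apply/(mulfI x0); rewrite -exprS prednK ?mulr1 ?expn_gt0 ?(ltnW (q_gt1 F)) //.
by rewrite -sgXn /= sg4.
Qed.

(** The exponent is (q^4 - 1) / (q + 1), so chi is 1 exactly on the nonzero (q+1)-th powers, among
    them the nonzero scalars. *)
Definition chi (t : L) := t ^+ ((q ^ 2).+1 * q.-1).

Lemma chiM s t : chi (s * t) = chi s * chi t. Proof. exact: exprMn. Qed.
Lemma chiV t : chi t^-1 = (chi t)^-1. Proof. exact: exprVn. Qed.
Lemma chi_sg t : chi (sg t) = sg (chi t). Proof. by rewrite /chi rmorphXn. Qed.

Lemma q4E : ((q ^ 4).-1 = q.+1 * ((q ^ 2).+1 * q.-1))%N.
Proof.
have := q_gt1 F; case: (#|F|) => // n _; rewrite [n.+1.-1]/=.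
suff -> : (n.+1 ^ 4 = (n.+2 * ((n.+1 ^ 2).+1 * n)).+1)%N by [].
by ring.
Qed.

Lemma chi_scalar (c : F) : c != 0 -> chi c%:A = 1.
Proof.
move=> c0; rewrite /chi mulnC exprM.
have -> : c%:A ^+ q.-1 = 1 :> L; last by rewrite expr1n.
apply/(@mulfI _ c%:A); first by rewrite scaler_eq0 negb_or c0 oner_eq0.
by rewrite -exprS prednK ?(ltnW (q_gt1 F)) // -/(sg _) sg_scalar mulr1.
Qed.

Lemma chi_eps (k : L) : k != 0 -> sg k = - k -> chi k = 1.
Proof.
move=> k0 sk; rewrite /chi mulnC exprM.
have -> : k ^+ q.-1 = -1.
  by apply/(mulfI k0); rewrite -exprS prednK ?(ltnW (q_gt1 F)) // -/(sg _) sk mulrN1.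
by rewrite exprS -(sgXn 2) /= !rmorphN1 mulrNN mulr1.
Qed.

Lemma chi_norm (u : L) : u != 0 -> chi (u ^+ q.+1) = 1.
Proof. by move=> u0; rewrite /chi -exprM -q4E expL. Qed.

(** Values of chi are (q+1)-th roots of unity and q^2 is 1 modulo q + 1, so the square of the
    Frobenius map fixes them. *)
Lemma chi_sg2 (t : L) : t != 0 -> chi (t / sg (sg t)) = 1.
Proof.
move=> t0; rewrite chiM chiV !chi_sg.
suff -> : sg (sg (chi t)) = chi t by rewrite divff // expf_neq0.
rewrite -[LHS]/(iter 2 (@sg F L) _) sgXn /chi -exprM.
have -> : ((q ^ 2).+1 * q.-1 * q ^ 2 = (q ^ 4).-1 * q.-1 + (q ^ 2).+1 * q.-1)%N.
  rewrite q4E; have := q_gt1 F; case: (#|F|) => // n _; rewrite [n.+1.-1]/=.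
  by ring.
by rewrite exprD exprM expL // expr1n mul1r.
Qed.

Lemma chi_root (t : L) : t != 0 -> chi t = 1 -> exists2 u, u != 0 & t = u ^+ q.+1.
Proof.
move=> t0 ct; have [g hg] := prim_rootL.
have [i ei] : exists i : nat, t = g ^+ i by have [i ->] := prim_rootP hg (expL t0); exists i.
have g0 : g != 0.
  apply/eqP => g0; have := prim_expr_order hg.
  by rewrite g0 expr0n eqn0Ngt (prim_order_gt0 hg) => /eqP; rewrite eq_sym oner_eq0.
have : (q.+1 %| i)%N.
  have : ((q ^ 4).-1 %| i * ((q ^ 2).+1 * q.-1))%N.
    by rewrite (prim_order_dvd hg) exprM -ei -/(chi t) ct.
  rewrite q4E dvdn_pmul2r // muln_gt0 /=.
  by have := q_gt1 F; case: (#|F|) => [|[]].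
case/dvdnP => j ej; exists (g ^+ j); first exact: expf_neq0.
by rewrite -exprM -ej.
Qed.

Lemma mem_mulW (t y : L) : t != 0 -> (y \in (<[t]> * W)%VS) = (y / t \in W).
Proof.
move=> t0; rewrite prodvC; apply/memv_cosetP/idP => [[u uW ->]|h].
  by rewrite mulfK.
by exists (y / t); rewrite // divfK.
Qed.

Lemma dim_mulW (t : L) : t != 0 -> \dim (<[t]> * W)%VS = 3%N.
Proof. by move=> t0; rewrite prodvC dim_cosetv // dim_W. Qed.

(** Take y0 of nonzero trace and c with tr((m - c) y0) = 0. The functional x -> tr((m - c) x)
    vanishes on W and at y0, hence everywhere, which is impossible for m - c invertible. *)
Lemma stabW (m : L) : (forall y, y \in W -> m * y \in W) -> exists c : F, m = c%:A.
Proof.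
move=> h; have [y0 y00] := tr4_neq0 hL.
have [c0 e0] := tr4_scalar hL y0; have [c1 e1] := tr4_scalar hL (m * y0).
have c00 : c0 != 0 by apply: contraNneq y00 => c0e; rewrite e0 c0e scale0r.
exists (c1 / c0); apply/eqP; rewrite -subr_eq0; apply: contrapT => /negP n0.
have [z z0] := tr4_neq0 hL.
have [c2 e2] := tr4_scalar hL ((m - (c1 / c0)%:A)^-1 * z).
have wW : (m - (c1 / c0)%:A)^-1 * z - (c2 / c0) *: y0 \in W.
  by rewrite mem_W linearB /= tr4Z e2 e0 scalerA divfK // subrr.
have := h _ wW; rewrite mem_W => /eqP hm.
have : tr4 ((m - (c1 / c0)%:A) * ((m - (c1 / c0)%:A)^-1 * z)) = 0.
  rewrite -[X in _ * X](subrK ((c2 / c0) *: y0)) mulrDr linearD /=.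
  rewrite mulrBl linearB /= hm sub0r -scalerAl mul1r tr4Z.
  move: wW; rewrite mem_W => /eqP ->; rewrite scaler0 oppr0 add0r.
  rewrite -scalerAr tr4Z mulrBl linearB /= e1 -scalerAl mul1r tr4Z e0 scalerA divfK //.
  by rewrite subrr scaler0.
by rewrite mulrA divff // mul1r => /eqP; rewrite (negPf z0).
Qed.

Lemma mulW_eq (s t : L) : s != 0 -> t != 0 -> (<[t]> * W)%VS = (<[s]> * W)%VS ->
  exists2 c : F, c != 0 & t = c *: s.
Proof.
move=> s0 t0 e; have [y yW|c ec] := @stabW (t / s).
  rewrite mulrAC -mem_mulW // -e mem_mulW // mulrC mulKf //.
exists c; last by rewrite -[t](divfK s0) ec -scalerAl mul1r.
by apply: contraNneq t0 => c0; rewrite -[t](divfK s0) ec c0 scale0r mul0r.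
Qed.

(** Up to sign, tr(m x) is k times the 4 x 4 Moore determinant of x, y, z and a repeated column x,
    expanded along that column: the minors are conjugates of [moore3 x y z], and the conjugates of k
    supply the alternating signs. *)
Lemma tr4_moore (k x y z : L) : sg k = - k ->
  let m := k * sg (moore3 x y z) in
  [/\ tr4 (m * x) = 0, tr4 (m * y) = 0 & tr4 (m * z) = 0].
Proof.
by move=> sk; split; rewrite tr4E // /moore3 !deltaE !(sgM, sgD, sgB, sgN) !sk !sgN !sk
  ?sg4 // !sgN ?sk ?opprK; ring.
Qed.

Lemma moore3_mul (x y z : L) :
  moore3 x (x * y) (x * z) = x * sg x * sg (sg x) * delta (D y) (D z).
Proof. by rewrite /moore3 !deltaE !(sgM, sgB); ring. Qed.

(** A combination of y/x and z/x killed by D is a scalar, hence gives a relation between x, y, z. *)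
Lemma D_indep (x y z : L) : x != 0 -> indep3 x y z -> indep2 (D (y / x)) (D (z / x)).
Proof.
move=> x0 ind c d e.
have [g eg] : exists g : F, c *: (y / x) + d *: (z / x) = g%:A.
  apply: sg_fix; apply/eqP; rewrite -subr_eq0 -[X in _ == X]e sgD !sgZ !scalerBr.
  by apply/eqP; ring.
have [] := ind (- g) c d; last by move=> _ -> ->.
rewrite -addrA; have -> : c *: y + d *: z = (c *: (y / x) + d *: (z / x)) * x.
  by rewrite mulrDl -!scalerAl !divfK.
by rewrite eg -scalerAl mul1r scaleNr addNr.
Qed.

Lemma indep3_neq0 (x y z : L) : indep3 x y z -> x != 0.
Proof.
move=> ind; apply/eqP => x0; have [] := ind 1 0 0; last by move/eqP; rewrite oner_eq0.
by rewrite x0 scaler0 !scale0r !addr0.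
Qed.

Lemma moore3_neq0 (x y z : L) : indep3 x y z -> moore3 x y z != 0.
Proof.
move=> ind; have x0 := indep3_neq0 ind.
have -> : moore3 x y z = moore3 x (x * (y / x)) (x * (z / x)) by rewrite !(mulrC x) !divfK.
rewrite moore3_mul !mulf_neq0 ?sg_eq0 //.
exact/indep_delta/D_indep.
Qed.

Lemma span3_moore (k x y z : L) : k != 0 -> sg k = - k -> indep3 x y z ->
  <<[:: x; y; z]>>%VS = (<[(k * sg (moore3 x y z))^-1]> * W)%VS.
Proof.
move=> k0 sk ind; have [tx ty tz] := tr4_moore x y z sk.
have m0 : k * sg (moore3 x y z) != 0 by rewrite mulf_neq0 ?sg_eq0 // moore3_neq0.
apply: plane_eq; rewrite ?dim_span3 ?dim_mulW ?invr_eq0 //.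
apply/span_subvP => w; rewrite !inE => /or3P[] /eqP->;
  by rewrite mem_mulW ?invr_eq0 // invrK mulrC mem_W ?tx ?ty ?tz.
Qed.

Lemma moore3_W (k x y z : L) : k != 0 -> sg k = - k -> indep3 x y z ->
  x \in W -> y \in W -> z \in W ->
  exists2 c : F, c != 0 & k * sg (moore3 x y z) = c%:A.
Proof.
move=> k0 sk ind xW yW zW; have m0 : k * sg (moore3 x y z) != 0 by rewrite mulf_neq0 ?sg_eq0 // moore3_neq0.
have e := span3_moore k0 sk ind.
have [|c ec] := @stabW (k * sg (moore3 x y z)).
  move=> w wW; rewrite mulrC -[_ * sg _]invrK -mem_mulW ?invr_eq0 // -e.
  by rewrite -(W_span hL xW yW zW ind).
by exists c => //; apply: contraNneq m0 => c0; rewrite ec c0 scale0r.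
Qed.

(** The third power of the Frobenius map applied to b is eliminated between the traces of b and r b,
    likewise for b'; then the terms in b^q b'^q are eliminated between the two relations. The result
    says that delta b b' / (D r)^(q^2) is negated by the Frobenius map. *)
Lemma orth_delta (b b' r : L) : tr4 b = 0 -> tr4 b' = 0 -> tr4 (r * b) = 0 ->
  tr4 (r * b') = 0 ->
  sg (delta b b') * sg (sg (D r)) = - (delta b b' * sg (sg (sg (D r)))).
Proof.
rewrite !tr4E // !deltaE !(sgM, sgB) => h1 h2 h3 h4.
have e1 : (r - sg (sg (sg r))) * b + (sg r - sg (sg (sg r))) * sg b +
   (sg (sg r) - sg (sg (sg r))) * sg (sg b) = 0.
  transitivity ((r * b + sg r * sg b + sg (sg r) * sg (sg b) +
    sg (sg (sg r)) * sg (sg (sg b))) - sg (sg (sg r)) * (b + sg b + sg (sg b) + sg (sg (sg b)))).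
    by ring.
  by rewrite h3 h1 mulr0 subrr.
have e2 : (r - sg (sg (sg r))) * b' + (sg r - sg (sg (sg r))) * sg b' +
   (sg (sg r) - sg (sg (sg r))) * sg (sg b') = 0.
  transitivity ((r * b' + sg r * sg b' + sg (sg r) * sg (sg b') +
    sg (sg (sg r)) * sg (sg (sg b'))) - sg (sg (sg r)) * (b' + sg b' + sg (sg b') + sg (sg (sg b')))).
    by ring.
  by rewrite h4 h2 mulr0 subrr.
rewrite sg4 //; apply/eqP; rewrite -addr_eq0; apply/eqP.
transitivity (sg b' * ((r - sg (sg (sg r))) * b + (sg r - sg (sg (sg r))) * sg b +
   (sg (sg r) - sg (sg (sg r))) * sg (sg b)) - sg b * ((r - sg (sg (sg r))) * b' + (sg r - sg (sg (sg r))) * sg b' +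
   (sg (sg r) - sg (sg (sg r))) * sg (sg b'))); first by ring.
by rewrite e1 e2 !mulr0 subrr.
Qed.

Lemma tr4_D (y : L) : tr4 (D y) = 0.
Proof. by rewrite linearB /= !tr4E // !sg4 //; ring. Qed.

Lemma delta_div (x v b : L) : x != 0 -> delta v x / delta x b = - (D (v / x) / D (b / x)).
Proof.
move=> x0; have sx : sg x != 0 by rewrite sg_eq0.
have -> : delta v x = - (x * sg x * D (v / x)).
  by rewrite !deltaE sgM sgV; field; rewrite x0 sx.
have -> : delta x b = x * sg x * D (b / x).
  by rewrite !deltaE sgM sgV; field; rewrite x0 sx.
by rewrite mulNr -mulf_div divff ?mulf_neq0 // mul1r.
Qed.

(** The Moore determinants of x, b, v and of x, b, b' are, up to the same factor, delta B (r B) =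
    B^(q+1) t and delta B B', where t = D r. Their quotient is B^(q+1) times t / t^(q^2) divided by
    e, with e^q = - e by [orth_delta]. The second determinant is a scalar up to k, since x, b, b'
    span W, and chi is 1 on every factor. *)
Lemma collision (x b v b' v' : L) : ndata x b v -> ndata x b' v' -> indep3 x b b' ->
  delta v x / delta x b = delta v' x / delta x b' ->
  exists2 u, u != 0 & <<[:: x; b; v]>>%VS = (<[u ^+ q.+1]> * W)%VS.
Proof.
move=> [xW bW d1 vW] [_ b'W d2 v'W] ind.
have x0 := indep3_neq0 ind; have [k k0 sk] := exists_eps hL.
rewrite !delta_div // => /oppr_inj; set B := D (b / x); set B' := D (b' / x) => eR.
have indB := D_indep x0 ind; rewrite -/B -/B' in indB.
have B0 : B != 0.
  apply/eqP => B0; have [] := indB 1 0; last by move/eqP; rewrite oner_eq0.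
  by rewrite B0 scaler0 scale0r addr0.
have B'0 : B' != 0.
  apply/eqP => B0'; have [] := indB 0 1; last by move=> _ /eqP; rewrite oner_eq0.
  by rewrite B0' scaler0 scale0r addr0.
set r := D (v / x) / B in eR.
have rB : D (v / x) = r * B by rewrite divfK.
have rB' : D (v' / x) = r * B' by rewrite eR divfK.
have ind3 : indep3 x b v.
  move=> c d e /eqP; have [->|e0] := eqVneq e 0.
    by rewrite scale0r addr0 => /eqP /(delta_neq0 d1)[-> ->].
  rewrite addrC addr_eq0 => /eqP h; case/negP: vW.
  by rewrite -[v](scalerK e0) h memvZ // memvN memvD ?memvZ.
have Dr : D r != 0.
  rewrite subr_eq0; apply/eqP => /sg_fix[c ec].
  have := D_indep x0 ind3 (c := - c) (d := 1); rewrite -/B rB ec scale1r -scalerAl mul1r scaleNr addNr.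
  by move=> /(_ erefl)[_ /eqP]; rewrite oner_eq0.
have dB : delta B B' != 0 by exact: indep_delta.
have := orth_delta (tr4_D (b / x)) (tr4_D (b' / x)); rewrite -/B -/B' => /(_ r).
rewrite -rB -rB' !tr4_D => /(_ erefl erefl) orth.
set t := D r in Dr orth.
have m3 (y z : L) : moore3 x y z = x * sg x * sg (sg x) * delta (D (y / x)) (D (z / x)).
  by rewrite -moore3_mul !(mulrC x) !divfK.
have [c c0 ec] := moore3_W k0 sk ind xW bW b'W.
pose e := delta B B' / sg (sg t).
have st0 : sg (sg t) != 0 by rewrite !sg_eq0.
have e0 : e != 0 by rewrite mulf_neq0 ?invr_eq0.
have se : sg e = - e.
  rewrite /e sgM sgV; apply: (@mulIf _ (sg (sg (sg t)) * sg (sg t))).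
    by rewrite mulf_neq0 ?sg_eq0.
  rewrite mulrA divfK ?sg_eq0 // orth.
  by rewrite mulrCA mulNr divfK // mulrN mulrC.
pose m := k * sg (moore3 x b v).
have mE : m = c%:A * sg (B ^+ q.+1 * (t / sg (sg t)) / e).
  rewrite /m m3 -/B rB -ec m3 -/B -/B'.
  have -> : delta B (r * B) = B ^+ q.+1 * t by rewrite deltaE sgM exprS -/(sg B) /t; ring.
  rewrite !sgM !sgV; apply: (@mulIf _ (sg (sg (sg t)) * sg e)); first by rewrite mulf_neq0 ?sg_eq0.
  rewrite /e !sgM !sgV.
  by field; rewrite !sg_eq0 Dr dB.
have cm : chi m = 1.
  rewrite mE chiM chi_scalar // mul1r chi_sg chiM chiM chi_norm // chi_sg2 // chiV chi_eps //.
  by rewrite invr1 !mulr1 rmorph1.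
have m0 : m != 0 by rewrite mulf_neq0 ?sg_eq0 // moore3_neq0.
have [||u u0 eu] := @chi_root m^-1; rewrite ?invr_eq0 ?chiV ?cm ?invr1 //.
by exists u => //; rewrite -eu; apply: span3_moore.
Qed.

(* With eps^q = - eps the space D(eps^-1 W) is closed under F_{q^2}. *)
Lemma eps_free (e b v : L) : e != 0 -> sg e = - e -> ndata e b v ->
  sg (sg (delta v e / delta e b)) <> delta v e / delta e b.
Proof.
move=> e0 se [eW bW d0 vW]; rewrite delta_div // !sgN => /oppr_inj.
have tE y : tr4 (e * y) = e * (D (sg (sg y)) + D y) * (-1).
  by rewrite tr4E // !(sgM, se, sgN); ring.
set B := D (b / e); set X := D (v / e) => h.
have hB : sg (sg B) = - B.
  move: bW; rewrite mem_W -{1}(divfK e0 b) mulrC tE mulrN1 oppr_eq0 mulf_eq0 (negPf e0) /=.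
  by rewrite addr_eq0 /B !sgB => /eqP.
have B0 : B != 0.
  apply: contraNneq d0 => B0; move/eqP: B0; rewrite subr_eq0 => /eqP/sg_fix[c ec].
  by rewrite -(divfK e0 b) ec -scalerAl mul1r deltaZr deltaxx scaler0.
have hX : sg (sg X) = - X.
  rewrite -(divfK B0 X) sgM sgM h hB; field; exact: B0.
case/negP: vW; rewrite mem_W -{1}(divfK e0 v) mulrC tE mulrN1 oppr_eq0 mulf_eq0 (negPf e0) /=.
by rewrite addr_eq0 -hX /X !sgB.
Qed.

End Collision.

(** * The code C0 *)

Section SpanAux.
Variables (K : fieldType) (U : vectType K).
Lemma dim_span2P (u v : U) : \dim <<[:: u; v]>> = 2%N -> indep2 u v.
Proof.
move=> d2 c d e; have fr : free [:: u; v] by apply/eqP; rewrite d2.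
have := @freeP _ _ 2 [tuple u; v] fr (fun i => [:: c; d]`_i).
rewrite !big_ord_recl big_ord0 addr0 => /(_ e) h.
by split; [have := h ord0 | have := h (lift ord0 ord0)].
Qed.

Lemma span3E (x y z : U) : <<[:: x; y; z]>>%VS = (<<[:: x; y]>> + <[z]>)%VS.
Proof. by rewrite -[[:: x; y; z]]/([:: x; y] ++ [:: z]) span_cat span_seq1. Qed.

Lemma indep3P (x y z : U) : indep2 x y -> z \notin <<[:: x; y]>>%VS -> indep3 x y z.
Proof.
move=> ind zn c d e /eqP; have [->|e0] := eqVneq e 0.
  by rewrite scale0r addr0 => /eqP /ind[-> ->].
rewrite addrC addr_eq0 => /eqP h; case/negP: zn.
by rewrite -[z](scalerK e0) h memvZ // memvN; apply/span2P; exists c, d.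
Qed.
End SpanAux.

Section Code.
Variables (F : finFieldType) (L : fieldExtType F).
Local Notation q := #|F|.
Hypothesis hL : \dim {:L} = 4%N.
Local Notation W := (W L).
Local Notation V := (V L).

Definition rem_coef (a0 a1 : L) := exists r u : L, [/\ r != 0, u \notin W,
  a0 = - (r * sg u) & a1 = r * u].

Lemma PG_inj (a0 a1 b0 b1 : L) : PG a0 a1 = PG b0 b1 -> a0 = b0 /\ a1 = b1.
Proof. by move=> e; apply: PG_inter; rewrite e capvv dim_PG. Qed.

Lemma calL0P (U : {vspace V}) : calL0 U <-> exists a0 a1 : L, U = PG a0 a1 /\ ~ rem_coef a0 a1.
Proof.
split=> [[[f [a0 [a1 fE]] Uf] nr]|[a0 [a1 [-> nr]]]].
  exists a0, a1; split; first by apply: set_vspace_inj; rewrite Uf (PG_graph fE).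
  move=> [r [u [r0 uW e0 e1]]]; apply: nr; exists f => //; exists r, u; split=> // x.
  by rewrite fE e0 e1 -!/(sg _); ring.
split.
  exists (fun x => a0 * vsval x + a1 * vsval x ^+ q); first by exists a0, a1.
  exact: PG_graph.
move=> [f [r [u [r0 uW fE]]] Uf]; apply: nr; exists r, u.
have [|-> ->] := @PG_inj a0 a1 (- (r * sg u)) (r * u); last by [].
apply: set_vspace_inj; rewrite Uf; apply/esym/PG_graph => x.
by rewrite fE -!/(sg _); ring.
Qed.

Lemma capW (E : {vspace L}) : \dim E = 3%N -> E != W -> \dim (E :&: W) = 2%N.
Proof.
move=> dE EW; have := dimv_sum_cap E W; rewrite dE dim_W // => e.
have h1 : (\dim (E + W) <= 4)%N by rewrite -hL dimvS // subvf.
have h2 : (\dim (E :&: W) < 3)%N.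
  rewrite ltn_neqAle -{2}dE dimvS ?capvSl // andbT; apply: contra EW => /eqP d3.
  have e1 : (E :&: W)%VS = E by apply: plane_eq; rewrite ?capvSl.
  by apply/eqP/plane_eq; rewrite ?dim_W // -e1 capvSr.
lia.
Qed.

Lemma ndata_span (a b v : L) : ndata a b v ->
  \dim <<[:: a; b; v]>> = 3%N /\ (<<[:: a; b; v]>> :&: W)%VS = <<[:: a; b]>>%VS.
Proof.
move=> [aW bW ab vW].
have d3 : \dim <<[:: a; b; v]>> = 3%N.
  apply/dim_span3/indep3P; first exact: delta_neq0.
  apply: contra vW => /span2P[c [d ->]]; by rewrite memvD ?memvZ.
split=> //.
have nW : <<[:: a; b; v]>>%VS != W.
  by apply: contra vW => /eqP <-; rewrite memv_span // !inE eqxx !orbT.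
apply/esym/eqP; rewrite eqEdim capW // dim_span2; last exact: delta_neq0.
rewrite andbT subv_cap; apply/andP; split; apply/span_subvP => x; rewrite !inE => /orP[] /eqP-> //.
  by rewrite memv_span // !inE eqxx.
by rewrite memv_span // !inE eqxx orbT.
Qed.

Lemma rscaleE r (a b v : L) (c : F) : ndata a b v -> ndata a b (c *: v) ->
  [set` Npl r a b (c *: v)]%classic =
  rscale r (planeN <<[:: a; b]>> (fun x => c *: (delta v x / delta a b))).
Proof.
move=> nd nd'; apply/seteqP; split=> w /=.
  case/(mem_Npl r _ nd') => wab [n en]; exists (w.1, delta (c *: v) (vsval w.1) / delta a b + n%:A).
    by split=> //; exists n; rewrite deltaZl -scalerAl.
  by rewrite /= -en; case: (w).
move=> [w' [wab [n en]] <-]; apply/(mem_Npl r _ nd') => /=; split=> //.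
by exists n; rewrite en deltaZl -scalerAl.
Qed.

Lemma ndataZ (a b v : L) (c : F) : c != 0 -> ndata a b v -> ndata a b (c *: v).
Proof.
move=> c0 [aW bW ab vW]; split=> //.
by apply: contra vW => h; rewrite -[v](scalerK c0) memvZ.
Qed.

Lemma spanZ (a b v : L) (c : F) : c != 0 -> <<[:: a; b; c *: v]>>%VS = <<[:: a; b; v]>>%VS.
Proof.
move=> c0; have := @span3_ch F L a b v a b c 0 0 c0 erefl.
by rewrite !scale0r !addr0.
Qed.

(** In one direction kappa is moved into v; in the other kappa = 1 suffices. *)
Lemma calNP (U : {vspace V}) :
  (exists (r : L) (E : {vspace L}) (N : set V),
     [/\ r != 0, admissible E, calN E N & [set` U]%classic = rscale r N]) <->
  exists r a b v : L, [/\ r != 0, ndata a b v, admissible <<[:: a; b; v]>> & U = Npl r a b v].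
Proof.
split=> [[r [E [N [r0 adm [a [b [e [k [EW eE eW k0 ->]]]]] UE]]]]|[r [a [b [v [r0 nd adm ->]]]]]].
  have [dE nE _] := adm; have d2 := capW dE nE.
  have nd : ndata a b e.
    have aE : a \in (E :&: W)%VS by rewrite EW memv_span // !inE eqxx.
    have bE : b \in (E :&: W)%VS by rewrite EW memv_span // !inE eqxx orbT.
    split; try by [move: aE bE; rewrite !memv_cap => /andP[]// | move: bE; rewrite !memv_cap => /andP[]//].
      by apply/indep_delta/dim_span2P; rewrite -EW.
    by move: eW; rewrite memv_cap eE.
  have nd' := ndataZ k0 nd; exists r, a, b, (k *: e); split=> //.
    rewrite spanZ //; suff -> : <<[:: a; b; e]>>%VS = E by [].
    apply: plane_eq => //; first by have [] := ndata_span nd.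
    rewrite span3E subv_add -EW capvSl /=; by rewrite -memvE.
  by apply: set_vspace_inj; rewrite UE EW (rscaleE _ nd nd').
have [d3 EW] := ndata_span nd; have [aW bW ab vW] := nd.
exists r, <<[:: a; b; v]>>%VS, (planeN <<[:: a; b]>> (fun x => 1 *: (delta v x / delta a b))).
split=> //.
  exists a, b, v, 1; rewrite EW; split=> //; rewrite ?oner_eq0 //.
    by rewrite memv_span // !inE eqxx !orbT.
  by apply: contra vW => /span2P[c [d ->]]; rewrite memvD ?memvZ.
by rewrite -rscaleE // ?scale1r //; apply: ndataZ; rewrite ?oner_eq0.
Qed.

Lemma calC0P (U : {vspace V}) : calC0 L U <-> calL0 U \/
  exists r a b v : L, [/\ r != 0, ndata a b v, admissible <<[:: a; b; v]>> & U = Npl r a b v].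
Proof. by rewrite -calNP. Qed.

Lemma mulW_span (t : L) : t != 0 -> ~ (exists c : F, t = c%:A) ->
  exists d : L * L * L, ndata d.1.1 d.1.2 d.2 /\
    <<[:: d.1.1; d.1.2; d.2]>>%VS = (<[t]> * W)%VS.
Proof.
move=> t0 tF; have dE := dim_mulW hL t0.
have nE : (<[t]> * W)%VS != W.
  apply/eqP => e; apply: tF; apply: (stabW hL) => y yW.
  by rewrite -e mem_mulW // mulrC mulKf.
have d2 := capW dE nE.
have [a [b [ha hb ind]]] : exists u v, [/\ u \in (<[t]> * W :&: W)%VS, v \in (<[t]> * W :&: W)%VS & indep2 u v].
  by apply: dim_gt1P; rewrite d2.
have : ~~ (<[t]> * W <= W)%VS by apply: contra nE => h; apply/eqP/plane_eq; rewrite ?dim_W.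
case/subvPn => v vE vW; exists (a, b, v); move: ha hb; rewrite !memv_cap /= => /andP[aE aW] /andP[bE bW].
have nd : ndata a b v by split=> //; apply: indep_delta.
split=> //; apply: plane_eq => //; first by have [] := ndata_span nd.
by apply/span_subvP => x; rewrite !inE => /or3P[] /eqP->.
Qed.

Lemma admissibleP (t : L) : t != 0 -> admissible (<[t]> * W)%VS <-> chi t != 1.
Proof.
move=> t0; split=> [[_ _ h]|h].
  apply/eqP => /(chi_root hL t0)[u u0 eu]; by have /eqP := h u u0; rewrite eu.
split; first exact: dim_mulW.
  apply: contra h => /eqP e; have [y yW|c ec] := @stabW _ _ hL t.
    by rewrite -e mem_mulW // mulrC mulKf.
  rewrite ec chi_scalar //; apply: contraNneq t0 => c0; by rewrite ec c0 scale0r.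
move=> u u0; apply: contra h => /eqP e.
have [c c0 ->] := mulW_eq hL (expf_neq0 q.+1 u0) t0 e.
by rewrite -mulr_algl chiM chi_scalar // chi_norm // mul1r.
Qed.

Lemma chi_nscal (t : L) : t != 0 -> chi t != 1 -> ~ (exists c : F, t = c%:A).
Proof.
move=> t0 h [c e]; case/negP: h; rewrite e chi_scalar //.
by apply: contraNneq t0 => c0; rewrite e c0 scale0r.
Qed.

Lemma exists_dat : exists dat : L -> L * L * L, forall t : L, t != 0 ->
  ~ (exists c : F, t = c%:A) -> ndata (dat t).1.1 (dat t).1.2 (dat t).2 /\
  <<[:: (dat t).1.1; (dat t).1.2; (dat t).2]>>%VS = (<[t]> * W)%VS.
Proof.
suff : forall t : L, exists d : L * L * L, t != 0 -> ~ (exists c : F, t = c%:A) ->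
   ndata d.1.1 d.1.2 d.2 /\ <<[:: d.1.1; d.1.2; d.2]>>%VS = (<[t]> * W)%VS.
  by move=> /boolp.choice[f hf]; exists f.
move=> t; have [h|h] := pselect (t != 0 /\ ~ (exists c : F, t = c%:A)).
  by have [d hd] := mulW_span h.1 h.2; exists d.
by exists (0, 0, 0) => h1 h2; case: h.
Qed.

(* representatives modulo F of the t with <t>W admissible *)
Lemma exists_reps : exists s : seq L,
  [/\ uniq s, size s = (q ^ 3 + q)%N, forall t, t \in s -> t != 0 /\ chi t != 1,
   forall t, t != 0 -> chi t != 1 -> exists2 t', t' \in s & exists2 c : F, c != 0 & t = c *: t' &
   forall t t' (c : F), t \in s -> t' \in s -> t = c *: t' -> t = t'].
Proof.
have [g hg] := prim_rootL hL.
have g0 : g != 0.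
  apply/eqP => g0; have := prim_expr_order hg.
  by rewrite g0 expr0n eqn0Ngt (prim_order_gt0 hg) => /eqP; rewrite eq_sym oner_eq0.
(* This is the order of g modulo nonzero scalars. The representatives are g^i with i < m not
   divisible by q + 1, and there are m - (q^2 + 1) = q^3 + q of them. *)
pose m := (q.+1 * (q ^ 2).+1)%N.
have q1 := q_gt1 F.
have q1' : (0 < q.-1)%N by rewrite -subn1 subn_gt0.
have nE : ((q ^ 4).-1 = m * q.-1)%N by rewrite q4E mulnA.
pose I := [seq i <- iota 0 m | ~~ (q.+1 %| i)%N].
have key (i j : nat) (c : F) : (i < m)%N -> (j < m)%N -> g ^+ i = c *: g ^+ j -> i = j.
  wlog ij : i j c / (j <= i)%N.
    move=> H im jm e; have [ji|/ltnW ji] := leqP j i; first exact: (H i j c ji im jm e).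
    apply/esym/(H j i c^-1) => //; rewrite e scalerK //.
    by apply: contraTneq (expf_neq0 i g0) => c0; rewrite e c0 scale0r eqxx.
  move=> im jm e; have ec : g ^+ (i - j) = c%:A.
    apply: (mulIf (expf_neq0 j g0)); rewrite -exprD subnK // e.
    by rewrite -scalerAl mul1r.
  have c0 : c != 0.
    by apply: contraTneq (expf_neq0 (i - j) g0) => c0; rewrite ec c0 scale0r eqxx.
  have : ((i - j) * q.-1)%N = 0%N \/ ((q ^ 4).-1 <= (i - j) * q.-1)%N.
    have : ((q ^ 4).-1 %| (i - j) * q.-1)%N.
      rewrite (prim_order_dvd hg) exprM ec; apply/eqP/(@mulfI _ c%:A).
        by rewrite scaler_eq0 negb_or c0 oner_eq0.
      by rewrite -exprS prednK ?(ltnW q1) // -/(sg _) sg_scalar mulr1.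
    case: ((i - j) * q.-1)%N => [|n] hn; [by left|right].
    exact: dvdn_leq.
  rewrite nE leq_pmul2r // => -[/eqP|]; last by lia.
  by rewrite muln_eq0 => /orP[]; lia.
exists [seq g ^+ i | i <- I]; split.
- rewrite map_inj_in_uniq ?filter_uniq ?iota_uniq // => i j.
  rewrite !mem_filter !mem_iota /= !add0n => /andP[_ im] /andP[_ jm] e.
  by apply: (key i j 1); rewrite ?scale1r.
- rewrite size_map size_filter.
  have -> : m = ((q ^ 2).+1 * q.+1)%N by rewrite mulnC.
  have cnt n : count (fun i => ~~ (q.+1 %| i)%N) (iota 0 (n * q.+1)) = (n * q)%N.
    elim: n => // n IHn; rewrite mulSn addnC iotaD count_cat IHn add0n -[in RHS]addn1 mulnDl mul1n.
    congr addn; rewrite -[(n * q.+1)%N]addn0 iotaDl count_map /=.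
    rewrite (@eq_count _ _ (fun i => ~~ (q.+1 %| i)%N)) => [|i /=]; last by rewrite dvdn_addr ?dvdn_mull.
    rewrite /= addn0 dvdn_mull //= add0n; rewrite -[RHS](size_iota 1 q); apply/eqP; rewrite -all_count; apply/allP => i.
    by rewrite mem_iota => /andP[i0 iq]; rewrite gtnNdvd.
  by rewrite cnt mulSn addnC -expnSr.
- move=> t /mapP[i]; rewrite mem_filter => /andP[hi _] ->; split; first exact: expf_neq0.
  rewrite /chi -exprM -(prim_order_dvd hg) q4E dvdn_pmul2r //.
  by rewrite muln_gt0.
- move=> t t0 ct; have [i ei] : exists i : nat, t = g ^+ i.
    by have [i ->] := prim_rootP hg (expL hL t0); exists i.
  have m0 : (0 < m)%N by [].
  exists (g ^+ (i %% m)).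
    apply/mapP; exists (i %% m)%N => //; rewrite mem_filter mem_iota add0n ltn_mod m0 andbT.
    rewrite leq0n andbT /=; apply: contra ct => hd.
    have hi : (q.+1 %| i)%N by rewrite (divn_eq i m) dvdn_add // dvdn_mull // dvdn_mulr.
    rewrite ei /chi -exprM -(prim_order_dvd hg) q4E dvdn_pmul2r //.
    by rewrite muln_gt0.
  have [c ec] : exists c : F, g ^+ (i %/ m * m) = c%:A.
    apply: sg_fix; apply/eqP; rewrite -subr_eq0 /sg.
    have -> : (g ^+ (i %/ m * m)) ^+ q = g ^+ (i %/ m * m).
      rewrite -exprM -{1}(prednK (ltnW q1)) mulnS exprD -mulnA -nE.
      by rewrite [(_ * (q ^ 4).-1)%N]mulnC [X in _ * X]exprM (prim_expr_order hg) expr1n mulr1.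
    by rewrite subrr.
  have e : t = c *: g ^+ (i %% m) by rewrite ei {1}(divn_eq i m) exprD ec -scalerAl mul1r.
  by exists c => //; apply: contraNneq t0 => c0; rewrite e c0 scale0r.
move=> t t' c /mapP[i]; rewrite mem_filter mem_iota add0n => /andP[_ /andP[_ im]] ->.
move=> /mapP[j]; rewrite mem_filter mem_iota add0n => /andP[_ /andP[_ jm]] -> e.
by rewrite (key _ _ _ im jm e).
Qed.

End Code.

(** * The size of C0 and the intersections of its members *)

Section Enum.
Variables (F : finFieldType) (L : fieldExtType F).
Local Notation q := #|F|.
Hypothesis hL : \dim {:L} = 4%N.
Local Notation W := (W L).
Local Notation V := (V L).
Local Notation T := (finvect_type L).

Definition units : seq L := enum (predC1 (0 : T)).
Lemma mem_units r : (r \in units) = (r != 0).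
Proof. by rewrite /units (mem_enum (predC1 (0 : T))). Qed.
Lemma units_uniq : uniq units. Proof. exact: (enum_uniq (predC1 (0 : T))). Qed.
Lemma size_units : size units = (q ^ 4).-1.
Proof. by rewrite /units -(cardE (predC1 (0 : T))) cardC1 card_L. Qed.

Lemma card_tr1 : #|[pred u : T | tr4 (u : L) == 1]| = (q ^ 3)%N.
Proof.
have e := @card_vspace F T _ (W : {vspace T}).
have [u u0] := tr4_neq0 hL; have [c ec] := tr4_scalar hL u.
have c0 : c != 0 by apply: contraNneq u0 => c0; rewrite ec c0 scale0r.
pose u1 : T := c^-1 *: u.
have tu1 : tr4 (u1 : L) = 1 by rewrite tr4Z ec scalerK.
transitivity #|(W : {vspace T})|; last by rewrite e; congr (_ ^ _)%N; apply: (dim_W hL).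
rewrite -[RHS](card_imset _ (addrI u1)); apply: eq_card => x.
apply/idP/imsetP => [tx|[y yW ->]].
  have {}tx : tr4 (x : L) = 1 := eqP tx.
  exists (x - u1); last by rewrite addrC subrK.
  by rewrite [_ \in _]mem_W (linearB (@tr4 F L)) /= tx tu1 subrr.
have ty : tr4 (y : L) = 0 by apply/eqP; rewrite -mem_W; exact: yW.
by apply/eqP; rewrite (linearD (@tr4 F L)) /= tu1 ty addr0.
Qed.

(** Multiplying u by a scalar and r by its inverse changes neither coefficient, so tr u = 1 may be
    assumed. Then the pair (r u, u) parametrises the removed graphs, which gives q^3 (q^4 - 1) of
    them. *)
Lemma rem_coefP (a0 a1 : L) : rem_coef a0 a1 <->
  exists p : T * T, [/\ (p.1 : L) != 0, tr4 (p.2 : L) = 1 &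
    (a0, a1) = (- (p.1 * p.2 ^+ q.-1), p.1) :> L * L].
Proof.
have q0 := ltnW (q_gt1 F).
split=> [[r [u [r0 uW -> ->]]]|[[a u] /= [a0' tu [-> ->]]]].
  have u0 : u != 0 by apply: contraNneq uW => ->; rewrite mem0v.
  have [c ec] := tr4_scalar hL u; rewrite mem_W ec in uW.
  have c0 : c != 0 by apply: contraNneq uW => ->; rewrite scale0r.
  exists (r * u : T, c^-1 *: u : T); split=> /=; first by rewrite mulf_neq0.
    by rewrite (tr4Z c^-1 u) ec scalerK.
  congr (- _, _); rewrite exprZn /sg -{1}(prednK q0) exprS -mulrA; congr (_ * (_ * _)).
  have : (c^-1) ^+ q.-1 = 1.
    apply: (@mulfI _ c^-1); first by rewrite invr_eq0.
    by rewrite -exprS prednK // expf_card mulr1.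
  by move=> ->; rewrite scale1r.
have u0 : (u : L) != 0.
  by apply: contra_eqN tu => /eqP ->; rewrite (linear0 (@tr4 F L)) eq_sym oner_eq0.
exists (a / u), u; split.
- by rewrite mulf_neq0 ?invr_eq0.
- by rewrite mem_W tu oner_eq0.
- by rewrite /sg -{2}(prednK q0) exprS mulrA divfK.
by rewrite divfK.
Qed.

Lemma L0_seq : exists s : seq {vspace V},
  [/\ uniq s, (size s + q ^ 3 * (q ^ 4).-1 = q ^ 8)%N & forall U, U \in s <-> calL0 U].
Proof.
pose P := [pred p : T * T | `[< ~ rem_coef (p.1 : L) (p.2 : L) >]].
have Pinj : injective (fun p : T * T => PG (p.1 : L) (p.2 : L)).
  by case=> [a b] [c d] /(PG_inj hL)[/= -> ->].
exists [seq PG (p.1 : L) (p.2 : L) | p <- enum P]; split.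
- by rewrite (map_inj_uniq Pinj) enum_uniq.
- rewrite size_map -(cardE P).
  pose Q := [pred p : T * T | (p.1 != 0) && (tr4 (p.2 : L) == 1)].
  pose f (p : T * T) : T * T := ((- (p.1 * p.2 ^+ q.-1))%R, p.1).
  (* The power u^(q-1) determines u up to a scalar, and the trace fixes the scalar. *)
  have finj : {in Q &, injective f}.
    move=> [a u] [b v] /andP[/= a0 /eqP tu] /andP[/= b0 /eqP tv] [/eqP e ab].
    rewrite {}ab eqr_opp in a0 e *; have {}e : u ^+ q.-1 = v ^+ q.-1.
      by apply/eqP; move: e; rewrite (inj_eq (mulfI b0)).
    have q0 := ltnW (q_gt1 F); congr pair.
    have u0 : (u : L) != 0.
      by apply: contra_eqN tu => /eqP ->; rewrite (linear0 (@tr4 F L)) eq_sym oner_eq0.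
    have v0 : (v : L) != 0.
      by apply: contra_eqN tv => /eqP ->; rewrite (linear0 (@tr4 F L)) eq_sym oner_eq0.
    have [c ec] : exists c : F, (u : L) / v = c%:A.
      apply: sg_fix; rewrite /sg -[in RHS](mulr1 (_ / _)) -{1}(prednK q0) exprS.
      congr (_ * _); rewrite exprMn exprVn [(u : L) ^+ _]e divff // expf_neq0 //.
    have uv : (u : L) = c *: (v : L) by rewrite -[u : L](divfK v0) ec -scalerAl mul1r.
    have : tr4 (u : L) = c *: tr4 (v : L) by rewrite uv tr4Z.
    rewrite tu tv => /esym/eqP; rewrite -[X in _ == X]scale1r -subr_eq0 -scalerBl scaler_eq0 oner_eq0 orbF subr_eq0.
    by move=> /eqP c1; rewrite uv c1 scale1r.
  have cQ : #|Q| = ((q ^ 4).-1 * q ^ 3)%N.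
    rewrite -card_tr1 -(card_L hL) -(cardC1 (0 : T)).
    rewrite -cardX; apply: eq_card => -[a u]; rewrite !inE //.
  have cf : #|f @: Q| = #|Q| by rewrite card_in_imset.
  rewrite mulnC -cQ -cf.
  have -> : #|f @: Q| = #|predC P|.
    apply: eq_card => -[a0 a1]; rewrite !inE /=; apply/imsetP/negP.
      move=> [[a u]]; rewrite !inE /= => /andP[h1 /eqP h2] [-> ->] hb.
      apply: hb; by apply/rem_coefP; exists (a, u).
    move=> h; have /rem_coefP : rem_coef (a0 : L) (a1 : L).
      by apply: contrapT => h'; apply/h/asboolP.
    move=> [[a u] /= [h1 h2 [h3 h4]]]; exists (a, u).
      by rewrite !inE /= h1 h2 eqxx.
    by rewrite /f /= h3 h4.
  by rewrite cardC card_prod card_L // -expnD.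
have eP (p : L * L) : (p \in (enum P : seq (L * L))) = `[< ~ rem_coef p.1 p.2 >].
  exact: (mem_enum P (p : T * T)).
move=> U; rewrite (calL0P hL); split=> [/mapP[p]|[a0 [a1 [-> h]]]].
  by rewrite eP => /asboolP h ->; exists p.1, p.2.
apply/mapP; exists (a0 : T, a1 : T) => //.
by rewrite eP; apply/asboolP.
Qed.

Definition Nadm (U : {vspace V}) := exists r a b v : L,
  [/\ r != 0, ndata a b v, admissible <<[:: a; b; v]>> & U = Npl r a b v].

Lemma Npl_unscale r r' (a b v : L) : r != 0 -> ndata a b v ->
  Npl r a b v = Npl r' a b v -> r = r'.
Proof.
move=> r0 nd /(Npl_same r0 nd nd)[c [d [e [c0 rc vE]]]].
suff c1 : c = 1 by rewrite rc c1 scale1r.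
have [aW bW _ vW] := nd; apply/eqP; rewrite -subr_eq0; apply: contraNT vW => c1.
have : (c - 1) *: v \in W.
  have -> : (c - 1) *: v = - (d *: a + e *: b).
    by apply/eqP; rewrite scalerBl scale1r -subr_eq0 opprK addrAC -vE subrr.
  by rewrite memvN memvD ?memvZ.
by move=> h; rewrite -[v](scalerK c1) memvZ.
Qed.

Lemma Npl_Z r r' (a b v a' b' v' : L) : r != 0 -> ndata a b v -> ndata a' b' v' ->
  Npl r a b v = Npl r' a' b' v' -> a \in <<[:: a'; b']>>%VS /\ b \in <<[:: a'; b']>>%VS.
Proof.
move=> r0 nd nd' e; have [aW bW _ _] := nd.
have h x : x \in [:: a; b] -> x \in <<[:: a'; b']>>%VS.
  move=> xab; have xW : x \in W by move: xab; rewrite !inE => /orP[] /eqP->.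
  have : npl_basis r a b v x \in Npl r' a' b' v'.
    by rewrite -e memv_span //; move: xab; rewrite !inE => /orP[] /eqP->; rewrite eqxx ?orbT.
  by case/(mem_Npl r' _ nd') => h _; rewrite mk1 in h.
by split; apply: h; rewrite !inE eqxx ?orbT.
Qed.

Lemma Npl_data r r' (a b v a' b' v' : L) : r != 0 -> r' != 0 -> ndata a b v -> ndata a' b' v' ->
  Npl r a b v = Npl r' a' b' v' -> <<[:: a; b; v]>>%VS = <<[:: a'; b'; v']>>%VS.
Proof.
move=> r0 r'0 nd nd' e; have [ha hb] := Npl_Z r0 nd nd' e.
have [c [c0 ce sp nd2 eN]] := Npl_rebase r'0 nd' ha hb (ndata_neq0 nd).
rewrite eN in e; have [c' [d' [e' [c'0 _ vE]]]] := Npl_same r0 nd nd2 e.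
rewrite -(@span3_ch _ _ a b v a b c' d' e' c'0 erefl) -vE.
have := @span3_ch _ _ a' b' v' a b c 0 0 c0 sp; by rewrite !scale0r !addr0.
Qed.

Lemma Npl_sameE r (a b v a' b' v' : L) : r != 0 -> ndata a b v -> ndata a' b' v' ->
  <<[:: a; b; v]>>%VS = <<[:: a'; b'; v']>>%VS ->
  exists2 c : F, c != 0 & Npl r a b v = Npl (c *: r) a' b' v'.
Proof.
move=> r0 nd nd' eE; have [_ EW] := ndata_span hL nd; have [_ EW'] := ndata_span hL nd'.
have sp : <<[:: a; b]>>%VS = <<[:: a'; b']>>%VS by rewrite -EW eE EW'.
have a'in : a' \in <<[:: a; b]>>%VS by rewrite sp memv_span // !inE eqxx.
have b'in : b' \in <<[:: a; b]>>%VS by rewrite sp memv_span // !inE eqxx orbT.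
have [k [k0 _ _ nd2 ->]] := Npl_rebase r0 nd a'in b'in (ndata_neq0 nd').
have : v \in <<[:: a'; b'; v']>>%VS by rewrite -eE memv_span // !inE eqxx !orbT.
case/span3P => d [e [m vE]].
have m0 : m != 0.
  apply/eqP => m0; have [_ _ _ /negP] := nd; apply.
  by rewrite vE m0 scale0r addr0; have [a'W b'W _ _] := nd'; rewrite memvD ?memvZ.
have km0 : k * m != 0 by rewrite mulf_neq0.
exists (k * m) => //; have [nd3 ->] := Npl_scale r0 km0 nd'.
have -> : k *: v = (k * m) *: v' + ((k * d) *: a' + (k * e) *: b').
  by rewrite vE !scalerDr !scalerA addrC.
by have [_ <-] := Npl_shift (k * d) (k * e) r0 nd3.
Qed.

(** By [Npl_sameE] all planes over one E arise from a single one by scaling r, kappa being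
    interchangeable with a scalar factor of r. Each of the q^3 + q admissible E therefore carries
    q^4 - 1 planes. *)
Lemma Nadm_seq : exists s : seq {vspace V},
  [/\ uniq s, (size s = (q ^ 3 + q) * (q ^ 4).-1)%N & forall U, U \in s <-> Nadm U].
Proof.
have [dat hdat] := exists_dat hL; have [R [Ru Rs R1 R2 R3]] := exists_reps hL.
have hd t : t \in R -> ndata (dat t).1.1 (dat t).1.2 (dat t).2 /\
  <<[:: (dat t).1.1; (dat t).1.2; (dat t).2]>>%VS = (<[t]> * W)%VS.
  by move=> /R1[t0 ct]; apply: hdat => //; apply: chi_nscal.
exists [seq Npl r (dat t).1.1 (dat t).1.2 (dat t).2 | t <- R, r <- units]; split.
- rewrite allpairs_uniq ?units_uniq // => -[t r] [t' r'].
  move=> /allpairsP[[t1 r1] /= [tR rU [-> ->]]] /allpairsP[[t2 r2] /= [tR' rU' [-> ->]]] e.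
  rewrite !mem_units in rU rU'; have [nd E] := hd _ tR; have [nd' E'] := hd _ tR'.
  have := Npl_data rU rU' nd nd' e; rewrite E E' => eW.
  have [c c0 ec] := mulW_eq hL (R1 _ tR').1 (R1 _ tR).1 eW.
  have tt : t1 = t2 by apply: R3 ec.
  by rewrite tt in nd e *; rewrite (Npl_unscale rU nd e).
- by rewrite size_allpairs Rs size_units.
move=> U; split=> [/allpairsP[[t r] /= [tR rU ->]]|[r [a [b [v [r0 nd adm ->]]]]]].
  rewrite mem_units in rU; have [nd E] := hd _ tR; have [t0 ct] := R1 _ tR.
  exists r, (dat t).1.1, (dat t).1.2, (dat t).2; split=> //.
  by rewrite E; apply/admissibleP.
have [k k0 sk] := exists_eps hL; have [aW bW ab vW] := nd.
have ind3 : indep3 a b v.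
  apply/indep3P; first exact: delta_neq0.
  by apply: contra vW => /span2P[c [d ->]]; rewrite memvD ?memvZ.
have eE := span3_moore hL k0 sk ind3; set t := (_ * _)^-1 in eE.
have t0 : t != 0 by rewrite invr_eq0 mulf_neq0 ?sg_eq0 // moore3_neq0.
have ct : chi t != 1 by apply/(admissibleP hL t0); rewrite -eE.
have [t' tR' [c c0 tE]] := R2 t t0 ct.
have [nd' E'] := hd _ tR'.
have eE' : <<[:: a; b; v]>>%VS = <<[:: (dat t').1.1; (dat t').1.2; (dat t').2]>>%VS.
  rewrite eE E' tE; congr (_ * _)%VS; apply/eqP; rewrite eqEdim !dim_vline.
  by rewrite scaler_eq0 (negPf c0) leqnn andbT -memvE memvZ ?memv_line.
have [m m0 ->] := Npl_sameE r0 nd nd' eE'.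
by apply: allpairs_f => //; rewrite mem_units scaler_eq0 negb_or m0.
Qed.

Lemma Npl_S r (a b v : L) : r != 0 -> ndata a b v -> \dim (Npl r a b v :&: SV L) = 1%N.
Proof.
move=> r0 nd; have -> : (Npl r a b v :&: SV L)%VS = <[mk 0 r]>%VS.
  apply/vspaceP => w; rewrite memv_cap mem_SV; apply/andP/vlineP => [[wN /eqP w1]|[c ->]].
    exact: Npl_vert nd wN w1.
  split; first by rewrite memvZ // memv_span // !inE eqxx !orbT.
  by rewrite mkZ scaler0 mk0_1.
rewrite dim_vline; have -> // : mk 0 r != 0.
by apply: contraNneq r0 => /mk_eq0[]; rewrite ?mem0v // => _ ->.
Qed.

Lemma C0_seq : exists s : seq {vspace V},
  [/\ uniq s, (size s = q ^ 8 + q ^ 5 - q)%N & forall U, U \in s <-> calC0 L U].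
Proof.
have [s1 [u1 z1 m1]] := L0_seq; have [s2 [u2 z2 m2]] := Nadm_seq.
exists (s1 ++ s2); split.
- rewrite cat_uniq u1 u2 andbT; apply/hasPn => U /m2[r [a [b [v [r0 nd _ ->]]]]].
  apply/negP => /m1/(calL0P hL)[a0 [a1 [e _]]].
  by have := Npl_S r0 nd; rewrite e PG_S dimv0.
- rewrite size_cat z2; have := q_gt1 F; move: z1; case: (#|F|) => // n z1 _.
  have e : ((n.+1 ^ 4).-1 = n.+1 ^ 3 * n + n.+1 ^ 2 * n + n.+1 * n + n)%N.
    suff -> : (n.+1 ^ 4 = (n.+1 ^ 3 * n + n.+1 ^ 2 * n + n.+1 * n + n).+1)%N by [].
    by ring.
  rewrite e in z1 *.
  apply/eqP; rewrite -(eqn_add2r (n.+1 ^ 3 * (n.+1 ^ 3 * n + n.+1 ^ 2 * n + n.+1 * n + n))).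
  rewrite addnAC z1 -(eqn_add2r n.+1) [X in _ == X]addnAC subnK; last first.
    by apply: leq_trans (leq_addr _ _); rewrite expnS leq_pmulr // expn_gt0.
  by apply/eqP; ring.
move=> U; rewrite mem_cat (calC0P hL); split=> [/orP[/m1|/m2]|[/m1|/m2]] h; rewrite ?h ?orbT //.
- by left.
- by right.
Qed.

Lemma calC0_dim U : calC0 L U -> \dim U = 3%N.
Proof.
case/(calC0P hL) => [/(calL0P hL)[a0 [a1 [-> _]]]|[r [a [b [v [r0 nd _ ->]]]]]].
  exact: dim_PG.
exact: dim_Npl.
Qed.

(** Only one of the two planes has to be admissible, since a collision makes both inadmissible. This
    is what lets planes over inadmissible E be added to C0. *)
Lemma N_inter_adm r r' (a b v a' b' v' : L) : r != 0 -> r' != 0 -> ndata a b v ->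
  ndata a' b' v' -> admissible <<[:: a; b; v]>> ->
  Npl r a b v != Npl r' a' b' v' -> (\dim (Npl r a b v :&: Npl r' a' b' v') <= 1)%N.
Proof.
move=> r0 r'0 nd nd' [_ _ adm] ne; rewrite leqNgt; apply/negP => dI.
have [/eqP|[_ [x [b1 [v1 [b1' [v1' [n1 n2 ind e [_ E1 _ _]]]]]]]]] := Npl_inter r0 r'0 nd nd' dI.
  by rewrite (negPf ne).
have [u u0 eu] := collision hL n1 n2 ind e.
by have /eqP := adm u u0; rewrite -E1.
Qed.

Lemma C0_N_inter (U : {vspace V}) r (a b v : L) : calC0 L U -> r != 0 -> ndata a b v ->
  U != Npl r a b v -> (\dim (U :&: Npl r a b v) <= 1)%N.
Proof.
case/(calC0P hL) => [/(calL0P hL)[a0 [a1 [-> nr]]]|[r' [a' [b' [v' [r'0 nd' adm ->]]]]]] r0 nd ne.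
  rewrite leqNgt; apply/negP => /(PG_N r0 nd)[r' [u [r'0 uW e0 e1]]].
  by apply: nr; exists r', u.
exact: N_inter_adm.
Qed.

Lemma calC0_inter U U' : calC0 L U -> calC0 L U' -> U != U' -> (\dim (U :&: U') <= 1)%N.
Proof.
move=> hU /(calC0P hL)[/(calL0P hL)[a0 [a1 [-> nr]]]|[r' [a' [b' [v' [r'0 nd' adm ->]]]]]]; last first.
  by apply: C0_N_inter.
move: hU => /(calC0P hL)[/(calL0P hL)[b0 [b1 [-> nr']]] ne|[r' [a' [b' [v' [r'0 nd' adm ->]]]]] ne].
  rewrite leqNgt; apply/negP => /PG_inter[e0 e1].
  by rewrite e0 e1 eqxx in ne.
rewrite capvC; apply: C0_N_inter => //; last by rewrite eq_sym.
by apply/(calC0P hL); left; apply/(calL0P hL); exists a0, a1.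
Qed.

End Enum.

(** * Extensions for general q *)

Section Ext.
Variables (F : finFieldType) (L : fieldExtType F).
Local Notation q := #|F|.
Hypothesis hL : \dim {:L} = 4%N.
Local Notation W := (W L).
Local Notation V := (V L).

Definition NplD (r : L) (d : L * L * L) := Npl r d.1.1 d.1.2 d.2.
Definition ndataD (d : L * L * L) := ndata d.1.1 d.1.2 d.2.
Definition spanD (d : L * L * L) : {vspace L} := <<[:: d.1.1; d.1.2; d.2]>>%VS.

(* One inadmissible E for each point of S: the planes rN(E_r) are compatible. *)
Definition inadm_choice (tau : L -> L * L * L) :=
  (forall r, r != 0 -> ndataD (tau r) /\ ~ admissible (spanD (tau r))) /\
  (forall r (c : F), r != 0 -> c != 0 -> tau (c *: r) = tau r).

Lemma NplD_point r r' d d' : ndataD d' -> NplD r d = NplD r' d' ->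
  r != 0 -> exists2 c : F, c != 0 & r = c *: r'.
Proof.
move=> nd' e r0; have [n en] : exists n : F, mk 0 r = n *: mk 0 r'.
  apply: (Npl_vert nd' _ (mk0_1 r)); rewrite -[Npl _ _ _ _]e.
  by rewrite memv_span // !inE eqxx !orbT.
have rr : r = n *: r' by move: en; rewrite mkZ => /mk_inj[]; rewrite ?scaler0 ?mem0v.
by exists n => //; apply: contraNneq r0 => n0; rewrite rr n0 scale0r.
Qed.

Lemma extraN_notC0 r d : r != 0 -> ndataD d -> ~ admissible (spanD d) -> ~ calC0 L (NplD r d).
Proof.
move=> r0 nd adm /(calC0P hL)[/(calL0P hL)[a0 [a1 [e _]]]|[r' [a [b [v [r'0 nd' adm' e]]]]]].
  by have := Npl_S r0 nd; rewrite -/(NplD r d) e PG_S dimv0.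
by apply: adm; rewrite /spanD (Npl_data r0 r'0 nd nd' e).
Qed.

(** Planes sharing a line without being equal have the same point on S but different Z by
    [Npl_inter]; the same point means the same value of [tau], hence the same Z. *)
Lemma extraN_inter tau r r' : inadm_choice tau -> r != 0 -> r' != 0 ->
  NplD r (tau r) != NplD r' (tau r') -> (\dim (NplD r (tau r) :&: NplD r' (tau r')) <= 1)%N.
Proof.
move=> [h1 h2] r0 r'0 ne; rewrite leqNgt; apply/negP => dI.
have [nd _] := h1 r r0; have [nd' _] := h1 r' r'0.
case: (Npl_inter r0 r'0 nd nd' dI) => [/eqP|[[c c0 rc]]]; first exact/negP.
move=> [x [b1 [v1 [b1' [v1' [n1 n2 ind _ [E1 _ E2 _]]]]]]].
have e : <<[:: x; b1]>>%VS = <<[:: x; b1']>>%VS by rewrite E1 E2 rc h2.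
have : b1' \in <<[:: x; b1]>>%VS by rewrite e memv_span // !inE eqxx orbT.
case/span2P => a [b bE].
have [|_ _] := ind (- a) (- b) 1; last by move/eqP; rewrite oner_eq0.
by rewrite bE scale1r !scaleNr addrA -addrA addrACA addNr add0r addNr.
Qed.

Lemma extraN_uniq tau : inadm_choice tau -> uniq [seq NplD r (tau r) | r <- units L].
Proof.
move=> [h1 h2]; rewrite map_inj_in_uniq ?units_uniq // => r r'.
rewrite !mem_units => r0 r'0 e; have [nd _] := h1 r r0; have [nd' _] := h1 r' r'0.
have [c c0 rc] := NplD_point nd' e r0.
move: e; rewrite {2}/NplD -(_ : tau r = tau r'); last by rewrite rc h2.
exact: Npl_unscale.
Qed.

Definition PA (x r1 r2 : L) : {vspace V} := <<[:: mk x 0; mk 0 r1; mk 0 r2]>>%VS.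

Lemma mem_PA x r1 r2 w : x \in W ->
  reflect ((exists c : F, vsval w.1 = c *: x) /\ w.2 \in <<[:: r1; r2]>>%VS)
          (w \in PA x r1 r2).
Proof.
move=> xW; apply: (iffP (span3P _ _ _ _)) => [[c [d [e ->]]]|[[c ec] /span2P[d [e ed]]]].
  rewrite !mkZ !mkD !scaler0 !addr0 add0r mk1 ?memvZ //; split; first by exists c.
  by apply/span2P; exists d, e.
exists c, d, e; rewrite -[w]mkK ec ed !mkZ !mkD.
by rewrite !scaler0 !addr0 add0r.
Qed.

Lemma dim_PA x r1 r2 : x \in W -> x != 0 -> indep2 r1 r2 -> \dim (PA x r1 r2) = 3%N.
Proof.
move=> xW x0 ind; rewrite dim_span3 // => c d e; rewrite !mkZ !mkD !scaler0 !addr0 add0r.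
move=> /mk_eq0[]; first exact: memvZ.
by move=> /eqP; rewrite scaler_eq0 (negPf x0) orbF => /eqP -> /ind[-> ->].
Qed.

Lemma PA_S x r1 r2 : x \in W -> indep2 r1 r2 -> x != 0 -> \dim (PA x r1 r2 :&: SV L) = 2%N.
Proof.
move=> xW ind x0; have -> : (PA x r1 r2 :&: SV L)%VS = <<[:: mk 0 r1; mk 0 r2]>>%VS.
  apply/vspaceP => w; rewrite memv_cap mem_SV; apply/andP/span2P => [[/(mem_PA _ _ _ xW)]|].
    move=> [_ /span2P[c [d e]] /eqP w1]; exists c, d.
    by rewrite -[w]mkK e w1 linear0 !mkZ !mkD !scaler0 addr0.
  move=> [c [d ->]]; rewrite !mkZ !mkD !scaler0 addr0; split; last by rewrite mk0_1.
  apply/mem_PA => //; rewrite mk0_1 linear0; split; first by exists 0; rewrite scale0r.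
  by apply/span2P; exists c, d.
rewrite dim_span2 // => c d; rewrite !mkZ !mkD !scaler0 addr0 => /mk_eq0[]; first exact: mem0v.
by move=> _ /ind.
Qed.

Lemma fst_eq0 (w : V) : vsval w.1 = 0 -> w.1 = 0.
Proof. by move=> h; apply: val_inj; exact: h. Qed.

(** The plane meets S in a line, and two lines of a plane meet. *)
Lemma PA_line x r1 r2 (U : {vspace V}) : x \in W -> x != 0 -> (U <= PA x r1 r2)%VS ->
  (1 < \dim U)%N -> exists2 w, w \in (U :&: SV L)%VS & w != 0.
Proof.
move=> xW x0 /subvP sU /dim_gt1P[w1 [w2 [h1 h2 ind]]].
have /(mem_PA _ _ _ xW)[[c1 e1] _] := sU _ h1.
have /(mem_PA _ _ _ xW)[[c2 e2] _] := sU _ h2.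
have z : vsval (c2 *: w1 - c1 *: w2).1 = 0.
  change (vsval (c2 *: w1.1 - c1 *: w2.1) = 0).
  transitivity (c2 *: vsval w1.1 - c1 *: vsval w2.1); first by rewrite linearB !linearZ.
  by rewrite e1 e2 !scalerA mulrC subrr.
have [c10|c10] := eqVneq c1 0.
  exists w1; last first.
    apply: contra_neq (oner_neq0 F) => w10; by have [] := ind 1 0; rewrite ?w10 ?scaler0 ?scale0r ?addr0.
  by rewrite memv_cap h1 mem_SV; apply/eqP/fst_eq0; rewrite e1 c10 scale0r.
exists (c2 *: w1 - c1 *: w2); last first.
  apply: contra_neq c10; rewrite -scaleNr => /ind[_ /eqP]; rewrite oppr_eq0.
  by move/eqP.
by rewrite memv_cap memvB ?memvZ //= mem_SV; apply/eqP/fst_eq0/z.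
Qed.

Lemma PA_PG a0 a1 x r1 r2 : x \in W -> x != 0 -> (\dim (PG a0 a1 :&: PA x r1 r2) <= 1)%N.
Proof.
move=> xW x0; rewrite leqNgt; apply/negP => dI.
have [w] := PA_line xW x0 (capvSr _ _) dI.
by rewrite capvC capvA (capvC (SV L)) PG_S cap0v memv0 => ->.
Qed.

(** All first components in [PA x r1 r2] lie in <x>, which leaves the second case of [sub_Npl]; the
    point off S is scaled to lie over x and the other plane is normalised there. *)
Lemma PA_N r (a b v : L) x r1 r2 : r != 0 -> ndata a b v -> x \in W -> x != 0 ->
  (1 < \dim (Npl r a b v :&: PA x r1 r2))%N ->
  r \in <<[:: r1; r2]>>%VS /\ exists b1 v1, [/\ ndata x b1 v1,
    <<[:: x; b1]>>%VS = <<[:: a; b]>>%VS, <<[:: x; b1; v1]>>%VS = <<[:: a; b; v]>>%VS,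
    Npl r a b v = Npl r x b1 v1 &
    r * (delta v1 x / delta x b1) \in <<[:: r1; r2]>>%VS].
Proof.
move=> r0 nd xW x0 dI; have [[w1 [w2 []]]|] := sub_Npl nd (capvSl _ _) dI.
  rewrite !memv_cap => /andP[_ /(mem_PA _ _ _ xW)[[c1 e1] _]] /andP[_ /(mem_PA _ _ _ xW)[[c2 e2] _]].
  rewrite e1 e2 => ind; have [|_ /eqP] := ind c2 (- c1).
    by rewrite !scalerA mulNr scaleNr (mulrC c1) subrr.
  by rewrite oppr_eq0 => /eqP c10; have [] := ind 1 0;
    rewrite ?c10 ?scale0r ?scaler0 ?addr0 // => /eqP; rewrite oner_eq0.
rewrite memv_cap => -[/andP[_ /(mem_PA _ _ _ xW)[_ rin]] [t]].
rewrite memv_cap => /andP[tN /(mem_PA _ _ _ xW)[[c ec] tin]] t0; split; first exact: rin.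
have c0 : c != 0 by apply: contraNneq t0 => c0; rewrite ec c0 scale0r.
have tN' : c^-1 *: t \in Npl r a b v by rewrite memvZ.
have t1 : vsval (c^-1 *: t).1 = x.
  change (vsval (c^-1 *: t.1) = x); by rewrite linearZ /= ec scalerK.
have [|b1 [v1 [n1 s1 s2 eN e2]]] := Npl_point r0 nd tN'; first by rewrite t1.
rewrite t1 in n1 s1 s2 eN e2; exists b1, v1; split=> //.
by rewrite -e2; exact: memvZ.
Qed.

Lemma PA_PA x r1 r2 x' s1 s2 : x \in W -> x != 0 -> x' \in W -> x' != 0 ->
  (<<[:: r1; r2]>> :&: <<[:: s1; s2]>> = 0)%VS ->
  (\dim (PA x r1 r2 :&: PA x' s1 s2) <= 1)%N.
Proof.
move=> xW x0 x'W x'0 dl; rewrite leqNgt; apply/negP => dI.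
have [w] := PA_line xW x0 (capvSl _ _) dI.
rewrite !memv_cap mem_SV => /andP[/andP[/(mem_PA _ _ _ xW)[_ h] /(mem_PA _ _ _ x'W)[_ h']] /eqP w1].
have : w.2 \in (<<[:: r1; r2]>> :&: <<[:: s1; s2]>>)%VS by rewrite memv_cap h h'.
rewrite dl memv0 => /eqP w2; rewrite -[w]mkK w1 w2 linear0 mk00.
by rewrite eqxx.
Qed.

Lemma PA_PA_line x r1 r2 x' s1 s2 : x \in W -> x' \in W -> indep2 x x' ->
  (\dim (<<[:: r1; r2]>> :&: <<[:: s1; s2]>>) <= 1)%N ->
  (\dim (PA x r1 r2 :&: PA x' s1 s2) <= 1)%N.
Proof.
move=> xW x'W ind dl; rewrite leqNgt; apply/negP => /dim_gt1P[w1 [w2 []]].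
rewrite !memv_cap.
move=> /andP[/(mem_PA _ _ _ xW)[[c1 e1] h1] /(mem_PA _ _ _ x'W)[[c1' e1'] h1']].
move=> /andP[/(mem_PA _ _ _ xW)[[c2 e2] h2] /(mem_PA _ _ _ x'W)[[c2' e2'] h2']] ind2.
have z c c' : c *: x = c' *: x' -> c = 0.
  by move=> e; have [] := ind c (- c'); rewrite // scaleNr e subrr.
have c10 := z _ _ (etrans (esym e1) e1'); have c20 := z _ _ (etrans (esym e2) e2').
move: dl; rewrite leqNgt => /negP; apply; apply: (@dim_ge2 _ _ _ w1.2 w2.2).
- by rewrite memv_cap h1.
- by rewrite memv_cap h2.
move=> c d cd; apply: ind2; rewrite -[w1]mkK -[w2]mkK e1 e2 c10 c20 !scale0r.
by rewrite !mkZ !mkD !scaler0 addr0 cd mk00.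
Qed.

Lemma plane_code_seq (s : seq {vspace V}) :
  (forall U, U \in s -> \dim U = 3%N) ->
  (forall U U', U \in s -> U' \in s -> U != U' -> (\dim (U :&: U') <= 1)%N) ->
  plane_code (seq_fset tt s).
Proof.
move=> h1 h2; split=> [U|U U']; rewrite !seq_fsetE; first exact: h1.
exact: h2.
Qed.

Lemma pairwise_cat (s t : seq {vspace V}) :
  (forall U U', U \in s -> U' \in s -> U != U' -> (\dim (U :&: U') <= 1)%N) ->
  (forall U U', U \in t -> U' \in t -> U != U' -> (\dim (U :&: U') <= 1)%N) ->
  (forall U U', U \in s -> U' \in t -> (\dim (U :&: U') <= 1)%N) ->
  (forall U U', U \in s ++ t -> U' \in s ++ t -> U != U' -> (\dim (U :&: U') <= 1)%N).
Proof.
move=> hs ht hst U U'; rewrite !mem_cat => /orP[hU|hU] /orP[hU'|hU'] ne.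
- exact: hs.
- exact: hst.
- by rewrite capvC; apply: hst.
- exact: ht.
Qed.

Definition PAD (p : L * L * L) := PA p.1.1 p.1.2 p.2.
Definition good_PA (p : L * L * L) := [/\ p.1.1 \in W, p.1.1 != 0 & indep2 p.1.2 p.2].

(** Leaves only the planes [PAD p] to be examined. The three lists are disjoint because the new
    planes r N lie over inadmissible E and because only the planes [PAD p] meet S in a line. *)
Lemma extension_exists tau (ps : seq (L * L * L)) : inadm_choice tau ->
  (forall p, p \in ps -> good_PA p) -> uniq [seq PAD p | p <- ps] ->
  (forall p p', p \in ps -> p' \in ps -> PAD p != PAD p' -> (\dim (PAD p :&: PAD p') <= 1)%N) ->
  (forall p r a b v, p \in ps -> r != 0 -> ndata a b v ->
     admissible <<[:: a; b; v]>> \/ (a, b, v) = tau r ->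
     (\dim (Npl r a b v :&: PAD p) <= 1)%N) ->
  exists C, [/\ extension (calC0 L) C,
    (#|` C | = q ^ 8 + q ^ 5 - q + (q ^ 4).-1 + size ps)%N &
    forall p, p \in ps -> PAD p \in C].
Proof.
move=> htau hps ups hpp hpN; have [s0 [u0 z0 m0]] := C0_seq hL.
pose s1 := [seq NplD r (tau r) | r <- units L].
pose s2 := [seq PAD p | p <- ps].
have [ht1 ht2] := htau.
have m1 U : U \in s1 -> exists2 r, r != 0 & U = NplD r (tau r).
  by case/mapP => r; rewrite mem_units => r0 ->; exists r.
have hS2 U : U \in s2 -> \dim (U :&: SV L) = 2%N.
  by case/mapP => p /hps[xW x0 ind] ->; apply: PA_S.
have hS0 U : U \in s0 -> (\dim (U :&: SV L) <= 1)%N.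
  move/m0/(calC0P hL) => [/(calL0P hL)[a0 [a1 [-> _]]]|[r [a [b [v [r0 nd _ ->]]]]]].
    by rewrite PG_S dimv0.
  by rewrite Npl_S.
have hS1 U : U \in s1 -> \dim (U :&: SV L) = 1%N.
  by case/m1 => r r0 ->; rewrite Npl_S //; have [] := ht1 r r0.
exists (seq_fset tt (s0 ++ s1 ++ s2)); split.
- split.
    apply: plane_code_seq.
      move=> U; rewrite !mem_cat => /or3P[/m0/(calC0_dim hL)//|/m1[r r0 ->]|].
        by apply: dim_Npl => //; have [] := ht1 r r0.
      by case/mapP => p /hps[xW x0 ind] ->; apply: dim_PA.
    apply: pairwise_cat => [U U' /m0 h /m0 h'||U U' /m0 h].
    - exact: calC0_inter.
    - apply: pairwise_cat => [U U' /m1[r r0 ->] /m1[r' r'0 ->]||U U'].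
      + exact: extraN_inter.
      + move=> U U' /mapP[p hp ->] /mapP[p' hp' ->]; exact: hpp.
      move=> /m1[r r0 ->] /mapP[p hp ->]; apply: hpN => //; first by have [] := ht1 r r0.
      by right; case: (tau r) => -[].
    rewrite mem_cat => /orP[/m1[r r0 ->]|/mapP[p hp ->]].
      apply: C0_N_inter => //; first by have [] := ht1 r r0.
      apply: contraPneq h => ->; apply: extraN_notC0 => //; by have [] := ht1 r r0.
    move: h => /(calC0P hL)[/(calL0P hL)[a0 [a1 [-> _]]]|[r [a [b [v [r0 nd adm ->]]]]]].
      by have [xW x0 _] := hps _ hp; apply: PA_PG.
    by apply: hpN => //; left.
  move=> U /m0 h; change (U \in seq_fset tt (s0 ++ s1 ++ s2)).
  by rewrite seq_fsetE mem_cat h.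
- rewrite size_seq_fset undup_id; last first.
    rewrite cat_uniq u0 cat_uniq ups extraN_uniq // andbT /=; apply/andP; split.
      apply/hasPn => U; rewrite mem_cat => /orP[/m1[r r0 ->]|/hS2 h].
        apply/negP => /m0; apply: extraN_notC0 => //; by have [] := ht1 r r0.
      by apply/negP => /hS0; rewrite h.
    by apply/hasPn => U /hS2 h; apply/negP => /hS1; rewrite h.
  by rewrite !size_cat !size_map z0 size_units // addnA.
by move=> p hp; rewrite seq_fsetE !mem_cat map_f ?orbT.
Qed.

End Ext.

(** * The subfield of order q^2 and part (iii) *)

Section PartIII.
Variables (F : finFieldType) (L : fieldExtType F).
Local Notation q := #|F|.
Hypothesis hL : \dim {:L} = 4%N.
Local Notation W := (W L).
Local Notation V := (V L).

Lemma Fq2_basis : exists z : L, [/\ sg (sg z) = z, indep2 1 z &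
  forall y : L, sg (sg y) = y -> y \in <<[:: 1%R; z]>>%VS].
Proof.
have [g hg] := prim_rootL hL.
have g0 : g != 0.
  apply/eqP => g0; have := prim_expr_order hg.
  by rewrite g0 expr0n eqn0Ngt (prim_order_gt0 hg) => /eqP; rewrite eq_sym oner_eq0.
have q1 := q_gt1 F.
have e4 : ((q ^ 4).-1 = (q ^ 2).+1 * (q ^ 2).-1)%N.
  have : (0 < q ^ 2)%N by rewrite expn_gt0 (ltnW q1).
  rewrite (expnM q 2 2); case: (q ^ 2)%N => // n _; rewrite [n.+1.-1]/=.
  suff -> : (n.+1 ^ 2 = (n.+2 * n).+1)%N by [].
  by ring.
pose z := g ^+ (q ^ 2).+1.
have sz : sg (sg z) = z.
  rewrite -[LHS]/(iter 2 (@sg F L) z) sgXn /z -exprM.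
  have -> : ((q ^ 2).+1 * q ^ 2 = (q ^ 4).-1 + (q ^ 2).+1)%N.
    have : (0 < q ^ 2)%N by rewrite expn_gt0 (ltnW q1).
    by rewrite e4; case: (q ^ 2)%N => // n _; rewrite [n.+1.-1]/=; ring.
  by rewrite exprD (prim_expr_order hg) mul1r.
have zn : indep2 1 z.
  apply: indep2P; first exact: oner_neq0.
  apply/negP => /vlineP[c ec].
  have : ((q ^ 4).-1 %| (q ^ 2).+1 * q.-1)%N.
    rewrite (prim_order_dvd hg) exprM -/z ec; apply/eqP/(@mulfI _ c%:A).
      by rewrite -ec expf_neq0.
    by rewrite -exprS prednK ?(ltnW q1) // -/(sg _) sg_scalar mulr1.
  rewrite e4 dvdn_pmul2l // => /dvdn_leq; rewrite -subn1 subn_gt0 => /(_ q1).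
  have : (q < q ^ 2)%N by rewrite -{1}[q]expn1 ltn_exp2l.
  by lia.
exists z; split=> // y sy; apply: contrapT => /negP yn.
have := moore3_neq0 (indep3P zn yn); rewrite /moore3 !deltaE !rmorph1 sz sy.
by move/eqP; apply; ring.
Qed.

Lemma Fq2P (y : L) : Fq2 y <-> sg (sg y) = y.
Proof. by rewrite /Fq2 /= -(sgXn 2). Qed.

Lemma sg_line (r z : L) : indep2 1 z -> r != 0 -> indep2 r (r * z).
Proof.
move=> ind r0 c d e; apply: ind; apply: (mulfI r0).
by rewrite mulr0 -e mulrDr -!scalerAr mulr1.
Qed.

(* representatives for L^* modulo the nonzero elements of F_{q^2} *)
Lemma Fq2_reps (z : L) : sg (sg z) = z -> indep2 1 z ->
  (forall y : L, sg (sg y) = y -> y \in <<[:: 1%R; z]>>%VS) ->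
  exists s : seq L, [/\ uniq s, size s = (q ^ 2).+1, forall r, r \in s -> r != 0,
   forall r : L, r != 0 -> exists2 r', r' \in s & <<[:: r; (r * z)%R]>>%VS = <<[:: r'; (r' * z)%R]>>%VS &
   forall r r', r \in s -> r' \in s -> r != r' ->
     (<<[:: r; (r * z)%R]>> :&: <<[:: r'; (r' * z)%R]>>)%VS = 0%VS].
Proof.
move=> sz indz hz.
have fix2 (y : L) : (y \in <<[:: 1%R; z]>>%VS) = (sg (sg y) == y).
  apply/idP/eqP => [/span2P[c [d ->]]|]; last exact: hz.
  by rewrite !sgD !sgZ sz !rmorph1.
have memr (r y : L) : r != 0 -> (y \in <<[:: r; (r * z)%R]>>%VS) = (sg (sg (y / r)) == y / r).
  move=> r0; rewrite -fix2; apply/span2P/span2P => [[c [d ->]]|[c [d e]]]; exists c, d.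
    by rewrite mulrDl -!scalerAl divff // mulrAC divff // mul1r.
  by rewrite -(divfK r0 y) e mulrDl -!scalerAl mul1r mulrC.
have [g hg] := prim_rootL hL.
have g0 : g != 0.
  apply/eqP => g0; have := prim_expr_order hg.
  by rewrite g0 expr0n eqn0Ngt (prim_order_gt0 hg) => /eqP; rewrite eq_sym oner_eq0.
have q1 := q_gt1 F; have q20 : (0 < q ^ 2)%N by rewrite expn_gt0 (ltnW q1).
have e4 : ((q ^ 4).-1 = (q ^ 2).+1 * (q ^ 2).-1)%N.
  move: q20; rewrite (expnM q 2 2); case: (q ^ 2)%N => // n _; rewrite [n.+1.-1]/=.
  suff -> : (n.+1 ^ 2 = (n.+2 * n).+1)%N by [].
  by ring.
have q21 : (0 < (q ^ 2).-1)%N.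
  by rewrite -subn1 subn_gt0 -(expn0 q) ltn_exp2l.
(* The multiplicative group of the subfield consists of the powers of g^(q^2+1), so the g^i with i
   <= q^2 represent its cosets. *)
have gfix i : (sg (sg (g ^+ i)) == g ^+ i) = ((q ^ 2).+1 %| i)%N.
  rewrite -[sg (sg _)]/(iter 2 (@sg F L) _) sgXn -exprM.
  have -> : (i * q ^ 2 = i * (q ^ 2).-1 + i)%N by rewrite -{1}(prednK q20) mulnS addnC.
  rewrite exprD -{2}[g ^+ i]mul1r (inj_eq (mulIf (expf_neq0 i g0))) -(prim_order_dvd hg).
  by rewrite e4 dvdn_pmul2r.
have eqsp r r' : r != 0 -> r' != 0 -> sg (sg (r / r')) = r / r' ->
    <<[:: r; (r * z)%R]>>%VS = <<[:: r'; (r' * z)%R]>>%VS.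
  move=> r0 r'0 e; apply/vspaceP => y; rewrite !memr //.
  have -> : y / r' = (y / r) * (r / r') by rewrite mulrA divfK.
  rewrite !(sgM (y / r)) !(sgM (sg (y / r))) e (inj_eq (mulIf _)) //.
  by rewrite mulf_neq0 ?invr_eq0.
exists [seq g ^+ i | i <- iota 0 (q ^ 2).+1]; split.
- rewrite map_inj_in_uniq ?iota_uniq // => i j; rewrite !mem_iota /= add0n => hi hj.
  have lt4 k : (k < (q ^ 2).+1)%N -> (k < (q ^ 4).-1)%N.
    move=> hk; rewrite e4; apply: leq_trans hk _; exact: leq_pmulr.
  move=> e; have := eq_prim_root_expr hg i j; rewrite e eqxx => /esym/eqP.
  by rewrite /= !modn_small ?lt4.
- by rewrite size_map size_iota.
- by move=> r /mapP[i _ ->]; apply: expf_neq0.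
- move=> r r0; have [i ei] : exists i : nat, r = g ^+ i.
    by have [i ->] := prim_rootP hg (expL hL r0); exists i.
  exists (g ^+ (i %% (q ^ 2).+1)).
    by apply/map_f; rewrite mem_iota add0n ltn_mod.
  apply: eqsp => //; first exact: expf_neq0.
  rewrite ei {1 3}(divn_eq i (q ^ 2).+1) exprD mulfK ?expf_neq0 //.
  by apply/eqP; rewrite gfix dvdn_mull.
move=> r r' hr hr' ne; have r0 : r != 0 by case/mapP: hr => i _ ->; apply: expf_neq0.
have r'0 : r' != 0 by case/mapP: hr' => i _ ->; apply: expf_neq0.
apply/eqP; rewrite -subv0; apply/subvP => y; rewrite memv_cap !memr // memv0.
move=> /andP[/eqP e /eqP e']; apply: contraNT ne => y0.
have : sg (sg (r' / r)) = r' / r.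
  have -> : r' / r = (y / r) / (y / r') by field; rewrite r0 r'0 y0.
  by rewrite !(sgM _ (y / r')^-1) !sgV sgM !sgV e e'.
move: hr hr' => /mapP[i hi ->] /mapP[j hj ->].
wlog ij : i j hi hj / (i <= j)%N.
  move=> H; have [/H|/ltnW ji e1] := leqP i j; first by apply.
  rewrite eq_sym; apply: (H j i) => //.
  by rewrite -(invf_div (g ^+ j) (g ^+ i)) !sgV e1.
rewrite mem_iota add0n in hj.
have -> : g ^+ j / g ^+ i = g ^+ (j - i) by rewrite -{1}(subnK ij) exprD mulfK ?expf_neq0.
move/eqP; rewrite gfix; case: (posnP (j - i)%N) => [ji _|ji].
  have -> // : i = j; by apply/eqP; rewrite eqn_leq ij -subn_eq0 ji.
by move=> /(dvdn_leq ji); rewrite leqNgt (leq_ltn_trans (leq_subr _ _)).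
Qed.

Lemma part3 : exists C, [/\ extension (calC0 L) C,
     (#|` C | = q ^ 8 + q ^ 5 + q ^ 4 + q ^ 2 - q)%N,
     exists2 eps : L, (eps != 0)%R & (eps ^+ q.-1 = -1)%R &
     forall eps : L, (eps != 0)%R -> (eps ^+ q.-1 = -1)%R ->
       (eps_planes eps #= `I_(q ^ 2).+1)%card /\ (eps_planes eps `<=` [set` C])%classic].
Proof.
have q1 := q_gt1 F; have [e e0 se] := exists_eps hL.
have epsE (k : L) : k != 0 -> (k ^+ q.-1 = -1) <-> sg k = - k.
  move=> k0; rewrite /sg -{2}(prednK (ltnW q1)) exprS; split=> [->|]; first by rewrite mulrN1.
  by move=> h; apply: (mulfI k0); rewrite mulrN1.
have epsW k : sg k = - k -> k \in W.
  by move=> sk; rewrite mem_W tr4E // !(sk, sgN); apply/eqP; ring.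
have [z [sz indz hz]] := Fq2_basis.
have [R [Ru Rs R0 R1 R2]] := Fq2_reps sz indz hz.
have [tau ht] : exists tau, @inadm_choice F L tau.
  have [g hg] := prim_rootL hL.
  have g0 : g != 0.
    apply/eqP => g0; have := prim_expr_order hg.
    by rewrite g0 expr0n eqn0Ngt (prim_order_gt0 hg) => /eqP; rewrite eq_sym oner_eq0.
  (* One inadmissible plane, g^(q+1) W, serves for all r. It is not W because g^(q+1) is not a
     scalar. *)
  have t0 : g ^+ q.+1 != 0 by exact: expf_neq0.
  have [|d [nd E]] := mulW_span hL t0.
    move=> [c ec]; have : ((q ^ 4).-1 %| q.+1 * q.-1)%N.
      rewrite (prim_order_dvd hg) exprM ec; apply/eqP/(@mulfI _ c%:A); first by rewrite -ec.
      by rewrite -exprS prednK ?(ltnW q1) // -/(sg _) sg_scalar mulr1.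
    have q1' : (0 < q.-1)%N by rewrite -subn1 subn_gt0.
    rewrite q4E mulnA dvdn_pmul2r // -{2}[q.+1]muln1 dvdn_pmul2l // dvdn1.
    by rewrite eqSS expn_eq0 eqn0Ngt (ltnW q1).
  exists (fun _ => d); split=> // r r0; split=> //; rewrite /spanD E.
  by move/(admissibleP hL t0); rewrite chi_norm ?eqxx.
pose ps := [seq (e, r, r * z) | r <- R].
have psP p : p \in ps -> exists2 r, r \in R & p = (e, r, r * z).
  by case/mapP => r hr ->; exists r.
have [||||C [hC zC inC]] := extension_exists hL ht (ps := ps).
- move=> p /psP[r hr ->]; split=> //=; first exact: epsW.
  exact/sg_line/R0.
- rewrite -map_comp map_inj_in_uniq // => r r' hr hr' /= E; apply/eqP; apply: contrapT => /negP ne.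
  have : mk 0 r \in PA e r' (r' * z).
    by have <- : PA e r (r * z) = PA e r' (r' * z) := E; rewrite memv_span // !inE eqxx orbT.
  case/(mem_PA _ _ _ (epsW _ se)) => _ /= h.
  have : r \in (<<[:: r; (r * z)%R]>> :&: <<[:: r'; (r' * z)%R]>>)%VS.
    by rewrite memv_cap h memv_span // !inE eqxx.
  by rewrite R2 // memv0 (negPf (R0 _ hr)).
- move=> p p' /psP[r hr ->] /psP[r' hr' ->] ne.
  apply: PA_PA => //; try exact: epsW.
  apply: (R2 r r') => //; apply: contraNneq ne => ->; exact: eqxx.
- move=> p r a b v /psP[r' hr' ->] r0 nd _; rewrite leqNgt; apply/negP => dI.
  have [rin [b1 [v1 [nd1 _ _ _ hin]]]] := PA_N r0 nd (epsW _ se) e0 dI.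
  have fix2 (y : L) : y \in <<[:: 1%R; z]>>%VS -> sg (sg y) = y.
    by move=> /span2P[c [d ->]]; rewrite !sgD !sgZ sz !rmorph1.
  have r'0 := R0 _ hr'.
  have memr (y : L) : y \in <<[:: r'; (r' * z)%R]>>%VS -> sg (sg (y / r')) = y / r'.
    move=> /span2P[c [d ->]]; apply: fix2; apply/span2P; exists c, d.
    by rewrite mulrDl -!scalerAl divff // mulrAC divff // mul1r.
  (* Both r and r times the ratio lie in r' F_{q^2}, so the ratio itself would lie in F_{q^2}. *)
  apply: (eps_free e0 se nd1).
  have -> : delta v1 e / delta e b1 = (r * (delta v1 e / delta e b1) / r') / (r / r').
    by move: (delta v1 e / delta e b1) => t; field; rewrite r0 r'0.
  have divfix (A B : L) : sg (sg A) = A -> sg (sg B) = B -> sg (sg (A / B)) = A / B.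
    by move=> hA hB; rewrite !sgM !sgV hA hB.
  exact: divfix (memr _ hin) (memr _ rin).
exists C; split=> //.
- rewrite zC size_map Rs; have : (q <= q ^ 5)%N by rewrite -{1}[q]expn1 leq_exp2l.
  have : (0 < q ^ 4)%N by rewrite expn_gt0 (ltnW q1).
  by lia.
- by exists e => //; apply/epsE.
move=> k k0 /(epsE k k0) sk.
(* Solutions of eps^q = - eps differ by scalars, so the planes do not depend on eps. *)
have [c ec] : exists c : F, k / e = c%:A.
  by apply: sg_fix; rewrite sgM sgV se sk invrN mulrNN.
have kE : k = c *: e by rewrite -[k](divfK e0) ec -scalerAl mul1r.
have c0 : c != 0 by apply: contraNneq k0 => c0; rewrite kE c0 scale0r.
have PAset r : r != 0 -> [set` PA e r (r * z)]%classic =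
   [set v : V | (exists lambda : F, vsval v.1 = lambda *: k) /\
                (exists2 y, Fq2 y & v.2 = r * y)]%classic.
  move=> r0; apply/seteqP; split=> w /=.
    move=> /(mem_PA _ _ _ (epsW _ se))[[l el] /span2P[m [n emn]]]; split.
      by exists (l / c); rewrite kE scalerA divfK.
    exists (m *: 1 + n *: z); last by rewrite emn mulrDr -!scalerAr mulr1.
    by apply/Fq2P; rewrite !sgD !sgZ sz !rmorph1.
  move=> [[l el] [y /Fq2P/hz/span2P[m [n emn]] e2]]; apply/(mem_PA _ _ _ (epsW _ se)); split.
    by exists (l * c); rewrite el kE scalerA.
  by apply/span2P; exists m, n; rewrite e2 emn mulrDr -!scalerAr mulr1.
have epsP U : eps_planes k U <-> exists2 r, r \in R & U = PA e r (r * z).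
  split=> [[r r0 eU]|[r hr ->]]; last by exists r; [exact: R0 | apply/PAset/R0].
  have [r' hr' sp] := R1 _ r0; exists r' => //; apply: set_vspace_inj; rewrite eU -PAset //.
  suff -> : PA e r (r * z) = PA e r' (r' * z) by [].
  apply/vspaceP => w.
  by apply/(mem_PA _ _ _ (epsW _ se))/(mem_PA _ _ _ (epsW _ se)); rewrite sp.
split; last first.
  move=> U /epsP[r hr ->]; change (PA e r (r * z) \in C).
  by apply: (inC (e, r, r * z)); apply/mapP; exists r.
pose s := [seq PA e r (r * z) | r <- R].
have -> : eps_planes k = [set` seq_fset tt s]%classic.
  apply/seteqP; split=> U hU.
    change (U \in seq_fset tt s).
    by move/epsP: hU => [r hr ->]; rewrite seq_fsetE; apply/mapP; exists r.
  have {hU} : U \in seq_fset tt s := hU.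
  by rewrite seq_fsetE => /mapP[r hr ->]; apply/epsP; exists r.
have -> : (q ^ 2).+1 = #|` seq_fset tt s|.
  rewrite size_seq_fset undup_id ?size_map ?Rs // map_inj_in_uniq // => r r' hr hr' E.
  apply/eqP; apply: contrapT => /negP ne.
  have : mk 0 r \in PA e r' (r' * z) by rewrite -E memv_span // !inE eqxx orbT.
  case/(mem_PA _ _ _ (epsW _ se)) => _ /= h.
  have : r \in (<<[:: r; (r * z)%R]>> :&: <<[:: r'; (r' * z)%R]>>)%VS.
    by rewrite memv_cap h memv_span // !inE eqxx.
  by rewrite R2 // memv0 (negPf (R0 _ hr)).
exact/card_eq_fsetP.
Qed.

End PartIII.

(** * q = 3 *)

Inductive t3 := O3 | P3 | M3.
Definition add3 (x y : t3) := match x, y with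
  | O3, z | z, O3 => z | P3, P3 => M3 | M3, M3 => P3 | _, _ => O3 end.
Definition opp3 x := match x with O3 => O3 | P3 => M3 | M3 => P3 end.
Definition mul3 x y := match x with O3 => O3 | P3 => y | M3 => opp3 y end.
Definition eq3 x y := match x, y with O3, O3 | P3, P3 | M3, M3 => true | _, _ => false end.
(** Nested conditionals make [vm_compute] stop at the first failure. *)
Definition all3 (P : t3 -> bool) := if P O3 then if P P3 then P M3 else false else false.

(* a + b beta + c beta^2 + d beta^3 with beta^4 = beta^2 + 1 *)
Inductive k81 := K4 of t3 & t3 & t3 & t3.
Definition k0 := K4 O3 O3 O3 O3.
Definition k1 := K4 P3 O3 O3 O3.
Definition kadd x y := let: K4 a b c d := x in let: K4 e f g h := y in
  K4 (add3 a e) (add3 b f) (add3 c g) (add3 d h).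
Definition kopp x := let: K4 a b c d := x in K4 (opp3 a) (opp3 b) (opp3 c) (opp3 d).
Definition ksub x y := kadd x (kopp y).
Definition kmul x y := let: K4 a b c d := x in let: K4 e f g h := y in
  let s4 := add3 (mul3 b h) (add3 (mul3 c g) (mul3 d f)) in
  let s5 := add3 (mul3 c h) (mul3 d g) in
  let s6 := mul3 d h in
  K4 (add3 (mul3 a e) (add3 s4 s6))
     (add3 (add3 (mul3 a f) (mul3 b e)) s5)
     (add3 (add3 (mul3 a g) (add3 (mul3 b f) (mul3 c e))) (add3 s4 (opp3 s6)))
     (add3 (add3 (add3 (mul3 a h) (mul3 b g)) (add3 (mul3 c f) (mul3 d e))) s5).
Definition keq x y := let: K4 a b c d := x in let: K4 e f g h := y in
  if eq3 a e then if eq3 b f then if eq3 c g then eq3 d h else false else false else false.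
Definition allk (P : k81 -> bool) :=
  all3 (fun a => all3 (fun b => all3 (fun c => all3 (fun d => P (K4 a b c d))))).
Definition kfr x := kmul x (kmul x x).
Definition kD x := ksub (kfr x) x.
Definition ktr x := let y := kfr x in let z := kfr y in
  kadd (kadd (kadd x y) z) (kfr z).
Definition kdelta x y := ksub (kmul x (kfr y)) (kmul (kfr x) y).
Definition ksq x := kmul x x.
(** The power x^79, which is the inverse of a nonzero x since x^80 = 1. *)
Definition kinv x := let x2 := ksq x in let x3 := kmul x x2 in let x9 := kfr x3 in
  let x27 := kfr x9 in kmul (kmul (ksq x27) (kmul x9 x9)) (kmul x3 (kmul x3 x)).
(** For q = 3 the exponent (q^2 + 1)(q - 1) is 20. *)
Definition kchi x := let x4 := ksq (ksq x) in ksq (ksq (kmul x4 x)).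
Definition ksc c x := let: K4 a b d e := x in K4 (mul3 c a) (mul3 c b) (mul3 c d) (mul3 c e).
Definition kcomb (u v : k81) c d := kadd (ksc c u) (ksc d v).
Definition allspan u v (P : k81 -> bool) := all3 (fun c => all3 (fun d => P (kcomb u v c d))).
Definition inspan u v x := ~~ allspan u v (fun y => ~~ keq x y).
Definition isk0 x := keq x k0.

(* Found by computer: the inadmissible plane <a, b, v> = s^4 W attached to r depends on r^8 only,
   and the 96 further planes <x> * <r1, r2> form 24 orbits under multiplication by F_9^*. *)
Definition tab3 : seq (k81 * (k81 * k81 * k81 * k81)) := [::
  (K4 P3 O3 O3 O3, (K4 O3 P3 O3 O3, K4 P3 O3 P3 P3, K4 M3 O3 P3 O3, K4 M3 O3 P3 P3));
  (K4 M3 O3 P3 M3, (K4 O3 M3 O3 P3, K4 P3 O3 P3 P3, K4 M3 P3 O3 O3, K4 M3 P3 O3 O3));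
  (K4 O3 P3 P3 O3, (K4 O3 P3 O3 O3, K4 P3 O3 P3 P3, K4 M3 O3 P3 O3, K4 M3 O3 P3 P3));
  (K4 O3 P3 M3 O3, (K4 P3 O3 P3 M3, K4 P3 M3 P3 P3, K4 P3 P3 O3 O3, K4 M3 O3 O3 P3));
  (K4 P3 O3 M3 M3, (K4 O3 M3 O3 P3, K4 P3 O3 P3 P3, K4 M3 P3 O3 O3, K4 M3 P3 O3 O3));
  (K4 M3 O3 O3 O3, (K4 O3 P3 O3 O3, K4 P3 O3 P3 P3, K4 M3 O3 P3 O3, K4 M3 O3 P3 P3));
  (K4 P3 O3 M3 P3, (K4 P3 P3 P3 M3, K4 P3 P3 P3 P3, K4 P3 P3 O3 O3, K4 M3 M3 P3 M3));
  (K4 O3 M3 M3 O3, (K4 O3 M3 O3 P3, K4 P3 O3 P3 M3, K4 P3 P3 O3 O3, K4 M3 M3 O3 O3));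
  (K4 O3 M3 P3 O3, (K4 O3 M3 O3 P3, K4 O3 P3 O3 O3, K4 P3 O3 O3 O3, K4 O3 O3 O3 M3));
  (K4 M3 O3 P3 P3, (K4 P3 P3 P3 M3, K4 P3 O3 P3 P3, K4 M3 P3 O3 O3, K4 M3 M3 M3 P3))].
Definition base3 : seq (k81 * k81 * k81) := [::
  (K4 M3 O3 M3 P3, K4 M3 O3 P3 O3, K4 M3 O3 O3 P3);
  (K4 M3 M3 M3 P3, K4 P3 O3 O3 O3, K4 O3 M3 O3 P3);
  (K4 P3 M3 P3 P3, K4 P3 O3 O3 O3, K4 O3 P3 O3 O3);
  (K4 O3 O3 O3 P3, K4 P3 O3 O3 O3, K4 O3 M3 P3 O3);
  (K4 O3 M3 O3 P3, K4 O3 P3 O3 O3, K4 M3 O3 P3 O3);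
  (K4 P3 P3 P3 O3, K4 M3 M3 P3 O3, K4 O3 M3 O3 P3);
  (K4 P3 M3 P3 O3, K4 P3 P3 O3 O3, K4 O3 O3 P3 O3);
  (K4 P3 P3 P3 O3, K4 M3 P3 O3 O3, K4 O3 O3 P3 O3);
  (K4 O3 P3 O3 P3, K4 O3 M3 P3 O3, K4 O3 M3 O3 P3);
  (K4 P3 M3 P3 O3, K4 O3 P3 O3 O3, K4 P3 O3 O3 P3);
  (K4 O3 P3 O3 O3, K4 P3 P3 O3 O3, K4 M3 O3 O3 P3);
  (K4 P3 O3 P3 P3, K4 O3 M3 P3 O3, K4 P3 O3 O3 P3);
  (K4 M3 P3 M3 P3, K4 M3 M3 P3 O3, K4 O3 P3 O3 P3);
  (K4 M3 P3 M3 P3, K4 O3 P3 P3 O3, K4 M3 P3 O3 P3);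
  (K4 M3 M3 M3 P3, K4 P3 P3 O3 O3, K4 M3 O3 P3 P3);
  (K4 P3 P3 P3 P3, K4 M3 P3 O3 O3, K4 P3 O3 P3 P3);
  (K4 O3 M3 O3 P3, K4 O3 M3 P3 O3, K4 P3 P3 O3 P3);
  (K4 O3 O3 O3 P3, K4 P3 P3 P3 O3, K4 O3 O3 O3 P3);
  (K4 P3 M3 P3 P3, K4 P3 P3 P3 O3, K4 P3 M3 O3 P3);
  (K4 O3 P3 O3 O3, K4 M3 P3 O3 O3, K4 M3 O3 P3 O3);
  (K4 O3 P3 O3 P3, K4 P3 O3 O3 O3, K4 O3 O3 P3 P3);
  (K4 P3 P3 P3 P3, K4 O3 P3 O3 O3, K4 P3 O3 P3 O3);
  (K4 M3 O3 M3 P3, K4 P3 M3 P3 O3, K4 O3 M3 O3 P3);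
  (K4 P3 O3 P3 P3, K4 P3 P3 O3 O3, K4 P3 O3 M3 P3)].
(** Representatives modulo sign of the eighth roots of unity, that is, of the nonzero elements of
    F_9. *)
Definition zs3 : seq k81 := [:: K4 P3 O3 O3 O3; K4 O3 O3 M3 O3; K4 P3 O3 P3 O3; K4 M3 O3 P3 O3].
Fixpoint lookup3 k t := match t with
  | [::] => (k0, k0, k0, k0)
  | (k', d) :: t' => if keq k k' then d else lookup3 k t' end.
Definition tau3 k := lookup3 (ksq (ksq (ksq k))) tab3.
Definition ps3 := [seq (p.1.1, kmul z p.1.2, kmul z p.2) | p <- base3, z <- zs3].

Definition chk_tau (d : k81 * k81 * k81 * k81) := let: (a, b, v, s) := d in
  let s4 := ksq (ksq s) in
  [&& isk0 (ktr a), isk0 (ktr b), ~~ isk0 (ktr v), ~~ isk0 (kdelta a b), ~~ isk0 s,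
      isk0 (ktr (kmul a s4)), isk0 (ktr (kmul b s4)) & isk0 (ktr (kmul v s4))].
Definition chk_good (p : k81 * k81 * k81) := let: (x, r1, r2) := p in
  [&& isk0 (ktr x), ~~ isk0 x & ~~ isk0 (kdelta r1 r2)].
(** Over the same point <x> the two lines of S have to be disjoint; over different points the planes
    meet inside S, and distinct lines suffice. *)
Definition chk_pair (p p' : k81 * k81 * k81) :=
  let: (x, r1, r2) := p in let: (x', s1, s2) := p' in
  if isk0 (kdelta x x')
  then allspan r1 r2 (fun y => if isk0 y then true else ~~ inspan s1 s2 y)
  else if inspan s1 s2 r1 then ~~ inspan s1 s2 r2 else true.
(* h is not of the form delta v x / delta x b with <x, b, v> admissible *)
Definition chk_slot x h := let dh := kD h in let ix := kinv x in
  if isk0 dh then true else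
  if keq (kchi (kmul (kmul x (kmul (kfr x) (kfr (kfr x)))) dh)) k1 then true else
  allk (fun b => if isk0 (ktr b) then
     let hb := kmul h (kD (kmul b ix)) in
     if isk0 (ktr hb) then
       ~~ allk (fun w => if isk0 (ktr w) then ~~ keq hb (kD (kmul w ix)) else true)
     else true else true).
(** Only the 24 base planes are examined: a factor z with z^8 = 1 changes neither the ratio y / r
    nor the plane E_r, which depends on r^8. Here y runs over all values that a plane over r could
    take at x, and x itself has to lie in Z for the plane E_r to matter. *)
Definition chk_base (p : k81 * k81 * k81) := let: (x, r1, r2) := p in
  allspan r1 r2 (fun r => if isk0 r then true else
    let ir := kinv r in let: (a, b, v, _) := tau3 r in let xab := inspan a b x in
    allspan r1 r2 (fun y => if chk_slot x (kmul y ir) then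
      if xab then ~~ keq (kmul y (kdelta a b)) (kmul r (kdelta v x)) else true
      else false)).

Lemma chk_tau3 : allk (fun k => isk0 k || chk_tau (tau3 k)).
Proof. by vm_compute. Qed.
Lemma chk_good3 : all chk_good ps3. Proof. by vm_compute. Qed.
Lemma chk_pair3 : pairwise chk_pair ps3. Proof. by vm_compute. Qed.
Lemma chk_base3 : all chk_base base3. Proof. by vm_compute. Qed.
Lemma chk_zs3 : all (fun z => keq (ksq (ksq (ksq z))) k1) zs3. Proof. by vm_compute. Qed.
Lemma kinv_chk : allk (fun k => isk0 k || keq (kmul k (kinv k)) k1). Proof. by vm_compute. Qed.

Lemma all3P Q a : all3 Q -> Q a.
Proof. by rewrite /all3; case: a; case: (Q O3) => //; case: (Q P3). Qed.

Lemma allkP P k : allk P -> P k.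
Proof.
by case: k => a b c d /all3P-/(_ a)/all3P-/(_ b)/all3P-/(_ c)/all3P-/(_ d).
Qed.

Lemma allkT (P : k81 -> bool) : (forall k, P k) -> allk P.
Proof. by move=> h; rewrite /allk /all3 !h. Qed.

Lemma allspanP u v P c d : allspan u v P -> P (kcomb u v c d).
Proof.
by move=> /all3P-/(_ c)/all3P-/(_ d).
Qed.

Lemma keqP x y : keq x y -> x = y.
Proof.
have e3 a b : eq3 a b -> a = b by case: a; case: b.
case: x => a b c d; case: y => e f g h /=.
case E1: (eq3 a e) => //; case E2: (eq3 b f) => //; case E3: (eq3 c g) => //.
by move/e3 ->; rewrite (e3 _ _ E1) (e3 _ _ E2) (e3 _ _ E3).
Qed.

Lemma keqxx x : keq x x.
Proof. by case: x => -[] [] [] []. Qed.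

Lemma keq_axiom : Equality.axiom keq.
Proof. by move=> x y; apply: (iffP idP) => [/keqP|->] //; apply: keqxx. Qed.
HB.instance Definition _ := hasDecEq.Build k81 keq_axiom.

(** * F_81 as a model of L and part (ii) *)

Section PartII.
Variables (F : finFieldType) (L : fieldExtType F).
Hypothesis hL : \dim {:L} = 4%N.
Hypothesis hq : #|F| = 3%N.
Local Notation W := (W L).

Lemma three0F : 1 + 1 + 1 = 0 :> F.
Proof.
have [p p_pr pF] := finPcharP F.
have := card_pprimeChar pF; rewrite hq => e.
have p3 : p = 3%N.
  have : (p %| 3)%N.
    rewrite {1}e; case: (logn p 3) e => [|n]; first by rewrite expn0.
    by rewrite expnS dvdn_mulr.
  by rewrite dvdn_divisors // => /[!inE] /orP[] /eqP pE; rewrite pE in p_pr *.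
by have := pcharf0 pF; rewrite p3 mulrSr mulr2n.
Qed.

Lemma three0 : 1 + 1 + 1 = 0 :> L.
Proof.
have := congr1 (fun c : F => c%:A : L) three0F.
by rewrite /= !scalerDl scale1r scale0r.
Qed.

Lemma beta_exists : exists b : L, b ^+ 4 = b ^+ 2 + 1.
Proof.
have [g hg] := prim_rootL hL; rewrite hq in hg.
(* This b has order 16. Modulo 3, X^8 + 1 is the product of X^4 - X^2 - 1 and X^4 + X^2 - 1, and the
   fifth power of a root of the second factor is a root of the first. *)
pose b := g ^+ 5.
have b8 : b ^+ 8 = -1.
  have : (b ^+ 8) ^+ 2 == 1 by rewrite /b -!exprM -(prim_order_dvd hg).
  rewrite sqrf_eq1 => /orP[|/eqP//].
  by rewrite /b -exprM -(prim_order_dvd hg).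
have : (b ^+ 4 - b ^+ 2 - 1) * (b ^+ 4 + b ^+ 2 - 1) = 0.
  transitivity ((b ^+ 8 + 1) - (1 + 1 + 1) * b ^+ 4); first by ring.
  by rewrite b8 three0 mul0r addNr subr0.
move/eqP; rewrite mulf_eq0 => /orP[] /eqP e; [exists b | exists (b ^+ 5)].
  by apply/eqP; rewrite -subr_eq0 opprD addrA e.
have b4 : b ^+ 4 = 1 - b ^+ 2 by apply/eqP; rewrite -subr_eq0 -e; apply/eqP; ring.
have -> : b ^+ 5 ^+ 4 = (b ^+ 8) ^+ 2 * b ^+ 4 by rewrite -!exprM -exprD.
have -> : b ^+ 5 ^+ 2 = b ^+ 8 * b ^+ 2 by rewrite -!exprM -exprD.
by rewrite b8 b4; ring.
Qed.

Definition ev3 (a : t3) : L := match a with O3 => 0 | P3 => 1 | M3 => -1 end.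

Lemma two1 : 1 + 1 = -1 :> L.
Proof. by apply/eqP; rewrite -addr_eq0 three0. Qed.

Lemma ev3D a b : ev3 (add3 a b) = ev3 a + ev3 b.
Proof.
by case: a; case: b => /=; rewrite ?addr0 ?add0r ?two1 ?subrr ?addNr // -opprD two1 opprK.
Qed.
Lemma ev3N a : ev3 (opp3 a) = - ev3 a.
Proof. by case: a; rewrite /= ?oppr0 ?opprK. Qed.
Lemma ev3M a b : ev3 (mul3 a b) = ev3 a * ev3 b.
Proof. by case: a => /=; rewrite ?mul0r ?mul1r // ev3N mulN1r. Qed.

Lemma ev3_scalar (c : F) : exists a : t3, c%:A = ev3 a /\ forall x : L, c *: x = ev3 a * x.
Proof.
have : c ^+ 3 = c by rewrite -{1}hq expf_card.
move/eqP; rewrite -subr_eq0; have -> : c ^+ 3 - c = c * ((c - 1) * (c + 1)) by ring.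
rewrite !mulf_eq0 => /or3P[] /eqP e.
- by exists O3; rewrite e scale0r; split=> // x; rewrite scale0r mul0r.
- move/eqP: e; rewrite subr_eq0 => /eqP ->.
  by exists P3; rewrite scale1r; split=> // x; rewrite scale1r mul1r.
move/eqP: e; rewrite addr_eq0 => /eqP ->.
by exists M3; rewrite scaleN1r; split=> // x; rewrite scaleN1r mulN1r.
Qed.

Section Model.
Variable b : L.
Hypothesis hb : b ^+ 4 = b ^+ 2 + 1.

Definition ev (k : k81) : L := let: K4 a c d e := k in
  ev3 a + ev3 c * b + ev3 d * b ^+ 2 + ev3 e * b ^+ 3.

Lemma evD x y : ev (kadd x y) = ev x + ev y.
Proof. by case: x y => [a1 a2 a3 a4] [c1 c2 c3 c4]; rewrite /= !ev3D; ring. Qed.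
Lemma evN x : ev (kopp x) = - ev x.
Proof. by case: x => [a1 a2 a3 a4]; rewrite /= !ev3N; ring. Qed.
Lemma evB x y : ev (ksub x y) = ev x - ev y.
Proof. by rewrite /ksub evD evN. Qed.
Lemma evM x y : ev (kmul x y) = ev x * ev y.
Proof.
case: x y => [a1 a2 a3 a4] [c1 c2 c3 c4]; rewrite /= !(ev3D, ev3M, ev3N).
move: (ev3 a1) (ev3 a2) (ev3 a3) (ev3 a4) (ev3 c1) (ev3 c2) (ev3 c3) (ev3 c4).
move=> u1 u2 u3 u4 w1 w2 w3 w4.
have e5 : b ^+ 5 = b ^+ 3 + b by rewrite exprS hb; ring.
have e6 : b ^+ 6 = (1 + 1) * b ^+ 2 + 1 by rewrite exprS e5 mulrDr -exprS hb; ring.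
rewrite two1 in e6.
transitivity (u1 * w1 + (u1 * w2 + u2 * w1) * b + (u1 * w3 + u2 * w2 + u3 * w1) * b ^+ 2 +
  (u1 * w4 + u2 * w3 + u3 * w2 + u4 * w1) * b ^+ 3 + (u2 * w4 + u3 * w3 + u4 * w2) * b ^+ 4 +
  (u3 * w4 + u4 * w3) * b ^+ 5 + u4 * w4 * b ^+ 6); last by ring.
by rewrite e6 e5 hb; ring.
Qed.
Lemma ev0 : ev k0 = 0. Proof. by rewrite /= !mul0r !addr0. Qed.
Lemma ev1 : ev k1 = 1. Proof. by rewrite /= !mul0r !addr0. Qed.

(** Injectivity comes from the inverses found by computation, which replaces an irreducibility
    argument for the defining polynomial. *)
Lemma ev_eq0 x : ev x = 0 -> isk0 x.
Proof.
move=> e; have := allkP x kinv_chk; case: (isk0 x) => //= /keqP h.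
by have := evM x (kinv x); rewrite h ev1 e mul0r => /eqP; rewrite oner_eq0.
Qed.
Lemma isk0_ev x : isk0 x = (ev x == 0).
Proof. by apply/idP/eqP => [/keqP ->|/ev_eq0//]; rewrite ev0. Qed.
Lemma keq_ev x y : keq x y = (ev x == ev y).
Proof.
apply/idP/eqP => [/keqP -> //|e].
have : isk0 (ksub x y) by rewrite isk0_ev evB e subrr.
by case: x y {e} => -[] [] [] [] [[] [] [] []].
Qed.
Lemma ev_inj : injective ev.
Proof. by move=> x y e; apply/keqP; rewrite keq_ev e. Qed.

Lemma ev_surj (y : L) : exists x, y = ev x.
Proof.
pose s3 := [:: O3; P3; M3].
pose sk := [seq K4 p.1.1 p.1.2 p.2.1 p.2.2 |
  p <- [seq (x, y) | x <- [seq (x, y) | x <- s3, y <- s3], y <- [seq (x, y) | x <- s3, y <- s3]]].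
have skE : size sk = 81%N by [].
pose sL : seq (finvect_type L) := map ev sk.
have uL : uniq sL.
  rewrite uniq_pairwise pairwise_map; have : pairwise (fun x y => ~~ keq x y) sk by vm_compute.
  by apply: sub_pairwise => u v /=; rewrite keq_ev.
have : sL =i (finvect_type L).
  have hc : #|sL| = #|finvect_type L| by rewrite (card_uniqP uL) size_map skE card_L // hq.
  by apply/(subset_cardP hc); apply/fintype.subsetP.
by move/(_ y); rewrite [RHS]inE => /mapP[x _ ->]; exists x.
Qed.

Lemma evsg x : ev (kfr x) = sg (ev x).
Proof. by rewrite /kfr !evM /sg hq !exprS mulr1. Qed.
Lemma evtr x : ev (ktr x) = tr4 (ev x).
Proof. by rewrite /ktr !evD !evsg tr4E. Qed.
Lemma evdelta x y : ev (kdelta x y) = delta (ev x) (ev y).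
Proof. by rewrite /kdelta evB (evM x) (evM (kfr x)) !evsg deltaE. Qed.
Lemma evD' x : ev (kD x) = sg (ev x) - ev x.
Proof. by rewrite /kD evB evsg. Qed.
Lemma evinv x : ~~ isk0 x -> ev (kinv x) = (ev x)^-1.
Proof.
move=> x0; have := allkP x kinv_chk; rewrite (negPf x0) => /keqP e.
have ex0 : ev x != 0 by rewrite -isk0_ev.
by apply: (mulfI ex0); rewrite -evM e ev1 divff.
Qed.
Lemma evchi x : ev (kchi x) = chi (ev x).
Proof. by rewrite /kchi /ksq !evM /chi hq -!expr2 -!exprM; rewrite -exprSr -exprM. Qed.
Lemma ktrW x : isk0 (ktr x) = (ev x \in W).
Proof. by rewrite isk0_ev evtr mem_W. Qed.
Lemma evsc c x : ev (ksc c x) = ev3 c * ev x.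
Proof. by case: x => ? ? ? ?; rewrite /= !ev3M; ring. Qed.

Lemma inspanP u v x : inspan u v x = (ev x \in <<[:: ev u; ev v]>>%VS).
Proof.
apply/idP/span2P => [|[c [d e]]].
  rewrite /inspan; move=> h.
  suff : exists c d, keq x (kcomb u v c d).
    move=> [c [d]]; rewrite keq_ev evD !evsc => /eqP ->.
    have ex (a : t3) : exists c : F, forall y : L, ev3 a * y = c *: y.
      case: a; [exists 0 | exists 1 | exists (-1)] => y /=;
      by rewrite ?mul0r ?scale0r ?mul1r ?scale1r ?mulN1r ?scaleN1r.
    by have [c' hc] := ex c; have [d' hd] := ex d; exists c', d'; rewrite hc hd.
  apply: contrapT => /forallNP hn; case/negP: h.
  have hf c d : ~~ keq x (kcomb u v c d) by apply/negP => h; apply: (hn c); exists d.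
  by rewrite /allspan /all3 !hf.
have [c' [_ hc]] := ev3_scalar c; have [d' [_ hd]] := ev3_scalar d.
apply/negP => /(allspanP c' d'); rewrite keq_ev evD !evsc -hc -hd e.
by rewrite eqxx.
Qed.

Lemma span_ev (u v : k81) (y : L) : y \in <<[:: ev u; ev v]>>%VS ->
  exists c d, y = ev (kcomb u v c d).
Proof.
case/span2P => c [d ->]; have [c' [_ hc]] := ev3_scalar c; have [d' [_ hd]] := ev3_scalar d.
by exists c', d'; rewrite evD !evsc hc hd.
Qed.

(** The four conditions refuted by [chk_slot]. The hypothesis means D(v1/x) = - h D(b1/x). So h is
    not a scalar and D(v1/x) is not D(w/x) for w in W, since v1 is not in W; and the Moore
    determinant of x, b1, v1 is, up to sign, x^(1+q+q^2) D(h) D(b1/x)^(q+1), which gives the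
    condition on chi. *)
Lemma slot_adm (x h b1 v1 : L) : ndata x b1 v1 -> delta v1 x = h * delta x b1 ->
  admissible <<[:: x; b1; v1]>> ->
  [/\ sg h - h != 0, chi (x * (sg x * sg (sg x)) * (sg h - h)) != 1,
      tr4 (h * (sg (b1 / x) - b1 / x)) = 0 &
      forall w, w \in W -> h * (sg (b1 / x) - b1 / x) <> sg (w / x) - w / x].
Proof.
move=> nd e adm; have [xW b1W d0 v1W] := nd.
have x0 : x != 0 by apply: contraNneq d0 => ->; rewrite deltaE sg0 !mul0r subrr.
have ind3 : indep3 x b1 v1.
  apply: indep3P; first exact: delta_neq0.
  by apply: contra v1W => /span2P[c [d ->]]; rewrite memvD ?memvZ.
have hD : sg (v1 / x) - v1 / x = - (h * (sg (b1 / x) - b1 / x)).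
  have B0 : sg (b1 / x) - b1 / x != 0.
    apply: contraNneq d0 => /eqP; rewrite subr_eq0 => /eqP/sg_fix[c ec].
    by rewrite -(divfK x0 b1) ec -scalerAl mul1r deltaZr deltaxx scaler0.
  have := delta_div v1 b1 x0; rewrite e mulfK // => ->.
  by rewrite mulNr divfK // opprK.
have notin w : w \in W -> sg (v1 / x) - v1 / x <> sg (w / x) - w / x.
  move=> wW e1; have [|c ec] := @sg_fix _ _ ((v1 - w) / x).
    move/eqP: e1; rewrite -subr_eq0 => /eqP e1; apply/eqP.
    by rewrite mulrBl sgB -subr_eq0 -e1; apply/eqP; ring.
  case/negP: v1W; rewrite -(subrK w v1) -(divfK x0 (v1 - w)) ec -scalerAl mul1r.
  by rewrite memvD ?memvZ.
split.
- apply/negP; rewrite subr_eq0 => /eqP/sg_fix[c ec]; apply: (notin (- c *: b1)).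
    by rewrite memvZ.
  by rewrite hD ec -!scalerAl mul1r sgZ -scalerBr scaleNr.
- apply/negP => /eqP c1; have [k kn0 sk] := exists_eps hL.
  have eE := span3_moore hL kn0 sk ind3; set m := k * _ in eE.
  have m0 : m != 0 by rewrite mulf_neq0 ?sg_eq0 // moore3_neq0.
  move: adm; rewrite eE => /admissibleP; rewrite invr_eq0 => /(_ hL m0).
  rewrite chiV /m chiM chi_eps // mul1r chi_sg.
  suff -> : chi (moore3 x b1 v1) = 1 by rewrite rmorph1 invr1 eqxx.
  set B := sg (b1 / x) - b1 / x in hD *.
  have -> : moore3 x b1 v1 = - 1 * (x * (sg x * sg (sg x)) * (sg h - h)) * B ^+ 3.+1.
    have -> : moore3 x b1 v1 = moore3 x (x * (b1 / x)) (x * (v1 / x)) by rewrite !(mulrC x) !divfK.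
    rewrite moore3_mul hD -/B deltaE sgN sgM exprS.
    have -> : B ^+ 3 = sg B by rewrite /sg hq.
    by ring.
  rewrite (chiM _ (B ^+ 4)) (chiM (-1)) c1 mulr1 -hq chi_norm // ?mulr1.
    by rewrite -(scaleN1r 1) chi_scalar // oppr_eq0 oner_eq0.
  apply: contraNneq d0 => /eqP; rewrite subr_eq0 => /eqP/sg_fix[c ec].
  by rewrite -(divfK x0 b1) ec -scalerAl mul1r deltaZr deltaxx scaler0.
- have : tr4 (- (h * (sg (b1 / x) - b1 / x))) = 0 by rewrite -hD tr4_D.
  by rewrite linearN => /eqP; rewrite oppr_eq0 => /eqP.
move=> w wW e1; apply: (notin (- w)); first by rewrite memvN.
by rewrite hD e1 mulNr sgN; ring.
Qed.

Definition evD4 (d : k81 * k81 * k81 * k81) : L * L * L := (ev d.1.1.1, ev d.1.1.2, ev d.1.2).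
Definition evP (p : k81 * k81 * k81) : L * L * L := (ev p.1.1, ev p.1.2, ev p.2).

Lemma chk_tauP d : chk_tau d -> ndataD (evD4 d) /\ ~ admissible (spanD (evD4 d)).
Proof.
case: d => [[[a c] v] s] /=; rewrite !ktrW /chk_tau.
rewrite !isk0_ev evdelta /ksq !evM => /and5P[aW cW vW d0 /and4P[s0 ta tc tv]].
have nd : ndata (ev a) (ev c) (ev v) by split.
split=> // -[_ _ adm]; have u0 : (ev s)^-1 != 0 by rewrite invr_eq0.
move: (adm _ u0) => /eqP; apply; rewrite hq.
have t0 : (ev s)^-1 ^+ 4 != 0 by rewrite expf_neq0.
apply: plane_eq; rewrite ?dim_mulW //; first by have [] := ndata_span hL nd.
have sE : (ev s)^-1 ^+ 4 = (ev s * ev s * (ev s * ev s))^-1 by rewrite exprVn; congr _^-1; ring.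
apply/span_subvP => y; rewrite !inE => /or3P[] /eqP->;
  by rewrite mem_mulW // sE invrK.
Qed.

Lemma ev3_neg (c : t3) k : c <> O3 -> tau3 (ksc c k) = tau3 k.
Proof.
by case: c k => // k _; case: k => -[] [] [] [].
Qed.

Lemma tau_choice : exists tau : L -> L * L * L, @inadm_choice F L tau /\
  forall k, tau (ev k) = evD4 (tau3 k).
Proof.
have [cd hcd] : exists cd : L -> k81, forall y, y = ev (cd y).
  by have [f hf] := boolp.choice ev_surj; exists f.
have cdK k : cd (ev k) = k by apply: ev_inj; rewrite -hcd.
exists (fun r => evD4 (tau3 (cd r))); split; last by move=> k; rewrite cdK.
split=> [r r0|r c r0 c0].
  have := allkP (cd r) chk_tau3; rewrite isk0_ev -hcd (negPf r0) => h.
  exact: chk_tauP.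
have [c' [e hc]] := ev3_scalar c.
rewrite hc (hcd r) -evsc !cdK ev3_neg // => c'0.
by case/negP: c0; move/eqP: e; rewrite c'0 scaler_eq0 oner_eq0 orbF.
Qed.

Lemma pairwise_sym (T : eqType) (R : rel T) (s : seq T) : symmetric R ->
  pairwise R s -> forall x y, x \in s -> y \in s -> x != y -> R x y.
Proof.
move=> sR; elim: s => //= z s IH /andP[/allP hz hs] x y; rewrite !inE.
move=> /orP[/eqP->|xs] /orP[/eqP->|ys] ne; first by rewrite eqxx in ne.
- exact: hz.
- by rewrite sR hz.
- exact: IH.
Qed.

Lemma span_ev_in (u v w : k81) : (ev w \in <<[:: ev u; ev v]>>%VS) = inspan u v w.
Proof. by rewrite inspanP. Qed.

Lemma good_evP p : chk_good p -> good_PA (evP p).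
Proof.
case: p => [[x r1] r2] /and3P[]; rewrite ktrW !isk0_ev evdelta => xW x0 d0.
by split=> //; apply: delta_neq0.
Qed.

Lemma chk_pairP p p' : chk_good p -> chk_good p' -> chk_pair p p' ->
  (\dim (PAD (evP p) :&: PAD (evP p')) <= 1)%N.
Proof.
move=> /good_evP g /good_evP g'.
case: p p' g g' => [[x r1] r2] [[x' s1] s2] [/= xW x0 ind] [/= x'W x'0 ind'] /=.
rewrite isk0_ev evdelta; case: eqP => [_ h|/eqP dxx h].
  apply: PA_PA => //; apply/eqP; rewrite -subv0; apply/subvP => y.
  rewrite memv_cap memv0 => /andP[/span_ev[c [d ->]]]; rewrite span_ev_in => hy.
  by have := allspanP c d h; rewrite hy isk0_ev; case: eqP.
apply: PA_PA_line => //; first exact: delta_neq0.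
rewrite leqNgt; apply/negP => hd.
have sub : (<<[:: ev r1; ev r2]>> <= <<[:: ev s1; ev s2]>>)%VS.
  have e : (<<[:: ev r1; ev r2]>> :&: <<[:: ev s1; ev s2]>>)%VS = <<[:: ev r1; ev r2]>>%VS.
    by apply/eqP; rewrite eqEdim capvSl dim_span2.
  by rewrite -e capvSr.
move: h; rewrite -!span_ev_in !(subvP sub) // memv_span // !inE ?eqxx ?orbT //.
Qed.

Lemma ps3P p : p \in ps3 -> exists x r1 r2 z, [/\ (x, r1, r2) \in base3,
  keq (ksq (ksq (ksq z))) k1 & p = (x, kmul z r1, kmul z r2)].
Proof.
case/allpairsP => -[[[x r1] r2] z] /= [hp hz ->]; exists x, r1, r2, z; split=> //.
exact: (allP chk_zs3).
Qed.

Lemma tau3_mul z k : keq (ksq (ksq (ksq z))) k1 -> tau3 (kmul z k) = tau3 k.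
Proof.
move=> /keqP h; rewrite /tau3; congr lookup3; apply: ev_inj.
have e : ev (ksq (ksq (ksq z))) = 1 by rewrite h ev1.
rewrite /ksq !evM in e *.
transitivity ((ev z * ev z * (ev z * ev z) * (ev z * ev z * (ev z * ev z))) *
   (ev k * ev k * (ev k * ev k) * (ev k * ev k * (ev k * ev k)))); first by ring.
by rewrite e mul1r.
Qed.

Lemma part2 : exists2 C, extension (calC0 L) C & #|` C| = 6977%N.
Proof.
have [tau [ht htau]] := tau_choice.
pose ps := [seq evP p | p <- ps3].
have good p : p \in ps3 -> chk_good p by move/(allP chk_good3).
have pw : pairwise (fun P Q : L * L * L => \dim (PAD P :&: PAD Q) <= 1)%N ps.
  rewrite pairwise_map; apply: (sub_in_pairwise (P := [in ps3])) chk_pair3.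
    by move=> p p' hp hp'; apply: chk_pairP; apply: good.
  by apply/allP.
have psP P : P \in ps -> exists2 p, p \in ps3 & P = evP p by move/mapP => [p hp ->]; exists p.
have sym : symmetric (fun P Q : L * L * L => \dim (PAD P :&: PAD Q) <= 1)%N.
  by move=> P Q /=; rewrite capvC.
have [||||C [hC zC _]] := extension_exists hL ht (ps := ps).
- by move=> P /psP[p hp ->]; apply/good_evP/good.
- rewrite uniq_pairwise pairwise_map; apply: (sub_in_pairwise (P := [in ps])) pw; last exact/allP.
  move=> P Q /psP[p hp ->] _ /= d1; apply: contraTneq d1 => <-.
  by have [xW x0 ind] := good_evP (good _ hp); rewrite capvv dim_PA.
- move=> P Q hP hQ ne; apply: (pairwise_sym sym pw) => //.
  by apply: contraNneq ne => ->.
- move=> P r a c v /psP[p hp ->] r0 nd hN; rewrite leqNgt; apply/negP => dI.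
  have := good _ hp; have [x [r1 [r2 [z [hB hz pE]]]]] := ps3P hp; rewrite pE => /good_evP[/= xW x0 ind].
  rewrite pE in dI; have [rin [b1 [v1 [nd1 _ sp eN hin]]]] := PA_N r0 nd xW x0 dI.
  have z0 : ev z != 0.
    apply/negP => /eqP z0; have := congr1 ev (keqP hz).
    by rewrite /ksq !evM z0 !mul0r ev1 => /eqP; rewrite eq_sym oner_eq0.
  have unz y : y \in <<[:: ev (kmul z r1); ev (kmul z r2)]>>%VS ->
      exists c' d', y = ev z * ev (kcomb r1 r2 c' d').
    case/span_ev => c' [d' ->]; exists c', d'.
    by rewrite !evD !evsc !evM; ring.
  have [c1 [d1 rE]] := unz _ rin; have [c2 [d2 yE]] := unz _ hin.
  set rk := kcomb r1 r2 c1 d1 in rE; set yk := kcomb r1 r2 c2 d2 in yE.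
  have rk0 : ~~ isk0 rk.
    by rewrite isk0_ev; apply: contraNneq r0 => h; rewrite rE h mulr0.
  have := allP chk_base3 _ hB => /= /(allspanP c1 d1); rewrite -/rk (negPf rk0).
  case tE : (tau3 rk) => [[[ta tb] tv] ts] chk.
  have hE : delta v1 (ev x) = ev (kmul yk (kinv rk)) * delta (ev x) b1.
    have [_ _ d0 _] := nd1; rewrite evM evinv //; apply: (mulfI r0).
    rewrite -[delta v1 _](divfK d0) mulrA yE rE.
    by field; rewrite -isk0_ev.
  case: hN => [adm|hN].
    rewrite -sp in adm; have [s1 s2 s3 s4] := slot_adm nd1 hE adm.
    have [_ b1W _ _] := nd1; have [bk bE] := ev_surj b1.
    have := allspanP c2 d2 chk; rewrite -/yk.
    suff -> : chk_slot x (kmul yk (kinv rk)) = false by [].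
    rewrite /chk_slot; set h := kmul yk (kinv rk) in s1 s2 s3 s4 *.
    rewrite isk0_ev evD' (negPf s1) keq_ev evchi ev1 !(evM _ (kD h)) evD'.
    rewrite (evM x) (evM (kfr x)) !evsg (negPf s2).
    apply/negP => /(allkP bk); rewrite ktrW -bE b1W isk0_ev evtr.
    have kx0 : ~~ isk0 x by rewrite isk0_ev.
    have eB y : ev (kD (kmul y (kinv x))) = sg (ev y / ev x) - ev y / ev x.
      by rewrite evD' evM evinv.
    rewrite (evM h) eB -bE s3 eqxx => /negP; apply.
    apply: allkT => w; case: ifP => // wW; rewrite keq_ev (evM h) !eB -bE.
    by apply/eqP/s4; rewrite -ktrW.
  have : (a, c, v) = evD4 (ta, tb, tv, ts).
    by rewrite hN rE -evM htau tau3_mul // tE.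
  rewrite /evD4 /= => -[aE cE vE].
  have hw : npl_basis r (ev x) b1 v1 (ev x) \in Npl r a c v.
    by rewrite eN memv_span // !inE eqxx.
  have [_ _ d0 _] := nd.
  case/(mem_Npl r _ nd): hw; rewrite mk1 // aE cE span_ev_in => xin [n /= en].
  have [n' [_ hn]] := ev3_scalar n.
  (* The summand nu = n shifts the value by a multiple of r, which stays in <r1, r2>; the check
     covers the shifted value. *)
  have [c3 [d3 e3]] : exists c3 d3, ev (ksub yk (ksc n' rk)) = ev (kcomb r1 r2 c3 d3).
    apply: span_ev; rewrite evB evsc -hn memvB ?memvZ //; apply/span2P.
      have ex (t : t3) : exists m : F, forall y : L, ev3 t * y = m *: y.
        case: t; [exists 0 | exists 1 | exists (-1)] => y /=;
        by rewrite ?mul0r ?scale0r ?mul1r ?scale1r ?mulN1r ?scaleN1r.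
      have [m1 h1] := ex c2; have [m2 h2] := ex d2; exists m1, m2.
      by rewrite /yk evD !evsc h1 h2.
    have ex (t : t3) : exists m : F, forall y : L, ev3 t * y = m *: y.
      case: t; [exists 0 | exists 1 | exists (-1)] => y /=;
      by rewrite ?mul0r ?scale0r ?mul1r ?scale1r ?mulN1r ?scaleN1r.
    have [m1 h1] := ex c1; have [m2 h2] := ex d1; exists m1, m2.
    by rewrite /rk evD !evsc h1 h2.
  have := allspanP c3 d3 chk; rewrite xin; case: ifP => // _ /negP; apply.
  rewrite keq_ev (evM (kcomb r1 r2 c3 d3)) (evM rk) !evdelta -e3 evB evsc -hn.
  rewrite -aE -cE -vE; apply/eqP; apply: (mulfI z0).
  have key : ev z * ev yk = r * (delta v (ev x) / delta a c + n%:A) by rewrite -yE en -aE -cE.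
  transitivity ((ev z * ev yk - n *: (ev z * ev rk)) * delta a c).
    by rewrite scalerAr -mulrBr mulrA.
  rewrite key -rE (mulrDr r (delta v (ev x) / delta a c)) -scalerAr mulr1 addrK -mulrA divfK // rE.
  by rewrite mulrA.
exists C => //; rewrite zC hq size_map.
by [].
Qed.

End Model.
End PartII.

(** * q = 2: points over F_16 *)

(* a + b alpha + c alpha^2 + d alpha^3 with alpha^4 = alpha + 1 *)
Inductive h16 := H4 of bool & bool & bool & bool.
Definition h0 := H4 false false false false.
Definition h1 := H4 true false false false.
Definition hal := H4 false true false false.
Definition hadd x y := let: H4 a b c d := x in let: H4 e f g h := y in
  H4 (a (+) e) (b (+) f) (c (+) g) (d (+) h).
Definition hmul x y := let: H4 a b c d := x in let: H4 e f g h := y in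
  let s4 := b && h (+) (c && g) (+) (d && f) in
  let s5 := c && h (+) (d && g) in
  let s6 := d && h in
  H4 (a && e (+) s4) (a && f (+) (b && e) (+) s4 (+) s5)
     (a && g (+) (b && f) (+) (c && e) (+) s5 (+) s6)
     (a && h (+) (b && g) (+) (c && f) (+) (d && e) (+) s6).
Definition heq x y := let: H4 a b c d := x in let: H4 e f g h := y in
  if eqb a e then if eqb b f then if eqb c g then eqb d h else false else false else false.
Definition allb (P : bool -> bool) := if P false then P true else false.
Definition allh (P : h16 -> bool) :=
  allb (fun a => allb (fun b => allb (fun c => allb (fun d => P (H4 a b c d))))).
Definition hsq x := hmul x x.
Definition htr x := let y := hsq x in let z := hsq y in hadd (hadd (hadd x y) z) (hsq z).
Definition hdelta x y := hadd (hmul x (hsq y)) (hmul (hsq x) y).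
(** The power x^14, inverse to x for x <> 0, and 0 at 0. *)
Definition hinv x := let x2 := hsq x in let x4 := hsq x2 in hmul x2 (hmul x4 (hsq x4)).
Definition hpow k := iter k (hmul hal) h1.

Lemma allbP P a : allb P -> P a.
Proof. by rewrite /allb; case: a; case: (P false). Qed.
Lemma allhP P k : allh P -> P k.
Proof. by case: k => a b c d /allbP-/(_ a)/allbP-/(_ b)/allbP-/(_ c)/allbP-/(_ d). Qed.
Lemma heq_axiom : Equality.axiom heq.
Proof.
move=> x y; apply: (iffP idP) => [|->]; last by case: y => -[] [] [] [].
by case: x y => [[] [] [] []] [[] [] [] []].
Qed.
HB.instance Definition _ := hasDecEq.Build h16 heq_axiom.

(* the point (x, y) with x = a + b alpha + c alpha^2 in W *)
Inductive pt := Pt of bool & bool & bool & h16.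
Definition px p := let: Pt a b c _ := p in H4 a b c false.
Definition py p := let: Pt _ _ _ y := p in y.
Definition padd p p' := let: Pt a b c y := p in let: Pt d e f z := p' in
  Pt (a (+) d) (b (+) e) (c (+) f) (hadd y z).
Definition p0 := Pt false false false h0.
Definition peq p p' := let: Pt a b c y := p in let: Pt d e f z := p' in
  if eqb a d then if eqb b e then if eqb c f then heq y z else false else false else false.
Definition allp (P : pt -> bool) :=
  allb (fun a => allb (fun b => allb (fun c => allh (fun y => P (Pt a b c y))))).
Lemma allpP P p : allp P -> P p.
Proof. by case: p => a b c y /allbP-/(_ a)/allbP-/(_ b)/allbP-/(_ c)/allhP-/(_ y). Qed.
Lemma peq_axiom : Equality.axiom peq.
Proof.
move=> [a b c y] [d e f z]; apply: (iffP idP) => [|[-> -> -> ->]].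
  rewrite /peq; case: (a =P d) => [->|ne]; last by case: a d ne => -[].
  case: (b =P e) => [->|ne]; last by case: b e ne => -[]; rewrite ?eqbb; case: d.
  case: (c =P f) => [->|ne]; last by case: c f ne => -[]; case: d; case: e.
  by case: heq_axiom => [->|]; case: d; case: e; case: f.
by rewrite /peq; case: heq_axiom => //; case: d; case: e; case: f.
Qed.
HB.instance Definition _ := hasDecEq.Build pt peq_axiom.
Definition is0 p := peq p p0.

Definition tri := (pt * pt * pt)%type.
Definition pts7 (t : tri) := let: (u, v, w) := t in let uv := padd u v in
  [:: u; v; uv; w; padd u w; padd v w; padd uv w].
Fixpoint inp p s := if s is p' :: s' then if peq p p' then true else inp p s' else false.
Definition okt (t : tri) := let: (u, v, w) := t in
  ~~ is0 u && ~~ inp v [:: p0; u] && ~~ inp w [:: p0; u; v; padd u v].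
Fixpoint cntp (P : pt -> bool) s := if s is p :: s' then
  if P p then (cntp P s').+1 else cntp P s' else 0%N.
Definition share t t' := let s := pts7 t' in (1 < cntp (fun p => inp p s) (pts7 t))%N.
Definition samt t t' := let: (u, v, w) := t in let s := pts7 t' in
  if inp u s then if inp v s then inp w s else false else false.

Lemma inpE p s : inp p s = (p \in s).
Proof.
elim: s => //= p' s ->; rewrite inE -[peq p p']/(p == p'); by case: (p == p').
Qed.
Lemma cntpE P s : cntp P s = count P s.
Proof. by elim: s => //= p s ->; case: (P p). Qed.
Lemma is0E p : is0 p = (p == p0). Proof. by []. Qed.
Lemma paddC p p' : padd p p' = padd p' p.
Proof.
case: p p' => [a b c [d e f g]] [a' b' c' [d' e' f' g']] /=.
by rewrite 7!(addbC _ (_ : bool)) /= addbC (addbC b) (addbC c) (addbC d) (addbC e) (addbC f) (addbC g).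
Qed.

(** * F_16 as a model of L, points of V and planes as triples of points *)

Section F16.
Variables (F : finFieldType) (L : fieldExtType F).
Hypothesis hL : \dim {:L} = 4%N.
Hypothesis hq : #|F| = 2%N.
Local Notation W := (W L).
Local Notation V := (V L).

Lemma F2_01 (c : F) : c = 0 \/ c = 1.
Proof.
have : c ^+ 2 = c by rewrite -{1}hq expf_card.
move/eqP; rewrite -subr_eq0 expr2 -{3}[c]mulr1 -mulrBr mulf_eq0 subr_eq0.
by move=> /orP[] /eqP; [left | right].
Qed.

Lemma two0 : 1 + 1 = 0 :> L.
Proof.
have [/eqP|] := F2_01 (1 + 1).
  by move/eqP => h; have := congr1 (fun c : F => c%:A : L) h; rewrite /= scalerDl scale1r scale0r.
by move/eqP; rewrite -[X in _ == X]addr0 (inj_eq (addrI _)) oner_eq0.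
Qed.

Lemma addxx (x : L) : x + x = 0.
Proof. by rewrite -[x]mul1r -mulrDl two0 mul0r. Qed.
Lemma oppx (x : L) : - x = x.
Proof. by apply/eqP; rewrite eq_sym -addr_eq0 addxx. Qed.

Lemma alpha_exists : exists a : L, a ^+ 4 = a + 1.
Proof.
have [g hg] := prim_rootL hL; rewrite hq in hg.
have g15 : g ^+ 15 = 1 by have := prim_expr_order hg.
have gn i : (0 < i < 15)%N -> g ^+ i - 1 != 0.
  move=> /andP[i0 i15]; rewrite subr_eq0 -(prim_order_dvd hg) /=.
  by apply/negP => /(dvdn_leq i0); rewrite leqNgt i15.
(* Modulo 2 the product of these four factors is (X^15 - 1)(X - 1), and g has order 15. If the
   second factor vanishes at g, then the first one vanishes at 1/g. *)
have /eqP : (g ^+ 4 + g + 1) * ((g ^+ 4 + g ^+ 3 + 1) * ((g ^+ 5 - 1) * (g ^+ 3 - 1))) = 0.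
  transitivity ((g ^+ 15 - 1) * (g - 1) +
      (1 + 1) * ((g ^+ 7 + (1 + 1) * g ^+ 4 + g) * ((g ^+ 5 - 1) * (g ^+ 3 - 1)))).
    by ring.
  by rewrite g15 two0 subrr !mul0r addr0.
have gE (x y : L) : x + y = 0 -> x = y by rewrite -{1}(oppx y) => /eqP; rewrite subr_eq0 => /eqP.
rewrite !mulf_eq0 (negPf (gn 5 isT)) (negPf (gn 3 isT)) !orbF => /orP[] /eqP e.
  by exists g; apply: gE; rewrite addrA.
exists (g ^+ 14).
have g0 : g != 0.
  by apply/negP => /eqP g0; move/eqP: g15; rewrite g0 expr0n eq_sym oner_eq0.
apply: (mulfI (expf_neq0 4 g0)); rewrite mulrDr mulr1 -exprM -!exprD.
rewrite (_ : (4 + 14 * 4 = 15 * 4)%N) // (_ : (4 + 14 = 15 + 3)%N) // exprD exprM g15 expr1n mul1r.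
by apply/esym/gE; rewrite addrAC addrC -e; ring.
Qed.

Lemma boolD a b : (a (+) b)%:R = a%:R + b%:R :> L.
Proof. by case: a; case: b; rewrite /= ?addr0 ?add0r ?two0. Qed.
Lemma boolM a b : (a && b)%:R = a%:R * b%:R :> L.
Proof. by case: a; rewrite /= ?mul1r ?mul0r. Qed.

Section Model.
Variable al : L.
Hypothesis hal4 : al ^+ 4 = al + 1.

Definition hev (k : h16) : L := let: H4 a b c d := k in
  a%:R + b%:R * al + c%:R * al ^+ 2 + d%:R * al ^+ 3.

Lemma hevD x y : hev (hadd x y) = hev x + hev y.
Proof. by case: x y => [a1 a2 a3 a4] [c1 c2 c3 c4]; rewrite /= !boolD; ring. Qed.
Lemma hevM x y : hev (hmul x y) = hev x * hev y.
Proof.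
case: x y => [a1 a2 a3 a4] [c1 c2 c3 c4]; rewrite /= !(boolD, boolM).
move: (a1%:R) (a2%:R) (a3%:R) (a4%:R) (c1%:R) (c2%:R) (c3%:R) (c4%:R).
move=> u1 u2 u3 u4 w1 w2 w3 w4.
have e5 : al ^+ 5 = al ^+ 2 + al by rewrite exprS hal4; ring.
have e6 : al ^+ 6 = al ^+ 3 + al ^+ 2 by rewrite exprS e5; ring.
transitivity (u1 * w1 + (u1 * w2 + u2 * w1) * al + (u1 * w3 + u2 * w2 + u3 * w1) * al ^+ 2 +
  (u1 * w4 + u2 * w3 + u3 * w2 + u4 * w1) * al ^+ 3 + (u2 * w4 + u3 * w3 + u4 * w2) * al ^+ 4 +
  (u3 * w4 + u4 * w3) * al ^+ 5 + u4 * w4 * al ^+ 6); last by ring.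
by rewrite e6 e5 hal4; ring.
Qed.
Lemma hev0 : hev h0 = 0. Proof. by rewrite /= !mul0r !addr0. Qed.
Lemma hev1 : hev h1 = 1. Proof. by rewrite /= !mul0r !addr0. Qed.
Lemma hev_al : hev hal = al. Proof. by rewrite /= !mul0r !addr0 add0r mul1r. Qed.

Lemma hinv_chk : allh (fun x => if heq x h0 then true else heq (hmul x (hinv x)) h1).
Proof. by vm_compute. Qed.
Lemma hmul_inv x : x != h0 -> hmul x (hinv x) = h1.
Proof.
by move=> x0; have := allhP x hinv_chk; rewrite -/(x == h0) (negPf x0) => /eqP.
Qed.
Lemma hev_eq0 x : (hev x == 0) = (x == h0).
Proof.
apply/eqP/eqP => [e|->]; last exact: hev0.
apply/eqP; apply: contrapT => /negP x0; have := hevM x (hinv x).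
by rewrite hmul_inv // e mul0r hev1 => /eqP; rewrite oner_eq0.
Qed.
Lemma hev_inj : injective hev.
Proof.
move=> x y e; have : hadd x y == h0 by rewrite -hev_eq0 hevD e addxx.
by case: x y {e} => [[] [] [] []] [[] [] [] []].
Qed.
Lemma hevV x : x != h0 -> hev (hinv x) = (hev x)^-1.
Proof.
move=> x0; have e0 : hev x != 0 by rewrite hev_eq0.
by apply: (mulfI e0); rewrite -hevM hmul_inv // hev1 divff.
Qed.

Lemma hev_surj (y : L) : exists x, y = hev x.
Proof.
pose s2 := [:: false; true].
pose sk := [seq H4 p.1.1 p.1.2 p.2.1 p.2.2 |
  p <- [seq (x, y) | x <- [seq (x, y) | x <- s2, y <- s2], y <- [seq (x, y) | x <- s2, y <- s2]]].
have skE : size sk = 16%N by [].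
pose sL : seq (finvect_type L) := map hev sk.
have uL : uniq sL by rewrite map_inj_uniq //; exact: hev_inj.
have : sL =i (finvect_type L).
  have hc : #|sL| = #|finvect_type L| by rewrite (card_uniqP uL) size_map skE card_L // hq.
  by apply/(subset_cardP hc); apply/fintype.subsetP.
by move/(_ y); rewrite [RHS]inE => /mapP[x _ ->]; exists x.
Qed.

Lemma hevsg x : hev (hsq x) = sg (hev x).
Proof. by rewrite /hsq hevM /sg hq expr2. Qed.
Lemma hevtr x : hev (htr x) = tr4 (hev x).
Proof. by rewrite /htr !hevD !hevsg tr4E. Qed.
Lemma hevdelta x y : hev (hdelta x y) = delta (hev x) (hev y).
Proof. by rewrite /hdelta hevD (hevM x) (hevM (hsq x)) !hevsg deltaE oppx. Qed.
Lemma htrW x : (hev x \in W) = (htr x == h0).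
Proof. by rewrite mem_W -hevtr hev_eq0. Qed.
Lemma pxW p : hev (px p) \in W.
Proof. by rewrite htrW; case: p => [[] [] []] y; vm_compute. Qed.

Definition pev p : V := mk (hev (px p)) (hev (py p)).

Lemma pxD p p' : px (padd p p') = hadd (px p) (px p').
Proof. by case: p p' => [a b c y] [a' b' c' y']. Qed.
Lemma pyD p p' : py (padd p p') = hadd (py p) (py p').
Proof. by case: p p' => [a b c y] [a' b' c' y']. Qed.
Lemma pevD p p' : pev (padd p p') = pev p + pev p'.
Proof. by rewrite /pev mkD pxD pyD !hevD. Qed.
Lemma pev0 : pev p0 = 0. Proof. by rewrite /pev hev0 mk00. Qed.
Lemma pev_inj : injective pev.
Proof.
move=> p p' /mk_inj[]; [exact: pxW | exact: pxW | ].
move=> /hev_inj + /hev_inj.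
by case: p p' => [a b c y] [a' b' c' y'] /= [-> -> ->] ->.
Qed.
Lemma pev_eq0 p : (pev p == 0) = (p == p0).
Proof. by rewrite -pev0 (inj_eq pev_inj). Qed.
Lemma pev_surj v : exists p, v = pev p.
Proof.
have [x ex] := hev_surj (vsval v.1); have [y ey] := hev_surj v.2.
have xW : htr x == h0 by rewrite -htrW -ex subvsP.
case: x ex xW => a b c d ex xW; exists (Pt a b c y); rewrite -[v]mkK /pev ex ey.
by case: a b c d xW ex => [] [] [] [].
Qed.
Definition spn (t : tri) : {vspace V} := let: (u, v, w) := t in
  <<[:: pev u; pev v; pev w]>>%VS.

Lemma spnP t p : (pev p \in spn t) = (p \in p0 :: pts7 t).
Proof.
case: t => [[u v] w]; apply/span3P/idP => [[c [d [e]]]|].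
  have h (x : F) : exists b : bool, forall v : V, x *: v = b%:R *: v.
    have [->|->] := F2_01 x; [by exists false | by exists true].
  have [c' hc] := h c; have [d' hd] := h d; have [e' he] := h e.
  rewrite hc hd he {h hc hd he} => h.
  have -> : p = padd (padd (if c' then u else p0) (if d' then v else p0)) (if e' then w else p0).
    apply: pev_inj; rewrite !pevD h.
    by case: c' {h}; case: d'; case: e'; rewrite /= ?scale1r ?scale0r ?pev0.
  have z1 x : padd p0 x = x by case: x => [a b f [e1 e2 e3 e4]].
  have z2 x : padd x p0 = x by rewrite paddC z1.
  by case: c' {h}; case: d'; case: e'; rewrite ?z1 ?z2 /pts7 !inE eqxx ?orbT.
rewrite /pts7 !inE -?orbA; have w1 (x : V) : x = 1 *: x by rewrite scale1r.
have w0 (x : V) : 0 = 0 *: x :> V by rewrite scale0r.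
case/or4P => [||| /or4P[||| /orP[]]] /eqP ->; rewrite ?pevD ?pev0.
- by exists 0, 0, 0; rewrite !scale0r !addr0.
- by exists 1, 0, 0; rewrite scale1r !scale0r !addr0.
- by exists 0, 1, 0; rewrite scale1r !scale0r !addr0 add0r.
- by exists 1, 1, 0; rewrite !scale1r !scale0r !addr0.
- by exists 0, 0, 1; rewrite scale1r !scale0r !add0r.
- by exists 1, 0, 1; rewrite !scale1r !scale0r !addr0.
- by exists 0, 1, 1; rewrite !scale1r !scale0r !add0r.
- by exists 1, 1, 1; rewrite !scale1r.
Qed.

Lemma okt_indep t : okt t -> indep3 (pev t.1.1) (pev t.1.2) (pev t.2).
Proof.
case: t => [[u v] w]; rewrite /okt !inpE !inE !negb_or -!andbA is0E.
case/and5P => u0 v0 vu w0 /and3P[wu wv wuv] c d e /=.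
have nz p : p != p0 -> pev p != 0 by rewrite pev_eq0.
have ne p p' : p != p' -> pev p + pev p' != 0.
  have N1 : -1 = 1 :> F.
    by have [/eqP|->] := F2_01 (-1) => //; rewrite oppr_eq0 oner_eq0.
  by rewrite -(scale1r (pev p')) -N1 scaleN1r subr_eq0 (inj_eq pev_inj).
have [->|->] := F2_01 c; have [->|->] := F2_01 d; have [->|->] := F2_01 e;
  rewrite ?scale0r ?scale1r ?add0r ?addr0 // => /eqP h; case/negP: h.
- exact/negP/nz.
- exact/negP/nz.
- by rewrite addrC; apply/negP/ne.
- exact/negP/nz.
- by rewrite addrC; apply/negP/ne.
- by rewrite addrC; apply/negP/ne.
- by rewrite addrC -pevD; apply/negP/ne.
Qed.

Lemma dim_spn t : okt t -> \dim (spn t) = 3%N.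
Proof. by case: t => [[u v] w] /okt_indep/dim_span3. Qed.

Lemma tri_of (U : {vspace V}) u v w : pev u \in U -> pev v \in U -> pev w \in U ->
  \dim U = 3%N -> okt (u, v, w) -> U = spn (u, v, w).
Proof.
move=> hu hv hw dU ok; apply/esym; apply: plane_eq => //; first exact: dim_spn.
by apply/span_subvP => x; rewrite !inE => /or3P[] /eqP ->.
Qed.

Lemma vspace_uniq (U : {vspace V}) s : (forall p, (pev p \in U) = (p \in s)) ->
  size s = (2 ^ \dim U)%N -> uniq s.
Proof.
move=> hs hz; pose T := finvect_type V.
suff : uniq [seq (pev p : T) | p <- s] by rewrite map_inj_uniq //; exact: pev_inj.
apply/card_uniqP; rewrite size_map hz -hq; transitivity #|[pred x : T | x \in U]|.
  apply: eq_card => x; rewrite !inE; have [p ->] := pev_surj x.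
  by rewrite mem_map ?hs //; exact: pev_inj.
exact: (@card_vspace F T _ (U : {vspace T})).
Qed.

Lemma dim_uniq t : \dim (spn t) = 3%N -> uniq (p0 :: pts7 t).
Proof.
move=> d3; apply: (vspace_uniq (spnP t)); rewrite d3.
by case: (t) => [[]].
Qed.

Lemma okt_uniq t : okt t -> uniq (p0 :: pts7 t).
Proof. by move/dim_spn/dim_uniq. Qed.

Lemma dim_okt t : \dim (spn t) = 3%N -> okt t.
Proof.
move/dim_uniq; case: t => [[u v] w]; rewrite /okt !inpE is0E /pts7 /= !inE !negb_or -!andbA.
do ![case/andP; let h := fresh "h" in intro h]; move=> _.
by do ![apply/andP; split]; first [assumption | rewrite eq_sym; assumption].
Qed.

Lemma tri_exists (U : {vspace V}) : \dim U = 3%N -> exists2 t, okt t & U = spn t.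
Proof.
move=> dU; have [u [v [w e]]] : exists u v w, U = <<[:: u; v; w]>>%VS.
  have := span_basis (vbasisP U); have : size (vbasis U) = 3%N by rewrite size_tuple.
  by case: (tval _) => [|u [|v [|w [|]]]] // _ <-; exists u, v, w.
have [p ep] := pev_surj u; have [p' ep'] := pev_surj v; have [p'' ep''] := pev_surj w.
have eU : U = spn (p, p', p'') by rewrite e /= -ep -ep' -ep''.
by exists (p, p', p'') => //; apply: dim_okt; rewrite -eU.
Qed.

Lemma card_spn t (U : {vspace V}) (P : pred pt) : okt t -> (forall p, (pev p \in U) = P p) ->
  (2 ^ \dim (spn t :&: U) = (count P (pts7 t)).+1)%N.
Proof.
move=> ok hP; pose T := finvect_type V.
have -> : (2 ^ \dim (spn t :&: U) = #|[pred x : T | x \in (spn t :&: U)%VS]|)%N.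
  by rewrite -hq -(@card_vspace F T _).
pose s := p0 :: pts7 t.
have P0 : P p0 by rewrite -hP pev0 mem0v.
transitivity #|[seq (pev p : T) | p <- filter P s]|.
  apply: eq_card => x; rewrite !inE memv_cap; have [p ->] := pev_surj x.
  by rewrite mem_map ?mem_filter ?spnP ?hP 1?andbC //; exact: pev_inj.
rewrite (card_uniqP _) ?map_inj_uniq ?filter_uniq ?okt_uniq //; last exact: pev_inj.
by rewrite size_map size_filter /= P0.
Qed.

Lemma shareP t t' : okt t -> okt t' -> (\dim (spn t :&: spn t') <= 1)%N = ~~ share t t'.
Proof.
move=> ok ok'; have := card_spn (P := [in p0 :: pts7 t']) ok (spnP t').
have -> : count [in p0 :: pts7 t'] (pts7 t) = count [in pts7 t'] (pts7 t).
  apply: eq_in_count => p hp; rewrite !inE; case: eqP => // e.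
  by have := okt_uniq ok; rewrite /= -e hp.
rewrite /share cntpE (eq_count (a2 := [in pts7 t'])); last by move=> p; rewrite inpE.
move: (\dim _) (count _ _) => d n; case: d => [|[|d]].
- by move=> /= [<-].
- by move=> /= [<-].
by rewrite !expnS => e; case: n e => [|[|n]] //; have := expn_gt0 2 d; lia.
Qed.

Lemma samtP t t' : okt t -> okt t' -> samt t t' -> spn t = spn t'.
Proof.
case: t => [[u v] w] ok ok'; rewrite /samt !inpE.
case hu: (u \in _) => //; case hv: (v \in _) => // hw; apply/esym.
by apply: tri_of; rewrite ?dim_spn // spnP inE ?hu ?hv ?hw orbT.
Qed.
Lemma samtE t t' : okt t -> okt t' -> samt t t' = (spn t == spn t').
Proof.
move=> ok ok'; apply/idP/eqP => [|e]; first exact: samtP.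
have h p : p \in [:: t.1.1; t.1.2; t.2] -> inp p (pts7 t').
  move=> hp; have : pev p \in spn t'.
    rewrite -e; case: t hp {ok e} => [[u v] w]; rewrite /= => hp.
    by apply: memv_span; apply: (map_f pev hp).
  rewrite inpE spnP inE => /orP[/eqP p_0|//].
  have := okt_uniq ok; case: t hp {ok e} => [[u v] w] /=; rewrite p_0 !inE !(eq_sym p0).
  by case/or3P => /eqP <-; rewrite eqxx ?orbT.
by case: t h {ok e} => [[u v] w] h; rewrite /samt !h // !inE eqxx ?orbT.
Qed.
End Model.
End F16.

(** The fourth coordinate is dropped, so this is the point (x, y) only for x in W = <1, alpha,
    alpha^2>. *)
Definition mpt x y := let: H4 a b c _ := x in Pt a b c y.
Definition c2 := [:: false; true].
Definition c16 : seq h16 := [seq H4 p.1.1 p.1.2 p.2.1 p.2.2 |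
  p <- [seq (x, y) | x <- [seq (x, y) | x <- c2, y <- c2], y <- [seq (x, y) | x <- c2, y <- c2]]].
Definition units16 := behead c16.
Definition pts127_ : seq pt := behead [seq mpt x y | x <- take 8 [seq H4 p.1 p.2.1 p.2.2 false |
  p <- [seq (x, y) | x <- c2, y <- [seq (x, y) | x <- c2, y <- c2]]], y <- c16].

Definition hal2 := hmul hal hal.
Definition hgr a0 a1 x := hadd (hmul a0 x) (hmul a1 (hsq x)).
Definition gtri a0 a1 : tri :=
  (mpt h1 (hgr a0 a1 h1), mpt hal (hgr a0 a1 hal), mpt hal2 (hgr a0 a1 hal2)).
Definition ntri r (d : h16 * h16 * h16) : tri := let: (a, b, v) := d in
  let i := hmul r (hinv (hdelta a b)) in
  (mpt a (hmul (hdelta v a) i), mpt b (hmul (hdelta v b) i), mpt h0 r).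
Definition atri x r1 r2 : tri := (mpt x h0, mpt h0 r1, mpt h0 r2).
Definition is0h x := heq x h0.
(** For q = 2 a graph is removed when a1 <> 0 and a0 / a1 has trace 1. Graphs with a1 = 0 are kept,
    in accordance with [hinv h0 = h0]. *)
Definition rcond a0 a1 := is0h (htr (hmul a0 (hinv a1))).
Definition L0l_ := [seq p <- [seq (a0, a1) | a0 <- c16, a1 <- c16] | rcond p.1 p.2].
Definition hpow3 i j k (m : nat) := (hpow (i * m), hpow (j * m), hpow (k * m)).
(* the q^3 + q = 10 admissible planes <a, b, v> up to scaling *)
Definition adl_ := [seq hpow3 1 2 3 m | m <- [:: 1; 2; 4; 8]%N] ++
  [seq hpow3 0 1 3 m | m <- [:: 1; 2; 4; 8]%N] ++ [seq hpow3 0 5 9 m | m <- [:: 1; 2]%N].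
Definition L0t_ := [seq gtri p.1 p.2 | p <- L0l_].
Definition N0t_ := [seq ntri r d | d <- adl_, r <- units16].
Definition C0t_ := L0t_ ++ N0t_.
Definition hmoore x y z :=
  hadd (hadd (hmul x (hdelta (hsq y) (hsq z))) (hmul y (hdelta (hsq x) (hsq z))))
       (hmul z (hdelta (hsq x) (hsq y))).
(** This is chi, whose exponent is 5 for q = 2. *)
Definition hp5 x := hmul x (hsq (hsq x)).
Definition chk_adl (d : h16 * h16 * h16) := let: (a, b, v) := d in
  [&& is0h (htr a), is0h (htr b), ~~ is0h (htr v), ~~ is0h (hdelta a b) & ~~ heq (hp5 (hmoore a b v)) h1].
(* has, all and pairwise written with "if": vm_compute is eager in the arguments of && and ||. *)
Fixpoint hasf T (P : T -> bool) s := if s is x :: s' then if P x then true else hasf P s' else false.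
Fixpoint allf T (P : T -> bool) s := if s is x :: s' then if P x then allf P s' else false else true.
Fixpoint pwf T (R : T -> T -> bool) s := if s is x :: s' then if allf (R x) s' then pwf R s' else false else true.

Lemma chk_adlT_ : allf chk_adl adl_. Proof. by vm_compute. Qed.
Lemma C0t_size : size C0t_ = 286%N. Proof. by vm_compute. Qed.
Lemma C0t_ok_ : allf okt C0t_. Proof. by vm_compute. Qed.
Lemma C0t_pw_ : pwf (fun t t' => ~~ samt t t') C0t_. Proof. by vm_compute. Qed.

(** * q = 2: the planes compatible with C0 *)

(* Labels for the 170 planes meeting every member of C0 in at most a point: LS, LA, LB meet S in
   a line, LT lies in S, and LN r k is a plane r N(Z, g) over a point r of S. *)
Inductive lab := LS of nat | LT of nat | LA of nat & nat | LB of nat & nat | LN of nat & nat.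
Definition leqb l l' := match l, l' with
  | LS s, LS s' | LT s, LT s' => eqn s s'
  | LA s c, LA s' c' | LB s c, LB s' c' | LN s c, LN s' c' => if eqn s s' then eqn c c' else false
  | _, _ => false end.
Lemma leqb_axiom : Equality.axiom leqb.
Proof.
move=> l l'; apply: (iffP idP) => [|<-]; last by case: l => *; rewrite /= ?eqnE ?eqxx.
have e2 s c s' c' : (if eqn s s' then eqn c c' else false) -> s = s' /\ c = c'.
  by case: eqnP => // -> /eqnP.
case: l l' => [s|s|s c|s c|s c] [s'|s'|s' c'|s' c'|s' c'] //=;
  by [move/eqnP -> | move/e2 => [-> ->]].
Qed.
HB.instance Definition _ := hasDecEq.Build lab leqb_axiom.

Definition xcol c := nth 0%N [:: 10; 1; 4]%N c.
(** The points of <alpha^s, alpha^(s+1)> are alpha^s, alpha^(s+1), alpha^(s+4). A plane [LA s c]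
    conflicts with planes [LN r k] over just one of them, alpha^(s + off c), and there for the two k
    in its mask. *)
Definition off c := nth 0%N [:: 0; 1; 4]%N c.
Definition maskA c := nth [::] [:: [:: 1; 3]; [:: 1; 2]; [:: 0; 3]]%N c.
Definition maskB c := nth [::] [:: [:: 0; 2]; [:: 2; 3]; [:: 0; 1]]%N c.
(** The differences of 0, 1, 4 modulo 15: two lines <alpha^s, alpha^(s+1)> with different s meet
    exactly when their indices differ by one of these. *)
Definition dist := [:: 1; 3; 4; 11; 12; 14]%N.
(** [LS s] is <1> times alpha^s F_4, and [LB s c] is the image of [LA s c] under the Frobenius map.
    The planes E of [LN r k] are the four inadmissible ones other than W, conjugate under the
    Frobenius map. *)
Definition ltri l : tri := match l with
  | LS s => atri h1 (hpow s) (hpow (s + 5))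
  | LT r => (mpt h0 (hpow r), mpt h0 (hpow r.+1), mpt h0 (hpow r.+2))
  | LA s c => atri (hpow (xcol c)) (hpow s) (hpow s.+1)
  | LB s c => atri (hpow (xcol c).*2) (hpow s.*2) (hpow s.+1.*2)
  | LN r k => ntri (hpow r) (hpow3 4 8 3 (2 ^ k))
  end.
Definition i15 := iota 0 15.
Definition labs_ := [seq LS s | s <- iota 0 5] ++ [seq LT r | r <- i15] ++
  [seq LA s c | s <- i15, c <- iota 0 3] ++ [seq LB s c | s <- i15, c <- iota 0 3] ++
  [seq LN r k | r <- i15, k <- iota 0 4].
Definition m15 n := (n %% 15)%N.
Fixpoint inn (n : nat) s := if s is m :: s' then if eqn n m then true else inn n s' else false.
(** The three lines <alpha^s, alpha^(s+1)> in the plane [LT r]; the last comes from alpha^(r+4) =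
    alpha^r + alpha^(r+1). For [LB] the index is halved, 8 being the inverse of 2 modulo 15. *)
Definition onT (r s : nat) := inn s [:: m15 r; m15 (r + 1); m15 (r + 4)].
Definition conf l l' := match l, l' with
  | LS s, LT r | LT r, LS s => eqn s (r %% 5)
  | LT r, LT r' => true
  | LT r, LA s _ | LA s _, LT r => onT r s
  | LT r, LB s _ | LB s _, LT r => onT (8 * r) s
  | LA s c, LA s' c' | LB s c, LB s' c' =>
      if eqn s s' then true else if eqn c c' then inn (m15 (s + 15 - s')) dist else false
  | LA s c, LN r k | LN r k, LA s c => if eqn r (m15 (s + off c)) then inn k (maskA c) else false
  | LB s c, LN r k | LN r k, LB s c => if eqn r (m15 ((s + off c).*2)) then inn k (maskB c) else false
  | LN r k, LN r' k' => eqn r r'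
  | _, _ => false end.

Definition labp_ := [seq (l, pts7 (ltri l)) | l <- labs_].
Definition sharep s s' := (1 < cntp (fun p => inp p s') s)%N.
Definition C0p_ := [seq pts7 t | t <- C0t_].
(** The points q for which no member of C0 contains the line through p and q. A plane is compatible
    with C0 exactly when all pairs of its points are free in this sense. *)
Definition frees_ p := let cs := [seq s <- C0p_ | inp p s] in
  [seq q <- pts127_ | if peq q p then false else ~~ hasf (inp q) cs].
Definition row := (pt * (seq pt * seq (lab * seq pt)))%type.
Definition tabl_ : seq row := [seq (p, (frees_ p, [seq l <- labp_ | inp p l.2])) | p <- pts127_].
Fixpoint look (p : pt) (t : seq row) := if t is (p', r) :: t' then if peq p p' then r else look p t'
  else ([::], [::]).

Lemma ltri_ok_ : allf (fun l => okt (ltri l)) labs_. Proof. by vm_compute. Qed.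
Lemma conf_chk : allf (fun l : lab * seq pt => allf (fun l' : lab * seq pt =>
  if leqb l.1 l'.1 then true else eqb (sharep l.2 l'.2) (conf l.1 l'.1)) labp_) labp_.
Proof. by vm_compute. Qed.
Definition chk_free (T : seq row) := allf (fun l : lab * seq pt => allf (fun p => let f := (look p T).1 in
  allf (fun q => if peq p q then true else inp q f) l.2) l.2) labp_.
Lemma free_chk : chk_free tabl_.
Proof. by vm_compute. Qed.
(** Completeness of the labels: already some of the 21 pairs of points of a plane <p, q, r> being
    free forces the plane to be a labelled one. *)
Definition chk_cls (T : seq row) := allf (fun pr : row => let: (p, (fs, ls)) := pr in
  allf (fun q => let fq := (look q T).1 in let pq := padd p q in let fpq := (look pq T).1 in
  allf (fun r => if inp r fq then if inp r fpq then if inp (padd p r) fq then if inp pq (look (padd p r) T).1 then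
     hasf (fun l : lab * seq pt => if inp q l.2 then inp r l.2 else false) ls
     else true else true else true else true) fs) fs) T.
Lemma cls_chk : chk_cls tabl_.
Proof. by vm_compute. Qed.

Definition isA p := heq (px p) h1.
(* From every slot in sl, no label can be chosen such that the choices conflict neither with
   cur nor with each other. *)
Fixpoint nocov (sl : seq (seq lab)) (cur : seq lab) : bool := if sl is s :: sl' then
  if hasf (fun l => hasf (leqb l) cur) s then nocov sl' cur else
  allf (fun l => if hasf (conf l) cur then true else nocov sl' (l :: cur)) s else false.
Definition slots (T : seq row) (pr : row) : seq (seq lab) := let: (p, (fs, ls)) := pr in
  [seq [seq l.1 | l <- ls & inp q l.2] | q <- fs].
(** At a point not of the form (1, y), no pairwise compatible set of labelled planes covers all the
    free points, so no extension joins this point to all others. *)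
Definition chk_nf (T : seq row) := allf (fun pr : row => if isA pr.1 then true else nocov (slots T pr) [::]) T.
Lemma nf_chk : chk_nf tabl_.
Proof. by vm_compute. Qed.
Definition isS l := if l is LS _ then true else false.
(** The planes [LS], which every maximal extension contains, already cover the points that are free
    at (1, y). *)
Lemma A_chk : allf (fun pr : row => if isA pr.1 then
  allf (fun q => hasf (fun l : lab * seq pt => if isS l.1 then inp q l.2 else false) pr.2.2) pr.2.1 else true) tabl_.
Proof. by vm_compute. Qed.

Lemma hasfE T (P : T -> bool) s : hasf P s = has P s.
Proof. by elim: s => //= x s ->. Qed.
Lemma allfE T (P : T -> bool) s : allf P s = all P s.
Proof. by elim: s => //= x s ->. Qed.
Lemma pwfE T (R : T -> T -> bool) s : pwf R s = pairwise R s.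
Proof. by elim: s => //= x s ->; rewrite allfE. Qed.
Lemma innE n s : inn n s = (n \in s).
Proof. by elim: s => //= m s ->; rewrite inE eqnE; case: eqP. Qed.
Lemma mem_c16 x : x \in c16.
Proof. by case: x => [] [] [] [] []. Qed.

(* The lists are sealed, since conversion would try to enumerate them. *)
Fact L0l_key : {s | s = L0l_}. Proof. by exists L0l_. Qed.
Definition L0l := sval L0l_key.
Fact adl_key : {s | s = adl_}. Proof. by exists adl_. Qed.
Definition adl := sval adl_key.
Definition L0t := [seq gtri p.1 p.2 | p <- L0l].
Definition C0t := L0t ++ [seq ntri r d | d <- adl, r <- units16].
Fact C0tE : C0t = C0t_.
Proof. by rewrite /C0t /L0t /L0l /adl (svalP L0l_key) (svalP adl_key). Qed.
Fact C0t_ok : all okt C0t. Proof. by rewrite C0tE -allfE; exact: C0t_ok_. Qed.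
Fact C0t_pw : pairwise (fun t t' => ~~ samt t t') C0t.
Proof. by rewrite C0tE -pwfE; exact: C0t_pw_. Qed.
Fact chk_adlT : all chk_adl adl.
Proof. by rewrite /adl (svalP adl_key) -allfE; exact: chk_adlT_. Qed.
Lemma mem_L0l p : (p \in L0l) = rcond p.1 p.2.
Proof.
rewrite /L0l (svalP L0l_key) mem_filter andbC; case: p => a b.
by rewrite (allpairs_f (fun x y => (x, y))) ?mem_c16.
Qed.

Section Semantics.
Variables (F : finFieldType) (L : fieldExtType F).
Hypothesis hL : \dim {:L} = 4%N.
Hypothesis hq : #|F| = 2%N.
Local Notation W := (W L).
Variable al : L.
Hypothesis hal4 : al ^+ 4 = al + 1.
Local Notation hev := (hev al).
Local Notation pev := (pev al).
Local Notation spn := (spn al).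

Lemma pev_mpt x y : htr x = h0 -> pev (mpt x y) = mk (hev x) (hev y).
Proof. by case: x => [] [] [] [] []. Qed.

Lemma hevgr a0 a1 x : hev (hgr a0 a1 x) = hev a0 * hev x + hev a1 * sg (hev x).
Proof. by rewrite /hgr hevD // (hevM hq hal4 a0) (hevM hq hal4 a1) hevsg. Qed.

Lemma hev_indep : indep3 (hev h1) (hev hal) (hev hal2).
Proof.
move=> c d e; have [c' ->] : exists b : bool, c = b%:R.
  by have [->|->] := F2_01 hq c; [exists false | exists true].
have [d' ->] : exists b : bool, d = b%:R.
  by have [->|->] := F2_01 hq d; [exists false | exists true].
have [e' ->] : exists b : bool, e = b%:R.
  by have [->|->] := F2_01 hq e; [exists false | exists true].
have h (b : bool) (x : h16) : b%:R *: hev x = hev (if b then x else h0).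
  by case: b; rewrite ?scale1r ?scale0r ?hev0.
rewrite !h -!hevD // => /eqP; rewrite hev_eq0 //.
by case: c'; case: d'; case: e'.
Qed.

Lemma gtriE a0 a1 : spn (gtri a0 a1) = PG (hev a0) (hev a1).
Proof.
have hW x : htr x = h0 -> hev x \in W by move=> e; rewrite htrW // e.
rewrite (PG_span hL _ _ (hW h1 erefl) (hW hal erefl) (hW hal2 erefl) hev_indep).
rewrite /(spn _) /gtri !pev_mpt // !hevgr //.
Qed.

Lemma ntriE r d : chk_adl d ->
  [/\ ndata (hev d.1.1) (hev d.1.2) (hev d.2), admissible <<[:: hev d.1.1; hev d.1.2; hev d.2]>> &
  spn (ntri r d) = Npl (hev r) (hev d.1.1) (hev d.1.2) (hev d.2)].
Proof.
case: d => [[a b] v] /and5P[/eqP ta /eqP tb tv d0 m5].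
have is0 x : is0h x = (hev x == 0) by rewrite hev_eq0.
have nd : ndata (hev a) (hev b) (hev v).
  split; first by rewrite htrW // ta.
  - by rewrite htrW // tb.
  - by rewrite -hevdelta // hev_eq0.
  by rewrite htrW.
split=> //; last first.
  rewrite /(spn _) /ntri pev_mpt // pev_mpt // pev_mpt // /Npl /npl_basis hev0.
  rewrite (hevM hq hal4 (hdelta v a)) (hevM hq hal4 (hdelta v b)) (hevM hq hal4 r) (hevV hq hal4) //.
  by rewrite !hevdelta // !(mulrCA (hev r)).
have [xW b1W dn v1W] := nd.
have ind3 : indep3 (hev a) (hev b) (hev v).
  apply: indep3P; first exact: delta_neq0.
  by apply: contra v1W => /span2P[c [d ->]]; rewrite memvD ?memvZ.
rewrite (span3_moore hL (oner_neq0 L) _ ind3); last by rewrite rmorph1 (oppx hq).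
have m0 : moore3 (hev a) (hev b) (hev v) != 0 by exact: moore3_neq0.
rewrite mul1r; apply/admissibleP => //; first by rewrite invr_eq0 sg_eq0.
rewrite chiV chi_sg invr_eq1 -(rmorph1 (@sg F L)) (inj_eq (fmorph_inj _)).
have <- : hev (hmoore a b v) = moore3 (hev a) (hev b) (hev v).
  rewrite /hmoore !hevD // (hevM hq hal4 a) (hevM hq hal4 b) (hevM hq hal4 v) !hevdelta // !hevsg //.
  by rewrite /moore3 (oppx hq).
have -> : chi (hev (hmoore a b v)) = hev (hp5 (hmoore a b v)).
  by rewrite /hp5 (hevM hq hal4 (hmoore a b v)) !hevsg // /chi hq /sg hq -exprM -exprS.
by rewrite -(hev1 al) (inj_eq (hev_inj hq hal4)).
Qed.

Lemma rcondP a0 a1 : rcond a0 a1 <-> ~ rem_coef (hev a0) (hev a1).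
Proof.
have tr01 (x : L) : tr4 x = 0 \/ tr4 x = 1.
  have [c ->] := tr4_scalar hL x.
  by have [->|->] := F2_01 hq c; [left; rewrite scale0r | right; rewrite scale1r].
have -> : rcond a0 a1 = (tr4 (hev a0 / hev a1) == 0).
  rewrite /rcond /is0h -/(_ == _) -(hev_eq0 hq hal4) hevtr // hevM //.
  have [->|a1n] := eqVneq a1 h0; last by rewrite hevV.
  by rewrite (_ : hinv h0 = h0) // !hev0 invr0.
split=> [/eqP t0 /(rem_coefP hL)[[r u] /= [r0 tu [e0 e1]]]|nr].
  move/eqP: t0; rewrite e0 e1 hq expr1 -mulrN mulrAC divff // mul1r linearN /= tu.
  by rewrite oppr_eq0 oner_eq0.
have [/eqP //|t1] := tr01 (hev a0 / hev a1).
have a10 : hev a1 != 0.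
  by apply/eqP => z; move/eqP: t1; rewrite z invr0 mulr0 linear0 eq_sym oner_eq0.
case: nr; apply/(rem_coefP hL); exists (hev a1, hev a0 / hev a1); split=> //=.
by rewrite hq expr1 mulrC divfK // (oppx hq).
Qed.

Lemma L0tP U : calL0 U <-> exists2 t, t \in L0t & U = spn t.
Proof.
split=> [/(calL0P hL)[x [y [-> nr]]]|[t /mapP[[a0 a1]]]].
  have [a0 e0] := hev_surj hL hq hal4 x; have [a1 e1] := hev_surj hL hq hal4 y.
  rewrite e0 e1 in nr *; exists (gtri a0 a1); last by rewrite gtriE.
  apply: (map_f (fun p : h16 * h16 => gtri p.1 p.2) (x := (a0, a1))).
  by rewrite mem_L0l; exact/rcondP.
rewrite mem_L0l => /rcondP nr -> ->; apply/(calL0P hL).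
by exists (hev a0), (hev a1); rewrite gtriE.
Qed.

Lemma units16_neq0 r : r \in units16 -> hev r != 0.
Proof.
by rewrite hev_eq0 //; case: r => [] [] [] [] [].
Qed.

Lemma C0t_sub t : t \in C0t -> calC0 L (spn t).
Proof.
rewrite mem_cat => /orP[ht|ht]; apply/(calC0P hL); first by left; apply/L0tP; exists t.
case/allpairsP: ht => -[d r] /= [hd hr ->]; right.
have h := allP chk_adlT _ hd; have [nd adm ->] := ntriE r h.
by exists (hev r), (hev d.1.1), (hev d.1.2), (hev d.2); split=> //; exact: units16_neq0.
Qed.

Lemma C0t_okt t : t \in C0t -> okt t.
Proof. exact: (allP C0t_ok). Qed.

Lemma C0t_uniq : uniq (map spn C0t).
Proof.
have := C0t_okt; have := C0t_pw.
move: C0t => s pw ok; rewrite uniq_pairwise pairwise_map.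
apply: (sub_in_pairwise (P := [in s])) pw; last exact/allP.
by move=> t t' ht ht' /=; rewrite (samtE hL hq hal4) ?ok.
Qed.

(** Only one inclusion is proved directly; the other follows because both sides have 286 members.
    Hence the completeness of the list [adl] is never checked. *)
Lemma C0tP U : calC0 L U <-> U \in map spn C0t.
Proof.
split=> [h|/mapP[t ht ->]]; last exact: C0t_sub.
have [s [us zs hs]] := C0_seq hL.
have sub : {subset map spn C0t <= s} by move=> _ /mapP[t ht ->]; apply/hs/C0t_sub.
have [|_ e] := uniq_min_size C0t_uniq sub; first by rewrite zs hq size_map C0tE C0t_size.
by rewrite e; apply/hs.
Qed.

End Semantics.

Fact labs_key : {s | s = labs_}. Proof. by exists labs_. Qed.
Definition labs := sval labs_key.
Fact labsE : labs = labs_. Proof. exact: svalP labs_key. Qed.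
Fact pts127_key : {s | s = pts127_}. Proof. by exists pts127_. Qed.
Definition pts127 := sval pts127_key.
Fact pts127E : pts127 = pts127_. Proof. exact: svalP pts127_key. Qed.

Lemma mem_pts127 p : (p \in pts127) = (p != p0).
Proof. by rewrite pts127E; case: p => [] [] [] [] [] [] [] [] []. Qed.

Definition labp := [seq (l, pts7 (ltri l)) | l <- labs].
Definition frees p := let cs := [seq s <- [seq pts7 t | t <- C0t] | inp p s] in
  [seq q <- pts127 | if peq q p then false else ~~ hasf (inp q) cs].
Definition lthru p := [seq l <- labp | inp p l.2].
Definition tabl := [seq (p, (frees p, lthru p)) | p <- pts127].

Lemma tablE : tabl = tabl_.
Proof.
rewrite /tabl /tabl_ pts127E; apply: eq_map => p.
by rewrite /frees /lthru /labp labsE pts127E C0tE.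
Qed.
Lemma labpE : labp = labp_. Proof. by rewrite /labp labsE. Qed.

Lemma ltri_uniq_chk : pwf (fun l l' => ~~ samt (ltri l) (ltri l')) labs_.
Proof. by vm_compute. Qed.

Lemma peqE p q : peq p q = (p == q). Proof. by []. Qed.
Lemma leqbE l l' : leqb l l' = (l == l'). Proof. by []. Qed.

Lemma look_map (f : pt -> seq pt * seq (lab * seq pt)) p (s : seq pt) : p \in s ->
  look p [seq (p', f p') | p' <- s] = f p.
Proof.
elim: s => //= p' s IH; rewrite inE peqE.
by case: eqP => [->|_] //=; exact: IH.
Qed.

Lemma look_tabl p : p != p0 -> look p tabl = (frees p, lthru p).
Proof. by rewrite -mem_pts127 => h; exact: (look_map (fun p => (frees p, lthru p))). Qed.

Lemma tabl_row p : p != p0 -> (p, (frees p, lthru p)) \in tabl.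
Proof. by rewrite -mem_pts127 => h; exact: (map_f (fun p => (p, (frees p, lthru p)))). Qed.

Lemma freesP p q : q \in frees p <-> [/\ q != p0, q != p &
  forall t, t \in C0t -> p \in pts7 t -> q \notin pts7 t].
Proof.
rewrite mem_filter mem_pts127 peqE hasfE; case: (q == p); first by split=> // -[].
split=> [/andP[/hasPn h q0]|[q0 _ h]].
  by split=> // t ht pt; rewrite -inpE; apply: h; rewrite mem_filter inpE pt; apply: map_f.
rewrite q0 andbT; apply/hasPn => s; rewrite mem_filter inpE => /andP[ps /mapP[t ht e]].
by rewrite e inpE in ps *; apply: h.
Qed.

(** * Extensions as sets of pairwise compatible labels *)

Section Labels.
Variables (F : finFieldType) (L : fieldExtType F).
Hypothesis hL : \dim {:L} = 4%N.
Hypothesis hq : #|F| = 2%N.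
Local Notation V := (V L).
Variable al : L.
Hypothesis hal4 : al ^+ 4 = al + 1.
Local Notation pev := (pev al).
Local Notation spn := (spn al).
Definition lspn l := spn (ltri l).

Lemma line_dim (U : {vspace V}) a b : a != p0 -> b != p0 -> a != b ->
  pev a \in U -> pev b \in U -> (1 < \dim U)%N.
Proof.
move=> a0 b0 ab aU bU; apply: dim_ge2 aU bU _; apply: indep2P.
  by rewrite pev_eq0.
apply/negP => /vlineP[c]; have [->|->] := F2_01 hq c; rewrite ?scale0r ?scale1r.
  by move/eqP; rewrite pev_eq0 // (negPf b0).
by move/(pev_inj hq hal4) => e; rewrite e eqxx in ab.
Qed.

Lemma ok_labs l : l \in labs -> okt (ltri l).
Proof. by have := ltri_ok_; rewrite -labsE allfE => /allP; apply. Qed.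

Lemma spn_pts7 t p : p \in pts7 t -> pev p \in spn t.
Proof. by rewrite spnP // inE => ->; rewrite orbT. Qed.

Lemma pts7_neq0 t p : okt t -> p \in pts7 t -> p != p0.
Proof.
move=> /(okt_uniq hL hq hal4) /= /andP[n0 _] hp; by apply: contraNneq n0 => <-.
Qed.

Lemma labp_mem l s : (l, s) \in labp <-> l \in labs /\ s = pts7 (ltri l).
Proof.
split=> [/mapP[l' hl' [-> ->]] //|[hl ->]].
exact: (map_f (fun l => (l, pts7 (ltri l))) hl).
Qed.

Lemma conf_dim l l' : l \in labs -> l' \in labs -> l != l' ->
  (\dim (lspn l :&: lspn l') <= 1)%N = ~~ conf l l'.
Proof.
move=> hl hl' ne; rewrite /lspn (shareP hL hq hal4) ?ok_labs //.
have h1 : (l, pts7 (ltri l)) \in labp by apply/labp_mem.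
have h2 : (l', pts7 (ltri l')) \in labp by apply/labp_mem.
have := conf_chk; rewrite -labpE allfE => /allP/(_ _ h1); rewrite allfE => /allP/(_ _ h2) /=.
by rewrite leqbE (negPf ne) => /eqP <-.
Qed.

Lemma free_dim l U : l \in labs -> calC0 L U -> (\dim (U :&: lspn l) <= 1)%N.
Proof.
move=> hl /(C0tP hL hq hal4) /mapP[t ht ->]; rewrite leqNgt; apply/negP => d.
have ok := C0t_okt ht; have okl := ok_labs hl.
move: d; rewrite ltnNge /lspn (shareP hL hq hal4) // negbK /share cntpE -size_filter.
case E : (filter _ _) => [|a [|b s]] // _.
have fP x : x \in [:: a, b & s] -> x \in pts7 t /\ x \in pts7 (ltri l).
  by rewrite -E mem_filter inpE => /andP[].
have [at_ al_] := fP a (mem_head _ _); have [bt bl] : b \in pts7 t /\ b \in pts7 (ltri l).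
  by apply: fP; rewrite !inE eqxx orbT.
have ab : a != b.
  have : uniq [:: a, b & s].
    by rewrite -E filter_uniq //; have := okt_uniq hL hq hal4 ok => /= /andP[].
  by rewrite /= inE negb_or => /andP[/andP[]].
have h1 : (l, pts7 (ltri l)) \in labp by apply/labp_mem.
have := free_chk; rewrite -tablE /chk_free -labpE allfE => /allP/(_ _ h1) /=.
rewrite allfE => /allP/(_ _ al_); rewrite allfE => /allP/(_ _ bl).
rewrite peqE (negPf ab) look_tabl ?(pts7_neq0 okl al_) //= inpE.
by move/freesP => [_ _ /(_ _ ht at_)]; rewrite bt.
Qed.

Lemma lspn_inj l l' : l \in labs -> l' \in labs -> lspn l = lspn l' -> l = l'.
Proof.
move=> hl hl' e; have pw : pairwise (fun l l' => ~~ samt (ltri l) (ltri l')) labs.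
  by rewrite -pwfE labsE; exact: ltri_uniq_chk.
apply/eqP; apply: contrapT => /negP ne.
have sym : symmetric (fun l l' => ~~ (lspn l == lspn l')) by move=> ? ?; rewrite eq_sym.
have pw' : pairwise (fun l l' => ~~ (lspn l == lspn l')) labs.
  apply: (sub_in_pairwise (P := [in labs])) pw; last exact/allP.
  by move=> x y hx hy /=; rewrite (samtE hL hq hal4) ?ok_labs.
move: hl hl' pw'; move: labs => s hl hl'; elim: s hl hl' => //= z s IH.
rewrite !inE => /orP[/eqP lz|hl] /orP[/eqP l'z|hl'] /andP[/allP hz hs].
- by rewrite lz l'z eqxx in ne.
- by have := hz _ hl'; rewrite -lz e eqxx.
- by have := hz _ hl; rewrite -l'z e eqxx.
- exact: IH.
Qed.

Lemma lspn_dim l : l \in labs -> \dim (lspn l) = 3%N.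
Proof. by move=> hl; apply: dim_spn => //; exact: ok_labs. Qed.

Lemma lspn_notC0 l : l \in labs -> ~ calC0 L (lspn l).
Proof. by move=> hl /(free_dim hl); rewrite capvv lspn_dim. Qed.

Lemma cls (C : code V) U : extension (calC0 L) C -> U \in C -> ~ calC0 L U ->
  exists2 l, l \in labs & U = lspn l.
Proof.
move=> [[dC pC] sC] hU nU; have [t ok eU] := tri_exists hL hq hal4 (dC _ hU).
(* A member of C0 through two points of U would share a line with U. *)
have fr a b : a \in pts7 t -> b \in pts7 t -> a != b -> inp b (frees a).
  move=> ha hb ab; rewrite inpE; apply/freesP; split; first exact: (pts7_neq0 ok).
    by rewrite eq_sym.
  move=> t' ht' a'; apply/negP => b'.
  have ht'C : spn t' \in C by apply: sC; apply/(C0tP hL hq hal4)/map_f.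
  have ne : U != spn t'.
    by apply/eqP => e; apply: nU; rewrite e; apply/(C0tP hL hq hal4)/map_f.
  have := pC _ _ hU ht'C ne; rewrite leqNgt => /negP; apply.
  apply: (line_dim (pts7_neq0 ok ha) (pts7_neq0 ok hb) ab);
    by rewrite memv_cap eU !spn_pts7.
case: t ok eU fr => [[p q] r] ok eU fr.
have p_0 : p != p0 by apply: (pts7_neq0 ok); rewrite !inE eqxx.
have := cls_chk; rewrite -tablE /chk_cls allfE => /allP/(_ _ (tabl_row p_0)) /=.
have un : uniq (pts7 (p, q, r)) by have := okt_uniq hL hq hal4 ok => /= /andP[].
have m1 : p \in pts7 (p, q, r) by rewrite !inE eqxx ?orbT.
have m2 : q \in pts7 (p, q, r) by rewrite !inE eqxx ?orbT.
have m3 : padd p q \in pts7 (p, q, r) by rewrite !inE eqxx ?orbT.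
have m4 : r \in pts7 (p, q, r) by rewrite !inE eqxx ?orbT.
have m5 : padd p r \in pts7 (p, q, r) by rewrite !inE eqxx ?orbT.
have ne (i j : nat) (x y : pt) : (i < 7)%N -> (j < 7)%N -> i != j ->
    nth p0 (pts7 (p, q, r)) i = x -> nth p0 (pts7 (p, q, r)) j = y -> x != y.
  by move=> i7 j7 ij <- <-; rewrite nth_uniq.
have n1 : p != q := ne 0%N 1%N _ _ isT isT isT erefl erefl.
have n2 : p != r := ne 0%N 3%N _ _ isT isT isT erefl erefl.
have n3 : q != r := ne 1%N 3%N _ _ isT isT isT erefl erefl.
have n4 : padd p q != r := ne 2%N 3%N _ _ isT isT isT erefl erefl.
have n5 : q != padd p r := ne 1%N 4%N _ _ isT isT isT erefl erefl.
have n6 : padd p r != padd p q := ne 4%N 2%N _ _ isT isT isT erefl erefl.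
rewrite allfE => /allP/(_ q); rewrite -inpE fr // => /(_ isT).
rewrite allfE => /allP/(_ r); rewrite -inpE fr // => /(_ isT).
rewrite !look_tabl ?(pts7_neq0 ok) //= !fr //.
rewrite hasfE => /hasP[[l s]]; rewrite mem_filter /= => /andP[ps /labp_mem[hl es]].
case hq' : (inp q s) => // hr'; exists l => //; rewrite eU; apply/esym.
rewrite es !inpE in ps hq' hr'.
by apply: tri_of => //; rewrite ?spn_pts7 // lspn_dim.
Qed.

Definition indepl (s : seq lab) := forall l l', l \in s -> l' \in s -> l != l' -> ~~ conf l l'.
Definition codeOf (s : seq lab) : code V := seq_fset tt ([seq spn t | t <- C0t] ++ [seq lspn l | l <- s]).
Definition labsOf (C : code V) := [seq l <- labs | lspn l \in C].

Lemma mem_codeOf s U : U \in codeOf s <-> calC0 L U \/ exists2 l, l \in s & U = lspn l.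
Proof.
rewrite seq_fsetE mem_cat; split=> [/orP[h|/mapP[l hl ->]]|[h|[l hl ->]]].
- by left; apply/(C0tP hL hq hal4).
- by right; exists l.
- by apply/orP; left; apply/(C0tP hL hq hal4).
- by apply/orP; right; exact: map_f.
Qed.

Lemma codeOf_uniq s : {subset s <= labs} -> uniq s ->
  uniq ([seq spn t | t <- C0t] ++ [seq lspn l | l <- s]).
Proof.
move=> sub us; rewrite cat_uniq (C0t_uniq hL hq hal4) /= map_inj_in_uniq ?us ?andbT.
  apply/hasPn => _ /mapP[l hl ->]; apply/negP => /(C0tP hL hq hal4).
  exact: lspn_notC0 (sub _ hl).
by move=> l l' hl hl'; apply: lspn_inj; exact: sub.
Qed.

Lemma codeOf_ext s : {subset s <= labs} -> indepl s -> extension (calC0 L) (codeOf s).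
Proof.
move=> sub ind; split; last by move=> U hU; change (U \in codeOf s); apply/mem_codeOf; left.
split=> [U /mem_codeOf[/(calC0_dim hL)//|[l hl ->]]|U U']; first exact/lspn_dim/sub.
move=> /mem_codeOf[h|[l hl ->]] /mem_codeOf[h'|[l' hl' ->]] ne.
- exact: (calC0_inter hL).
- by apply: free_dim => //; exact: sub.
- by rewrite capvC; apply: free_dim => //; exact: sub.
- have ne' : l != l' by apply: contraNneq ne => ->.
  by rewrite conf_dim ?ind //; exact: sub.
Qed.

Lemma codeOf_size s : {subset s <= labs} -> uniq s -> #|` codeOf s| = (286 + size s)%N.
Proof.
move=> sub us; rewrite size_seq_fset undup_id ?codeOf_uniq //.
by rewrite size_cat !size_map C0tE C0t_size.
Qed.

Lemma ext_codeOf C : extension (calC0 L) C -> C = codeOf (labsOf C).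
Proof.
move=> eC; apply/fsetP => U; apply/idP/idP => [hU|].
  apply/mem_codeOf; have [|n] := pselect (calC0 L U); first by left.
  have [l hl e] := cls eC hU n; right; exists l => //.
  by rewrite mem_filter hl -e hU.
case/mem_codeOf => [h|[l]]; first by case: eC => _; apply.
by rewrite mem_filter => /andP[+ _] ->.
Qed.

Lemma labsOf_indep C : extension (calC0 L) C -> indepl (labsOf C).
Proof.
move=> [[_ pC] _] l l'; rewrite !mem_filter => /andP[h hl] /andP[h' hl'] ne.
rewrite -conf_dim //; apply: pC => //; apply: contraNneq ne => e.
by apply/eqP; apply: lspn_inj.
Qed.

Lemma labsOf_sub C : {subset labsOf C <= labs}.
Proof. by move=> l; rewrite mem_filter => /andP[]. Qed.

Lemma labsOf_codeOf s : {subset s <= labs} -> labsOf (codeOf s) =i s.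
Proof.
move=> sub l; rewrite mem_filter; apply/andP/idP => [[/mem_codeOf[h hl|[l' hl' e] hl]]|hl].
- by case: (lspn_notC0 hl).
- by rewrite (lspn_inj hl (sub _ hl') e).
- by split; [apply/mem_codeOf; right; exists l | apply: sub].
Qed.

End Labels.

(** * q = 2: colourings of Z/15 *)

Section Colourings.
Local Open Scope nat_scope.

(* A colouring assigns to s = 0, ..., 14 a colour c < 3, or 3 for no plane at s. *)
Definition okc c l := if eqn c 3 then true else allf (fun d => ~~ eqn (nth 3 l d.-1) c) dist.
(** Looking ahead in the list covers the cyclic distances, as [dist] is closed under d -> 15 - d. *)
Fixpoint valid l := if l is c :: l' then okc c l' && valid l' else true.
Definition nexts (p : nat * seq nat) :=
  [seq c <- iota 0 4 | if eqn c 3 then (p.1 < 4)%N else okc c p.2].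
(** Each colouring carries its number of gaps, cut off at four: when 43 planes are added, both
    colourings have at least three gaps and seven planes are missing in all. *)
Fixpoint cols n : seq (nat * seq nat) := if n is n'.+1 then
  [seq (if eqn c 3 then p.1.+1 else p.1, c :: p.2) | p <- cols n', c <- nexts p]
  else [:: (0%N, [::])].
Definition colk n k := [seq p.2 | p <- cols n & eqn p.1 k].

Lemma colsP n k l : (k, l) \in cols n <->
  [/\ size l = n, all (gtn 4) l, valid l, k = count_mem 3 l & (k <= 4)%N].
Proof.
elim: n k l => [|n IH] k l.
  rewrite inE; split=> [/eqP[-> ->] //|[/size0nil -> _ _ -> _]]; by [].
split=> [/allpairsPdep[[k' l'] [c [/IH[zl al vl kE k4]]]]|].
  rewrite mem_filter mem_iota /= => /andP[hc c4] [-> ->] /=; rewrite zl c4 al vl andbT.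
  move: hc; rewrite -kE /okc !eqnE; case: eqP => c3 hc; split=> //.
  by rewrite hc.
case: l => [|c l] [//= [zl] /andP[c4 al] /andP[oc vl] kE k4].
have k4' : (count_mem 3 l <= 4)%N by move: k4; rewrite kE; apply: leq_trans; exact: leq_addl.
apply/allpairsPdep; exists (count_mem 3 l, l), c; split; first exact/IH.
  rewrite mem_filter mem_iota c4 andbT /=; move: oc; rewrite !eqnE /=.
  by case: eqP => [c3 _|_ ->//]; move: k4; rewrite kE c3 eqxx add1n andbT.
by rewrite kE eqnE /=; case: (c == 3).
Qed.

Lemma cols_uniq n : uniq (cols n).
Proof.
elim: n => //= n IH; apply: allpairs_uniq_dep => //.
  by move=> p _; rewrite filter_uniq // iota_uniq.
move=> _ _ /allpairsPdep[[k l] [c [_ _ ->]]] /allpairsPdep[[k' l'] [c' [_ _ ->]]] /=.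
case=> + ec el; rewrite ec el.
by move=> e; have -> : k = k' by move: e; case: (eqn c' 3) => // -[].
Qed.

Lemma colkP n k l : (k <= 4)%N -> l \in colk n k <->
  [/\ size l = n, all (gtn 4) l, valid l & count_mem 3 l = k].
Proof.
move=> k4; split=> [/mapP[[k' l']]|[zl al vl kE]].
  by rewrite mem_filter eqnE /= => /andP[/eqP -> /colsP[zl al vl kE _]] ->.
apply/mapP; exists (k, l) => //; rewrite mem_filter eqnE eqxx; apply/colsP.
by split.
Qed.

Lemma colk_uniq n k : uniq (colk n k).
Proof.
rewrite map_inj_in_uniq ?filter_uniq ?cols_uniq // => -[k1 l1] [k2 l2].
by rewrite !mem_filter !eqnE /= => /andP[/eqP -> _] /andP[/eqP -> _] ->.
Qed.

Lemma valid_nth l : valid l <-> (forall i j, (i < j < size l)%N -> (j - i)%N \in dist ->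
  nth 3%N l i <> 3%N -> nth 3%N l j <> nth 3%N l i).
Proof.
elim: l => [|c l IH]; first by split=> // _ i j; rewrite ltn0 andbF.
split=> [/= /andP[oc vl]|h] /=.
  case=> [|i] [|j] //=; last by rewrite ltnS subSS; move/IH: vl; apply.
  rewrite ltnS subn0 => jl jd c3; move: oc; rewrite /okc eqnE; case: eqP => // _.
  by rewrite allfE => /allP/(_ _ jd)/eqP.
apply/andP; split; last by apply/IH => i j ij jd; apply: (h i.+1 j.+1).
rewrite /okc eqnE; case: eqP => // c3; rewrite allfE; apply/allP => d hd.
have d0 : (0 < d)%N by move: hd; rewrite !inE => /or4P[|||/or3P[]] /eqP ->.
have [dl|dl] := ltnP d.-1 (size l); last by rewrite nth_default // eq_sym; apply/eqP.
by move: hd dl; rewrite -(prednK d0) => hd dl; apply/eqP; exact: (h 0 d.-1.+1).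
Qed.

Definition hor x y := let: H4 a b c d := x in let: H4 e f g h := y in
  H4 (a || e) (b || f) (c || g) (d || h).
Definition hbit k x := let: H4 a b c d := x in nth true [:: a; b; c; d] k.
Definition mA c := match c with
  | 0 => H4 false true false true | 1 => H4 false true true false
  | 2 => H4 true false false true | _ => h0 end%N.
Definition mB c := match c with
  | 0 => H4 true false true false | 1 => H4 false false true true
  | 2 => H4 true true false false | _ => h0 end%N.
(* blk m a r codes as four bits the set of the k for which LN r k conflicts with a plane of the
   colouring a: such a plane of colour c sits at s = r - off c. *)
Definition only c d : nat := if eqn c d then d else 3.
Definition blk (m : nat -> h16) (a : seq nat) r :=
  hor (hor (m (only (nth 3 a (m15 r)) 0)) (m (only (nth 3 a (m15 (r + 14))) 1)))
      (m (only (nth 3 a (m15 (r + 11))) 2)).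
Definition blkA a := [seq blk mA a r | r <- i15].
(** Over alpha^r the index of an [LB] plane is halved, by the factor 8 modulo 15. *)
Definition blkB a := [seq blk mB a (8 * r) | r <- i15].
Arguments blkA a : simpl never.
Arguments blkB a : simpl never.
Definition nfree x y := [seq k <- iota 0 4 | ~~ hbit k (hor x y)].
Definition opts xy := let f := nfree xy.1 xy.2 in if f is [::] then [:: 4%N] else f.
Fixpoint cart (os : seq (seq nat)) := if os is o :: os' then
  [seq k :: e | k <- o, e <- cart os'] else [:: [::]].
Definition nz (z : seq (h16 * h16)) := count (fun xy => nilp (nfree xy.1 xy.2)) z.
Definition ezip a b := zip (blkA a) (blkB b).
(** A point of S with a free k receives a plane, and 4 marks a point without one, so exactly z
    points of S remain without a plane. *)
Definition echoice z a b := if eqn (nz (ezip a b)) z then cart (map opts (ezip a b)) else [::].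
Definition Dz z s s' := [seq (ab.1, ab.2, e) | ab <- [seq (a, b) | a <- s, b <- s'],
  e <- echoice z ab.1 ab.2].

Lemma cartP os e : e \in cart os <-> size e = size os /\
  forall i, (i < size os)%N -> nth 0%N e i \in nth [::] os i.
Proof.
elim: os e => [|o os IH] e.
  by rewrite inE; split=> [/eqP -> //|[/size0nil ->]].
split=> [/allpairsP[[k e'] [/= hk /IH[ze he] ->]]|].
  by split=> [|[|i]] //=; [rewrite ze | rewrite ltnS; apply: he].
case: e => [|k e] [//= [ze] he]; apply/allpairsP; exists (k, e); split=> //=.
  exact: (he 0%N).
by apply/IH; split=> // i; apply: (he i.+1).
Qed.

Lemma cart_uniq os : all uniq os -> uniq (cart os).
Proof.
elim: os => //= o os IH /andP[uo uos]; apply: allpairs_uniq => //; first exact: IH.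
by move=> [k e] [k' e'] _ _ [-> ->].
Qed.

Definition b2 (b : bool) (n : nat) := if b then n else n.+1.
Definition cnt0 x y := let: H4 a b c d := x in let: H4 e f g h := y in
  b2 (if a then true else e) (b2 (if b then true else f)
    (b2 (if c then true else g) (b2 (if d then true else h) 0))).
Local Notation N := BinNums.N.
(** The size of [echoice] as a product of numbers of options, in binary arithmetic; this spares the
    enumeration of the choices. *)
Fixpoint wt (z : nat) ma mb : N := match ma, mb with
  | x :: ma', y :: mb' => match cnt0 x y with
     | 0 => if z is z'.+1 then wt z' ma' mb' else BinNums.N0
     | 1 => wt z ma' mb' | 2 => BinNat.N.double (wt z ma' mb')
     | n => BinNat.N.mul (BinNat.N.of_nat n) (wt z ma' mb') end
  | _, _ => if z is 0 then BinNums.Npos BinNums.xH else BinNums.N0 end.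
Definition sumN T (f : T -> N) s := foldr (fun x n => BinNat.N.add (f x) n) BinNums.N0 s.
Definition Tz z s s' := let ma := map blkA s in let mb := map blkB s' in
  sumN (fun a => sumN (wt z a) mb) ma.

Lemma cnt0E x y : cnt0 x y = size (nfree x y).
Proof. by case: x y => [] [] [] [] [] [] [] [] [] []. Qed.

Lemma wt_cons z x y ma mb : BinNat.N.to_nat (wt z (x :: ma) (y :: mb)) =
  if nilp (nfree x y) then (if z is z'.+1 then BinNat.N.to_nat (wt z' ma mb) else 0)
  else size (nfree x y) * BinNat.N.to_nat (wt z ma mb).
Proof.
rewrite /nilp -cnt0E; cbn [wt]; case: (cnt0 x y) => [|[|[|n]]]; first by case: z.
- by rewrite mul1n.
- by rewrite Nnat.N2Nat.inj_double.
by rewrite Nnat.N2Nat.inj_mul Nnat.Nat2N.id.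
Qed.

Lemma wtE z ma mb : BinNat.N.to_nat (wt z ma mb) =
  if nz (zip ma mb) == z then size (cart (map opts (zip ma mb))) else 0.
Proof.
elim: ma mb z => [|x ma IH] [|y mb] z; try by case: z.
rewrite wt_cons /nz /= -/(nz _) size_allpairs {1}/opts /=.
case E : (nfree x y) => [|k s] /=; last by rewrite IH add0n; case: eqP; rewrite ?muln0.
by case: z => [|z]; rewrite add1n ?eqSS //= IH; case: eqP => // _; rewrite mul1n.
Qed.

Lemma sumNE T (f : T -> N) s :
  BinNat.N.to_nat (sumN f s) = sumn [seq BinNat.N.to_nat (f x) | x <- s].
Proof. by elim: s => //= x s IH; rewrite Nnat.N2Nat.inj_add IH. Qed.

Lemma sumn_pairs T (f : T -> T -> nat) s s' :
  sumn [seq f ab.1 ab.2 | ab <- [seq (a, b) | a <- s, b <- s']] =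
  sumn [seq sumn [seq f a b | b <- s'] | a <- s].
Proof. by elim: s => //= a s IH; rewrite map_cat sumn_cat IH -map_comp. Qed.

Lemma size_echoice z a b : size (echoice z a b) = BinNat.N.to_nat (wt z (blkA a) (blkB b)).
Proof. by rewrite wtE /echoice eqnE /ezip; case: (_ == z). Qed.

Lemma size_Dz z s s' : size (Dz z s s') = BinNat.N.to_nat (Tz z s s').
Proof.
rewrite /Dz size_allpairs_dep (sumn_pairs (fun a b => size (echoice z a b))).
rewrite /Tz sumNE -map_comp; congr sumn; apply: eq_map => a; rewrite [RHS]sumNE -map_comp.
by congr sumn; apply: eq_map => b; exact: size_echoice.
Qed.

(** No colouring has fewer than three gaps. *)
Lemma col_chk : allf (fun p => if eqn p.1 3 then true else eqn p.1 4) (cols 15).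
Proof. by vm_compute. Qed.
Definition chk_nz (ma mb : seq (seq h16)) :=
  allf (fun a => allf (fun b => if wt 0 a b is BinNums.N0 then true else false) mb) ma.
(** Two colourings with three gaps each always block all four planes over some point of S. So gaps
    and points without a plane add up to at least 3 + 3 + 1 = 7, and [T14], [T15] count the cases of
    equality. *)
Lemma nz_chk : chk_nz (map blkA (colk 15 3)) (map blkB (colk 15 3)).
Proof. by vm_compute. Qed.
Lemma T14 : Tz 1 (colk 15 3) (colk 15 3) = BinNat.N.mul (BinNat.N.of_nat 60) (BinNat.N.of_nat 10368).
Proof. by vm_compute. Qed.
Lemma T15 : BinNat.N.add (Tz 0 (colk 15 3) (colk 15 4)) (Tz 0 (colk 15 4) (colk 15 3)) =
  BinNat.N.mul (BinNat.N.of_nat 60) (BinNat.N.of_nat 16128).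
Proof. by vm_compute. Qed.

End Colourings.

(** * Reading two colourings and a choice over S off an extension *)

Section Reading.
Local Open Scope nat_scope.

Fact c12_key : {s | s = colk 15 3}. Proof. by exists (colk 15 3). Qed.
Definition c12 := sval c12_key.
Fact c12E : c12 = colk 15 3. Proof. exact: svalP c12_key. Qed.
Fact c11_key : {s | s = colk 15 4}. Proof. by exists (colk 15 4). Qed.
Definition c11 := sval c11_key.
Fact c11E : c11 = colk 15 4. Proof. exact: svalP c11_key. Qed.

(* Together with the five planes LS, a triple (a, b, e) stands for the planes LA of the colouring
   a, the planes LB of b, and the planes LN r k with k = e_r < 4; in D14 there are 12 + 12 + 14 of
   them, in D15 there are 12 + 11 + 15 or 11 + 12 + 15. *)
Definition D14 := Dz 1 c12 c12.
Definition D15 := Dz 0 c12 c11 ++ Dz 0 c11 c12.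

Lemma size_D14 : size D14 = 60 * 10368.
Proof. by rewrite size_Dz c12E T14 Nnat.N2Nat.inj_mul !Nnat.Nat2N.id. Qed.
Lemma size_D15 : size D15 = 60 * 16128.
Proof.
rewrite size_cat !size_Dz c12E c11E -[_ + _]Nnat.N2Nat.inj_add T15.
by rewrite Nnat.N2Nat.inj_mul !Nnat.Nat2N.id.
Qed.

(** A plane [LT r] forbids the lines r, r + 1, r + 4 in both colourings. By this check, three gaps
    are never enough for that. *)
Definition chk_T (s : seq (seq nat)) := allf (fun a => allf (fun r =>
  if eqn (nth 3 a r) 3 then if eqn (nth 3 a (m15 (r + 1))) 3 then
    ~~ eqn (nth 3 a (m15 (r + 4))) 3 else true else true) i15) s.
Lemma T_chk : chk_T (colk 15 3). Proof. by vm_compute. Qed.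

Lemma count_sub T (P Q : pred T) s : all (fun x => P x ==> Q x) s ->
  count P s <= count Q s /\ (count P s = count Q s -> all (fun x => Q x ==> P x) s).
Proof.
elim: s => //= x s IH /andP[pq /IH[le eq]]; case: (P x) pq => /=; first move=> -> /=.
  by split=> [|[/eq ->]]; rewrite ?leq_add2l ?implybT.
move=> _; case: (Q x) => /=; last by [].
split=> [|e]; first exact: leqW.
by move: le; rewrite -[count P s]add0n e add1n ltnn.
Qed.

Lemma find_iota (p : pred nat) n c : (forall i j, i < n -> j < n -> p i -> p j -> i = j) ->
  c < n -> p c = (find p (iota 0 n) == c).
Proof.
move=> un cn; have fn : find p (iota 0 n) < n -> p (find p (iota 0 n)).
  move=> h; have : has p (iota 0 n) by rewrite has_find size_iota.
  by move/(nth_find 0); rewrite nth_iota.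
apply/idP/eqP => [pc|e]; last by rewrite -{1}e; apply: fn; rewrite e.
have h : find p (iota 0 n) < n.
  by rewrite -[X in _ < X](size_iota 0) -has_find; apply/hasP; exists c; rewrite ?mem_iota.
by apply: un => //; exact: fn.
Qed.

Lemma count_iota (p : pred nat) n : (forall i j, i < n -> j < n -> p i -> p j -> i = j) ->
  count p (iota 0 n) = (find p (iota 0 n) != n).
Proof.
move=> un; have := find_size p (iota 0 n); rewrite size_iota leq_eqVlt => /orP[/eqP e|lt].
  rewrite e eqxx; apply/eqP; rewrite eqn0Ngt -has_count has_find e size_iota ltnn //.
rewrite (ltn_eqF lt) [RHS]/=.
have -> : 1 = count_mem (find p (iota 0 n)) (iota 0 n).
  by rewrite count_uniq_mem ?iota_uniq // mem_iota lt.
apply: eq_in_count => i; rewrite mem_iota => /andP[_ hi].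
by rewrite (find_iota un hi) eq_sym.
Qed.

Lemma m15_small s : s < 15 -> m15 s = s. Proof. exact: modn_small. Qed.
Lemma m15_lt s : m15 s < 15. Proof. by rewrite ltn_mod. Qed.

Local Opaque i15.

Lemma mem_labs l : (l \in labs) = match l with
  | LS s => s < 5 | LT r => r < 15 | LA s c | LB s c => (s < 15) && (c < 3)
  | LN r k => (r < 15) && (k < 4) end.
Proof.
have cat5 (A B C D E : seq lab) : (l \in A ++ B ++ C ++ D ++ E) =
    [|| l \in A, l \in B, l \in C, l \in D | l \in E] by rewrite !mem_cat.
rewrite labsE /labs_ cat5 {cat5}.
have mm (f : nat -> lab) n x : injective f -> (f x \in [seq f s | s <- iota 0 n]) = (x < n).
  by move=> fi; rewrite mem_map // mem_iota.
have mn (f : nat -> lab) n l' : (forall x, f x != l') -> (l' \in [seq f s | s <- iota 0 n]) = false.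
  by move=> h; apply/mapP => -[x _ e]; have := h x; rewrite e eqxx.
have am (f : nat -> nat -> lab) n x y : (forall a b a' b', f a b = f a' b' -> a = a' /\ b = b') ->
    (f x y \in [seq f s c | s <- i15, c <- iota 0 n]) = (x < 15) && (y < n).
  move=> fi; apply/allpairsP/andP => [[[a b] /= [ha hb /fi[-> ->]]]|[hx hy]].
    by rewrite !mem_iota in ha hb.
  by exists (x, y); rewrite !mem_iota.
have an (f : nat -> nat -> lab) n l' : (forall x y, f x y != l') ->
    (l' \in [seq f s c | s <- i15, c <- iota 0 n]) = false.
  by move=> h; apply/allpairsP => -[[a b] /= [_ _ e]]; have := h a b; rewrite e eqxx.
case: l => [s|r|s c|s c|r k].
- rewrite mm; last by move=> ? ? [].
  by rewrite mn // !an // !orbF.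
- rewrite (mm LT); last by move=> ? ? [].
  by rewrite mn // !an // !orbF.
- rewrite (am LA); last by move=> ? ? ? ? [].
  by rewrite !mn // !an // !orbF.
- rewrite (am LB); last by move=> ? ? ? ? [].
  by rewrite !mn // !an // !orbF.
rewrite (am LN); last by move=> ? ? ? ? [].
by rewrite !mn // !an.
Qed.

Lemma labs_uniq : uniq labs.
Proof. by rewrite labsE; vm_compute. Qed.

Lemma hbit_hor k x y : k < 4 -> hbit k (hor x y) = hbit k x || hbit k y.
Proof. by case: x y => [] ? ? ? ? [] ? ? ? ?; case: k => [|[|[|[|]]]]. Qed.

Lemma hbit_blk m (M : nat -> seq nat) a r k : (forall c, c < 3 -> hbit k (m c) = (k \in M c)) -> ~~ hbit k (m 3) ->
  k < 4 -> hbit k (blk m a r) = [|| (nth 3 a (m15 r) == 0) && (k \in M 0),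
   (nth 3 a (m15 (r + 14)) == 1) && (k \in M 1) |
   (nth 3 a (m15 (r + 11)) == 2) && (k \in M 2)].
Proof.
move=> hm m3 k4; rewrite /blk !hbit_hor // -orbA /only !eqnE.
have h (b : bool) c : c < 3 -> hbit k (m (if b then c else 3)) = b && (k \in M c).
  by move=> c3; case: b; [exact: hm | exact: negPf].
by rewrite !h.
Qed.

Lemma hbitA a r k : k < 4 -> hbit k (blk mA a r) = [|| (nth 3 a (m15 r) == 0) && (k \in maskA 0),
   (nth 3 a (m15 (r + 14)) == 1) && (k \in maskA 1) | (nth 3 a (m15 (r + 11)) == 2) && (k \in maskA 2)].
Proof.
move=> k4; apply: hbit_blk => //; last by case: k k4 => [|[|[|[|]]]].
by move=> [|[|[|]]] // _; case: k k4 => [|[|[|[|]]]].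
Qed.
Lemma hbitB a r k : k < 4 -> hbit k (blk mB a r) = [|| (nth 3 a (m15 r) == 0) && (k \in maskB 0),
   (nth 3 a (m15 (r + 14)) == 1) && (k \in maskB 1) | (nth 3 a (m15 (r + 11)) == 2) && (k \in maskB 2)].
Proof.
move=> k4; apply: hbit_blk => //; last by case: k k4 => [|[|[|[|]]]].
by move=> [|[|[|]]] // _; case: k k4 => [|[|[|[|]]]].
Qed.

Definition eopt a b r := nfree (blk mA a r) (blk mB b (8 * r)).
Lemma nfreeE x y k : (k \in nfree x y) = [&& k < 4, ~~ hbit k x & ~~ hbit k y].
Proof.
rewrite mem_filter mem_iota /= andbC add0n; case: ltnP => //= k4.
by rewrite hbit_hor // negb_or.
Qed.

Lemma ezipE a b : ezip a b = [seq (blk mA a r, blk mB b (8 * r)) | r <- i15].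
Proof. by rewrite /ezip /blkA /blkB -zip_map. Qed.

Lemma nzE a b : nz (ezip a b) = count (fun r => nilp (eopt a b r)) i15.
Proof. by rewrite /nz ezipE count_map. Qed.

Lemma mem_cart a b e : e \in cart (map opts (ezip a b)) <-> size e = 15 /\
  forall r, r < 15 -> nth 4 e r \in (if nilp (eopt a b r) then [:: 4] else eopt a b r).
Proof.
have -> : map opts (ezip a b) = [seq (if nilp (eopt a b r) then [:: 4] else eopt a b r) | r <- i15].
  by rewrite ezipE -map_comp; apply: eq_map => r /=; rewrite /opts /eopt; case: nfree.
rewrite cartP size_map size_iota; split=> -[ze he]; split=> // r r15; have := he r r15;
  by rewrite (nth_map 0) ?size_iota // nth_iota // (set_nth_default 4) // ze.
Qed.

Lemma DzP z s s' a b e : (a, b, e) \in Dz z s s' <->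
  [/\ a \in s, b \in s', nz (ezip a b) = z & e \in cart (map opts (ezip a b))].
Proof.
split=> [/allpairsPdep[[a' b'] [e' [/allpairsP[[a2 b2'] /= [ha hb [-> ->]]]]]]|[ha hb hz he]].
  by rewrite /echoice eqnE; case: eqP => // hz he [-> -> ->].
apply/allpairsPdep; exists (a, b), e; split=> //; first by apply/allpairsP; exists (a, b).
by rewrite /echoice eqnE hz eqxx.
Qed.

Lemma Dz_uniq z s s' : uniq s -> uniq s' -> uniq (Dz z s s').
Proof.
move=> us us'; apply: allpairs_uniq_dep.
- by apply: allpairs_uniq => // -[? ?] [? ?].
- move=> [a b] _; rewrite /echoice; case: eqn => //; apply: cart_uniq.
  apply/allP => _ /mapP[[x y] _ ->]; rewrite /opts /=.
  by case E : nfree => [|k t] //; rewrite -E filter_uniq // iota_uniq.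
by move=> [[a b] e] [[a' b'] e'] _ _ /= [-> -> ->].
Qed.

Lemma c12P l : l \in c12 <-> [/\ size l = 15, all (gtn 4) l, valid l & count_mem 3 l = 3].
Proof. by rewrite c12E colkP. Qed.
Lemma c11P l : l \in c11 <-> [/\ size l = 15, all (gtn 4) l, valid l & count_mem 3 l = 4].
Proof. by rewrite c11E colkP. Qed.

Lemma c12_uniq : uniq c12. Proof. by rewrite c12E colk_uniq. Qed.
Lemma c11_uniq : uniq c11. Proof. by rewrite c11E colk_uniq. Qed.
Lemma D14_uniq : uniq D14. Proof. exact: Dz_uniq c12_uniq c12_uniq. Qed.

Lemma D15_uniq : uniq D15.
Proof.
rewrite cat_uniq (Dz_uniq _ c12_uniq c11_uniq) (Dz_uniq _ c11_uniq c12_uniq) andbT /=.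
apply/hasPn => -[[a b] e] /DzP[/c11P[_ _ _ h] _ _ _]; apply/negP => /DzP[/c12P[_ _ _ h'] _ _ _].
by rewrite h in h'.
Qed.

Lemma valid_count a : size a = 15 -> all (gtn 4) a -> valid a -> 3 <= count_mem 3 a.
Proof.
move=> za aa va; case: (leqP (count_mem 3 a) 4) => [h|]; last by move=> h; apply: ltnW; exact: ltnW.
have : (count_mem 3 a, a) \in cols 15 by apply/colsP.
move: (col_chk); rewrite allfE; move: (cols 15) => s /allP hs /hs /=.
by case: (count_mem 3 a) => [|[|[|]]].
Qed.

Lemma nz_gt0 a b : a \in c12 -> b \in c12 -> 0 < nz (ezip a b).
Proof.
rewrite c12E; move: nz_chk; rewrite /chk_nz; move: (colk 15 3) => s; rewrite allfE => /allP h ha hb.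
have := h (blkA a) (map_f _ ha); rewrite allfE => /allP/(_ (blkB b) (map_f _ hb)).
case E : wt => // _; have := wtE 0 (blkA a) (blkB b); rewrite E -/(ezip a b).
rewrite lt0n; case: eqP => // _; have : 0 < size (cart (map opts (ezip a b))).
  elim: (ezip a b) => //= xy s' IH; rewrite size_allpairs muln_gt0 IH andbT.
  by rewrite /opts; case: nfree.
by move=> + e; rewrite -e.
Qed.

Section Read.
Variable P : pred lab.
Hypothesis ind : forall l l', l \in labs -> l' \in labs -> P l -> P l' -> l != l' -> ~~ conf l l'.

(** When no plane is present, [find] returns n, the code for a gap. *)
Definition rd (f : nat -> nat -> lab) n := [seq find (fun c => P (f s c)) (iota 0 n) | s <- i15].

Lemma nth_rd f n s : s < 15 -> nth n (rd f n) s = find (fun c => P (f s c)) (iota 0 n).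
Proof. by move=> h; rewrite (nth_map 0) ?size_iota // nth_iota. Qed.

Lemma size_rd f n : size (rd f n) = 15. Proof. by rewrite size_map size_iota. Qed.

Lemma rd_le f n : all (gtn n.+1) (rd f n).
Proof.
by apply/allP => _ /mapP[s _ ->]; rewrite /= ltnS -[X in _ <= X](size_iota 0 n) find_size.
Qed.

Lemma ind' l l' : l \in labs -> l' \in labs -> P l -> P l' -> conf l l' -> l = l'.
Proof.
by move=> hl hl' pl pl' c; apply/eqP; apply: contraTT c => /ind; apply.
Qed.

Lemma uA s c c' : s < 15 -> c < 3 -> c' < 3 -> P (LA s c) -> P (LA s c') -> c = c'.
Proof.
move=> hs hc hc' p p'; have : LA s c = LA s c'.
  by apply: ind' => //; rewrite ?mem_labs ?hs //= eqnE eqxx.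
by case.
Qed.
Lemma uB s c c' : s < 15 -> c < 3 -> c' < 3 -> P (LB s c) -> P (LB s c') -> c = c'.
Proof.
move=> hs hc hc' p p'; have : LB s c = LB s c'.
  by apply: ind' => //; rewrite ?mem_labs ?hs //= eqnE eqxx.
by case.
Qed.
Lemma uN s c c' : s < 15 -> c < 4 -> c' < 4 -> P (LN s c) -> P (LN s c') -> c = c'.
Proof.
move=> hs hc hc' p p'; have : LN s c = LN s c'.
  by apply: ind' => //; rewrite ?mem_labs ?hs //= eqnE eqxx.
by case.
Qed.

Lemma rdA s c : s < 15 -> c < 3 -> P (LA s c) = (nth 3 (rd LA 3) s == c).
Proof.
by move=> hs hc; rewrite nth_rd // -(@find_iota (fun c => P (LA s c)) 3) // => i j; exact: uA.
Qed.
Lemma rdB s c : s < 15 -> c < 3 -> P (LB s c) = (nth 3 (rd LB 3) s == c).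
Proof.
by move=> hs hc; rewrite nth_rd // -(@find_iota (fun c => P (LB s c)) 3) // => i j; exact: uB.
Qed.
Lemma rdN s c : s < 15 -> c < 4 -> P (LN s c) = (nth 4 (rd LN 4) s == c).
Proof.
by move=> hs hc; rewrite nth_rd // -(@find_iota (fun c => P (LN s c)) 4) // => i j; exact: uN.
Qed.

Lemma count_rd f n : (forall s i j, s < 15 -> i < n -> j < n -> P (f s i) -> P (f s j) -> i = j) ->
  count P [seq f s c | s <- i15, c <- iota 0 n] = 15 - count_mem n (rd f n).
Proof.
move=> un; have -> : 15 - count_mem n (rd f n) = count (predC (pred1 n)) (rd f n).
  by rewrite -(size_rd f n) -(count_predC (pred1 n)) addKn.
rewrite count_flatten -map_comp /rd count_map -sumn_count; congr sumn.
apply/eq_in_map => s; rewrite mem_iota => /andP[_ hs] /=.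
by rewrite count_map -count_iota // => i j; exact: un.
Qed.

Lemma count_labs : count P labs = count (fun s => P (LS s)) (iota 0 5) +
  count (fun r => P (LT r)) i15 + (15 - count_mem 3 (rd LA 3)) +
  (15 - count_mem 3 (rd LB 3)) + (15 - count_mem 4 (rd LN 4)).
Proof.
have cat5 (A B C D E : seq lab) : count P (A ++ B ++ C ++ D ++ E) =
    count P A + count P B + count P C + count P D + count P E by rewrite !count_cat !addnA.
rewrite labsE /labs_ cat5 (@count_rd LA 3) ?(@count_rd LB 3) ?(@count_rd LN 4).
- by rewrite (count_map LS) (count_map LT).
- by move=> s i j; exact: uN.
- by move=> s i j; exact: uB.
- by move=> s i j; exact: uA.
Qed.

Lemma dist15 s s' : s < s' < 15 -> (s' - s \in dist) = (m15 (s + 15 - s') \in dist).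
Proof.
move=> /andP[h1 h2]; have -> : m15 (s + 15 - s') = 15 - (s' - s).
  by rewrite /m15 modn_small; lia.
have : 0 < s' - s < 15 by lia.
by move: (s' - s); do 15!case=> //.
Qed.

Lemma valid_rdA : valid (rd LA 3).
Proof.
apply/valid_nth => i j; rewrite size_rd => /andP[ij j15] hd ci e.
have i15' := ltn_trans ij j15.
have c3 : nth 3 (rd LA 3) i < 3.
  have := allP (rd_le LA 3) (nth 3 (rd LA 3) i); rewrite mem_nth ?size_rd //= ltnS leq_eqVlt.
  by move/(_ isT) => /orP[/eqP|].
have p : P (LA i (nth 3 (rd LA 3) i)) by rewrite rdA.
have p' : P (LA j (nth 3 (rd LA 3) i)) by rewrite rdA // e.
have [e'] : LA i (nth 3 (rd LA 3) i) = LA j (nth 3 (rd LA 3) i).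
  apply: ind' => //; [by rewrite mem_labs /= i15' | by rewrite mem_labs /= j15 |].
  by rewrite /conf !eqnE eqxx innE -dist15 ?ij // hd; case: eqP.
by rewrite e' ltnn in ij.
Qed.
Lemma valid_rdB : valid (rd LB 3).
Proof.
apply/valid_nth => i j; rewrite size_rd => /andP[ij j15] hd ci e.
have i15' := ltn_trans ij j15.
have c3 : nth 3 (rd LB 3) i < 3.
  have := allP (rd_le LB 3) (nth 3 (rd LB 3) i); rewrite mem_nth ?size_rd //= ltnS leq_eqVlt.
  by move/(_ isT) => /orP[/eqP|].
have p : P (LB i (nth 3 (rd LB 3) i)) by rewrite rdB.
have p' : P (LB j (nth 3 (rd LB 3) i)) by rewrite rdB // e.
have [e'] : LB i (nth 3 (rd LB 3) i) = LB j (nth 3 (rd LB 3) i).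
  apply: ind' => //; [by rewrite mem_labs /= i15' | by rewrite mem_labs /= j15 |].
  by rewrite /conf !eqnE eqxx innE -dist15 ?ij // hd; case: eqP.
by rewrite e' ltnn in ij.
Qed.

Lemma offA c r : c < 3 -> r < 15 -> m15 (m15 (r + nth 0 [:: 0; 14; 11] c) + off c) = r.
Proof. by case: c => [|[|[|]]] // _; do 15!case: r => [|r] //. Qed.
Lemma offB c r : c < 3 -> r < 15 -> m15 ((m15 (8 * r + nth 0 [:: 0; 14; 11] c) + off c).*2) = r.
Proof. by case: c => [|[|[|]]] // _; do 15!case: r => [|r] //. Qed.

Lemma noconfA c r k : c < 3 -> r < 15 -> k < 4 -> P (LN r k) ->
  ~~ ((nth 3 (rd LA 3) (m15 (r + nth 0 [:: 0; 14; 11] c)) == c) && (k \in maskA c)).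
Proof.
move=> c3 r15 k4 p; apply/negP => /andP[]; rewrite -rdA ?m15_lt // => p' hk.
have := ind' _ _ p' p; rewrite !mem_labs c3 r15 k4 m15_lt /= innE hk offA // eqnE eqxx.
by case/(_ isT isT isT).
Qed.
Lemma noconfB c r k : c < 3 -> r < 15 -> k < 4 -> P (LN r k) ->
  ~~ ((nth 3 (rd LB 3) (m15 (8 * r + nth 0 [:: 0; 14; 11] c)) == c) && (k \in maskB c)).
Proof.
move=> c3 r15 k4 p; apply/negP => /andP[]; rewrite -rdB ?m15_lt // => p' hk.
have := ind' _ _ p' p; rewrite !mem_labs c3 r15 k4 m15_lt /= innE hk offB // eqnE eqxx.
by case/(_ isT isT isT).
Qed.

Lemma rdN_free r k : r < 15 -> k < 4 -> P (LN r k) -> k \in eopt (rd LA 3) (rd LB 3) r.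
Proof.
move=> r15 k4 p; rewrite nfreeE k4 hbitA // hbitB // !negb_or.
have := noconfA (c := 0) isT r15 k4 p; have := noconfA (c := 1) isT r15 k4 p.
have := noconfA (c := 2) isT r15 k4 p; have := noconfB (c := 0) isT r15 k4 p.
have := noconfB (c := 1) isT r15 k4 p; have := noconfB (c := 2) isT r15 k4 p.
by rewrite /= !addn0 => -> -> -> -> -> ->.
Qed.

Lemma eopt_rdN : all (fun r => nilp (eopt (rd LA 3) (rd LB 3) r) ==> (nth 4 (rd LN 4) r == 4)) i15.
Proof.
apply/allP => r; rewrite mem_iota => /andP[_ r15]; apply/implyP; apply: contraTT => ne.
have k4 : nth 4 (rd LN 4) r < 4.
  have := allP (rd_le LN 4) (nth 4 (rd LN 4) r); rewrite mem_nth ?size_rd //= ltnS leq_eqVlt.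
  by move/(_ isT); rewrite (negPf ne).
by have := rdN_free r15 k4; rewrite rdN // eqxx => /(_ isT); case: eopt.
Qed.

Lemma count_nth n (e : seq nat) : size e = 15 -> count_mem n e = count (fun r => nth n e r == n) i15.
Proof.
move=> ze; rewrite -{1}(mkseq_nth n e) ze /mkseq count_map; apply: eq_count => r.
by [].
Qed.

Lemma nz_le : nz (ezip (rd LA 3) (rd LB 3)) <= count_mem 4 (rd LN 4) /\
  (nz (ezip (rd LA 3) (rd LB 3)) = count_mem 4 (rd LN 4) ->
   all (fun r => (nth 4 (rd LN 4) r == 4) ==> nilp (eopt (rd LA 3) (rd LB 3) r)) i15).
Proof. by rewrite nzE count_nth ?size_rd //; exact: count_sub eopt_rdN. Qed.

Lemma rdN_cart : nz (ezip (rd LA 3) (rd LB 3)) = count_mem 4 (rd LN 4) ->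
  rd LN 4 \in cart (map opts (ezip (rd LA 3) (rd LB 3))).
Proof.
case: nz_le => _ h /h /allP nzr; apply/mem_cart; split=> [|r r15]; first exact: size_rd.
have := nzr r; rewrite mem_iota r15 => /(_ isT) /implyP nr.
have := allP eopt_rdN r; rewrite mem_iota r15 => /(_ isT) /implyP rn.
case: ifP => [/rn/eqP -> //|nn]; have ne : nth 4 (rd LN 4) r != 4 by apply/negP => /nr; rewrite nn.
have k4 : nth 4 (rd LN 4) r < 4.
  have := allP (rd_le LN 4) (nth 4 (rd LN 4) r); rewrite mem_nth ?size_rd //= ltnS leq_eqVlt.
  by move/(_ isT); rewrite (negPf ne).
by apply: rdN_free => //; rewrite rdN.
Qed.

Lemma countS : count (fun s => P (LS s)) (iota 0 5) <= 5.
Proof. exact: leq_trans (count_size _ _) _. Qed.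

Lemma count_rdA : 3 <= count_mem 3 (rd LA 3).
Proof. by apply: valid_count; [exact: size_rd | exact: rd_le | exact: valid_rdA]. Qed.
Lemma count_rdB : 3 <= count_mem 3 (rd LB 3).
Proof. by apply: valid_count; [exact: size_rd | exact: rd_le | exact: valid_rdB]. Qed.
Lemma rdA_c12 : count_mem 3 (rd LA 3) = 3 -> rd LA 3 \in c12.
Proof. by move=> h; apply/c12P; split; [exact: size_rd | exact: rd_le | exact: valid_rdA | exact: h]. Qed.
Lemma rdB_c12 : count_mem 3 (rd LB 3) = 3 -> rd LB 3 \in c12.
Proof. by move=> h; apply/c12P; split; [exact: size_rd | exact: rd_le | exact: valid_rdB | exact: h]. Qed.
Lemma rdA_c11 : count_mem 3 (rd LA 3) = 4 -> rd LA 3 \in c11.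
Proof. by move=> h; apply/c11P; split; [exact: size_rd | exact: rd_le | exact: valid_rdA | exact: h]. Qed.
Lemma rdB_c11 : count_mem 3 (rd LB 3) = 4 -> rd LB 3 \in c11.
Proof. by move=> h; apply/c11P; split; [exact: size_rd | exact: rd_le | exact: valid_rdB | exact: h]. Qed.

Lemma sum7 : 7 <= count_mem 3 (rd LA 3) + count_mem 3 (rd LB 3) + count_mem 4 (rd LN 4).
Proof.
have := count_rdA; have := count_rdB.
case eA : (count_mem 3 (rd LA 3) == 3); last by move/eqP: eA; lia.
case eB : (count_mem 3 (rd LB 3) == 3); last by move/eqP: eA; move/eqP: eB; lia.
have := nz_gt0 (rdA_c12 (eqP eA)) (rdB_c12 (eqP eB)); have [le _] := nz_le.
by rewrite (eqP eA) (eqP eB) => h _ _; move: (leq_trans h le); lia.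
Qed.

Lemma sum7_D : count_mem 3 (rd LA 3) + count_mem 3 (rd LB 3) + count_mem 4 (rd LN 4) = 7 ->
  (rd LA 3, rd LB 3, rd LN 4) \in D14 ++ D15.
Proof.
have := count_rdA; have := count_rdB; have [le _] := nz_le; rewrite !mem_cat.
have cs : count_mem 3 (rd LA 3) + count_mem 3 (rd LB 3) + count_mem 4 (rd LN 4) = 7 ->
  3 <= count_mem 3 (rd LB 3) -> 3 <= count_mem 3 (rd LA 3) ->
  [\/ [/\ count_mem 3 (rd LA 3) = 3, count_mem 3 (rd LB 3) = 3 & count_mem 4 (rd LN 4) = 1],
      [/\ count_mem 3 (rd LA 3) = 3, count_mem 3 (rd LB 3) = 4 & count_mem 4 (rd LN 4) = 0] |
      [/\ count_mem 3 (rd LA 3) = 4, count_mem 3 (rd LB 3) = 3 & count_mem 4 (rd LN 4) = 0]].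
  move: (count_mem 3 _) (count_mem 3 _) (count_mem 4 _) => x y z e hy hx.
  case: z e => [|z] e; last by constructor 1; split; lia.
  by case: (eqVneq y 3) => [x3|/eqP x3]; [constructor 2 | constructor 3]; split; lia.
move=> hB hA /cs/(_ hB hA) [] [eA eB eN].
- apply/orP; left; have g := nz_gt0 (rdA_c12 eA) (rdB_c12 eB).
  have e : nz (ezip (rd LA 3) (rd LB 3)) = 1 by rewrite eN in le; lia.
  by apply/DzP; split; [exact: rdA_c12 | exact: rdB_c12 | | apply: rdN_cart; rewrite e eN].
- apply/orP; right; apply/orP; left.
  have e : nz (ezip (rd LA 3) (rd LB 3)) = 0 by rewrite eN in le; lia.
  by apply/DzP; split; [exact: rdA_c12 | exact: rdB_c11 | | apply: rdN_cart; rewrite e eN].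
apply/orP; right; apply/orP; right.
have e : nz (ezip (rd LA 3) (rd LB 3)) = 0 by rewrite eN in le; lia.
by apply/DzP; split; [exact: rdA_c11 | exact: rdB_c12 | | apply: rdN_cart; rewrite e eN].
Qed.

Lemma T_lines r : r < 15 -> P (LT r) -> [/\ ~~ P (LS (r %% 5)),
  forall i, i \in [:: 0; 1; 4] -> nth 3 (rd LA 3) (m15 (r + i)) = 3 &
  forall i, i \in [:: 0; 1; 4] -> nth 3 (rd LB 3) (m15 (8 * r + i)) = 3].
Proof.
move=> r15 p; split.
- apply/negP => p'; have // : LT r = LS (r %% 5).
  by apply: ind' => //; rewrite ?mem_labs ?ltn_mod //= eqnE.
- move=> i hi; have := allP (rd_le LA 3) (nth 3 (rd LA 3) (m15 (r + i))).
  rewrite mem_nth ?size_rd ?m15_lt //= ltnS leq_eqVlt => /(_ isT) /orP[/eqP //|c3].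
  have // : LT r = LA (m15 (r + i)) (nth 3 (rd LA 3) (m15 (r + i))).
  apply: ind' => //; [by rewrite mem_labs | by rewrite mem_labs /= m15_lt | by rewrite rdA ?m15_lt |].
  rewrite /conf /onT innE; move: hi; rewrite !inE => /or3P[] /eqP ->; by rewrite ?addn0 eqxx ?orbT.
move=> i hi; have := allP (rd_le LB 3) (nth 3 (rd LB 3) (m15 (8 * r + i))).
rewrite mem_nth ?size_rd ?m15_lt //= ltnS leq_eqVlt => /(_ isT) /orP[/eqP //|c3].
have // : LT r = LB (m15 (8 * r + i)) (nth 3 (rd LB 3) (m15 (8 * r + i))).
apply: ind' => //; [by rewrite mem_labs | by rewrite mem_labs /= m15_lt | by rewrite rdB ?m15_lt |].
rewrite /conf /onT innE; move: hi; rewrite !inE => /or3P[] /eqP ->; by rewrite ?addn0 eqxx ?orbT.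
Qed.

Lemma T_c12 a r : a \in c12 -> r < 15 ->
  ~ (forall i, i \in [:: 0; 1; 4] -> nth 3 a (m15 (r + i)) = 3).
Proof.
rewrite c12E; move: T_chk; rewrite /chk_T; move: (colk 15 3) => s; rewrite allfE => /allP h ha r15 hi.
have := h _ ha; rewrite allfE => /allP/(_ r); rewrite mem_iota r15 => /(_ isT).
have := hi 0 isT; have := hi 1 isT; have := hi 4 isT.
by rewrite addn0 (m15_small r15) => -> -> ->.
Qed.

(** Without planes in S the bound is 5 + 45 - 7. A plane in S is the only one, costs one plane [LS],
    and forces four gaps in each colouring, so that at most 1 + 4 + 11 + 11 + 15 = 42 planes are
    added. *)
Lemma count_le43 : count P labs <= 43 /\ (count P labs = 43 ->
  [/\ forall s, s < 5 -> P (LS s), forall r, r < 15 -> ~~ P (LT r) &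
      count_mem 3 (rd LA 3) + count_mem 3 (rd LB 3) + count_mem 4 (rd LN 4) = 7]).
Proof.
have c15 (n : nat) (e : seq nat) : size e = 15 -> count_mem n e <= 15 by move=> <-; exact: count_size.
have hA := c15 3 _ (size_rd LA 3); have hB := c15 3 _ (size_rd LB 3).
have hN := c15 4 _ (size_rd LN 4); have hS := countS.
rewrite count_labs; have [hT|] := posnP (count (fun r => P (LT r)) i15).
  have := sum7; move: hA hB hN hS; rewrite hT.
  move eS : (count (fun s => P (LS s)) (iota 0 5)) => cS.
  move: (count_mem 3 _) (count_mem 3 _) (count_mem 4 _) => x y z hA hB hN hS h7.
  split=> [|e]; first by lia.
  have cS5 : cS = 5 by lia.
  split; last by lia.
    move=> s s5; have : all (fun s => P (LS s)) (iota 0 5) by rewrite all_count eS cS5.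
    by move/allP/(_ s); rewrite mem_iota; apply.
  move=> r r15; apply/negP => p; have : has (fun r => P (LT r)) i15.
    by apply/hasP; exists r => //; rewrite mem_iota.
  by rewrite has_count hT.
rewrite -has_count => /hasP[r]; rewrite mem_iota => /andP[_ r15] p.
have [nS nA nB] := T_lines r15 p.
have cT : count (fun r => P (LT r)) i15 = 1.
  have un i j : i < 15 -> j < 15 -> P (LT i) -> P (LT j) -> i = j.
    move=> hi hj p1 p2; have [] // : LT i = LT j.
    by apply: ind' => //; rewrite mem_labs.
  rewrite (count_iota un); case: eqP => // e.
  by have := find_iota un r15; rewrite p e => /esym/eqP er; rewrite -er ltnn in r15.
have cS : count (fun s => P (LS s)) (iota 0 5) <= 4.
  rewrite -ltnS; apply: leq_ltn_trans (_ : 5 - 1 < 5) => //.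
  have : 0 < count (predC (fun s => P (LS s))) (iota 0 5).
    by rewrite -has_count; apply/hasP; exists (r %% 5) => //; rewrite mem_iota /= ltn_mod.
  have := count_predC (fun s => P (LS s)) (iota 0 5); rewrite size_iota.
  by move: (count _ _) (count _ _) => x y; lia.
have nB' i : i \in [:: 0; 1; 4] -> nth 3 (rd LB 3) (m15 (m15 (8 * r) + i)) = 3.
  by move=> hi; rewrite /m15 modnDml; exact: nB.
have gA : count_mem 3 (rd LA 3) != 3 by apply/eqP => /rdA_c12 h; exact: T_c12 h r15 nA.
have gB : count_mem 3 (rd LB 3) != 3 by apply/eqP => /rdB_c12 h; exact: T_c12 h (m15_lt _) nB'.
have := count_rdA; have := count_rdB; move: gA gB hA hB hN cS; rewrite cT.
move: (count _ (iota 0 5)) (count_mem 3 _) (count_mem 3 _) (count_mem 4 _) => s x y z.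
by move=> /eqP gA /eqP gB hA hB hN cS h1 h2; split; lia.
Qed.

End Read.
End Reading.

(** * q = 2: the maximal extensions *)

Section Selection.
Local Open Scope nat_scope.
Local Opaque i15.

Definition inX (X : seq nat * seq nat * seq nat) l := match l with
  | LS _ => true | LT _ => false | LA s c => nth 3 X.1.1 s == c
  | LB s c => nth 3 X.1.2 s == c | LN r k => nth 4 X.2 r == k end.
Definition sel X := [seq l <- labs | inX X l].
Definition coloring a := [/\ size a = 15, all (gtn 4) a & valid a].
Definition goodX (X : seq nat * seq nat * seq nat) := [/\ coloring X.1.1, coloring X.1.2, size X.2 = 15 &
  forall r, r < 15 -> nth 4 X.2 r \in (if nilp (eopt X.1.1 X.1.2 r) then [:: 4] else eopt X.1.1 X.1.2 r)].

Lemma Dz_good z a b e n m s s' : (forall l, l \in s <-> [/\ size l = 15, all (gtn 4) l, valid l & count_mem 3 l = n]) ->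
  (forall l, l \in s' <-> [/\ size l = 15, all (gtn 4) l, valid l & count_mem 3 l = m]) ->
  (a, b, e) \in Dz z s s' -> goodX (a, b, e) /\
  [/\ count_mem 3 a = n, count_mem 3 b = m & count_mem 4 e = z].
Proof.
move=> hs hs' /DzP[/hs[za aa va na] /hs'[zb ab vb nb] hz /mem_cart[ze he]]; split=> //.
split=> //; rewrite -hz nzE count_nth //; apply: eq_in_count => r.
rewrite mem_iota => /andP[_ r15]; have := he r r15; case: ifP => [_|_].
  by rewrite inE => ->.
by rewrite nfreeE => /andP[h _]; apply/eqP => e4; rewrite e4 in h.
Qed.

Lemma D14_good X : X \in D14 -> goodX X /\
  [/\ count_mem 3 X.1.1 = 3, count_mem 3 X.1.2 = 3 & count_mem 4 X.2 = 1].
Proof. by case: X => [[a b] e]; apply: Dz_good; exact: c12P. Qed.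
Lemma D15_good X : X \in D15 -> goodX X /\
  [/\ count_mem 3 X.1.1 + count_mem 3 X.1.2 = 7, count_mem 3 X.1.1 = 3 \/ count_mem 3 X.1.2 = 3
    & count_mem 4 X.2 = 0].
Proof.
case: X => [[a b] e]; rewrite mem_cat => /orP[] h.
  have [g [n1 n2 n3]] := Dz_good c12P c11P h.
  by split=> //; split; rewrite /= ?n1 ?n2 //; left.
have [g [n1 n2 n3]] := Dz_good c11P c12P h.
by split=> //; split; rewrite /= ?n1 ?n2 //; right.
Qed.

Lemma sel_sub X : {subset sel X <= labs}.
Proof. by move=> l; rewrite mem_filter => /andP[]. Qed.
Lemma sel_uniq X : uniq (sel X).
Proof. by rewrite filter_uniq // labs_uniq. Qed.

Lemma rd_col (f : nat -> lab) (P : pred lab) n m : m <= n -> (forall c, c < n -> P (f c) = (m == c)) ->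
  find (fun c => P (f c)) (iota 0 n) = m.
Proof.
move=> mn h; have un i j : i < n -> j < n -> P (f i) -> P (f j) -> i = j.
  by move=> hi hj; rewrite !h // => /eqP <- /eqP.
have [lt|] := ltnP m n.
  by apply/eqP; rewrite -(@find_iota (fun c => P (f c))) // h.
move=> nm; have -> : m = n by apply/eqP; rewrite eqn_leq mn nm.
apply/eqP; rewrite -[X in _ == X](size_iota 0) eq_sym eqn_leq find_size andbT leqNgt -has_find.
apply/hasPn => c; rewrite mem_iota => /andP[_ cn]; rewrite h //.
by apply/eqP => e; rewrite -e ltnNge nm in cn.
Qed.

Lemma rd_eq P f n a : size a = 15 -> all (gtn n.+1) a ->
  (forall s c, s < 15 -> c < n -> P (f s c) = (nth n a s == c)) -> rd P f n = a.
Proof.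
move=> za aa h; apply: (@eq_from_nth _ n); rewrite size_rd // => s s15.
rewrite nth_rd //; apply: rd_col => [|c cn]; last exact: h.
by have := allP aa (nth n a s); rewrite mem_nth ?za //= ltnS; apply.
Qed.

Lemma goodX_e X : goodX X -> all (gtn 5) X.2.
Proof.
case=> _ _ ze he; apply/(all_nthP 4) => r; rewrite ze => r15; have := he r r15.
case: ifP => _; first by rewrite inE => /eqP ->.
by rewrite nfreeE => /andP[/leq_trans h _]; apply: h.
Qed.

Lemma rd_inX X : goodX X -> [/\ rd (inX X) LA 3 = X.1.1, rd (inX X) LB 3 = X.1.2 & rd (inX X) LN 4 = X.2].
Proof.
move=> g; have ge := goodX_e g; case: g => [[za aa va] [zb ab vb] ze _].
by split; apply: rd_eq.
Qed.

Lemma dist_sym s s' : s < 15 -> s' < 15 -> (m15 (s + 15 - s') \in dist) = (m15 (s' + 15 - s) \in dist).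
Proof.
move=> h h'; have [->//|ne] := eqVneq s s'.
wlog lt : s s' h h' ne / s < s'.
  by move=> H; case: (ltngtP s s') => [/H->//|/H->//|e]; rewrite ?e ?eqxx // eq_sym in ne *.
rewrite -dist15 ?lt //; have -> : m15 (s' + 15 - s) = s' - s.
  have -> : s' + 15 - s = (s' - s) + 15 by lia.
  by rewrite /m15 modnDr modn_small; lia.
by [].
Qed.

Lemma conf_sym l l' : l \in labs -> l' \in labs -> conf l l' = conf l' l.
Proof.
have AA s c s' c' : (s < 15) && (c < 3) -> (s' < 15) && (c' < 3) ->
    (if eqn s s' then true else if eqn c c' then inn (m15 (s + 15 - s')) dist else false) =
    (if eqn s' s then true else if eqn c' c then inn (m15 (s' + 15 - s)) dist else false).
  move=> /andP[h _] /andP[h' _]; rewrite !eqnE (eq_sym s') (eq_sym c') !innE.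
  by rewrite (dist_sym h h').
rewrite !mem_labs; case: l l' => [s|r|s c|s c|r k] [s'|r'|s' c'|s' c'|r' k'] h h' //.
- exact: AA h h'.
- exact: AA h h'.
by rewrite /conf !eqnE eq_sym.
Qed.

Lemma coloring_conf a s s' c : coloring a -> s < 15 -> s' < 15 -> c < 3 -> s != s' ->
  nth 3 a s = c -> nth 3 a s' = c -> m15 (s + 15 - s') \notin dist.
Proof.
case=> za _ /valid_nth va; wlog lt : s s' / s < s'.
  move=> H h h' c3 ne e e'; case: (ltngtP s s') => [lt|lt|E]; first exact: H.
    by rewrite dist_sym //; apply: H => //; rewrite eq_sym.
  by rewrite E eqxx in ne.
move=> h h' c3 ne e e'; rewrite -dist15 ?lt //; apply/negP => hd.
have := va s s'; rewrite lt za h' hd e e' => /(_ isT isT) H; apply: H => //.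
by move=> c3'; rewrite c3' in c3.
Qed.

Lemma offA' c s : c < 3 -> s < 15 -> m15 (m15 (s + off c) + nth 0 [:: 0; 14; 11] c) = s.
Proof. by case: c => [|[|[|]]] // _; do 15!case: s => [|s] //. Qed.
Lemma offB' c s : c < 3 -> s < 15 -> m15 (8 * m15 ((s + off c).*2) + nth 0 [:: 0; 14; 11] c) = s.
Proof. by case: c => [|[|[|]]] // _; do 15!case: s => [|s] //. Qed.

Lemma inX_N X r k : goodX X -> r < 15 -> k < 4 -> nth 4 X.2 r = k ->
  (forall c, c < 3 -> ~~ ((nth 3 X.1.1 (m15 (r + nth 0 [:: 0; 14; 11] c)) == c) && (k \in maskA c))) /\
  (forall c, c < 3 -> ~~ ((nth 3 X.1.2 (m15 (8 * r + nth 0 [:: 0; 14; 11] c)) == c) && (k \in maskB c))).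
Proof.
move=> [_ _ ze he] r15 k4 e; have := he r r15; rewrite e; case: ifP => [_|_].
  by rewrite inE => /eqP k4'; rewrite k4' in k4.
rewrite nfreeE k4 hbitA // hbitB // !negb_or /= => /and4P[/andP[a0 /andP[a1 a2]] b0 b1 b2'] .
by split=> -[|[|[|c]]] // _; rewrite ?addn0.
Qed.

Lemma inX_ind X : goodX X -> forall l l', l \in labs -> l' \in labs -> inX X l -> inX X l' ->
  l != l' -> ~~ conf l l'.
Proof.
move=> g l l' hl hl'; have [ca cb ze he] := g.
have sym := conf_sym hl hl'; move: sym hl hl'.
have AN s c r k : LA s c \in labs -> LN r k \in labs -> inX X (LA s c) -> inX X (LN r k) ->
    ~~ conf (LA s c) (LN r k).
  rewrite !mem_labs => /andP[s15 c3] /andP[r15 k4] /eqP ha /eqP hn; rewrite /conf eqnE innE.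
  have [h _] := inX_N g r15 k4 hn; case: eqP => // er; have := h c c3.
  by rewrite {1}er offA' // ha eqxx.
have BN s c r k : LB s c \in labs -> LN r k \in labs -> inX X (LB s c) -> inX X (LN r k) ->
    ~~ conf (LB s c) (LN r k).
  rewrite !mem_labs => /andP[s15 c3] /andP[r15 k4] /eqP ha /eqP hn; rewrite /conf eqnE innE.
  have [_ h] := inX_N g r15 k4 hn; case: eqP => // er; have := h c c3.
  by rewrite {1}er offB' // ha eqxx.
case: l l' => [s|r|s c|s c|r k] [s'|r'|s' c'|s' c'|r' k'] // sym hl hl' h h' ne.
- move: hl hl' h h'; rewrite !mem_labs => /andP[s15 c3] /andP[s15' c3'] /eqP ea /eqP ea'; rewrite /conf !eqnE innE.
  case: eqP => [es|/eqP ns]; first by rewrite -ea -ea' es eqxx in ne.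
  case: eqP => // ec; apply: (coloring_conf ca s15 s15' c3 ns ea); by rewrite ea' ec.
- exact: AN.
- move: hl hl' h h'; rewrite !mem_labs => /andP[s15 c3] /andP[s15' c3'] /eqP ea /eqP ea'; rewrite /conf !eqnE innE.
  case: eqP => [es|/eqP ns]; first by rewrite -ea -ea' es eqxx in ne.
  case: eqP => // ec; apply: (coloring_conf cb s15 s15' c3 ns ea); by rewrite ea' ec.
- exact: BN.
- by rewrite sym; exact: AN.
- by rewrite sym; exact: BN.
move: h h' => /eqP e /eqP e'; rewrite /conf eqnE; apply: contraNneq ne => er.
by rewrite -e -e' er eqxx.
Qed.

Lemma size_sel X : goodX X -> count_mem 3 X.1.1 + count_mem 3 X.1.2 + count_mem 4 X.2 = 7 ->
  size (sel X) = 43.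
Proof.
move=> g e7; rewrite size_filter (count_labs (inX_ind g)); have [-> -> ->] := rd_inX g.
have [[za _ _] [zb _ _] ze _] := g.
have := count_size (pred1 3) X.1.1; have := count_size (pred1 3) X.1.2.
have := count_size (pred1 4) X.2; rewrite za zb ze.
have -> : count (fun s : nat => inX X (LS s)) (iota 0 5) = 5 by [].
have -> : count (fun r : nat => inX X (LT r)) i15 = 0 by exact: count_pred0.
by move: e7; move: (count _ _) (count _ _) (count _ _) => x y z; lia.
Qed.

Definition isN l := if l is LN _ _ then true else false.
Lemma count_sel_N X : goodX X -> count isN (sel X) = 15 - count_mem 4 X.2.
Proof.
move=> g; have [_ _ eN] := rd_inX g; have ind := inX_ind g.
have -> : 15 - count_mem 4 X.2 = count (inX X) [seq LN r k | r <- i15, k <- iota 0 4].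
  by rewrite (@count_rd (inX X) LN 4) ?eN // => s i j h1 h2 h3; exact: (uN ind h1 h2 h3).
have cat5 (P : pred lab) (A B C D E : seq lab) : count P (A ++ B ++ C ++ D ++ E) =
    count P A + count P B + count P C + count P D + count P E by rewrite !count_cat !addnA.
rewrite count_filter labsE /labs_ cat5.
have c0 (Q : pred lab) s : all (predC isN) s -> count (predI isN Q) s = 0.
  move=> /allP h; apply/eqP; rewrite eqn0Ngt -has_count; apply/hasPn => l /h /=.
  by case: isN.
have hS : all (predC isN) [seq LS s | s <- iota 0 5] by [].
have hT : all (predC isN) [seq LT r | r <- i15] by apply/allP => _ /mapP[s _ ->].
have hA : all (predC isN) [seq LA s c | s <- i15, c <- iota 0 3].
  by apply/allP => _ /allpairsP[[s c] [_ _ ->]].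
have hB : all (predC isN) [seq LB s c | s <- i15, c <- iota 0 3].
  by apply/allP => _ /allpairsP[[s c] [_ _ ->]].
rewrite (c0 _ _ hS) (c0 _ _ hT) (c0 _ _ hA) (c0 _ _ hB) !add0n; apply: eq_in_count => l.
by case/allpairsP => -[r k] [_ _ ->].
Qed.

Lemma sel_inj X X' : goodX X -> goodX X' -> sel X =i sel X' -> X = X'.
Proof.
move=> g g' e; have [a1 a2 a3] := rd_inX g; have [b1 b2' b3] := rd_inX g'.
have h l : l \in labs -> inX X l = inX X' l by move=> hl; have := e l; rewrite !mem_filter hl !andbT.
have ex f n : (forall s c, s < 15 -> c < n -> f s c \in labs) -> rd (inX X) f n = rd (inX X') f n.
  move=> hf; apply/eq_in_map => s; rewrite mem_iota => /andP[_ s15].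
  apply: eq_in_find => c; rewrite mem_iota => /andP[_ cn]; apply: h; exact: hf.
have E1 : X.1.1 = X'.1.1 by rewrite -a1 -b1 ex // => s c s15 c4; rewrite mem_labs s15 c4.
have E2 : X.1.2 = X'.1.2 by rewrite -a2 -b2' ex // => s c s15 c4; rewrite mem_labs s15 c4.
have E3 : X.2 = X'.2 by rewrite -a3 -b3 ex // => s c s15 c4; rewrite mem_labs s15 c4.
by case: X X' E1 E2 E3 {g g' e a1 a2 a3 b1 b2' b3 h ex} => [[a b] c] [[a' b'] c'] /= -> -> ->.
Qed.

End Selection.

Definition inS p := is0h (px p).
Definition cS t := cntp inS (pts7 t).
Lemma labs_S : allf (fun l => eqn (cS (ltri l)) (match l with LN _ _ => 1 | LT _ => 7 | _ => 3 end)%N) labs_.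
Proof. by vm_compute. Qed.
Lemma C0_S0 : count (fun t => cS t == 0%N) C0t_ = 136%N. Proof. by vm_compute. Qed.
Lemma C0_S1 : count (fun t => cS t == 1%N) C0t_ = 150%N. Proof. by vm_compute. Qed.

Section Maximal.
Variables (F : finFieldType) (L : fieldExtType F).
Hypothesis hL : \dim {:L} = 4%N.
Hypothesis hq : #|F| = 2%N.
Variable al : L.
Hypothesis hal4 : al ^+ 4 = al + 1.
Local Notation pev := (pev al).
Local Notation spn := (spn al).
Local Notation lspn := (lspn al).
Local Notation codeOf := (codeOf al).

Lemma pev_SV p : (pev p \in SV L) = inS p.
Proof.
rewrite mem_SV /inS -[is0h _]/(_ == h0) -(hev_eq0 hq hal4).
have e : vsval (pev p).1 = hev al (px p) by rewrite mk1 // pxW.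
by rewrite -e -(inj_eq val_inj).
Qed.

Lemma dim_S t : okt t -> (2 ^ \dim (spn t :&: SV L) = (cS t).+1)%N.
Proof. by move=> ok; rewrite (card_spn hL hq hal4 ok pev_SV) /cS cntpE. Qed.

Lemma dimS_eq t i : okt t -> (\dim (spn t :&: SV L) == i) = (cS t == (2 ^ i).-1).
Proof.
move=> /dim_S e; rewrite -eqSS -e prednK ?expn_gt0 //.
by rewrite eqn_exp2l.
Qed.

Lemma alpha_codeOf s i : {subset s <= labs} -> uniq s -> alpha (SV L) (codeOf s) i =
  (count (fun t => cS t == (2 ^ i).-1) C0t + count (fun l => cS (ltri l) == (2 ^ i).-1) s)%N.
Proof.
move=> sub us; set ls := [seq spn t | t <- C0t] ++ [seq lspn l | l <- s].
transitivity (count (fun U => \dim (U :&: SV L) == i) ls).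
  rewrite -size_filter; have ul : uniq ls by exact: codeOf_uniq.
  have <- : size (undup [seq U <- ls | \dim (U :&: SV L) == i]) = size [seq U <- ls | \dim (U :&: SV L) == i].
    by rewrite undup_id // filter_uniq.
  rewrite -(size_seq_fset tt) /alpha; congr (#|` _|); apply/fsetP => U; rewrite !inE seq_fsetE mem_filter.
  by rewrite seq_fsetE andbC.
rewrite count_cat !count_map; congr addn; apply: eq_in_count => t ht /=; rewrite dimS_eq //.
  exact: C0t_okt.
exact/ok_labs/sub.
Qed.

Lemma spectrum_sel X : goodX X ->
  count_mem 3%N X.1.1 + count_mem 3%N X.1.2 + count_mem 4%N X.2 = 7%N ->
  spectrum (SV L) (codeOf (sel X)) =
    [:: 136; 165 - count_mem 4%N X.2; 28 + count_mem 4%N X.2; 0]%N.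
Proof.
move=> g e7; rewrite /spectrum !alpha_codeOf; try exact: sel_sub; try exact: sel_uniq.
have h0 := C0_S0; have h1 := C0_S1; rewrite -C0tE in h0 h1.
have hs : all (fun l => cS (ltri l) == (match l with LN _ _ => 1 | LT _ => 7 | _ => 3 end)%N) (sel X).
  by have := labs_S; rewrite allfE -labsE => /allP h; apply/allP => l /sel_sub/h.
have nT : all (fun l => if l is LT _ then false else true) (sel X).
  by apply/allP => -[] //= ?; rewrite mem_filter.
have := size_sel g e7; have := count_sel_N g; have [_ _ ze _] := g.
have := count_size (pred1 4%N) X.2; rewrite ze.
(* As 136 + 150 = 286, no member of C0 meets S in a line or a plane. *)
have tot : (count (fun t => cS t == 0%N) C0t + count (fun t => cS t == 1%N) C0t +
    count (fun t => cS t == 3%N) C0t + count (fun t => cS t == 7%N) C0t <= size C0t)%N.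
  by elim: C0t => //= t s; case: (cS t) => [|[|[|[|[|[|[|[|]]]]]]]] /=; lia.
have z286 : size C0t = 286%N by rewrite C0tE C0t_size.
rewrite h0 h1 z286 in tot.
have cnt : count (fun l => cS (ltri l) == 0%N) (sel X) = 0%N /\
  count (fun l => cS (ltri l) == 1%N) (sel X) = count isN (sel X) /\
  (count (fun l => cS (ltri l) == 3%N) (sel X) + count isN (sel X) = size (sel X))%N /\
  count (fun l => cS (ltri l) == 7%N) (sel X) = 0%N.
  move: hs nT; elim: (sel X) => //= l s IH /andP[/eqP -> hs] /andP[nT hT].
  by have [a [b [c d]]] := IH hs hT; case: l nT => //= *; lia.
have -> : (2 ^ 0).-1 = 0%N by [].
have -> : (2 ^ 1).-1 = 1%N by [].
have -> : (2 ^ 2).-1 = 3%N by [].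
have -> : (2 ^ 3).-1 = 7%N by [].
move: cnt tot h0 h1.
move: (count _ C0t) (count _ C0t) (count _ C0t) (count _ C0t) (count_mem 4%N X.2) => a b c d n.
move: (count isN _) (size (sel X)) => m z [-> [-> [h3 ->]]] tot ea eb hn hm hz.
by congr [:: _; _; _; _]; lia.
Qed.

Lemma D_good X : X \in D14 ++ D15 -> goodX X /\
  (count_mem 3%N X.1.1 + count_mem 3%N X.1.2 + count_mem 4%N X.2 = 7)%N.
Proof.
rewrite mem_cat => /orP[/D14_good[g [-> -> ->]]|/D15_good[g [e _ ->]]] //.
by rewrite e.
Qed.

Lemma sel_ext X : goodX X -> extension (calC0 L) (codeOf (sel X)).
Proof.
move=> g; apply: codeOf_ext => // [|l l']; first exact: sel_sub.
by rewrite !mem_filter => /andP[h hl] /andP[h' hl'] ne; exact: (inX_ind g hl hl' h h' ne).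
Qed.

Lemma sel_card X : X \in D14 ++ D15 -> #|` codeOf (sel X)| = 329%N.
Proof.
move=> /D_good[g e7]; rewrite codeOf_size ?size_sel //; [exact: sel_sub | exact: sel_uniq].
Qed.

Lemma ext_ind C : extension (calC0 L) C -> forall l l', l \in labs -> l' \in labs ->
  lspn l \in C -> lspn l' \in C -> l != l' -> ~~ conf l l'.
Proof.
by move=> eC l l' hl hl' h h'; apply: (labsOf_indep hL hq hal4 eC); rewrite mem_filter ?h ?h'.
Qed.

Lemma ext_card C : extension (calC0 L) C -> #|` C| = (286 + count (fun l => lspn l \in C) labs)%N.
Proof.
move=> eC; rewrite {1}(ext_codeOf hL hq hal4 eC) codeOf_size //; first by rewrite size_filter.
  exact: labsOf_sub.
by rewrite filter_uniq // labs_uniq.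
Qed.

Lemma ext_le C : extension (calC0 L) C -> (#|` C| <= 329)%N.
Proof.
move=> eC; rewrite ext_card //; have [h _] := count_le43 (ext_ind eC).
by rewrite (leq_add2l 286 _ 43).
Qed.

Lemma D_neq0 : exists X, X \in D14 ++ D15.
Proof.
have : (0 < size D14)%N by rewrite size_D14.
by case: D14 => // X s _; exists X; rewrite mem_head.
Qed.

Lemma maximalP C : maximal_extension (calC0 L) C <->
  exists2 X, X \in D14 ++ D15 & C = codeOf (sel X).
Proof.
split=> [[eC mC]|[X hX ->]]; last first.
  by have [g _] := D_good hX; split=> [|C']; [exact: sel_ext | rewrite sel_card //; exact: ext_le].
have [X0 h0] := D_neq0; have [g0 _] := D_good h0.
have := mC _ (sel_ext g0); rewrite sel_card // => le.
have eq : count (fun l => lspn l \in C) labs = 43%N.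
  by move: le (ext_le eC); rewrite ext_card //; lia.
have [_ /(_ eq)[hS hT h7]] := count_le43 (ext_ind eC).
have hD := sum7_D (ext_ind eC) h7; set X := (_, _, _) in hD; exists X => //.
rewrite {1}(ext_codeOf hL hq hal4 eC); congr (codeOf _); apply: eq_in_filter => l.
rewrite mem_labs; case: l => [s|r|s c|s c|r k] /= h.
- by rewrite hS.
- by rewrite (negPf (hT _ h)).
- by case/andP: h => s15 c3; rewrite -(rdA (ext_ind eC)).
- by case/andP: h => s15 c3; rewrite -(rdB (ext_ind eC)).
by case/andP: h => s15 c3; rewrite -(rdN (ext_ind eC)).
Qed.

Lemma codeOf_inj X X' : goodX X -> goodX X' -> codeOf (sel X) = codeOf (sel X') -> X = X'.
Proof.
move=> g g' e; apply: sel_inj => // l.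
rewrite -(labsOf_codeOf hL hq hal4 (@sel_sub X)) -(labsOf_codeOf hL hq hal4 (@sel_sub X')).
by rewrite e.
Qed.

Lemma spectrum14 X : X \in D14 -> spectrum (SV L) (codeOf (sel X)) = [:: 136; 164; 29; 0]%N.
Proof.
move=> hX; have [g [e1 e2 e3]] := D14_good hX.
by rewrite spectrum_sel // ?e1 ?e2 ?e3.
Qed.
Lemma spectrum15 X : X \in D15 -> spectrum (SV L) (codeOf (sel X)) = [:: 136; 165; 28; 0]%N.
Proof.
move=> hX; have [g [e1 _ e3]] := D15_good hX.
have e7 : (count_mem 3 X.1.1 + count_mem 3 X.1.2 + count_mem 4 X.2 = 7)%N by rewrite e3 addn0.
by rewrite spectrum_sel // e3.
Qed.

End Maximal.

(** * q = 2: the group of order 60 *)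

Definition pfr p := mpt (hsq (px p)) (hsq (py p)).
Definition prot p := mpt (px p) (hmul hal (py p)).
Definition gam i k p := iter k prot (iter i pfr p).
Definition tmap (f : pt -> pt) (t : tri) : tri := (f t.1.1, f t.1.2, f t.2).
Definition i2 := [:: 0; 1]%N.
Definition i3 := [:: 0; 1; 2]%N.
Definition i4 := [:: 0; 1; 2; 3]%N.

Definition chk_pres (f : pt -> pt) (s : seq tri) (s7 : seq (seq pt)) := allf (fun t => let t' := tmap f t in
  if okt t' then hasf (fun s => if inp t'.1.1 s then if inp t'.1.2 s then inp t'.2 s else false else false) s7
  else false) s.
Lemma pfr_chk : chk_pres pfr C0t_ C0p_. Proof. by vm_compute. Qed.
Lemma prot_chk : chk_pres prot C0t_ C0p_. Proof. by vm_compute. Qed.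

(* The square of the Frobenius map exchanges the colours 1 and 2. *)
Definition pi2 j c := (if eqn j 0 then c else if eqn c 1 then 2 else if eqn c 2 then 1 else c)%N.
(** The index of the image of [LA s c] under [gam j.*2 k]. For [LB], with exponents 2s, the shift k
    becomes 8k. Odd powers of the Frobenius map exchange [LA] and [LB], so only even ones act on a
    single colouring. *)
Definition act j k s := m15 (4 ^ j * s + k).
Definition chk_lab f l l' := let t := tmap f (ltri l) in if okt t then samt t (ltri l') else false.
Lemma lab_chk : allf (fun j => allf (fun k => let f := gam j.*2 k in
  allf (fun s => allf (fun c =>
    if chk_lab f (LA s c) (LA (act j k s) (pi2 j c)) then
      chk_lab f (LB s c) (LB (act j (m15 (8 * k)) s) (pi2 j c)) else false) i3) i15) i15) i2.
Proof. by vm_compute. Qed.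

Lemma labN_chk : allf (fun k => let f := gam 2 k in allf (fun r => allf (fun c =>
  chk_lab f (LN r c) (LN (act 1 k r) ((c + 2) %% 4))) i4) i15) i15.
Proof. by vm_compute. Qed.

Definition moved a j k := hasf (fun s => let c := nth 3%N a s in if eqn c 3 then false else
  ~~ eqn (nth 3%N a (act j k s)) (pi2 j c)) i15.
(* For j = 1 and k divisible by 3, the map r -> 4 r + k fixes r0 = - k / 3 and r0 + 5, and
   every LN r c with r fixed is moved to LN r c' with c' <> c. *)
Definition fixr k := m15 (10 - k %/ 3).
Definition fixok k := let r := fixr k in let r' := m15 (r + 5) in
  if eqn (act 1 k r) r then if eqn (act 1 k r') r' then ~~ eqn r r' else false else false.
(** The second test of [fixok] serves the colouring of the planes [LB]: there the index tested is
    8k, and doubling it modulo 15 gives back k. *)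
Definition chk_moved (s : seq (seq nat)) := allf (fun a => allf (fun j => allf (fun k =>
  if eqn (j + k) 0 then true else if moved a j k then true else
  if eqn j 1 then if fixok k then fixok (m15 k.*2) else false else false) i15) i2) s.
Lemma moved_chk : chk_moved (colk 15 3). Proof. by vm_compute. Qed.

(** Squares of elements with an odd power of the Frobenius map involve its second power, so they
    fall under the even case and are not the identity. *)
Lemma sq_chk : allf (fun i => allf (fun k => let m := m15 (k * (2 ^ i).+1) in
  allp (fun p => peq (gam i k (gam i k p)) (gam 2 m p))) i15) [:: 1; 3]%N.
Proof. by vm_compute. Qed.
Lemma gam_uniq : uniq [seq gam i k (mpt hal hal) | i <- i4, k <- i15].
Proof. by vm_compute. Qed.

Definition inL0 a1 a2 w0 w1 w2 := hasf (fun d1 => let d0 := hadd w0 d1 in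
  if rcond d0 d1 then if heq (hgr d0 d1 a1) w1 then heq (hgr d0 d1 a2) w2 else false else false) c16.
Definition is_gam (a1 a2 z0 z1 z2 z3 : h16) := hasf (fun i => hasf (fun k =>
  let z j := hpow (k + j * 2 ^ i) in
  if heq a1 (hpow (2 ^ i)) then if heq a2 (hpow (2 * 2 ^ i)) then
  if heq z0 (z 0) then if heq z1 (z 1) then if heq z2 (z 2) then heq z3 (z 3)
  else false else false else false else false else false) i15) i4.
Definition w8 := [seq H4 p.1 p.2.1 p.2.2 false | p <- [seq (x, y) | x <- c2, y <- [seq (x, y) | x <- c2, y <- c2]]].
(** A linear map taking (x, y) to (A x, D y) is given by a1 = A alpha, a2 = A alpha^2 with A 1 = 1,
    and z_j = D alpha^j for j < 4. Five graphs of L0, those of x, alpha x, alpha^2 x, alpha^3 x and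
    x^2, must go to graphs of L0, and this leaves only the 60 maps. The first two graphs drive the
    search, the others prune it. *)
Definition chk_gl (l0 : seq (h16 * h16)) := allf (fun a1 => allf (fun a2 => allf (fun c : h16 * h16 =>
  let z0 := hgr c.1 c.2 h1 in let z1 := hgr c.1 c.2 a1 in let z2 := hgr c.1 c.2 a2 in
  if is0h z0 then true else
  allf (fun d1 => let d0 := hadd z1 d1 in
    if heq (hgr d0 d1 a1) z2 then if rcond d0 d1 then
      let z3 := hgr d0 d1 a2 in let z4 := hadd z0 z1 in
      if inL0 a1 a2 z2 z3 z4 then if inL0 a1 a2 z3 z4 (hadd z1 z2) then if inL0 a1 a2 z0 z2 z4 then
        is_gam a1 a2 z0 z1 z2 z3 else true else true else true else true else true) c16) l0) w8) w8.
Lemma gl_chk : chk_gl L0l_. Proof. by vm_compute. Qed.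

Definition L0p_ := [seq pts7 t | t <- L0t_].
(* the points joined by members of L0 to all points outside S but over other elements of W *)
Definition full0 (s : seq (seq pt)) p := let cs := [seq t <- s | inp p t] in
  allf (fun q => if is0h (px q) then true else if heq (px q) (px p) then true else hasf (inp q) cs) pts127_.
Definition chk_full0 s := allf (fun p => if is0h (px p) then true else eqb (full0 s p) (is0h (py p))) pts127_.
Lemma full0_chk : chk_full0 L0p_. Proof. by vm_compute. Qed.

Section CodeImage.
Variables (K : fieldType) (V : vectType K).
Implicit Types (g h : 'End(V)) (C : code V) (U : {vspace V}).

Lemma mem_code_image g C U : lker g == 0%VS -> ((g @: U)%VS \in code_image g C) = (U \in C).
Proof.
move=> kg; apply/imfsetP/idP => [[U' hU' /eqP]|hU]; last by exists U.
by rewrite (eq_limg_ker0 _ _ kg) => /eqP ->.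
Qed.
Lemma code_imageP g C U : reflect (exists2 U', U' \in C & U = (g @: U')%VS) (U \in code_image g C).
Proof. by apply: (iffP (imfsetP _ _ _ _)) => -[U' h ->]; exists U'. Qed.
Lemma code_image_comp g h C : code_image h (code_image g C) = code_image (h \o g)%VF C.
Proof.
apply/fsetP => U; apply/code_imageP/code_imageP => [[_ /code_imageP[U' h' ->] ->]|[U' h' ->]].
  by exists U' => //; rewrite limg_comp.
by exists (g @: U')%VS; [apply/code_imageP; exists U' | rewrite limg_comp].
Qed.
Lemma code_image1 C : code_image \1%VF C = C.
Proof.
apply/fsetP => U; apply/code_imageP/idP => [[U' h ->]|h]; first by rewrite lim1g.
by exists U; rewrite ?lim1g.
Qed.
Lemma code_image_card g C : lker g == 0%VS -> #|` code_image g C| = #|` C|.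
Proof.
by move=> kg; rewrite card_imfset // => U U' /eqP; rewrite (eq_limg_ker0 _ _ kg) => /eqP.
Qed.
Lemma lker_comp g h : lker g == 0%VS -> lker h == 0%VS -> lker (h \o g)%VF == 0%VS.
Proof.
move=> /lker0P ig /lker0P ih; apply/lker0P => x y; rewrite !comp_lfunE => /ih/ig //.
Qed.
Lemma lker_inv g : lker g == 0%VS -> lker g^-1%VF == 0%VS.
Proof.
by move=> kg; apply/lker0P => x y e; rewrite -(lker0_lfunVK kg x) e lker0_lfunVK.
Qed.
Lemma limg_dim g U : lker g == 0%VS -> \dim (g @: U) = \dim U.
Proof. by move=> /eqP kg; apply: limg_dim_eq; rewrite kg capv0. Qed.

Lemma plane_code_image g C : lker g == 0%VS -> plane_code C -> plane_code (code_image g C).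
Proof.
move=> kg [dC pC]; split=> [_ /code_imageP[U hU ->]|_ _ /code_imageP[U hU ->] /code_imageP[U' hU' ->]].
  by rewrite limg_dim //; exact: dC.
rewrite (eq_limg_ker0 _ _ kg) => ne; rewrite -(lker0_img_cap _ _ kg) limg_dim //; exact: pC.
Qed.

Lemma iso_typeP C C' : iso_type C = iso_type C' <-> exists2 g, GL g & C' = code_image g C.
Proof.
split=> [e|[g kg ->]].
  have : iso_type C' C' by exists \1%VF; [apply/lker0P => x y; rewrite !id_lfunE | exact: code_image1].
  by rewrite -e => -[g kg ge]; exists g.
apply/seteqP; split=> D [h kh <-].
  exists (h \o g^-1)%VF; first by apply: lker_comp => //; exact: lker_inv.
  by rewrite code_image_comp -comp_lfunA (lker0_compVf kg) comp_lfun1r.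
exists (h \o g)%VF; first exact: lker_comp.
by rewrite code_image_comp.
Qed.
End CodeImage.

Lemma chk_presP f s t : chk_pres f s [seq pts7 t | t <- s] -> t \in s ->
  okt (tmap f t) /\ exists2 t', t' \in s & samt (tmap f t) t'.
Proof.
rewrite /chk_pres allfE => /allP h /h; case: ifP => // ok.
by rewrite hasfE => /hasP[_ /mapP[t' ht' ->] hs]; split=> //; exists t'.
Qed.

Section Group.
Variables (F : finFieldType) (L : fieldExtType F).
Hypothesis hL : \dim {:L} = 4%N.
Hypothesis hq : #|F| = 2%N.
Local Notation V := (V L).
Variable al : L.
Hypothesis hal4 : al ^+ 4 = al + 1.
Local Notation pev := (pev al).
Local Notation spn := (spn al).

Definition phif (v : V) : V := mk (sg (vsval v.1)) (sg v.2).
Definition rhof (v : V) : V := (v.1, al * v.2).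
Fact phif_linear : linear phif.
Proof. by move=> c v v'; rewrite /phif /= mkZ mkD !linearP. Qed.
Fact rhof_linear : linear rhof.
Proof.
move=> c v v'; rewrite /rhof /= mulrDr -scalerAr; congr (_, _).
Qed.
HB.instance Definition _ := GRing.isLinear.Build F V V *:%R phif phif_linear.
HB.instance Definition _ := GRing.isLinear.Build F V V *:%R rhof rhof_linear.

Definition phi : 'End(V) := linfun phif.
Definition rho : 'End(V) := linfun rhof.
Definition gm i k : 'End(V) := iter k (fun g => (rho \o g)%VF) (iter i (fun g => (phi \o g)%VF) \1%VF).

Lemma htr_px p : htr (px p) = h0.
Proof. by case: p => [] [] [] [] y. Qed.
Lemma htr_sq x : htr x = h0 -> htr (hsq x) = h0.
Proof. by case: x => [] [] [] [] []. Qed.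

Lemma phiE p : phi (pev p) = pev (pfr p).
Proof.
rewrite lfunE /= /phif /pfr pev_mpt ?htr_sq ?htr_px // !hevsg //.
by rewrite /pev mk1 // pxW.
Qed.
Lemma rhoE p : rho (pev p) = pev (prot p).
Proof. by rewrite lfunE /= /rhof /prot pev_mpt ?htr_px // hevM // hev_al. Qed.
Lemma gmE i k p : gm i k (pev p) = pev (gam i k p).
Proof.
elim: k => [|k IH]; last by rewrite /= comp_lfunE IH rhoE.
by elim: i => [|i IH]; rewrite /= ?id_lfunE // comp_lfunE IH phiE.
Qed.

Lemma al_neq0 : al != 0.
Proof. by rewrite -(hev_al al) hev_eq0. Qed.
Lemma phi_ker : lker phi == 0%VS.
Proof.
apply/lker0P => x y; have [p ->] := pev_surj hL hq hal4 x; have [p' ->] := pev_surj hL hq hal4 y.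
have sq : injective hsq by move=> [] [] [] [] [] [] [] [] [] [].
have pe r : px (pfr r) = hsq (px r) /\ py (pfr r) = hsq (py r).
  by case: r => [] [] [] [] y'.
rewrite !phiE => /(pev_inj hq hal4) e; have [x1 y1] := pe p; have [x2 y2] := pe p'.
have ex : px p = px p' by apply: sq; rewrite -x1 e x2.
have ey : py p = py p' by apply: sq; rewrite -y1 e y2.
by rewrite /(pev _) ex ey.
Qed.
Lemma rho_ker : lker rho == 0%VS.
Proof.
apply/lker0P => x y; rewrite !lfunE /= => -[e1 /(mulfI al_neq0) e2].
by case: x y e1 e2 => [x1 x2] [y1 y2] /= -> ->.
Qed.
Lemma gm_ker i k : lker (gm i k) == 0%VS.
Proof.
elim: k => [|k IH]; last exact: lker_comp IH rho_ker.
elim: i => [|i IH]; last exact: lker_comp IH phi_ker.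
by apply/lker0P => x y; rewrite !id_lfunE.
Qed.

Lemma limg_spn (g : 'End(V)) (f : pt -> pt) t : (forall p, g (pev p) = pev (f p)) ->
  (g @: spn t)%VS = spn (tmap f t).
Proof. by move=> h; case: t => [[u v] w]; rewrite /(spn _) limg_span /= !h. Qed.

Definition pres (g : 'End(V)) := forall U, calC0 L U -> calC0 L (g @: U)%VS.

Lemma pres_chk (g : 'End(V)) f : (forall p, g (pev p) = pev (f p)) ->
  chk_pres f C0t [seq pts7 t | t <- C0t] -> pres g.
Proof.
move=> h chk U /(C0tP hL hq hal4)/mapP[t ht ->]; rewrite (limg_spn _ h); apply/(C0tP hL hq hal4).
have [ok [t2 ht2 hs]] := chk_presP chk ht.
by rewrite (samtP hq hal4 ok (C0t_okt ht2) hs) map_f.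
Qed.
Lemma pres_phi : pres phi.
Proof. by apply: (pres_chk phiE); rewrite C0tE; exact: pfr_chk. Qed.
Lemma pres_rho : pres rho.
Proof. by apply: (pres_chk rhoE); rewrite C0tE; exact: prot_chk. Qed.
Lemma pres_gm i k : pres (gm i k).
Proof.
elim: k => [|k IH U hU]; last by rewrite limg_comp; apply: pres_rho; exact: IH.
elim: i => [U|i IH U hU]; first by rewrite lim1g.
by rewrite limg_comp; apply: pres_phi; exact: IH.
Qed.

Lemma gm_ext i k C : extension (calC0 L) C -> extension (calC0 L) (code_image (gm i k) C).
Proof.
move=> [pC sC]; split; first exact: plane_code_image (gm_ker i k) pC.
pose s := [seq spn t | t <- C0t]; pose s' := [seq ((gm i k) @: U)%VS | U <- s].
have us : uniq s := C0t_uniq hL hq hal4.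
have us' : uniq s'.
  by rewrite map_inj_uniq // => U U' /eqP; rewrite (eq_limg_ker0 _ _ (gm_ker i k)) => /eqP.
have sub : {subset s' <= s}.
  move=> _ /mapP[U hU ->]; apply/(C0tP hL hq hal4)/pres_gm; exact/(C0tP hL hq hal4).
(* The images of the members of C0 lie in C0 and are equally many, so C0 is permuted. *)
have [|_ e] := uniq_min_size us' sub; first by rewrite /s' /s !size_map.
move=> U /(C0tP hL hq hal4); rewrite -/s -e => /mapP[U' hU' ->].
change ((gm i k @: U')%VS \in code_image (gm i k) C); rewrite mem_code_image ?gm_ker //.
by apply: sC; apply/(C0tP hL hq hal4).
Qed.

Lemma gm_max i k C : maximal_extension (calC0 L) C -> maximal_extension (calC0 L) (code_image (gm i k) C).
Proof.
move=> [eC mC]; split=> [|C']; first exact: gm_ext.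
by rewrite code_image_card ?gm_ker //; exact: mC.
Qed.
End Group.

Lemma fixokP k : fixok k -> exists r r', [/\ (r < 15)%N, (r' < 15)%N, r != r', act 1 k r = r & act 1 k r' = r'].
Proof.
rewrite /fixok; set r := fixr k; set r' := m15 _; move: r r' (m15_lt _ : r < 15)%N (m15_lt _ : r' < 15)%N => r r' h h'.
case: eqnP => // e; case: eqnP => // e' /eqnP/eqP ne.
by exists r, r'; split.
Qed.

Lemma mem_i15 s : (s \in i15) = (s < 15)%N.
Proof. by rewrite mem_iota. Qed.
Local Opaque i15.

Lemma c12_moved a j k : a \in c12 -> j \in i2 -> (k < 15)%N -> ~ moved a j k ->
  (j + k)%N = 0%N \/ [/\ j = 1%N, fixok k & fixok (m15 k.*2)].
Proof.
rewrite c12E; move: moved_chk; rewrite /chk_moved; move: (colk 15 3) => s; rewrite allfE => /allP h ha hj hk nm.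
have := h _ ha; rewrite allfE => /allP/(_ _ hj); rewrite allfE => /allP/(_ k).
rewrite mem_i15 => /(_ hk); case: eqnP => [e _|_]; first by left.
case: ifP => [/nm //|_]; case: eqnP => // -> ; case: ifP => // f1 f2; by right.
Qed.

(** * Freeness of the action on the solutions *)

Section Free.
Variables (F : finFieldType) (L : fieldExtType F).
Hypothesis hL : \dim {:L} = 4%N.
Hypothesis hq : #|F| = 2%N.
Local Notation V := (V L).
Variable al : L.
Hypothesis hal4 : al ^+ 4 = al + 1.
Local Notation pev := (pev al).
Local Notation lspn := (lspn al).
Local Notation codeOf := (codeOf al).
Local Notation gm := (gm al).

Lemma lab_img (g : 'End(V)) f l l' : (forall p, g (pev p) = pev (f p)) -> chk_lab f l l' ->
  l' \in labs -> (g @: lspn l)%VS = lspn l'.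
Proof.
move=> h; rewrite /chk_lab => + hl'; case: ifP => // ok hs.
by rewrite /(lspn _) (limg_spn _ h) (samtP hq hal4 ok (ok_labs hl') hs).
Qed.

Lemma sel_img X (g : 'End(V)) f l l' : (forall p, g (pev p) = pev (f p)) -> chk_lab f l l' ->
  lker g == 0%VS -> code_image g (codeOf (sel X)) = codeOf (sel X) ->
  l \in sel X -> l' \in labs -> inX X l'.
Proof.
move=> h chk kg e hl hl'; have : lspn l \in codeOf (sel X).
  by apply/(mem_codeOf hL hq hal4); right; exists l.
rewrite -(mem_code_image _ _ kg) e (lab_img h chk hl').
move=> hC; have : l' \in labsOf al (codeOf (sel X)) by rewrite mem_filter hC.
by rewrite (labsOf_codeOf hL hq hal4 (@sel_sub X)) mem_filter => /andP[].
Qed.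

Lemma D_facts X : X \in D14 ++ D15 -> goodX X /\ (X.1.1 \in c12 \/ X.1.2 \in c12) /\ (count_mem 4%N X.2 <= 1)%N.
Proof.
rewrite mem_cat => /orP[/D14_good[g [e _ ->]]|/D15_good[g [_ e ->]]]; split=> //; split=> //.
  by left; case: g => -[z a v] _ _ _; apply/c12P.
by case: e => e; [left | right]; case: g => -[z a v] [z' a' v'] _ _; apply/c12P.
Qed.

Lemma pi2_lt j c : (c < 3)%N -> (pi2 j c < 3)%N.
Proof. by rewrite /pi2; case: eqn => //; case: c => [|[|[|]]]. Qed.

Lemma lab_chkP j k s c : j \in i2 -> (k < 15)%N -> (s < 15)%N -> (c < 3)%N ->
  chk_lab (gam j.*2 k) (LA s c) (LA (act j k s) (pi2 j c)) /\
  chk_lab (gam j.*2 k) (LB s c) (LB (act j (m15 (8 * k)) s) (pi2 j c)).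
Proof.
move=> hj hk hs hc; have := lab_chk; rewrite allfE => /allP/(_ _ hj).
rewrite allfE => /allP/(_ k); rewrite mem_i15 => /(_ hk); cbv zeta.
rewrite allfE => /allP/(_ s); rewrite mem_i15 => /(_ hs).
rewrite allfE => /allP/(_ c); rewrite (mem_iota 0 3) => /(_ hc).
by case: ifP.
Qed.

Lemma m15_28 k : (k < 15)%N -> m15 (m15 (8 * k)).*2 = k.
Proof. by do 15!case: k => [|k] //. Qed.

Lemma nth_lt3 (a : seq nat) s : size a = 15%N -> all (gtn 4%N) a -> (s < 15)%N ->
  nth 3%N a s <> 3%N -> (nth 3%N a s < 3)%N.
Proof.
move=> za aa s15 ns; have := allP aa (nth 3%N a s); rewrite mem_nth ?za //= ltnS leq_eqVlt.
by move/(_ isT) => /orP[/eqP[]|].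
Qed.

(** At least one colouring has three gaps, and the check shows that it is moved unless j = 1 and two
    points of S are fixed. Over a fixed point the plane [LN r c] would go to one with c + 2 modulo
    4, so neither point carries a plane; but at most one point of S is without one. *)
Lemma free_even X j k : X \in D14 ++ D15 -> j \in i2 -> (k < 15)%N ->
  code_image (gm j.*2 k) (codeOf (sel X)) = codeOf (sel X) -> (j + k)%N = 0%N.
Proof.
move=> /D_facts[g [hc n4]] hj hk e; have kg := gm_ker hL hq hal4 j.*2 k.
have hg := gmE hq hal4 j.*2 k; have [[za aa va] [zb ab vb] ze he] := g.
have fe : j = 1%N -> fixok k -> False.
  move=> j1 /fixokP[r [r' [r15 r15' ne er er']]]; rewrite j1 in e kg hg.
  have key s : (s < 15)%N -> act 1 k s = s -> nth 4%N X.2 s = 4%N.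
    move=> s15 es; apply/eqP; apply: contrapT => /negP n.
    have c4 : (nth 4%N X.2 s < 4)%N.
      by have := allP (goodX_e g) (nth 4%N X.2 s); rewrite mem_nth ?ze //= ltnS leq_eqVlt (negPf n); apply.
    have chk : chk_lab (gam 2 k) (LN s (nth 4%N X.2 s)) (LN s ((nth 4%N X.2 s + 2) %% 4)).
      have := labN_chk; rewrite allfE => /allP/(_ k); rewrite mem_i15 => /(_ hk); cbv zeta.
      rewrite allfE => /allP/(_ s); rewrite mem_i15 => /(_ s15).
      by rewrite allfE => /allP/(_ (nth 4%N X.2 s)); rewrite (mem_iota 0 4) es; apply.
    have : inX X (LN s ((nth 4%N X.2 s + 2) %% 4)).
      apply: (sel_img hg chk kg e); last by rewrite mem_labs s15 ltn_mod.
      by rewrite mem_filter mem_labs /= eqxx s15 c4.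
    by move: c4; rewrite /=; case: (nth 4%N X.2 s) => [|[|[|[|]]]].
  have : (count (fun r => nth 4%N X.2 r == 4%N) i15 <= 1)%N by rewrite -count_nth.
  rewrite -size_filter; have h1 : r \in [seq r <- i15 | nth 4%N X.2 r == 4%N].
    by rewrite mem_filter mem_i15 r15 key.
  have h2 : r' \in [seq r <- i15 | nth 4%N X.2 r == 4%N] by rewrite mem_filter mem_i15 r15' key.
  move: h1 h2; case: (filter _ _) => [|x [|y s]] //.
  by rewrite !inE => /eqP er1 /eqP er2 _; rewrite er1 er2 eqxx in ne.
case: hc => hc.
  have nm : ~ moved X.1.1 j k.
    rewrite /moved hasfE => /hasP[s]; rewrite mem_i15 /= !eqnE => s15; case: eqP => // n3 /eqP; apply.
    have c3 := nth_lt3 za aa s15 n3; have [chk _] := lab_chkP hj hk s15 c3.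
    have := sel_img hg chk kg e; rewrite mem_filter !mem_labs /= eqxx s15 c3 m15_lt pi2_lt //.
    by move=> /(_ isT isT)/eqP.
  by have [//|[j1 f _]] := c12_moved hc hj hk nm; case: (fe j1 f).
have nm : ~ moved X.1.2 j (m15 (8 * k)).
  rewrite /moved hasfE => /hasP[s]; rewrite mem_i15 /= !eqnE => s15; case: eqP => // n3 /eqP; apply.
  have c3 := nth_lt3 zb ab s15 n3; have [_ chk] := lab_chkP hj hk s15 c3.
  have := sel_img hg chk kg e; rewrite mem_filter !mem_labs /= eqxx s15 c3 m15_lt pi2_lt //.
  by move=> /(_ isT isT)/eqP.
have [e0|[j1 _ f]] := c12_moved hc hj (m15_lt _) nm; last by rewrite m15_28 // in f; case: (fe j1 f).
have k0 : m15 (8 * k) = 0%N by lia.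
by have kk := m15_28 hk; rewrite k0 in kk e0; rewrite -kk.
Qed.

Lemma gm_free X i k : X \in D14 ++ D15 -> (i < 4)%N -> (k < 15)%N ->
  code_image (gm i k) (codeOf (sel X)) = codeOf (sel X) -> i = 0%N /\ k = 0%N.
Proof.
move=> hX i4 hk e.
have odd_case : i \in [:: 1; 3]%N -> False.
  move=> hi; have := sq_chk; rewrite allfE => /allP/(_ _ hi); rewrite allfE => /allP/(_ k).
  rewrite mem_i15 => /(_ hk) sq.
  have e2 : (gm i k \o gm i k)%VF = gm 2 (m15 (k * (2 ^ i).+1)).
    apply/lfunP => v; have [p ->] := pev_surj hL hq hal4 v; rewrite comp_lfunE !gmE //.
    by congr (pev _); apply/eqP; exact: (allpP p sq).
  have := free_even hX (j := 1%N) isT (m15_lt (k * (2 ^ i).+1)).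
  by rewrite -e2 -code_image_comp !e => /(_ erefl).
move: i4 e odd_case; case: i => [|[|[|[|i]]]] // _ e.
- by move=> _; have := free_even hX (j := 0%N) isT hk e.
- by move=> _; have := free_even hX (j := 1%N) isT hk e.
Qed.

End Free.

Fact L0lE : L0l = L0l_. Proof. exact: svalP L0l_key. Qed.
Fact L0tE : [seq pts7 t | t <- L0t] = L0p_. Proof. by rewrite /L0t L0lE. Qed.

Lemma padd0 p : padd p p0 = p.
Proof. by case: p => a b c [d e f g] /=; rewrite !addbF. Qed.
Lemma paddK p q : padd (padd p q) q = p.
Proof. by case: p q => a b c [d e f g] [a' b' c' [d' e' f' g']] /=; rewrite -!addbA !addbb !addbF. Qed.
Lemma padd_eq0 p q : (padd p q == p0) = (p == q).
Proof.
apply/eqP/eqP => [e|->]; last by case: q => a b c [d e f g] /=; rewrite !addbb.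
by rewrite -(paddK p q) e paddC padd0.
Qed.

Lemma pt_ext (f g : pt -> pt) : (forall p q, f (padd p q) = padd (f p) (f q)) ->
  (forall p q, g (padd p q) = padd (g p) (g q)) ->
  (forall j, (j < 3)%N -> f (mpt (hpow j) h0) = g (mpt (hpow j) h0)) ->
  (forall j, (j < 4)%N -> f (mpt h0 (hpow j)) = g (mpt h0 (hpow j))) -> f =1 g.
Proof.
move=> fD gD fg1 fg2; have z h : (forall p q, h (padd p q) = padd (h p) (h q)) -> h p0 = p0.
  by move=> hD; have := padd_eq0 (h p0) (h p0); rewrite eqxx -hD padd0 => /eqP.
have zf := z f fD; have zg := z g gD.
case=> a b c [d e i k]; pose m (b : bool) j := if b then mpt h0 (hpow j) else p0.
pose w (b : bool) j := if b then mpt (hpow j) h0 else p0.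
have -> : Pt a b c (H4 d e i k) =
    padd (padd (padd (padd (padd (padd (w a 0%N) (w b 1%N)) (w c 2%N)) (m d 0%N)) (m e 1%N)) (m i 2%N)) (m k 3%N).
  by rewrite /m /w; case: a; case: b; case: c; case: d; case: e; case: i; case: k.
have hm b' j : (j < 4)%N -> f (m b' j) = g (m b' j).
  by move=> hj; rewrite /m; case: b' => //; [exact: fg2 | rewrite zf zg].
have hw b' j : (j < 3)%N -> f (w b' j) = g (w b' j).
  by move=> hj; rewrite /w; case: b' => //; [exact: fg1 | rewrite zf zg].
by rewrite !fD !gD !hm ?hw.
Qed.

Lemma gam_chk : allf (fun i => allf (fun k => allf (fun j =>
  if peq (gam i k (mpt h0 (hpow j))) (mpt h0 (hpow (k + j * 2 ^ i))) then
    if eqn j 3 then true else peq (gam i k (mpt (hpow j) h0)) (mpt (hpow (j * 2 ^ i)) h0)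
  else false) i4) i15) i4.
Proof. by vm_compute. Qed.
Lemma pt_eta p : p = mpt (px p) (py p). Proof. by case: p. Qed.
Lemma mem_w8 p : px p \in w8. Proof. by case: p => [] [] [] [] y. Qed.
Lemma hgr1 a b : hgr a b h1 = hadd a b.
Proof. by case: a b => [] [] [] [] [] [] [] [] [] []. Qed.
Lemma haddK a b : hadd (hadd a b) b = a.
Proof. by case: a b => [] a b c d [] e f g h; rewrite /= -!addbA !addbb !addbF. Qed.

Lemma inL0I a1 a2 w0 w1 w2 : (exists d0 d1, [/\ rcond d0 d1, w0 = hgr d0 d1 h1,
  w1 = hgr d0 d1 a1 & w2 = hgr d0 d1 a2]) -> inL0 a1 a2 w0 w1 w2.
Proof.
move=> [d0 [d1 [rc -> -> ->]]]; rewrite /inL0 hasfE; apply/hasP; exists d1; first exact: mem_c16.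
by rewrite /= hgr1 haddK rc -![heq _ _]/(_ == _) !eqxx.
Qed.

Lemma gl_chkP a1 a2 z0 z1 z2 z3 : a1 \in w8 -> a2 \in w8 -> z0 != h0 ->
  let q w0 w1 w2 := exists d0 d1, [/\ rcond d0 d1, w0 = hgr d0 d1 h1,
    w1 = hgr d0 d1 a1 & w2 = hgr d0 d1 a2] in
  q z0 z1 z2 -> q z1 z2 z3 -> q z2 z3 (hadd z0 z1) -> q z3 (hadd z0 z1) (hadd z1 z2) ->
  q z0 z2 (hadd z0 z1) -> is_gam a1 a2 z0 z1 z2 z3.
Proof.
move=> h1' h2' n0 q [c0 [c1 [rc e0 e1 e2]]] [d0 [d1 [rd' f1 f2 f3]]] /inL0I g1 /inL0I g2 /inL0I g3.
have := gl_chk; rewrite -L0lE /chk_gl allfE => /allP/(_ _ h1').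
rewrite allfE => /allP/(_ _ h2'); rewrite allfE => /allP/(_ (c0, c1)).
rewrite mem_L0l => /(_ rc); cbv zeta; rewrite /fst /snd -e0 -e1 -e2.
rewrite -[is0h z0]/(z0 == h0) (negPf n0) allfE => /allP/(_ _ (mem_c16 d1)).
have -> : hadd z1 d1 = d0 by rewrite f1 hgr1 haddK.
by rewrite -f2 -f3 rd' -[heq z2 z2]/(z2 == z2) eqxx g1 g2 g3.
Qed.

Lemma is_gamP a1 a2 z0 z1 z2 z3 : is_gam a1 a2 z0 z1 z2 z3 -> exists i k,
  [/\ i \in i4, k \in i15, a1 = hpow (2 ^ i), a2 = hpow (2 * 2 ^ i) &
      [/\ z0 = hpow (k + 0 * 2 ^ i), z1 = hpow (k + 1 * 2 ^ i),
          z2 = hpow (k + 2 * 2 ^ i) & z3 = hpow (k + 3 * 2 ^ i)]].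
Proof.
rewrite /is_gam hasfE => /hasP[i hi]; rewrite hasfE => /hasP[k hk]; cbv zeta.
rewrite -![heq _ _]/(_ == _); do 6![case: eqP => //]; move=> -> -> -> -> -> -> _.
by exists i, k; split.
Qed.

(** * Isomorphisms between maximal extensions *)

Section Rigid.
Variables (F : finFieldType) (L : fieldExtType F).
Hypothesis hL : \dim {:L} = 4%N.
Hypothesis hq : #|F| = 2%N.
Local Notation V := (V L).
Variable al : L.
Hypothesis hal4 : al ^+ 4 = al + 1.
Local Notation pev := (pev al).
Local Notation spn := (spn al).
Local Notation lspn := (lspn al).
Local Notation gm := (gm al).

(** A compatible set P that meets every slot offers a branch of the search that never fails: the
    label of P in the current slot. *)
Lemma nocov_sound (P : pred lab) (sl : seq (seq lab)) (cur : seq lab) :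
  (forall l l', l \in labs -> l' \in labs -> P l -> P l' -> l != l' -> ~~ conf l l') ->
  (forall s, s \in sl -> exists2 l, l \in s & l \in labs /\ P l) ->
  (forall m, m \in cur -> m \in labs /\ P m) -> nocov sl cur = false.
Proof.
move=> ind; elim: sl cur => //= s sl IH cur hs hc.
have hsl s' : s' \in sl -> exists2 l, l \in s' & l \in labs /\ P l by move=> h; apply: hs; rewrite inE h orbT.
rewrite hasfE; case: hasP => [_|nh]; first exact: IH.
have [l ls [hl pl]] := hs s (mem_head _ _); rewrite allfE; apply/negbTE/allPn; exists l => //.
have lc : l \notin cur.
  apply/negP => lc; apply: nh; exists l => //; rewrite hasfE; apply/hasP; exists l => //.
  by rewrite leqbE.
rewrite hasfE; case: hasP => [[m mc cf]|_].
  have [hm pm] := hc m mc; have ne : l != m by apply: contraNneq lc => ->.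
  by have := ind l m hl hm pl pm ne; rewrite cf.
rewrite IH // => m; rewrite inE => /orP[/eqP ->|/hc //]; by split.
Qed.

Definition full (C : code V) p := forall q, q != p0 -> q != p ->
  exists2 U, U \in C & pev p \in U /\ pev q \in U.

Lemma lthruP p l s : (l, s) \in lthru p <-> [/\ l \in labs, s = pts7 (ltri l) & p \in s].
Proof.
rewrite mem_filter inpE /=; split=> [/andP[hp /labp_mem[hl es]]|[hl es hp]] //.
by rewrite hp; apply/labp_mem.
Qed.

Lemma full_A C p : maximal_extension (calC0 L) C -> isA p -> full C p.
Proof.
move=> mC hA q q0 qp; have [X hX eC] := (maximalP hL hq hal4 C).1 mC; have [[_ sC] _] := mC.
have p_0 : p != p0 by apply: contraTneq hA => ->.
have [hf|nf] := boolP (q \in frees p).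
  have := A_chk; rewrite -tablE allfE => /allP/(_ _ (tabl_row p_0)) /=; rewrite hA.
  rewrite allfE => /allP/(_ _ hf); rewrite hasfE => /hasP[[l s]] /lthruP[hl es ps] /=.
  case: ifP => // hS; rewrite inpE => qs; exists (lspn l).
    rewrite eC; apply/(mem_codeOf hL hq hal4); right; exists l => //.
    by rewrite mem_filter hl; case: l hS {hl es}.
  by rewrite /(lspn _) !spnP // !inE -es ps qs !orbT.
apply: contrapT => nU; case/negP: nf; apply/freesP; split=> // t ht pt; apply/negP => qt.
apply: nU; exists (spn t); first by apply: sC; apply/(C0tP hL hq hal4)/map_f.
by rewrite !spnP // !inE pt qt !orbT.
Qed.

Lemma full_isA C p : extension (calC0 L) C -> p != p0 -> full C p -> isA p.
Proof.
move=> eC p_0 hf; apply: contrapT => /negP nA.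
have := nf_chk; rewrite -tablE /chk_nf allfE => /allP/(_ _ (tabl_row p_0)).
rewrite [(_, _).1]/= (negPf nA) (nocov_sound (ext_ind hL hq hal4 eC)) // => s /mapP[q hq' ->].
have [q0 qp nq] := (freesP p q).1 hq'; have [U UC [pU qU]] := hf q q0 qp.
have nC0 : ~ calC0 L U.
  move/(C0tP hL hq hal4) => /mapP[t ht eU]; rewrite eU !spnP // !inE in pU qU.
  rewrite (negPf p_0) (negPf q0) /= in pU qU.
  by have := nq t ht pU; rewrite qU.
have [l hl eU] := cls hL hq hal4 eC UC nC0; exists l; last by rewrite -eU.
rewrite eU /(lspn _) !spnP // !inE (negPf p_0) (negPf q0) /= in pU qU.
apply/mapP; exists (l, pts7 (ltri l)) => //; rewrite mem_filter inpE qU /=.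
by apply/lthruP.
Qed.

Lemma calL0_C0 U : calL0 U -> calC0 L U. Proof. by left. Qed.

Lemma L0_dimS C U : extension (calC0 L) C -> U \in C -> \dim (U :&: SV L) = 0%N -> calL0 U.
Proof.
move=> eC UC d0; have [/(calC0P hL)[//|[r [a [b [v [r0 nd _ eU]]]]]]|nC0] := pselect (calC0 L U).
  by have := Npl_S r0 nd; rewrite -eU d0.
have [l hl eU] := cls hL hq hal4 eC UC nC0.
have := labs_S; rewrite -labsE allfE => /allP/(_ _ hl); rewrite eqnE => /eqP e.
have := dim_S hL hq hal4 (ok_labs hl); rewrite -/(lspn l) -eU d0 e.
by case: (l).
Qed.

Lemma L0_S U : calL0 U -> \dim (U :&: SV L) = 0%N.
Proof. by move=> /(calL0P hL)[a0 [a1 [-> _]]]; rewrite PG_S dimv0. Qed.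

Lemma full0P p : px p != h0 -> (py p == h0) <->
  (forall q, px q != h0 -> px q != px p -> exists2 U, calL0 U & pev p \in U /\ pev q \in U).
Proof.
move=> x0; have p_0 : p != p0 by apply: contraNneq x0 => ->.
have := full0_chk; rewrite /chk_full0 -pts127E allfE => /allP/(_ p); rewrite mem_pts127 => /(_ p_0).
rewrite -[is0h (px p)]/(px p == h0) (negPf x0) -[is0h (py p)]/(py p == h0) => /eqP <-.
rewrite /full0 -L0tE -pts127E allfE; split=> [/allP h q xq xqp|h].
  have q0 : q != p0 by apply: contraNneq xq => ->.
  have := h q; rewrite mem_pts127 => /(_ q0).
  rewrite -[is0h (px q)]/(px q == h0) -[heq _ _]/(px q == px p) (negPf xq) (negPf xqp).
  rewrite hasfE => /hasP[s]; rewrite mem_filter !inpE => /andP[ps /mapP[t ht es]] qs.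
  exists (spn t); first by apply/(L0tP hL hq hal4); exists t.
  by rewrite !spnP // !inE -es ps qs !orbT.
apply/allP => q _; case: ifP => //; rewrite -[is0h (px q)]/(px q == h0) => /negbT xq.
case: ifP => //; rewrite -[heq _ _]/(px q == px p) => /negbT xqp.
have q0 : q != p0 by apply: contraNneq xq => ->.
have [U /(L0tP hL hq hal4)[t ht ->]] := h q xq xqp.
rewrite !spnP // !inE (negPf p_0) (negPf q0) /= => -[pt qt].
by rewrite hasfE; apply/hasP; exists (pts7 t); rewrite ?mem_filter ?inpE ?pt //=; apply: map_f.
Qed.

Lemma gtri_mem a0 a1 p : (pev p \in spn (gtri a0 a1)) = (py p == hgr a0 a1 (px p)).
Proof.
rewrite gtriE // mk_PG ?pxW // -(inj_eq (hev_inj hq hal4)) /hgr.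
by rewrite hevD // (hevM hq hal4 a0) (hevM hq hal4 a1) hevsg.
Qed.

Lemma rigid C C' (g : 'End(V)) : maximal_extension (calC0 L) C -> maximal_extension (calC0 L) C' ->
  lker g == 0%VS -> code_image g C = C' ->
  exists i k, [/\ (i < 4)%N, (k < 15)%N & g = gm i k].
Proof.
move=> mC mC' kg gC; have [eC _] := mC; have [eC' _] := mC'.
have [ga hga] := boolp.choice (fun p => pev_surj hL hq hal4 (g (pev p))).
have gaD p q : ga (padd p q) = padd (ga p) (ga q).
  by apply: (pev_inj hq hal4); rewrite -hga (pevD hq al p q) linearD (pevD hq al (ga p)) -!hga.
have ga0 : ga p0 = p0 by apply: (pev_inj hq hal4); rewrite -hga !pev0 linear0.
have ga_inj : injective ga.
  by move=> p q e; apply: (pev_inj hq hal4); apply: (lker0P kg); rewrite !hga e.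
have ga_neq0 p : p != p0 -> ga p != p0 by rewrite -{2}ga0 (inj_eq ga_inj).
have ga_surj q : exists p, q = ga p.
  have [p ep] := pev_surj hL hq hal4 (g^-1%VF (pev q)); exists p.
  by apply: (pev_inj hq hal4); rewrite -hga -ep lker0_lfunVK.
have gaA p : isA p -> isA (ga p).
  move=> hA; have p_0 : p != p0 by apply: contraTneq hA => ->.
  apply: (full_isA eC'); first exact: ga_neq0.
  move=> q; have [q' ->] := ga_surj q => q0 qp.
  have q'0 : q' != p0 by apply: contraNneq q0 => ->; rewrite ga0.
  have q'p : q' != p by apply: contraNneq qp => ->.
  have [U UC [pU qU]] := full_A mC hA q'0 q'p; exists (g @: U)%VS.
    by rewrite -gC mem_code_image.
  by rewrite -!hga !memv_img.
pose e1 := mpt h1 h0.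
have ge1 : px (ga e1) = h1 by have /eqP := gaA e1 isT.
(* S consists of the differences of points (1, y). *)
have gaS p : px p = h0 -> px (ga p) = h0.
  move=> xp; have hA : isA (padd e1 p) by rewrite /isA pxD xp.
  have := gaA _ hA; rewrite /isA gaD pxD ge1 -[heq _ _]/(hadd h1 (px (ga p)) == h1).
  by case: (px (ga p)) => [] [] [] [] [].
have gSV : (g @: SV L)%VS = SV L.
  apply/eqP; rewrite eqEdim limg_dim // leqnn andbT; apply/subvP => _ /memv_imgP[v hv ->].
  have [p ep] := pev_surj hL hq hal4 v; rewrite ep hga pev_SV //.
  by rewrite ep pev_SV // in hv; rewrite /inS -[is0h _]/(px _ == h0) gaS //; apply/eqP.
have gaS' p : px p != h0 -> px (ga p) != h0.
  move=> xp; apply/negP => /eqP x0; case/negP: xp.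
  have : g (pev p) \in (g @: SV L)%VS by rewrite gSV hga pev_SV // /inS -[is0h _]/(px _ == h0) x0.
  case/memv_imgP => v hv /(lker0P kg) ev; rewrite -ev pev_SV // in hv; exact: hv.
have gL0 U : calL0 U -> calL0 (g @: U)%VS.
  move=> hU; apply: (L0_dimS eC'); last by rewrite -gSV -(lker0_img_cap _ _ kg) limg_dim // L0_S.
  rewrite -gC mem_code_image //; case: eC => _; apply; exact: calL0_C0.
have gaW p : py p = h0 -> py (ga p) = h0.
  move=> yp; have [x0|x0] := eqVneq (px p) h0.
    have -> : p = p0 by case: p yp x0 => a b c y /= -> [-> -> ->].
    by rewrite ga0.
  apply/eqP/(full0P (gaS' _ x0)) => q; have [q' ->] := ga_surj q => xq xqp.
  have xq' : px q' != h0 by apply: contraNneq xq => /gaS ->.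
  have xq'p : px q' != px p.
    apply: contraNneq xqp => e; have : px (ga (padd q' p)) = h0.
      by apply: gaS; rewrite pxD e; case: (px p) => a b c d; rewrite /= !addbb.
    rewrite gaD pxD; case: (px (ga q')) (px (ga p)) => a b c d [a' b' c' d'] /=.
    by case: a; case: a'; case: b; case: b'; case: c; case: c'; case: d; case: d'.
  have [U hU [pU qU]] := (full0P x0).1 (introT eqP yp) q' xq' xq'p.
  by exists (g @: U)%VS; [exact: gL0 | rewrite -!hga !memv_img].
(* Since S and W x 0 are preserved, g is a product map (x, y) -> (A x, D y). *)
pose A x := px (ga (mpt x h0)); pose D y := py (ga (mpt h0 y)).
have pyx x y : py (mpt x y) = y by case: x.
have px0 y : px (mpt h0 y) = h0 by [].
have DD y y' : D (hadd y y') = hadd (D y) (D y').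
  by rewrite /D -pyD -gaD; congr (py (ga _)); case: y y' => a b c d [].
have split_ga x y : px (ga (mpt x y)) = A x /\ py (ga (mpt x y)) = D y.
  have -> : mpt x y = padd (mpt x h0) (mpt h0 y).
    by case: x y => a b c d [e f i k] /=; rewrite !addbF.
  rewrite gaD pxD pyD (gaS (mpt h0 y)) // (gaW (mpt x h0)) ?pyx //; rewrite -/(A x) -/(D y).
  by split; [case: (A x) => a b c d; rewrite /= !addbF | case: (D y)].
have D1 : A h1 = h1 := ge1.
have key c0 c1 : rcond c0 c1 -> exists d0 d1, [/\ rcond d0 d1, D (hgr c0 c1 h1) = hgr d0 d1 h1,
    D (hgr c0 c1 hal) = hgr d0 d1 (A hal) & D (hgr c0 c1 hal2) = hgr d0 d1 (A hal2)].
  move=> rc; have /gL0/(L0tP hL hq hal4)[t] : calL0 (spn (gtri c0 c1)).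
    apply/(L0tP hL hq hal4); exists (gtri c0 c1) => //.
    by apply: (map_f (fun p : h16 * h16 => gtri p.1 p.2) (x := (c0, c1))); rewrite mem_L0l.
  case/mapP => -[d0 d1]; rewrite mem_L0l => rc' -> eU; exists d0, d1.
  have hx x : htr x = h0 -> D (hgr c0 c1 x) = hgr d0 d1 (A x).
    move=> hx; have hp : pev (mpt x (hgr c0 c1 x)) \in spn (gtri c0 c1).
      rewrite gtri_mem pyx; apply/eqP; congr hgr.
      by case: x hx => [] [] [] [] [].
    have := memv_img g hp; rewrite eU hga gtri_mem.
    by have [-> ->] := split_ga x (hgr c0 c1 x) => /eqP.
  by split; rewrite ?hx ?D1.
have z0n : D h1 != h0.
  have : ga (mpt h0 h1) != p0 by apply: ga_neq0.
  by apply: contraNneq => h; rewrite [ga _]pt_eta gaS // -/(D h1) h.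
have D4 : D (hpow 4) = hadd (D (hpow 0)) (D (hpow 1)) by rewrite -DD.
have D5 : D (hpow 5) = hadd (D (hpow 1)) (D (hpow 2)) by rewrite -DD.
(* The graphs of x, alpha x, alpha^2 x, alpha^3 x and x^2; their values at 1, alpha, alpha^2 are
   powers of alpha with exponent at most 5, reduced by alpha^4 = alpha + 1. *)
have k1 := key h1 h0 isT; have k2 := key hal h0 isT; have k3 := key hal2 h0 isT.
have k4 := key (hpow 3) h0 isT; have k5 := key h0 h1 isT.
have := gl_chkP (mem_w8 (ga (mpt hal h0))) (mem_w8 (ga (mpt hal2 h0))) z0n k1 k2.
rewrite -/(A hal) -/(A hal2) -[h1]/(hpow 0).
rewrite -[hgr hal h0 hal2]/(hpow 3) -[hgr h1 h0 hal]/(hpow 1) -[hgr h1 h0 hal2]/(hpow 2) -D4 -D5.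
move=> /(_ k3 k4 k5)/is_gamP[i [k [hi hk ea1 ea2 [ez0 ez1 ez2 ez3]]]].
have i4' : (i < 4)%N by move: hi; rewrite !inE => /or4P[] /eqP ->.
have hk' : (k < 15)%N by rewrite -mem_i15.
exists i, k; split=> //; apply/lfunP => v; have [p ->] := pev_surj hL hq hal4 v.
rewrite hga gmE //; congr (pev _); move: p; apply: pt_ext => // [p q|j j3|j j4].
- apply: (pev_inj hq hal4); rewrite -!gmE // (pevD hq al p q) linearD.
  by rewrite (pevD hq al (gam i k p)) -!gmE.
- have := gam_chk; rewrite allfE => /allP/(_ _ hi); rewrite allfE => /allP/(_ _ hk).
  rewrite allfE => /allP/(_ j); have -> : j \in i4 by case: j j3 => [|[|[|]]].
  move=> /(_ isT); case: ifP => // _; rewrite (_ : eqn j 3 = false); last by case: j j3 => [|[|[|]]].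
  rewrite peqE => /eqP ->; rewrite [ga _]pt_eta gaW ?pyx //; congr mpt.
  by case: j j3 => [|[|[|]]] // _; rewrite mul1n; exact: ea1.
have := gam_chk; rewrite allfE => /allP/(_ _ hi); rewrite allfE => /allP/(_ _ hk).
rewrite allfE => /allP/(_ j); have -> : j \in i4 by case: j j4 => [|[|[|[|]]]].
move=> /(_ isT); case: ifP => // + _.
rewrite peqE => /eqP ->; rewrite [ga _]pt_eta gaS //; congr mpt.
by case: j j4 => [|[|[|[|]]]].
Qed.
End Rigid.

(** * q = 2: counting isomorphism types *)

Lemma size_fibres (T U : eqType) (f : T -> U) (s : seq T) n :
  (forall x, x \in s -> count (fun y => f y == f x) s = n) ->
  size s = (n * size (undup (map f s)))%N.
Proof.
move=> h; rewrite -(size_map f s) -{1}(perm_size (perm_count_undup (map f s))) size_flatten /shape -map_comp.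
have : all (fun u => count_mem u (map f s) == n) (undup (map f s)).
  apply/allP => u; rewrite mem_undup => /mapP[x hx ->]; rewrite count_map; apply/eqP; exact: h.
elim: (undup _) => [|u t IH] /=; first by rewrite muln0.
by case/andP => /eqP e /IH ->; rewrite size_nseq e mulnS.
Qed.

Lemma map_uniq_inj (T U : eqType) (f : T -> U) (s : seq T) : uniq (map f s) -> {in s &, injective f}.
Proof.
elim: s => //= x s IH /andP[nx us] y z; rewrite !inE => /orP[/eqP->|hy] /orP[/eqP->|hz] //.
- by move=> e; case/negP: nx; rewrite e map_f.
- by move=> e; case/negP: nx; rewrite -e map_f.
exact: IH.
Qed.

(** Counting by fibres of equal size. The target carries only classical equality, whence
    [{classic U}] in the proof. *)
Lemma image_card (T : eqType) (U : Type) (f : T -> U) (s : seq T) n m : (0 < n)%N ->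
  (forall x, x \in s -> count (fun y => `[< f y = f x >]) s = n) -> size s = (n * m)%N ->
  ((f @` [set x | x \in s])%classic #= `I_m)%card.
Proof.
move=> n0 h zs; pose f' : T -> {classic U} := f.
have h' x : x \in s -> count (fun y => f' y == f' x) s = n.
  move=> hx; rewrite -(h x hx); apply: eq_count => y /=.
  by apply/eqP/asboolP.
have := size_fibres h'; rewrite zs => /eqP; rewrite eqn_pmul2l // => /eqP em.
have -> : ((f @` [set x | x \in s]) = [set` seq_fset tt (undup (map f' s))])%classic.
  apply/seteqP; split=> u.
    move=> [x hx <-]; change (f' x \in seq_fset tt (undup (map f' s))).
    by rewrite seq_fsetE mem_undup map_f.
  move=> hu; have {hu} : (u : {classic U}) \in seq_fset tt (undup (map f' s)) := hu.
  by rewrite seq_fsetE mem_undup => /mapP[x hx ->]; exists x.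
by apply/(@card_eq_fsetP {classic U} (seq_fset tt _)); rewrite size_seq_fset undup_id ?undup_uniq.
Qed.

Section Count.
Variables (F : finFieldType) (L : fieldExtType F).
Hypothesis hL : \dim {:L} = 4%N.
Hypothesis hq : #|F| = 2%N.
Local Notation V := (V L).
Variable al : L.
Hypothesis hal4 : al ^+ 4 = al + 1.
Local Notation codeOf := (codeOf al).
Local Notation gm := (gm al).
Local Notation maxi := (maximal_extension (calC0 L)).

Lemma alpha_image (g : 'End(V)) (C : code V) i : lker g == 0%VS -> (g @: SV L)%VS = SV L ->
  alpha (SV L) (code_image g C) i = alpha (SV L) C i.
Proof.
move=> kg gS; rewrite /alpha -[RHS](code_image_card _ kg); congr (#|` _|); apply/fsetP => U.
rewrite in_fset inE; apply/andP/code_imageP => [[/code_imageP[U' hU' ->] d]|[U' + ->]].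
  exists U' => //; rewrite !inE hU' /=.
  by move: d; rewrite -{1}gS -(lker0_img_cap _ _ kg) limg_dim.
rewrite !inE => /andP[hU' d]; split; first by rewrite mem_code_image.
by rewrite -{1}gS -(lker0_img_cap _ _ kg) limg_dim.
Qed.

Lemma gm_SV i k : (gm i k @: SV L)%VS = SV L.
Proof.
apply/eqP; rewrite eqEdim limg_dim ?gm_ker // leqnn andbT; apply/subvP => _ /memv_imgP[v hv ->].
have [p ep] := pev_surj hL hq hal4 v; rewrite ep gmE //; rewrite ep !pev_SV // in hv *.
elim: k => [|k IH]; last by move: IH; rewrite /gam /=; case: (iter k _ _) => [] [] [] [] y.
elim: i => [|i IH] //; move: IH; rewrite /gam /=; case: (iter i _ _) => [] [] [] [] y //.
Qed.

Lemma spectrum_gm i k C : spectrum (SV L) (code_image (gm i k) C) = spectrum (SV L) C.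
Proof. by rewrite /spectrum !alpha_image ?gm_ker ?gm_SV. Qed.

Lemma max_sel X : X \in D14 ++ D15 -> maxi (codeOf (sel X)).
Proof. by move=> h; apply/(maximalP hL hq hal4); exists X. Qed.

(** The quotient of the two maps stabilises C, hence is one of the 60 maps by [rigid] and trivial by
    [gm_free]. The indices are then read off the image of the point (alpha, alpha). *)
Lemma gm_inj C i k i' k' : maxi C -> (i < 4)%N -> (k < 15)%N -> (i' < 4)%N -> (k' < 15)%N ->
  code_image (gm i k) C = code_image (gm i' k') C -> (i, k) = (i', k').
Proof.
move=> mC hi hk hi' hk' e; have [X hX eC] := (maximalP hL hq hal4 C).1 mC.
have kg := gm_ker hL hq hal4 i k; have kg' := gm_ker hL hq hal4 i' k'.
pose g := (((gm i' k')^-1) \o gm i k)%VF.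
have kgg : lker g == 0%VS by apply: lker_comp => //; exact: lker_inv.
have gC : code_image g C = C.
  by rewrite -code_image_comp e code_image_comp (lker0_compVf kg') code_image1.
have [i2 [k2 [hi2 hk2 eg]]] := rigid hL hq hal4 mC mC kgg gC.
rewrite eg eC in gC; have [i20 k20] := gm_free hL hq hal4 hX hi2 hk2 gC.
have eqg : gm i k = gm i' k'.
  by rewrite -[LHS](lker0_compVKf kg') -/g eg i20 k20 comp_lfun1r.
have ep : gam i k (mpt hal hal) = gam i' k' (mpt hal hal).
  by apply: (pev_inj hq hal4); rewrite -!gmE // eqg.
have := gam_uniq; pose f (ik : nat * nat) := gam ik.1 ik.2 (mpt hal hal).
have -> : [seq gam i k (mpt hal hal) | i <- i4, k <- i15] = map f [seq (i, k) | i <- i4, k <- i15].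
  by rewrite map_allpairs.
have m4 j : (j < 4)%N -> j \in i4 by case: j => [|[|[|[|]]]].
have mi j j' : (j < 4)%N -> (j' < 15)%N -> (j, j') \in [seq (i, k) | i <- i4, k <- i15].
  by move=> h h'; apply/allpairsP; exists (j, j'); rewrite m4 // mem_i15.
move: (mi _ _ hi hk) (mi _ _ hi' hk'); move: [seq _ | _ <- i4, _ <- i15] => l h h' ul.
by apply: (map_uniq_inj ul).
Qed.

Lemma trivial C : maxi C -> trivial_aut C.
Proof.
move=> mC g kg gC; have [X hX eC] := (maximalP hL hq hal4 C).1 mC.
have [i [k [hi hk eg]]] := rigid hL hq hal4 mC mC kg gC.
by rewrite eg eC in gC; have [i0 k0] := gm_free hL hq hal4 hX hi hk gC; rewrite eg i0 k0.
Qed.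

Definition codes s := [seq codeOf (sel X) | X <- s].

(** By [rigid] the codes isomorphic to C are its images under the 60 maps, by [gm_inj] these are
    distinct, and closure of s keeps them in the list. *)
Lemma fibre60 s : uniq s -> {subset s <= D14 ++ D15} ->
  (forall X X' i k, X \in s -> X' \in D14 ++ D15 ->
     codeOf (sel X') = code_image (gm i k) (codeOf (sel X)) -> X' \in s) ->
  forall C, C \in codes s -> count (fun C' => `[< iso_type C' = iso_type C >]) (codes s) = 60%N.
Proof.
move=> us sub inv C /mapP[X hX eC]; have mC : maxi C by rewrite eC; apply/max_sel/sub.
have uc : uniq (codes s).
  rewrite map_inj_in_uniq // => Y Y' hY hY'; apply: (codeOf_inj hL hq hal4);
    [have [] := D_good (sub _ hY) | have [] := D_good (sub _ hY')] => //.
pose l := [seq code_image (gm i k) C | i <- i4, k <- i15].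
have m4 j : j \in i4 -> (j < 4)%N by rewrite !inE => /or4P[] /eqP ->.
have ul : uniq l.
  apply: allpairs_uniq => [//||[i k] [i' k']]; first exact: (iota_uniq 0 15).
  move=> /allpairsP[[a b] [ha hb [ea eb]]] /allpairsP[[a' b'] [ha' hb' [ea' eb']]].
  rewrite {}ea {}eb {}ea' {}eb'.
  by apply: gm_inj mC _ _ _ _; rewrite ?m4 // -mem_i15.
have <- : size l = 60%N by rewrite size_allpairs size_iota.
rewrite -size_filter; apply: perm_size; apply: uniq_perm => // [|C']; first by rewrite filter_uniq.
rewrite mem_filter; apply/andP/allpairsP => [[/asboolP e /mapP[X' hX' eC']]|[[i k] /= [hi hk eC']]].
  have [g kg gC] := (iso_typeP _ _).1 (esym e).
  have mC' : maxi C' by rewrite eC'; apply/max_sel/sub.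
  have [i [k [hi hk eg]]] := rigid hL hq hal4 mC mC' kg (esym gC).
  exists (i, k); split=> //=; last by rewrite gC eg.
    by case: i hi {eg} => [|[|[|[|]]]].
  by rewrite mem_i15.
split.
  by apply/asboolP/esym/iso_typeP; exists (gm i k) => //; exact: gm_ker.
have mC' : maxi C' by rewrite eC'; exact: gm_max.
have [X' hX' eX'] := (maximalP hL hq hal4 C').1 mC'.
by rewrite eX'; apply: map_f; apply: (inv X X' i k hX hX'); rewrite -eX' eC' eC.
Qed.

Lemma codes_types s n : uniq s -> {subset s <= D14 ++ D15} ->
  (forall X X' i k, X \in s -> X' \in D14 ++ D15 ->
     codeOf (sel X') = code_image (gm i k) (codeOf (sel X)) -> X' \in s) ->
  size s = (60 * n)%N -> (iso_types [set C | C \in codes s]%classic #= `I_n)%card.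
Proof.
move=> us sub inv zs; apply: (@image_card _ _ _ _ 60) => //; first exact: fibre60.
by rewrite size_map.
Qed.

Lemma D_uniq : uniq (D14 ++ D15).
Proof.
rewrite cat_uniq D14_uniq D15_uniq andbT /=; apply/hasPn => X h; apply/negP => h'.
by have [_ [_ _ e]] := D14_good h'; have [_ [_ _ e']] := D15_good h; rewrite e in e'.
Qed.

Lemma spec_neq : ([:: 136; 164; 29; 0] = [:: 136; 165; 28; 0] :> seq nat)%N -> False.
Proof. by []. Qed.

Lemma part1 :
  [/\ forall C, maxi C -> #|` C | = 329%N,
      (iso_types [set C | maxi C]%classic #= `I_26496)%card,
      forall C, maxi C -> trivial_aut C &
      [/\ forall C, maxi C ->
            spectrum (SV L) C = [:: 136; 164; 29; 0]%N \/ spectrum (SV L) C = [:: 136; 165; 28; 0]%N,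
          (iso_types [set C | maxi C /\ spectrum (SV L) C = [:: 136; 164; 29; 0]%N]%classic #= `I_10368)%card &
          (iso_types [set C | maxi C /\ spectrum (SV L) C = [:: 136; 165; 28; 0]%N]%classic #= `I_16128)%card]].
Proof.
have sp14 := spectrum14 hL hq hal4; have sp15 := spectrum15 hL hq hal4.
have maxP := maximalP hL hq hal4.
have s14 : {subset D14 <= D14 ++ D15} by move=> X h; rewrite mem_cat h.
have s15 : {subset D15 <= D14 ++ D15} by move=> X h; rewrite mem_cat h orbT.
split.
- by move=> C /maxP[X hX ->]; exact: (sel_card hL hq hal4 hX).
- have -> : [set C | maxi C]%classic = [set C | C \in codes (D14 ++ D15)]%classic.
    apply/seteqP; split=> C /=; first by move=> /maxP[X hX ->]; apply/map_f.
    by move=> /mapP[X hX ->]; exact: max_sel.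
  apply: codes_types => //; first exact: D_uniq.
  by rewrite size_cat size_D14 size_D15 -mulnDr.
- exact: trivial.
split.
- by move=> C /maxP[X]; rewrite mem_cat => /orP[hX ->|hX ->]; [left; exact: sp14 | right; exact: sp15].
- have -> : [set C | maxi C /\ spectrum (SV L) C = [:: 136; 164; 29; 0]%N]%classic =
      [set C | C \in codes D14]%classic.
    apply/seteqP; split=> C /=.
      move=> [/maxP[X]]; rewrite mem_cat => /orP[hX -> _|hX ->]; first exact: map_f.
      by rewrite sp15 // => /esym/spec_neq.
    by move=> /mapP[X hX ->]; split; [apply/max_sel/s14 | exact: sp14].
  apply: codes_types => //; [exact: D14_uniq | | exact: size_D14].
  (* The 60 maps preserve S and with it the spectrum, which separates [D14] from [D15]. *)
  move=> X X' i k hX; rewrite mem_cat => /orP[//|hX'] e; exfalso; apply: spec_neq.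
  by rewrite -(sp14 _ hX) -(sp15 _ hX') e spectrum_gm.
have -> : [set C | maxi C /\ spectrum (SV L) C = [:: 136; 165; 28; 0]%N]%classic =
    [set C | C \in codes D15]%classic.
  apply/seteqP; split=> C /=.
    move=> [/maxP[X]]; rewrite mem_cat => /orP[hX ->|hX -> _]; last exact: map_f.
    by rewrite sp14 // => /spec_neq.
  by move=> /mapP[X hX ->]; split; [apply/max_sel/s15 | exact: sp15].
apply: codes_types => //; [exact: D15_uniq | | exact: size_D15].
move=> X X' i k hX; rewrite mem_cat => /orP[hX'|//] e; exfalso; apply: spec_neq.
by rewrite -(sp15 _ hX) -(sp14 _ hX') e spectrum_gm.
Qed.

End Count.

Local Close Scope ring_scope.
Local Open Scope classical_set_scope.
Local Open Scope card_scope.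

Theorem theorem6p4 (F : finFieldType) (L : fieldExtType F) (q : nat)
    (hq : #|F| = q) (hL : \dim {:L} = 4) :
  (q = 2 ->
    [/\ forall C, maximal_extension (calC0 L) C -> #|` C | = 329,
        iso_types [set C | maximal_extension (calC0 L) C] #= `I_26496,
        forall C, maximal_extension (calC0 L) C -> trivial_aut C &
        [/\ forall C, maximal_extension (calC0 L) C ->
              spectrum (SV L) C = [:: 136; 164; 29; 0] \/
              spectrum (SV L) C = [:: 136; 165; 28; 0],
            iso_types [set C | maximal_extension (calC0 L) C /\
                spectrum (SV L) C = [:: 136; 164; 29; 0]] #= `I_10368 &
            iso_types [set C | maximal_extension (calC0 L) C /\
                spectrum (SV L) C = [:: 136; 165; 28; 0]] #= `I_16128]]) /\
  (q = 3 -> exists2 C, extension (calC0 L) C & #|` C | = 6977) /\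
  (exists C, [/\ extension (calC0 L) C,
     #|` C | = q ^ 8 + q ^ 5 + q ^ 4 + q ^ 2 - q,
     exists2 eps : L, (eps != 0)%R & (eps ^+ q.-1 = -1)%R &
     forall eps : L, (eps != 0)%R -> (eps ^+ q.-1 = -1)%R ->
       eps_planes eps #= `I_(q ^ 2).+1 /\ eps_planes eps `<=` [set` C]]).
Proof.
split; last split.
- by move=> q2; subst q; have [al hal] := alpha_exists hL q2; exact: (part1 hL q2 hal).
- by move=> q3; subst q; have [b hb] := beta_exists hL q3; exact: (part2 hL q3 hb).
by subst q; exact: (part3 hL).
Qed.
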